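(* Let $\theta\in(0,1)$ and let $f\in\mathcal F_\theta(\Sigma_A^+)$ be a real-valued function with $f>0$ on $\Sigma_A^+$. Assume that $f$ is non-lattice and that the Ruelle transfer operators related to $f$ are weakly contracting. Let $\rho$ be such that $0<\rho_1<\rho<1$ and the weak contraction estimate (W) of the context holds with $\rho$, where $\rho_1\in(0,1)$ is the constant described in the context. Let $d_1=\max f$ and $\epsilon_n=e^{-\delta n}$ with $0<\delta<-\frac{(\log\rho)\,\alpha}{3d_1}$. Then for any $0\le z\le\alpha$ and any $p<q$, $$\lim_{n\to\infty}\frac1n\log I(z,p,q;\epsilon_n)=h(m_0)-\delta,$$ and therefore $$\lim_{\delta\to0}\lim_{n\to\infty}\frac1n\log I(z,p,q;\epsilon_n)=h(m_0).$$
   Context: Symbol space. $\kappa_0\ge2$ is an integer and $A=(A(i,j))_{i,j=1}^{\kappa_0}$ is a matrix of $0$'s and $1$'s which is aperiodic ($A^M$ has strictly positive entries for some $M\ge1$). $\Sigma_A^+=\{(i_j)_{j=0}^\infty:1\le i_j\le\kappa_0,\ A(i_j,i_{j+1})=1\ \forall j\ge0\}$, with shift $\sigma((i_j)_j)=(i_{j+1})_j$. For $\theta\in(0,1)$, $d_\theta(\xi,\eta)=0$ if $\xi=\eta$, and $d_\theta(\xi,\eta)=\theta^m$ if $\xi_i=\eta_i$ for $0\le i<m$ and $m$ is maximal with this property. $\mathcal F_\theta(\Sigma_A^+)$ is the space of $d_\theta$-Lipschitz functions $g:\Sigma_A^+\to\mathbb C$; $|g|_\theta$ is the Lipschitz constant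 of $g$, $\|g\|_\theta=\|g\|_\infty+|g|_\theta$, and for $u\in\mathbb R\setminus\{0\}$, $\|g\|_{\theta,u}=\|g\|_\infty+|g|_\theta/|u|$. The same symbols denote the induced operator norms. $f^n(x)=f(x)+f(\sigma x)+\dots+f(\sigma^{n-1}x)$. Counting function: $$I(z,p,q;\epsilon_n)=\#\{\xi\in\Sigma_A^+:\ \exists\,m\in\mathbb N\text{ with }\sigma^m(\xi)=\xi\text{ and }z+n\alpha+p\,\epsilon_n\le f^m(\xi)\le z+n\alpha+q\,\epsilon_n\}.$$ Ruelle operator: $(\mathcal L_g v)(\xi)=\sum_{\sigma\eta=\xi}e^{g(\eta)}v(\eta)$. Pressure: for real-valued $F\in\mathcal F_\theta(\Sigma_A^+)$, $\mathrm{Pr}(F)=\sup_\mu\left[h(\mu)+\int F\,d\mu\right]$, the supremum over $\sigma$-invariant Borel probability measures, $h(\mu)$ being the measure-theoretic entropy of $\mu$ with respect to $\sigma$; an equilibrium state of $F$ is a measure attaining the supremum. $P_f\in\mathbb R$ is the unique number with $\mathrm{Pr}(-P_f f)=0$; $m_0$ is the equilibrium state of $-P_f f$; $\alpha=\int f\,dm_0$. Non-lattice: there do not exist constants $\gamma_0,\gamma_1$, a bounded function $G$ on $\Sigma_A^+$ and a bounded integer-valued function $Z$ on $\Sigma_A^+$ such that $f=G\circ\sigma-G+\gamma_0+\gamma_1Z$ on $\Sigma_A^+$. Weakly contracting: for every $\epsilon>0$ there exist $a_0>0$, $\rho\in(0,1)$ and $A_\epsilon>0$ (possibly depending on $f$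 and $\epsilon$) such that $$\text{(W)}\qquad \|\mathcal L^n_{(-P_f+\mathrm iu)f}\|_{\theta,u}\le A_\epsilon\,\rho^n|u|^\epsilon\qquad\text{for all }|u|\ge a_0\text{ and all integers }n\ge0.$$ ''(W) holds with $\rho$'' means that for every $\epsilon>0$ there are $a_0,A_\epsilon>0$ such that this estimate holds with this same $\rho$. The constant $\rho_1$: let $\chi_i$ be the characteristic function of the cylinder $\mathcal C_i=\{\eta\in\Sigma_A^+:\eta_0=i\}$ and fix arbitrary points $x_i\in\mathcal C_i$, $i=1,\dots,\kappa_0$. By a known version of Ruelle's Lemma there is a constant $\rho_1\in(0,1)$ such that for $a_0,b_0>0$ and every $\epsilon>0$ there is $C_\epsilon>0$ with $$\Big|\sum_{\sigma^nx=x}e^{(t+\mathrm iu)f^n(x)}-\sum_{i=1}^{\kappa_0}\mathcal L^n_{(t+\mathrm iu)f}\chi_i(x_i)\Big|\le C_\epsilon|u|\sum_{m=2}^n\|\mathcal L^{n-m}_{(t+\mathrm iu)f}\|_\theta\,\rho_1^m e^{m(\epsilon+\mathrm{Pr}(tf))}$$ for all $n\in\mathbb N$, $|t|\le a_0$, $|u|\ge b_0$; $\rho_1$ is this constant. *)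

(* Defs.v *)
From HB Require Import structures.
From mathcomp Require Import all_boot all_order all_algebra.
From mathcomp Require Import all_classical all_reals all_analysis.
From mathcomp Require Import complex.

Set Implicit Arguments.
Unset Strict Implicit.
Unset Printing Implicit Defensive.

Import Order.TTheory GRing.Theory Num.Theory.
Import numFieldNormedType.Exports.

Local Open Scope classical_set_scope.
Local Open Scope ring_scope.
Local Open Scope complex_scope.

Local Notation normc := ComplexField.Normc.normc.

(* Symbols are 0, ..., kappa - 1. Powers are taken in the semiring of matrices
   over nat. The hypotheses are bundled with the matrix because the library's
   measurable types are nonempty by construction: they are what makes the shift
   space inhabited. *)
Record aperiodic_matrix (kappa : nat) := AperiodicMatrix {
  tmx :> 'M[nat]_kappa;
  tmx_ge2 : (2 <= kappa)%N;
  tmx_01 : forall i j, tmx i j = 0%N \/ tmx i j = 1%N;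
  tmx_aperiodic :
    exists2 M : nat, (1 <= M)%N & forall i j, (0 < (tmx ^+ M) i j)%N }.

Definition admissible (kappa : nat) (A : aperiodic_matrix kappa)
    (xi : nat -> 'I_kappa) : Prop := forall j, A (xi j) (xi j.+1) = 1%N.

Definition shift_space (kappa : nat) (A : aperiodic_matrix kappa) : Type :=
  {xi : nat -> 'I_kappa | admissible A xi}.

Lemma aperiodic_successor kappa (A : aperiodic_matrix kappa) (i : 'I_kappa) :
  exists j, A i j = 1%N.
Proof.
have [[//|M] _ HM] := tmx_aperiodic A.
have : (0 < ((tmx A) ^+ M.+1) i i)%N := HM i i.
rewrite exprS mxE => Hpos; apply: contrapT => Hno.
suff S0 : \sum_j (tmx A) i j * ((tmx A) ^+ M) j i = 0.
  by move: Hpos; rewrite S0.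
apply: big1 => j _.
have [->|A1] := tmx_01 A i j; first exact: mul0r.
by exfalso; apply: Hno; exists j.
Qed.

Lemma shift_space_inhabited kappa (A : aperiodic_matrix kappa) :
  inhabited (shift_space A).
Proof.
have [g Hg] := choice (aperiodic_successor A).
have k0 : (0 < kappa)%N by exact: leq_trans (tmx_ge2 A).
by apply: inhabits; exists (fun n => iter n g (Ordinal k0)) => j; exact: Hg.
Qed.

HB.instance Definition _ kappa (A : aperiodic_matrix kappa) :=
  gen_eqMixin (shift_space A).
HB.instance Definition _ kappa (A : aperiodic_matrix kappa) :=
  gen_choiceMixin (shift_space A).
HB.instance Definition _ kappa (A : aperiodic_matrix kappa) :=
  isPointed.Build (shift_space A) (inhabited_witness (shift_space_inhabited A)).

Definition sft_shift kappa (A : aperiodic_matrix kappa)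
    (xi : shift_space A) : shift_space A :=
  exist (admissible A) (fun j => sval xi j.+1) (fun j => svalP xi j.+1).

Definition birkhoff (R : realType) kappa (A : aperiodic_matrix kappa)
    (f : shift_space A -> R) (n : nat) (xi : shift_space A) : R :=
  \sum_(j < n) f (iter j (@sft_shift _ A) xi).

Definition d_theta (R : realType) kappa (A : aperiodic_matrix kappa)
    (theta : R) (xi eta : shift_space A) : R :=
  match pselect (exists m, sval xi m != sval eta m) with
  | left differ => theta ^+ ex_minn differ
  | right _ => 0
  end.

Definition d_theta_open (R : realType) kappa (A : aperiodic_matrix kappa)
    (theta : R) : set (set (shift_space A)) :=
  [set U | forall xi, U xi ->
    exists2 e, 0 < e & forall eta, d_theta theta xi eta < e -> U eta].

Definition borel_shift (R : realType) kappa (A : aperiodic_matrix kappa)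
    (theta : R) := g_sigma_algebraType (@d_theta_open R kappa A theta).

Definition F_theta (R : realType) kappa (A : aperiodic_matrix kappa)
    (theta : R) : set (shift_space A -> R[i]) :=
  [set g | exists C : R, forall xi eta,
    normc (g xi - g eta) <= C * d_theta theta xi eta].

(* Norms and operator norms are computed in \bar R, so that an unbounded
   quantity is +oo rather than an arbitrary real. *)
Definition sup_norm (R : realType) kappa (A : aperiodic_matrix kappa)
    (g : shift_space A -> R[i]) : \bar R :=
  ereal_sup [set (normc (g xi))%:E | xi in [set: shift_space A]].

(* The diagonal only contributes 0 / 0 = 0. *)
Definition lip_const (R : realType) kappa (A : aperiodic_matrix kappa)
    (theta : R) (g : shift_space A -> R[i]) : \bar R :=
  ereal_sup [set (normc (g z.1 - g z.2) / d_theta theta z.1 z.2)%:E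
            | z in [set: shift_space A * shift_space A]].

Definition norm_theta (R : realType) kappa (A : aperiodic_matrix kappa)
    (theta : R) (g : shift_space A -> R[i]) : \bar R :=
  (sup_norm g + lip_const theta g)%E.

Definition norm_theta_u (R : realType) kappa (A : aperiodic_matrix kappa)
    (theta u : R) (g : shift_space A -> R[i]) : \bar R :=
  (sup_norm g + `|u|^-1%:E * lip_const theta g)%E.

Definition op_norm (R : realType) kappa (A : aperiodic_matrix kappa)
    (theta : R) (N : (shift_space A -> R[i]) -> \bar R)
    (T : (shift_space A -> R[i]) -> (shift_space A -> R[i])) : \bar R :=
  ereal_sup [set N (T v) | v in [set v | F_theta theta v /\ (N v <= 1)%E]].

Definition cexp (R : realType) (z : R[i]) : R[i] :=
  (expR (complex.Re z))%:C * (cos (complex.Im z) +i* sin (complex.Im z)).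

Definition ruelle_op (R : realType) kappa (A : aperiodic_matrix kappa)
    (g v : shift_space A -> R[i]) : shift_space A -> R[i] :=
  fun xi => \sum_(eta \in [set eta | sft_shift eta = xi]) cexp (g eta) * v eta.

Definition scaled_fun (R : realType) kappa (A : aperiodic_matrix kappa)
    (t u : R) (f : shift_space A -> R) : shift_space A -> R[i] :=
  fun xi => (t +i* u) * (f xi)%:C.

Definition invariant_measure (d : measure_display) (T : measurableType d)
    (R : realType) (S : T -> T) (mu : probability T R) : Prop :=
  forall B, measurable B -> mu (S @^-1` B) = mu B.

(* A finite measurable partition is given by the labelling c of points by their
   cells (empty cells are harmless since 0 * ln 0 = 0). The cells of the join
   of its first n preimages under S are indexed by the words w of length n. *)
Definition join_entropy (d : measure_display) (T : measurableType d)
    (R : realType) (S : T -> T) (mu : probability T R) (k : nat)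
    (c : T -> 'I_k) (n : nat) : R :=
  - \sum_(w : {ffun 'I_n -> 'I_k})
      let pw := fine (mu [set x | forall j : 'I_n, c (iter j S x) = w j]) in
      pw * ln pw.

Definition partition_entropy (d : measure_display) (T : measurableType d)
    (R : realType) (S : T -> T) (mu : probability T R) (k : nat)
    (c : T -> 'I_k) : \bar R :=
  limn (fun n => (n%:R^-1 * join_entropy S mu c n)%:E).

Definition entropy (d : measure_display) (T : measurableType d)
    (R : realType) (S : T -> T) (mu : probability T R) : \bar R :=
  ereal_sup [set e | exists (k : nat) (c : T -> 'I_k),
    (forall i, measurable (c @^-1` [set i])) /\ e = partition_entropy S mu c].

Definition shift_entropy (R : realType) kappa (A : aperiodic_matrix kappa)
    (theta : R) (mu : probability (borel_shift A theta) R) : \bar R :=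
  entropy (@sft_shift kappa A : borel_shift A theta -> borel_shift A theta) mu.

Definition shift_invariant (R : realType) kappa (A : aperiodic_matrix kappa)
    (theta : R) (mu : probability (borel_shift A theta) R) : Prop :=
  invariant_measure
    (@sft_shift kappa A : borel_shift A theta -> borel_shift A theta) mu.

Definition pressure (R : realType) kappa (A : aperiodic_matrix kappa)
    (theta : R) (F : shift_space A -> R) : \bar R :=
  ereal_sup [set (shift_entropy mu + \int[mu]_xi (F xi)%:E)%E
    | mu in [set mu : probability (borel_shift A theta) R
            | shift_invariant mu]].

Definition equilibrium_state (R : realType) kappa (A : aperiodic_matrix kappa)
    (theta : R) (F : shift_space A -> R)
    (mu : probability (borel_shift A theta) R) : Prop :=
  shift_invariant mu /\
  (shift_entropy mu + \int[mu]_xi (F xi)%:E)%E = pressure theta F.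

Definition non_lattice (R : realType) kappa (A : aperiodic_matrix kappa)
    (f : shift_space A -> R) : Prop :=
  ~ exists (gamma0 gamma1 : R) (G : shift_space A -> R)
      (Z : shift_space A -> int),
    [/\ exists M : R, forall xi, `|G xi| <= M,
        exists M : int, forall xi, `|Z xi| <= M &
        forall xi, f xi = G (sft_shift xi) - G xi + gamma0 + gamma1 * (Z xi)%:~R].

Definition contraction_estimate (R : realType) kappa
    (A : aperiodic_matrix kappa) (theta : R) (f : shift_space A -> R)
    (Pf eps a0 rho Aeps : R) : Prop :=
  forall (u : R) (n : nat), a0 <= `|u| ->
    (op_norm theta (norm_theta_u theta u)
       (iter n (ruelle_op (scaled_fun (- Pf) u f)))
     <= (Aeps * rho ^+ n * `|u| `^ eps)%:E)%E.

Definition weakly_contracting (R : realType) kappa (A : aperiodic_matrix kappa)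
    (theta : R) (f : shift_space A -> R) (Pf : R) : Prop :=
  forall eps : R, 0 < eps -> exists a0 rho Aeps : R,
    [/\ 0 < a0, 0 < rho < 1, 0 < Aeps &
        contraction_estimate theta f Pf eps a0 rho Aeps].

Definition weakly_contracting_with (R : realType) kappa
    (A : aperiodic_matrix kappa) (theta : R) (f : shift_space A -> R)
    (Pf rho : R) : Prop :=
  forall eps : R, 0 < eps -> exists a0 Aeps : R,
    [/\ 0 < a0, 0 < Aeps & contraction_estimate theta f Pf eps a0 rho Aeps].

Definition cylinder_indic (R : realType) kappa (A : aperiodic_matrix kappa)
    (i : 'I_kappa) : shift_space A -> R[i] :=
  fun eta => (sval eta 0%N == i)%:R.

(* rho1 satisfies the estimate of Ruelle's Lemma for the base points x. The
   estimate starts at n = 2: for n = 1 the sum on the right is empty, and the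
   left-hand side compares f at the fixed point (i, i, ...) with f at the point
   (i, x i), which need not be equal for arbitrary x i. *)
Definition ruelle_lemma_constant (R : realType) kappa
    (A : aperiodic_matrix kappa) (theta : R) (f : shift_space A -> R)
    (x : 'I_kappa -> shift_space A) (rho1 : R) : Prop :=
  forall a0 b0 eps : R, 0 < a0 -> 0 < b0 -> 0 < eps ->
  exists2 C : R, 0 < C & forall (n : nat) (t u : R),
    (2 <= n)%N -> `|t| <= a0 -> b0 <= `|u| ->
    ((normc (\sum_(xi \in [set xi | iter n (@sft_shift _ A) xi = xi])
               cexp ((t +i* u) * (birkhoff f n xi)%:C)
             - \sum_(i < kappa)
                 iter n (ruelle_op (scaled_fun t u f)) (@cylinder_indic R _ A i)
                   (x i)))%:E
     <= (C * `|u|)%:E * \sum_(2 <= m < n.+1)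
          (op_norm theta (norm_theta theta)
             (iter (n - m) (ruelle_op (scaled_fun t u f)))
           * (rho1 ^+ m)%:E
           * expeR (m%:R%:E
                    * (eps%:E + pressure theta (fun xi => (t * f xi)%R)))))%E.

(* epsn is the value of the scale epsilon_n. Period m = 0 is excluded, as every
   point would satisfy it. *)
Definition orbit_count (R : realType) kappa (A : aperiodic_matrix kappa)
    (f : shift_space A -> R) (alpha z p q epsn : R) (n : nat) : \bar R :=
  counting [set xi : shift_space A | exists m : nat,
    [/\ (1 <= m)%N, iter m (@sft_shift _ A) xi = xi &
        z + n%:R * alpha + p * epsn <= birkhoff f m xi
          <= z + n%:R * alpha + q * epsn]].

(* (1/n) log I(z, p, q; epsilon_n) with epsilon_n = e^(- delta n);
   here log 0 = -oo. *)
Definition count_rate (R : realType) kappa (A : aperiodic_matrix kappa)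
    (f : shift_space A -> R) (alpha z p q delta : R) (n : nat) : \bar R :=
  (n%:R^-1%:E
   * lne (orbit_count f alpha z p q (expR (- (delta * n%:R))) n))%E.

(* Main.v *)
Require Import Defs.
From HB Require Import structures.
From mathcomp Require Import all_boot all_order all_algebra.
From mathcomp Require Import all_classical all_reals all_analysis.
From mathcomp Require Import measurable_realfun complex.
From mathcomp Require Import ring lra zify.

Set Implicit Arguments.
Unset Strict Implicit.
Unset Printing Implicit Defensive.

Import Order.TTheory GRing.Theory Num.Theory.
Import numFieldNormedType.Exports.

Local Open Scope classical_set_scope.
Local Open Scope ring_scope.
Local Open Scope complex_scope.

Local Notation normc := ComplexField.Normc.normc.

(* Let K_e(y) = e / (e^2 + y^2), the Laplace transform of u |-> cos(u y), and let
   U(e, T) be the sum over periodic points of period m of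
   exp(- Pf f^m) K_e(f^m - T), averaged over periods m of order n. In Fourier
   space U involves the sums of exp((- Pf + i u) f^m) over periodic points.
   For u >= a0 they are O(m rho^m u^(2 + eps)) by Ruelle's Lemma and (W). For
   small u the spectral gap of the normalized operator and the positivity of f
   invert 1 - L_u with a loss C / u; for u in between this inversion holds because
   an almost fixed vector v of L_u would make v^k almost fixed by L_(k u) with
   k u >= a0, against (W). Averaging the periods over blocks of length r then
   gains a factor C / (u r), so that U(e, T) - U(1, T) is small for
   T = n alpha + O(1) and e = exp(- delta n). Since U(1, T) is bounded below by a
   renewal argument, comparing U at the scale e and at a slightly smaller scale
   gives exp(Pf alpha n - delta n) orbits in the window, up to subexponential
   factors.
   It remains to see that Pf alpha = h(m0) and that the eigenvalue lam of the
   transfer operator of - Pf f is 1. Both follow from the variational principle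
   Pr(- Pf f) = ln lam: the Gibbs measure built from the invariant functional
   gives one inequality, and Gibbs' inequality against that measure the other,
   after approximating a finite partition by cylinders. *)

(** * Subshifts and transfer operators *)

(** The kernel is positive, its transform is elementary, and off the window |y| <= v e it satisfies
    K_e' <= (e' / e) (1 + v^(-2)) K_e: its slow tail at the smaller scale is paid by the upper bound
    at the larger one.

    At middle frequencies periodic sums must become operator iterates with an error small against 1
    / n, because about n periods are averaged. Cylinders of length of order ln n achieve this, but
    their number and their Lipschitz norms cost a power n^(2 Q). Inverting 1 - L_u degenerates as u
    tends to 0, so it is used only for u >= eta / sqrt n, where one averaging over a block of length
    of order n gains n^(-1/2); 4 Q + 4 averagings pay for the cylinders and leave n^(-2). Below that
    cut-off the two transforms differ by at most u, which integrates to order eta^2 / n.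

    The 3 in the bound on delta is the order e^(-3) of the integral of u^2 exp(- e u): one factor u
    stands in Ruelle's Lemma, the other is the cost of passing from the norm weighted by 1 / |u| to
    the unweighted one. *)

Section ShiftSpace.
Context (kappa : nat) (A : aperiodic_matrix kappa).
Local Notation S := (shift_space A).
Local Notation sh := (@sft_shift kappa A).
Implicit Types (x y e : S) (n m : nat).

Lemma shift_space_ext x y : (forall i, sval x i = sval y i) -> x = y.
Proof.
case: x y => [x Hx] [y Hy] /= H.
by apply: eq_exist; apply/funext => i; exact: H.
Qed.

Lemma sval_iter_shift n x i : sval (iter n sh x) i = sval x (n + i)%N.
Proof. by elim: n x i => [//|n IH] x i; rewrite iterS /= IH addnS. Qed.

Lemma splice_subproof n x y : sval x n = sval y 0%N ->
  admissible A (fun i => if (i < n)%N then sval x i else sval y (i - n)%N).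
Proof.
move=> xy j; case: (ltnP j.+1 n) => jn.
  by rewrite ltnW //; exact: (svalP x).
case: ltnP => jn'.
  have -> : n = j.+1 by apply/eqP; rewrite eqn_leq jn.
  rewrite subnn; have <- : sval x j.+1 = sval y 0%N.
    by rewrite -xy; congr (sval x _); apply/eqP; rewrite eqn_leq jn jn'.
  exact: (svalP x).
by rewrite subSn//; exact: (svalP y).
Qed.

(* Junk value x when x n and y 0 differ. *)
Definition splice n x y : S :=
  match pselect (sval x n = sval y 0%N) with
  | left xy => exist _ _ (splice_subproof xy)
  | right _ => x
  end.

Lemma sval_splice n x y i : sval x n = sval y 0%N ->
  sval (splice n x y) i = if (i < n)%N then sval x i else sval y (i - n)%N.
Proof. by rewrite /splice; case: pselect. Qed.

Lemma splice_prefix n x y i : sval x n = sval y 0%N -> (i <= n)%N ->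
  sval (splice n x y) i = sval x i.
Proof.
move=> xy; rewrite sval_splice// leq_eqVlt => /predU1P[->|->//].
by rewrite ltnn subnn.
Qed.

Lemma iter_shift_splice n x y : sval x n = sval y 0%N ->
  iter n sh (splice n x y) = y.
Proof.
move=> xy; apply: shift_space_ext => i.
by rewrite sval_iter_shift sval_splice// ltnNge leq_addr /= addKn.
Qed.

Lemma cons_subproof (a : 'I_kappa) x : A a (sval x 0%N) = 1%N ->
  admissible A (fun i => if i is j.+1 then sval x j else a).
Proof. by move=> ax [//|j]; exact: (svalP x). Qed.

(* Junk value x when a cannot precede x. *)
Definition scons (a : 'I_kappa) x : S :=
  match pselect (A a (sval x 0%N) = 1%N) with
  | left ax => exist _ _ (cons_subproof ax)
  | right _ => x
  end.

Definition precedes (a : 'I_kappa) x := A a (sval x 0%N) == 1%N.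

Lemma sval_scons a x i : precedes a x ->
  sval (scons a x) i = if i is j.+1 then sval x j else a.
Proof. by rewrite /scons => /eqP ax; case: pselect. Qed.

Lemma shift_scons a x : precedes a x -> sh (scons a x) = x.
Proof.
by move=> ax; apply: shift_space_ext => i; rewrite /= sval_scons.
Qed.

Lemma precedes_shift x : precedes (sval x 0%N) (sh x).
Proof. by apply/eqP; exact: (svalP x). Qed.

Lemma scons_shift x : scons (sval x 0%N) (sh x) = x.
Proof.
by apply: shift_space_ext => -[|i]; rewrite sval_scons ?precedes_shift.
Qed.

Fixpoint preimages n x : seq S :=
  if n is n'.+1 then
    [seq scons a y | y <- preimages n' x,
                     a <- [seq a <- enum 'I_kappa | precedes a y]]
  else [:: x].

Lemma mem_preimages n x y : (y \in preimages n x) = (iter n sh y == x).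
Proof.
elim: n x y => [|n IH] x y /=; first by rewrite inE.
apply/allpairsPdep/eqP => [[z [a [+ + ->]]]|<-].
  by rewrite IH mem_filter -iterS iterSr => /eqP <- /andP[az _]; rewrite shift_scons.
exists (sh y), (sval y 0%N); rewrite IH -iterSr /= eqxx mem_filter mem_enum.
by rewrite precedes_shift scons_shift.
Qed.

Lemma preimages_uniq n x : uniq (preimages n x).
Proof.
elim: n x => [//|n IH] x /=.
apply: allpairs_uniq_dep => // [y _|[y a] [z b]].
  by rewrite filter_uniq ?enum_uniq.
move=> /allpairsPdep[y' [a' [_ + [-> ->]]]] /allpairsPdep[z' [b' [_ + [-> ->]]]].
rewrite !mem_filter /= => /andP[ay _] /andP[bz _] E.
have -> : y' = z' by rewrite -(shift_scons ay) E shift_scons.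
suff -> : a' = b' by [].
have := congr1 (fun w => sval w 0%N) E.
by rewrite /= !sval_scons.
Qed.

Lemma big_preimagesS (V : nmodType) n x (F : S -> V) :
  \sum_(y <- preimages n.+1 x) F y =
  \sum_(y <- preimages n x) \sum_(a | precedes a y) F (scons a y).
Proof.
rewrite /= big_allpairs_dep /=; apply: eq_bigr => y _.
by rewrite big_filter big_enum_cond.
Qed.

Lemma big_preimages1 (V : nmodType) x (F : S -> V) :
  \sum_(y <- preimages 1 x) F y = \sum_(a | precedes a x) F (scons a x).
Proof. by rewrite big_preimagesS /= big_seq1. Qed.

Lemma big_preimagesD (V : nmodType) n m x (F : S -> V) :
  \sum_(y <- preimages (n + m) x) F y =
  \sum_(y <- preimages m x) \sum_(z <- preimages n y) F z.
Proof.
elim: n F => [|n IH] F.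
  by rewrite add0n; apply: eq_bigr => y _; rewrite /= big_seq1.
rewrite addSn big_preimagesS IH; apply: eq_bigr => y _.
by rewrite big_preimagesS.
Qed.

Lemma exists_start i : exists x, sval x 0%N = i.
Proof.
have [g Hg] := choice (aperiodic_successor A).
have H : admissible A (fun n => iter n g i) by move=> j; exact: Hg.
by exists (exist _ _ H).
Qed.

(** A positive entry of the matrix power yields a path; it is carried by a whole point of the shift,
    so that it can be spliced directly. *)
Lemma connect_aux M i j : (0 < ((tmx A) ^+ M) i j)%N ->
  exists2 e : S, sval e 0%N = i & sval e M = j.
Proof.
elim: M i j => [|M IH] i j.
  rewrite expr0 mxE; case: eqVneq => // <- _.
  by have [x xi] := exists_start i; exists x.
rewrite exprS mxE => Hpos.
have [k /eqP Aik Akj] : exists2 k, A i k == 1%N & (0 < ((tmx A) ^+ M) k j)%N.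
  apply: contrapT => Hno; suff S0 : \sum_k (tmx A) i k * ((tmx A) ^+ M) k j = 0.
    by move: Hpos; rewrite S0.
  apply: big1 => k _; have [->|A1] := tmx_01 A i k; first exact: mul0r.
  have [->|k0] := posnP (((tmx A) ^+ M) k j); first exact: mulr0.
  by exfalso; apply: Hno; exists k => //; apply/eqP.
have [e e0 eM] := IH _ _ Akj.
have ie : precedes i e by rewrite /precedes e0 Aik.
by exists (scons i e); rewrite sval_scons.
Qed.

Definition mixing_time (M : nat) := (0 < M)%N /\
  forall i j, exists2 e : S, sval e 0%N = i & sval e M = j.

Lemma exists_mixing_time : exists M, mixing_time M.
Proof.
have [M M1 HM] := tmx_aperiodic A.
by exists M; split => // i j; exact: connect_aux.
Qed.

(** Splice y, a connecting path and x. Since M serves every pair of symbols, the order n + M of the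
    preimage does not depend on x and y. *)
Lemma mixing_preimage M n x y : mixing_time M ->
  exists2 w : S, iter (n + M) sh w = x & forall i, (i <= n)%N -> sval w i = sval y i.
Proof.
move=> [_ HM]; have [e e0 eM] := HM (sval y n) (sval x 0%N).
exists (splice n y (splice M e x)).
  rewrite addnC iterD !iter_shift_splice// splice_prefix//.
by move=> i ?; rewrite splice_prefix// splice_prefix.
Qed.

Lemma periodize_subproof m x : (0 < m)%N -> sval x m = sval x 0%N ->
  admissible A (fun i => sval x (i %% m)%N).
Proof.
move=> m0 xm j; have jm : (j %% m < m)%N by rewrite ltn_mod.
have -> : (j.+1 %% m = (j %% m).+1 %% m)%N by rewrite -addn1 -modnDml addn1.
have <- : sval x (j %% m).+1 = sval x ((j %% m).+1 %% m)%N.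
  have [->|neq] := eqVneq (j %% m).+1 m; first by rewrite modnn xm.
  by rewrite (@modn_small (j %% m).+1)// ltn_neqAle neq.
exact: (svalP x).
Qed.

Definition periodize m x : S :=
  match pselect ((0 < m)%N /\ sval x m = sval x 0%N) with
  | left H => exist _ _ (periodize_subproof H.1 H.2)
  | right _ => x
  end.

Lemma sval_periodize m x i : (0 < m)%N -> sval x m = sval x 0%N ->
  sval (periodize m x) i = sval x (i %% m)%N.
Proof. by rewrite /periodize => m0 xm; case: pselect => // -[]. Qed.

Lemma periodize_per m x : (0 < m)%N -> sval x m = sval x 0%N ->
  iter m sh (periodize m x) = periodize m x.
Proof.
move=> m0 xm; apply: shift_space_ext => i.
by rewrite sval_iter_shift !sval_periodize// modnDl.
Qed.

Lemma sval_per m x i : iter m sh x = x -> sval x i = sval x (i %% m)%N.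
Proof.
move=> xm; rewrite {1}(divn_eq i m); elim: (i %/ m)%N => [//|q <-].
by rewrite mulSn -addnA -sval_iter_shift xm.
Qed.

(** A point of period m is determined by its first m symbols. *)
Lemma finite_periodic m : (0 < m)%N -> finite_set [set x | iter m sh x = x].
Proof.
move=> m0; pose D (w : {ffun 'I_m -> 'I_kappa}) x :=
  forall i : nat, sval x i = w (Ordinal (ltn_pmod i m0)).
apply: (@sub_finite_set _ _ ((fun w => xget point [set x | D w x]) @` setT)).
  move=> x /= xm; have Dx : D [ffun i : 'I_m => sval x i] x.
    by move=> i; rewrite ffunE /=; exact: sval_per.
  exists [ffun i : 'I_m => sval x i] => //.
  case: xgetP => [y _ Dy|/(_ x)//].
  by apply: shift_space_ext => i; rewrite Dy Dx.
exact/finite_image/finite_finset.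
Qed.

End ShiftSpace.

Section ComplexModulus.
Context (R : realType).
Implicit Types (z w : R[i]) (r t : R).

Lemma normc_ge0 z : 0 <= normc z.
Proof. by case: z => a b; exact: sqrtr_ge0. Qed.

Lemma normc_triangle z w : normc (z + w) <= normc z + normc w.
Proof. exact: (le_normcD z w). Qed.

Lemma normc_opp z : normc (- z) = normc z.
Proof. exact: (normcN z). Qed.

Lemma normcBC z w : normc (z - w) = normc (w - z).
Proof. by rewrite -normc_opp opprB. Qed.

Lemma normcM z w : normc (z * w) = normc z * normc w.
Proof. exact: ComplexField.Normc.normcM. Qed.

Lemma normcX z n : normc (z ^+ n) = normc z ^+ n.
Proof.
elim: n => [|n IH]; first by rewrite !expr0 ComplexField.Normc.normc1.
by rewrite !exprS normcM IH.
Qed.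

Lemma normc_real r : normc r%:C = `|r|.
Proof. by rewrite /= expr0n /= addr0 sqrtr_sqr. Qed.

Lemma normc_sum (I : Type) (s : seq I) (P : pred I) (F : I -> R[i]) :
  normc (\sum_(i <- s | P i) F i) <= \sum_(i <- s | P i) normc (F i).
Proof.
elim/big_rec2: _ => [|i y1 y2 _ H]; first by rewrite ComplexField.Normc.normc0.
by rewrite (le_trans (normc_triangle _ _))// lerD2l.
Qed.

Lemma Re_le_normc z : `|complex.Re z| <= normc z.
Proof.
by case: z => a b /=; rewrite -sqrtr_sqr ler_sqrt ?addr_ge0 ?sqr_ge0// lerDl sqr_ge0.
Qed.

Lemma Im_le_normc z : `|complex.Im z| <= normc z.
Proof.
by case: z => a b /=; rewrite -sqrtr_sqr ler_sqrt ?addr_ge0 ?sqr_ge0// lerDr sqr_ge0.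
Qed.

Lemma normc_le_ReIm z : normc z <= `|complex.Re z| + `|complex.Im z|.
Proof.
case: z => a b /=.
rewrite -(@ger0_norm _ (`|a| + `|b|)) ?addr_ge0// -sqrtr_sqr ler_sqrt ?sqr_ge0//.
by rewrite sqrrD !real_normK ?num_real// addrAC lerDl mulrn_wge0// mulr_ge0.
Qed.

Definition cis t : R[i] := cos t +i* sin t.

Lemma cisD t s : cis (t + s) = cis t * cis s.
Proof. by rewrite /cis sinD cosD; congr (_ +i* _); rewrite addrC. Qed.

Lemma cis0 : cis 0 = 1.
Proof. by rewrite /cis sin0 cos0. Qed.

Lemma normc_cis t : normc (cis t) = 1.
Proof. by rewrite /= cos2Dsin2 sqrtr1. Qed.

Lemma normcB_triangle z w y : normc (z - y) <= normc (z - w) + normc (w - y).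
Proof. by have := normc_triangle (z - w) (w - y); rewrite addrA subrK. Qed.

Lemma bounded_derive_lipschitz (f f' : R -> R) t s :
  (forall x : R, is_derive x (1 : R) f (f' x)) -> (forall x, `|f' x| <= 1) ->
  `|f t - f s| <= `|t - s|.
Proof.
move=> df bf; wlog ts : t s / t <= s.
  move=> H; have [|/ltW st] := leP t s; first exact: H.
  by rewrite distrC (distrC t); exact: H.
have cf : {within `[t, s], continuous f}.
  by apply: derivable_within_continuous => x _; exact: ex_derive.
have [c _ E] := MVT_segment ts (fun x _ => df x) cf.
by rewrite distrC E normrM distrC ler_piMl// distrC.
Qed.

Lemma cis_lip t s : normc (cis t - cis s) <= 2 * `|t - s|.
Proof.
rewrite (le_trans (normc_le_ReIm _))// mulr2n mulrDl mul1r lerD//.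
- apply: (@bounded_derive_lipschitz cos (fun x => - sin x)) => x.
  by rewrite normrN sin_max.
- apply: (@bounded_derive_lipschitz sin cos) => x.
  exact: cos_max.
Qed.

End ComplexModulus.

(** * Lipschitz functions and transfer operators *)

Section Metric.
Context (R : realType) (kappa : nat) (A : aperiodic_matrix kappa) (theta : R).
Context (theta01 : 0 < theta < 1).
Local Notation S := (shift_space A).
Local Notation sh := (@sft_shift kappa A).
Local Notation d := (@d_theta R kappa A theta).
Implicit Types (x y : S).

Let th0 : 0 < theta. Proof. by case/andP: theta01. Qed.
Let th1 : theta < 1. Proof. by case/andP: theta01. Qed.
Let th0' : 0 <= theta. Proof. exact: ltW. Qed.
Let th1' : theta <= 1. Proof. exact: ltW. Qed.

Variant d_theta_spec x y : R -> Prop :=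
| DThetaEq of x = y : d_theta_spec x y 0
| DThetaNeq m of (forall i, (i < m)%N -> sval x i = sval y i) &
    sval x m != sval y m : d_theta_spec x y (theta ^+ m).

Lemma d_thetaP x y : d_theta_spec x y (d x y).
Proof.
rewrite /d_theta; case: pselect => [H|H].
  case: ex_minnP => m m1 m2; apply: DThetaNeq => // i im.
  by apply/eqP; apply: contraTT im => /m2; rewrite -leqNgt.
apply: DThetaEq; apply: shift_space_ext => i; apply: contrapT => /eqP xy.
by apply: H; exists i.
Qed.

Lemma d_ge0 x y : 0 <= d x y.
Proof. by case: d_thetaP => // m _ _; exact: exprn_ge0. Qed.

Lemma d_le1 x y : d x y <= 1.
Proof. by case: d_thetaP => // m _ _; exact: exprn_ile1. Qed.

Lemma d_refl x : d x x = 0.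
Proof. by case: d_thetaP => // m _; rewrite eqxx. Qed.

Lemma d_agree n x y : (forall i, (i < n)%N -> sval x i = sval y i) ->
  d x y <= theta ^+ n.
Proof.
move=> xy; case: d_thetaP => [_|m _ /eqP mxy]; first exact: exprn_ge0.
have nm : (n <= m)%N by rewrite leqNgt; apply/negP => /xy.
by rewrite ler_wiXn2l.
Qed.

Lemma d_lt_agree n x y i : d x y < theta ^+ n -> (i <= n)%N -> sval x i = sval y i.
Proof.
case: d_thetaP => [->//|m H _ mn ni]; apply: H.
rewrite (leq_ltn_trans ni)// ltnNge; apply/negP => nm.
by move: mn; rewrite ltNge ler_wiXn2l.
Qed.

Lemma d_head x y : sval x 0%N <> sval y 0%N -> d x y = 1.
Proof.
move=> xy; case: d_thetaP => [E|[|m] H _]; first by rewrite E in xy.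
- by rewrite expr0.
- by case: xy; exact: H.
Qed.

Lemma d_tail x y : sval x 0%N = sval y 0%N -> d x y = theta * d (sh x) (sh y).
Proof.
move=> xy; case: d_thetaP => [->|m H H']; first by rewrite d_refl mulr0.
case: m H H' => [_|m H H']; first by rewrite xy eqxx.
rewrite exprS; case: d_thetaP => [E|m' h h'].
  by move: H'; rewrite -[sval x _]/(sval (sh x) m) E eqxx.
suff -> : m = m' by [].
apply/eqP; rewrite eqn_leq; apply/andP; split; rewrite leqNgt; apply/negP => mm.
  by move: h'; rewrite (_ : sval (sh x) m' = sval (sh y) m') ?eqxx//; exact: (H m'.+1).
by move/eqP: H'; apply; exact: (h m).
Qed.

Lemma d_scons a x y : precedes a x -> precedes a y ->
  d (scons a x) (scons a y) = theta * d x y.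
Proof. by move=> ax ay; rewrite d_tail ?sval_scons// !shift_scons. Qed.

Lemma d_iter n x y : d (iter n sh x) (iter n sh y) <= d x y / theta ^+ n.
Proof.
have thn : 0 < theta ^+ n by exact: exprn_gt0.
case: (d_thetaP x y) => [->|m H _]; first by rewrite d_refl mul0r.
have [nm|mn] := leqP n m.
  rewrite -exprB ?gt_eqF// ?unitfE ?gt_eqF//; apply: d_agree => i im.
  by rewrite !sval_iter_shift; apply: H; lia.
rewrite (le_trans (d_le1 _ _))// ler_pdivlMr// mul1r ler_wiXn2l//.
exact: ltnW.
Qed.

Lemma exprn_lt_eps (r e : R) : 0 <= r < 1 -> 0 < e -> exists n, r ^+ n < e.
Proof.
move=> /andP[r0 r1] e0.
have /cvgrPdist_lt/(_ e e0)[n _ /(_ n (leqnn _))] : r ^+ n @[n --> \oo] --> 0.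
  by apply: cvg_expr; rewrite ger0_norm.
by rewrite /= sub0r normrN ger0_norm ?exprn_ge0// => ?; exists n.
Qed.

(** Bounds are predicates rather than norms in the extended reals: only estimates are propagated,
    and finiteness never has to be argued. *)
Definition bounded_by (v : S -> R[i]) (a : R) := forall x, normc (v x) <= a.
Definition lip_by (v : S -> R[i]) (b : R) :=
  forall x y, normc (v x - v y) <= b * d x y.

Lemma lip_by_cst c : lip_by (fun=> c) 0.
Proof. by move=> x y; rewrite subrr mul0r ComplexField.Normc.normc0. Qed.

Lemma lip_byW v b b' : b <= b' -> lip_by v b -> lip_by v b'.
Proof. by move=> bb vb x y; rewrite (le_trans (vb x y))// ler_wpM2r ?d_ge0. Qed.

Lemma bounded_byW v b b' : b <= b' -> bounded_by v b -> bounded_by v b'.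
Proof. by move=> bb vb x; rewrite (le_trans (vb x)). Qed.

Lemma bounded_by_ge0 v a : bounded_by v a -> 0 <= a.
Proof. by move=> /(_ point); apply: le_trans; exact: normc_ge0. Qed.

Lemma lip_byD v w b c : lip_by v b -> lip_by w c ->
  lip_by (fun x => v x + w x) (b + c).
Proof.
move=> vb wc x y; rewrite opprD addrACA mulrDl.
by rewrite (le_trans (normc_triangle _ _))// lerD.
Qed.

Lemma bounded_byD v w b c : bounded_by v b -> bounded_by w c ->
  bounded_by (fun x => v x + w x) (b + c).
Proof. by move=> vb wc x; rewrite (le_trans (normc_triangle _ _))// lerD. Qed.

Lemma lip_byN v b : lip_by v b -> lip_by (fun x => - v x) b.
Proof. by move=> vb x y; rewrite -opprD normc_opp. Qed.

Lemma bounded_byN v b : bounded_by v b -> bounded_by (fun x => - v x) b.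
Proof. by move=> vb x; rewrite normc_opp. Qed.

Lemma lip_byM v w a b a' b' : bounded_by v a -> lip_by v b ->
  bounded_by w a' -> lip_by w b' -> lip_by (fun x => v x * w x) (a * b' + b * a').
Proof.
move=> va vb wa wb x y.
have -> : v x * w x - v y * w y = v x * (w x - w y) + (v x - v y) * w y by ring.
rewrite (le_trans (normc_triangle _ _))// !normcM mulrDl lerD//.
  by rewrite -mulrA ler_pM ?normc_ge0.
by rewrite mulrAC ler_pM ?normc_ge0.
Qed.

Lemma bounded_byM v w a a' : bounded_by v a -> bounded_by w a' ->
  bounded_by (fun x => v x * w x) (a * a').
Proof. by move=> va wa x; rewrite normcM ler_pM ?normc_ge0. Qed.

Lemma lip_byX v b k : bounded_by v 1 -> lip_by v b ->
  lip_by (fun x => v x ^+ k) (k%:R * b).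
Proof.
move=> v1 vb; elim: k => [|k IH].
  by move=> x y; rewrite !expr0 subrr ComplexField.Normc.normc0 !mul0r.
have vk1 : bounded_by (fun x => v x ^+ k) 1.
  by move=> x; rewrite normcX exprn_ile1// normc_ge0.
move=> x y; rewrite !exprS; have := lip_byM v1 vb vk1 IH x y.
by suff -> : 1 * (k%:R * b) + b * 1 = k.+1%:R * b by []; rewrite -natr1; ring.
Qed.

Section Operators.
Context (K : nzRingType).

(** The sum runs over admissible symbols instead of over a set of preimages, and over any ring, so
    that the real eigenfunction equation and the complex twisted operators share their algebra. *)
Definition transfer (w v : S -> K) : S -> K :=
  fun x => \sum_(a | precedes a x) w (scons a x) * v (scons a x).

Lemma transferD (w v v' : S -> K) x :
  transfer w (fun x => v x + v' x) x = transfer w v x + transfer w v' x.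
Proof. by rewrite -big_split; apply: eq_bigr => a _; rewrite mulrDr. Qed.

Lemma transferB (w v v' : S -> K) x :
  transfer w (fun x => v x - v' x) x = transfer w v x - transfer w v' x.
Proof. by rewrite -sumrB; apply: eq_bigr => a _; rewrite mulrBr. Qed.

Lemma transfer_sum (I : Type) (s : seq I) (P : pred I) (w : S -> K) (F : I -> S -> K) x :
  transfer w (fun x => \sum_(i <- s | P i) F i x) x =
  \sum_(i <- s | P i) transfer w (F i) x.
Proof. by rewrite exchange_big /=; apply: eq_bigr => a _; rewrite mulr_sumr. Qed.

Lemma transfer_ext (w w' v v' : S -> K) x : (forall y, w y * v y = w' y * v' y) ->
  transfer w v x = transfer w' v' x.
Proof. by move=> H; apply: eq_bigr => a _. Qed.

Definition cocycle (w : S -> K) n x : K := \prod_(j < n) w (iter j sh x).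

Lemma cocycleS w n x : cocycle w n.+1 x = w x * cocycle w n (sh x).
Proof.
rewrite /cocycle big_ord_recl; congr (_ * _); apply: eq_bigr => i _.
by rewrite lift0 iterSr.
Qed.

End Operators.

Lemma iter_transfer (K : comNzRingType) (w v : S -> K) n x :
  iter n (transfer w) v x = \sum_(y <- preimages n x) cocycle w n y * v y.
Proof.
elim: n v x => [|n IH] v x.
  by rewrite /= big_seq1 /cocycle big_ord0 mul1r.
rewrite iterSr IH big_preimagesS; apply: eq_bigr => y _.
rewrite mulr_sumr; apply: eq_bigr => a ay.
by rewrite cocycleS shift_scons// mulrCA mulrA.
Qed.

(** A Lasota-Yorke inequality: the factor [theta] is the contraction of the inverse branches. Points
    with different first symbols have different branches, but they are at distance 1, where the
    crude bound [2 * a] suffices. *)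
Lemma transfer_lip w v C a b :
  (forall x, \sum_(s | precedes s x) normc (w (scons s x)) <= 1) ->
  lip_by w C -> bounded_by v a -> lip_by v b -> 0 <= C -> 0 <= b ->
  lip_by (transfer w v) (theta * b + (kappa%:R * C + 2) * a).
Proof.
move=> w1 wC va vb C0 b0 x y; have a0 := bounded_by_ge0 va.
have [xy|xy] := eqVneq (sval x 0%N) (sval y 0%N); last first.
  rewrite (d_head (elimN eqP xy)) mulr1.
  have H z : normc (transfer w v z) <= a.
    rewrite (le_trans (normc_sum _ _ _))//.
    rewrite (@le_trans _ _ (\sum_(s | precedes s z) normc (w (scons s z)) * a))//.
      by apply: ler_sum => s _; rewrite normcM ler_wpM2l ?normc_ge0.
    by rewrite -mulr_suml ler_piMl.
  rewrite (le_trans (normc_triangle _ _))// normc_opp (le_trans (lerD (H x) (H y)))//.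
  have : 0 <= theta * b by rewrite mulr_ge0.
  have : 0 <= kappa%:R * C * a by rewrite !mulr_ge0.
  lra.
have E s : precedes s y = precedes s x by rewrite /precedes xy.
rewrite /transfer (eq_bigl _ _ E) -sumrB (le_trans (normc_sum _ _ _))//.
rewrite (@le_trans _ _ (\sum_(s | precedes s x)
   (normc (w (scons s x)) * (b * (theta * d x y)) + C * (theta * d x y) * a)))//.
  apply: ler_sum => s sx; have sy : precedes s y by rewrite E.
  have -> : w (scons s x) * v (scons s x) - w (scons s y) * v (scons s y) =
    w (scons s x) * (v (scons s x) - v (scons s y)) +
    (w (scons s x) - w (scons s y)) * v (scons s y) by ring.
  rewrite (le_trans (normc_triangle _ _))// !normcM -(d_scons sx sy) lerD//.
    by rewrite ler_wpM2l ?normc_ge0.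
  by rewrite ler_pM ?normc_ge0.
rewrite big_split /= -mulr_suml.
rewrite (@le_trans _ _ (b * (theta * d x y) +
    \sum_(s < kappa) C * (theta * d x y) * a))//.
  rewrite lerD//.
    by rewrite ler_piMl// !mulr_ge0 ?d_ge0.
  rewrite big_mkcond; apply: ler_sum => s _; case: ifP => // _.
  by rewrite !mulr_ge0 ?d_ge0.
rewrite sumr_const card_ord -mulr_natl.
have H : kappa%:R * (C * (theta * d x y) * a) <= kappa%:R * C * a * d x y.
  rewrite (_ : _ * (C * _ * a) = kappa%:R * C * a * (theta * d x y)); last by ring.
  by rewrite ler_wpM2l ?mulr_ge0// ler_piMl ?d_ge0.
have : 0 <= 2 * a * d x y by rewrite !mulr_ge0 ?d_ge0.
lra.
Qed.

Lemma transfer_bounded w v a :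
  (forall x, \sum_(s | precedes s x) normc (w (scons s x)) <= 1) ->
  bounded_by v a -> bounded_by (transfer w v) a.
Proof.
move=> w1 va x; have a0 := bounded_by_ge0 va.
rewrite (le_trans (normc_sum _ _ _))//.
rewrite (@le_trans _ _ (\sum_(s | precedes s x) normc (w (scons s x)) * a))//.
  by apply: ler_sum => s _; rewrite normcM ler_wpM2l ?normc_ge0.
by rewrite -mulr_suml ler_piMl.
Qed.

End Metric.

(** * Spectral gap for products of Markov operators *)

Section SpectralGap.
Context (R : realType) (kappa : nat) (A : aperiodic_matrix kappa) (theta : R).
Context (theta01 : 0 < theta < 1).
Local Notation S := (shift_space A).
Local Notation sh := (@sft_shift kappa A).
Local Notation d := (@d_theta R kappa A theta).
Implicit Types (x y : S) (v : S -> R[i]) (g : S -> R) (gs : nat -> S -> R).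

Let th0 : 0 < theta. Proof. by case/andP: theta01. Qed.
Let th1 : theta < 1. Proof. by case/andP: theta01. Qed.

Definition osc_by v (o : R) := forall x y, normc (v x - v y) <= o.

Lemma osc_by_ge0 v o : osc_by v o -> 0 <= o.
Proof. by move=> /(_ point point); apply: le_trans; exact: normc_ge0. Qed.

Lemma lip_by_ge0 v b : lip_by theta v b -> 0 <= b.
Proof.
move=> vb; have k2 := tmx_ge2 A.
have i0 : (0 < kappa)%N by lia.
have [x x0] := exists_start A (Ordinal i0).
have [y y0] := exists_start A (Ordinal k2).
have xy : d x y = 1 by apply: d_head; rewrite x0 y0.
by have := vb x y; rewrite xy mulr1; apply: le_trans; exact: normc_ge0.
Qed.

Lemma lip_by_osc v b : lip_by theta v b -> osc_by v b.
Proof.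
move=> vb x y; rewrite (le_trans (vb x y))// ler_piMr ?d_le1//.
exact: lip_by_ge0 vb.
Qed.

Definition ctransfer g : (S -> R[i]) -> (S -> R[i]) := transfer (fun y => (g y)%:C).

Definition markov_weight (gamma C : R) g :=
  [/\ forall x, \sum_(a | precedes a x) g (scons a x) = 1,
      forall y, gamma <= g y & lip_by theta (fun y => (g y)%:C) C].

(** The weight may change from step to step, because the eigenfunction is constructed from such a
    nonstationary product, before any single normalized weight is available. *)
Fixpoint transfers gs n v :=
  if n is n'.+1 then ctransfer (gs n') (transfers gs n' v) else v.

Lemma transfers_cst g n v : transfers (fun=> g) n v = iter n (ctransfer g) v.
Proof. by elim: n => [//|n IH] /=; rewrite IH. Qed.

Lemma transfersD gs n m v :
  transfers gs (n + m) v = transfers (fun i => gs (n + i)%N) m (transfers gs n v).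
Proof. by elim: m => [|m IH]; rewrite ?addn0// addnS /= IH. Qed.

Context (gamma C : R) (gamma0 : 0 < gamma) (C0 : 0 <= C).

Lemma markov_norm g : markov_weight gamma C g ->
  forall x, \sum_(a | precedes a x) normc ((g (scons a x))%:C) <= 1.
Proof.
move=> [g1 ggamma _] x; rewrite -[leRHS](g1 x) le_eqVlt; apply/orP; left; apply/eqP.
by apply: eq_bigr => a _; rewrite normc_real ger0_norm// (le_trans _ (ggamma _))// ltW.
Qed.

Lemma markov_cst g c x : markov_weight gamma C g -> ctransfer g (fun=> c) x = c.
Proof.
move=> [g1 _ _]; rewrite /ctransfer /transfer -mulr_suml -[RHS]mul1r; congr (_ * _).
by rewrite -(rmorph_sum (@real_complex R)) /= g1.
Qed.

(** The difference of two averages is an average of differences over the product of the two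
    probability vectors. *)
Lemma markov_osc g v o : markov_weight gamma C g -> osc_by v o -> osc_by (ctransfer g v) o.
Proof.
move=> mg vo x y; pose p z a := g (@scons _ A a z).
have p1 z : \sum_(a | precedes a z) (p z a)%:C = 1 :> R[i].
  by rewrite -(rmorph_sum (@real_complex R)); case: mg => -> _ _.
have p0 z a : 0 <= p z a by case: mg => _ + _ => /(_ (scons a z)); apply/le_trans/ltW.
have -> : ctransfer g v x - ctransfer g v y =
    \sum_(a | precedes a x) \sum_(b | precedes b y)
      (p x a)%:C * (p y b)%:C * (v (scons a x) - v (scons b y)).
  rewrite (eq_bigr (fun a => (p x a)%:C * v (scons a x) - (p x a)%:C * ctransfer g v y)).
    by rewrite sumrB -mulr_suml p1 mul1r.
  move=> a _; rewrite (eq_bigr (fun b => (p y b)%:C * ((p x a)%:C * v (scons a x)) -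
      (p x a)%:C * ((p y b)%:C * v (scons b y)))).
    by rewrite sumrB -mulr_suml p1 mul1r -mulr_sumr.
  by move=> b _; ring.
rewrite (le_trans (normc_sum _ _ _))//.
rewrite (@le_trans _ _ (\sum_(a | precedes a x) p x a * o))//; last first.
  by rewrite -mulr_suml; case: mg => -> _ _; rewrite mul1r.
apply: ler_sum => a _; rewrite (le_trans (normc_sum _ _ _))//.
rewrite (@le_trans _ _ (\sum_(b | precedes b y) p y b * (p x a * o)))//; last first.
  by rewrite -mulr_suml; case: mg => -> _ _; rewrite mul1r.
apply: ler_sum => b _; rewrite !normcM !normc_real !ger0_norm//.
by rewrite mulrAC mulrA mulrC mulrA ler_wpM2l ?mulr_ge0// mulrC.
Qed.

Definition lip_gain := kappa%:R * C + 2.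

Lemma lip_gain_ge0 : 0 <= lip_gain. Proof. by rewrite addr_ge0// mulr_ge0. Qed.

(** Markov operators fix constants, so [v point] can be subtracted first; the sup norm in
    [transfer_lip] then becomes the oscillation of v. *)
Lemma markov_lip g v o l : markov_weight gamma C g -> osc_by v o ->
  lip_by theta v l -> lip_by theta (ctransfer g v) (theta * l + lip_gain * o).
Proof.
move=> mg vo vl; have l0 := lip_by_ge0 vl; have [_ _ gC] := mg.
have vl' : lip_by theta (fun x => v x + - v point) l.
  by move=> x y; have := vl x y; congr (normc _ <= _); ring.
have := transfer_lip theta01 (markov_norm mg) gC (fun x => vo x point) vl' C0 l0.
have E z : ctransfer g (fun x => v x + - v point) z = ctransfer g v z - v point.
  by rewrite /ctransfer transferD; congr (_ + _); exact: (markov_cst _ _ mg).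
rewrite -/(ctransfer g _) => H x y; have := H x y; rewrite !E.
by congr (normc _ <= _); ring.
Qed.

Lemma transfers_osc gs n v o : (forall i, markov_weight gamma C (gs i)) ->
  osc_by v o -> osc_by (transfers gs n v) o.
Proof. by move=> mg vo; elim: n => [//|n IH]; exact: markov_osc. Qed.

Lemma transfers_lip gs n v o l : (forall i, markov_weight gamma C (gs i)) ->
  osc_by v o -> lip_by theta v l ->
  lip_by theta (transfers gs n v) (theta ^+ n * l + lip_gain / (1 - theta) * o).
Proof.
move=> mg vo vl; elim: n => [|n IH].
  apply: (lip_byW theta01 _ vl); rewrite expr0 mul1r lerDl mulr_ge0 ?(osc_by_ge0 vo)//.
  by rewrite divr_ge0 ?lip_gain_ge0// subr_ge0 ltW.
apply: (lip_byW theta01 _ (markov_lip (mg n) (transfers_osc n mg vo) IH)).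
rewrite mulrDr mulrA -exprS -addrA lerD2l le_eqVlt; apply/orP; left; apply/eqP.
by field; rewrite subr_eq0 gt_eqF.
Qed.

(** The n-step operator is again an average over preimages, with weights bounded below: this is what
    the coupling of two such averages requires. *)
Lemma transfersE gs n v x : (forall i, markov_weight gamma C (gs i)) ->
  exists2 p : S -> R, (forall y, gamma ^+ n <= p y) &
    \sum_(y <- preimages n x) p y = 1 /\
    (transfers gs n v x = \sum_(y <- preimages n x) (p y)%:C * v y).
Proof.
move=> mg; pose p := fix p n (y : S) := if n is m.+1 then gs m (iter m sh y) * p m y else 1.
exists (p n).
  move=> y; elim: n => [|n IH]; first by rewrite expr0.
  have [_ /(_ (iter n sh y)) H _] := mg n.
  by rewrite exprS /=; apply: ler_pM => //; [exact: ltW|exact/exprn_ge0/ltW].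
elim: n x => [|n IH] x.
  by rewrite /= !big_seq1 mul1r.
have E (V : comNzRingType) (F G : S -> V) : \sum_(y <- preimages n.+1 x) G (iter n sh y) * F y =
    \sum_(a | precedes a x) G (scons a x) * \sum_(z <- preimages n (scons a x)) F z.
  rewrite -addn1 big_preimagesD big_preimages1; apply: eq_bigr => a ax.
  rewrite mulr_sumr big_seq [RHS]big_seq; apply: eq_bigr => y.
  by rewrite mem_preimages => /eqP ->.
split.
  have [g1 _ _] := mg n; rewrite -(g1 x).
  apply: etrans (E _ (p n) (gs n)) _.
  by apply: eq_bigr => a _; have [-> _] := IH (scons a x); rewrite mulr1.
have -> : transfers gs n.+1 v x = ctransfer (gs n) (transfers gs n v) x by [].
rewrite (eq_bigr (fun y => (gs n (iter n sh y))%:C * ((p n y)%:C * v y))).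
  rewrite (E _ _ (fun y => (gs n y)%:C)); apply: eq_bigr => a _.
  by have [_ ->] := IH (scons a x).
by move=> y _; rewrite /= rmorphM mulrA.
Qed.

Context (M : nat) (mixM : mixing_time A M).

(* Any two points have preimages of order N + M that share their first N
   symbols; the corresponding terms of the two averages are paired. *)
Lemma transfers_osc_contract gs N v o l : (forall i, markov_weight gamma C (gs i)) ->
  osc_by v o -> lip_by theta v l ->
  osc_by (transfers gs (N + M) v)
    ((1 - gamma ^+ (N + M) ^+ 2) * o + gamma ^+ (N + M) ^+ 2 * (theta ^+ N * l)).
Proof.
move=> mg vo vl x y; set n := (N + M)%N; set q := gamma ^+ n.
have l0 := lip_by_ge0 vl; have o0 := osc_by_ge0 vo.
have [p pq [p1 ->]] := transfersE n v x mg.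
have [p' pq' [p1' ->]] := transfersE n v y mg.
have q0 : 0 < q by exact: exprn_gt0.
have [w wx wp] := mixing_preimage N x x mixM.
have [w' wy wp'] := mixing_preimage N y x mixM.
have ww : normc (v w - v w') <= theta ^+ N * l.
  rewrite (le_trans (vl w w'))// mulrC ler_wpM2r//; apply: d_agree => // i iN.
  by rewrite wp ?(ltnW iN)// wp' ?(ltnW iN).
have wi : w \in preimages n x by rewrite mem_preimages wx.
have wi' : w' \in preimages n y by rewrite mem_preimages wy.
pose s := preimages n x; pose s' := preimages n y.
have -> : \sum_(z <- s) (p z)%:C * v z - \sum_(z <- s') (p' z)%:C * v z =
    \sum_(z <- s) \sum_(z' <- s') (p z)%:C * (p' z')%:C * (v z - v z').
  set X' := \sum_(z <- s') _.
  have P1 : \sum_(z <- s) (p z)%:C = 1 :> R[i] by rewrite -(rmorph_sum (@real_complex R)) p1.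
  have P1' : \sum_(z <- s') (p' z)%:C = 1 :> R[i] by rewrite -(rmorph_sum (@real_complex R)) p1'.
  transitivity (\sum_(z <- s) ((p z)%:C * v z - (p z)%:C * X')).
    by rewrite sumrB -mulr_suml P1 mul1r.
  apply: eq_bigr => z _; rewrite [RHS](eq_bigr (fun b => (p' b)%:C * ((p z)%:C * v z) -
      (p z)%:C * ((p' b)%:C * v b))).
    by rewrite sumrB -mulr_suml P1' mul1r -mulr_sumr.
  by move=> b _; ring.
have p0 z : 0 <= p z by rewrite (le_trans _ (pq z))// ltW.
have p0' z : 0 <= p' z by rewrite (le_trans _ (pq' z))// ltW.
pose D z z' := if (z == w) && (z' == w') then normc (v w - v w') else o.
have Do z z' : normc (v z - v z') <= D z z'.
  by rewrite /D; case: ifP => [/andP[/eqP -> /eqP ->]|_].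
rewrite (@le_trans _ _ (\sum_(z <- s) \sum_(z' <- s') p z * p' z' * D z z'))//.
  rewrite (le_trans (normc_sum _ _ _))//; apply: ler_sum => z _.
  rewrite (le_trans (normc_sum _ _ _))//; apply: ler_sum => z' _.
  rewrite !normcM !normc_real !ger0_norm// ler_wpM2l// mulr_ge0//.
set dw := normc (v w - v w'); have dwo : dw <= o by exact: vo.
have -> : \sum_(z <- s) \sum_(z' <- s') p z * p' z' * D z z' =
    o - p w * p' w' * (o - dw).
  rewrite (eq_bigr (fun z => p z * o - (if z == w then p w * p' w' * (o - dw) else 0))).
    rewrite sumrB -mulr_suml p1 mul1r -big_mkcond /=.
    by rewrite -big_filter filter_pred1_uniq ?preimages_uniq// big_seq1.
  move=> z _.
  rewrite (eq_bigr (fun z' => p' z' * (p z * o) -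
     (if z' == w' then (if z == w then p w * p' w' * (o - dw) else 0) else 0))).
    rewrite sumrB -mulr_suml p1' mul1r -big_mkcond /=.
    by rewrite -big_filter filter_pred1_uniq ?preimages_uniq// big_seq1.
  move=> z' _; rewrite /D; case: eqVneq => [->|_] /=; case: eqVneq => [->|_] /=; rewrite -?/dw; ring.
have : q ^+ 2 * (o - dw) <= p w * p' w' * (o - dw).
  by rewrite ler_wpM2r ?subr_ge0// expr2 ler_pM// ltW.
have : q ^+ 2 * dw <= q ^+ 2 * (theta ^+ N * l) by rewrite ler_wpM2l// exprn_ge0// ltW.
lra.
Qed.

End SpectralGap.

Section Gap.
Context (R : realType) (kappa : nat) (A : aperiodic_matrix kappa) (theta : R).
Context (theta01 : 0 < theta < 1).
Local Notation S := (shift_space A).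
Implicit Types (x y : S) (v w : S -> R[i]).

Let th0 : 0 < theta. Proof. by case/andP: theta01. Qed.
Let th1 : theta < 1. Proof. by case/andP: theta01. Qed.

Lemma markov_weightW (gamma gamma' C : R) (g : S -> R) : gamma' <= gamma ->
  markov_weight theta gamma C g -> markov_weight theta gamma' C g.
Proof. by move=> gg [g1 g2 g3]; split=> // y; rewrite (le_trans gg). Qed.

(** Neither the oscillation o nor the Lipschitz constant l contracts alone, since each is fed by the
    other; the combination [o + b * l] contracts over a block of N + M steps once b is small. *)
Lemma spectral_gap (gamma C : R) : 0 < gamma -> 0 <= C ->
  exists K r : R, [/\ 0 <= K, 0 < r < 1 &
    forall (gs : nat -> S -> R) v l n,
      (forall i, markov_weight theta gamma C (gs i)) -> lip_by theta v l ->
      osc_by (transfers gs n v) (K * r ^+ n * l) /\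
      lip_by theta (transfers gs n v) (K * r ^+ n * l)].
Proof.
(* The cap 1/2 gives g <= 1/2 below, which keeps [1 - g] and r0 positive. *)
move=> gamma_gt0 C0; pose gamma1 := Num.min gamma 2^-1.
have g10 : 0 < gamma1 by rewrite lt_min gamma_gt0 invr_gt0 ltr0n.
have g11 : gamma1 <= 2^-1 by rewrite ge_min lexx orbT.
have g1g : gamma1 <= gamma by rewrite ge_min lexx.
have [M mixM] := exists_mixing_time A.
pose C1 := lip_gain kappa C / (1 - theta).
have C12 : 2 <= C1.
  rewrite /C1 ler_pdivlMr ?subr_gt0// /lip_gain.
  have : 0 <= kappa%:R * C by rewrite mulr_ge0.
  by have := th0; lra.
(* N makes [C1 * theta ^+ N] at most 1/16, so that the Lipschitz part fed into the oscillation is at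
   most a quarter of [b * l]. *)
have [N HN] : exists N, theta ^+ N < (16 * C1)^-1.
  by apply: exprn_lt_eps; rewrite ?ltW// invr_gt0; lra.
pose n := (N + M)%N; pose g := gamma1 ^+ n ^+ 2.
have g0 : 0 < g by rewrite !exprn_gt0.
have n0 : (0 < n)%N by rewrite /n addn_gt0; case: mixM => ->; rewrite orbT.
have g1 : g <= 2^-1.
  rewrite /g -exprM (le_trans _ g11)// -[leRHS]expr1 ler_wiXn2l// ?ltW//; first lra.
  by rewrite muln_gt0 n0.
(* With this b one has [b * C1 = g / 4]: the oscillation fed into the Lipschitz part returns only a
   quarter of the gain g of the coupling. *)
pose b := g / (4 * C1).
have b0 : 0 < b by rewrite divr_gt0//; lra.
pose r0 := 1 - g / 2.
have r00 : 0 < r0 by rewrite /r0; lra.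
have r01 : r0 < 1 by rewrite /r0; lra.
have step gs v o l : (forall i, markov_weight theta gamma1 C (gs i)) ->
    osc_by v o -> lip_by theta v l -> exists c1 l1, [/\ osc_by (transfers gs n v) c1,
    lip_by theta (transfers gs n v) l1 & c1 + b * l1 <= r0 * (o + b * l)].
  move=> mg vo vl; have o0 := osc_by_ge0 vo; have l0 := lip_by_ge0 theta01 vl.
  exists ((1 - g) * o + g * (theta ^+ N * l)), (theta ^+ n * l + C1 * o); split.
  - exact: (transfers_osc_contract theta01 g10 mixM).
  - exact: (transfers_lip theta01 g10 C0).
  have bC : b * C1 = g / 4 by rewrite /b; field; lra.
  have gb : g = 4 * C1 * b by rewrite /b; field; lra.
  have thn : theta ^+ n <= theta ^+ N by rewrite ler_wiXn2l ?ltW// leq_addr.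
  have tN0 : 0 <= theta ^+ N by rewrite exprn_ge0 ?ltW.
  have C1t : C1 * theta ^+ N <= 16^-1.
    rewrite mulrC -ler_pdivlMr; last lra.
    by rewrite -invfM ltW.
  have tN : theta ^+ N <= 32^-1.
    have : 2 * theta ^+ N <= C1 * theta ^+ N by rewrite ler_wpM2r.
    lra.
  have bl0 : 0 <= b * l by rewrite mulr_ge0// ltW.
  have H1 : g * (theta ^+ N * l) <= 4^-1 * (b * l).
    rewrite {1}gb (_ : _ * (_ * l) = 4 * (C1 * theta ^+ N) * (b * l)); last by ring.
    by rewrite ler_wpM2r//; lra.
  have H2 : b * (theta ^+ n * l) <= 32^-1 * (b * l).
    by rewrite mulrCA ler_wpM2r// (le_trans thn).
  have H3 : b * (C1 * o) = g / 4 * o by rewrite mulrA bC.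
  have H4 : g / 2 * (b * l) <= 4^-1 * (b * l) by rewrite ler_wpM2r//; lra.
  have H5 : 0 <= g * o by rewrite mulr_ge0// ltW.
  rewrite mulrDr /r0 H3; move: H1 H2 H4 H5 bl0; set X := g * (_ * l).
  set Y := b * (theta ^+ n * l); set Z := b * l; lra.
have blocks q gs v o l : (forall i, markov_weight theta gamma1 C (gs i)) ->
    osc_by v o -> lip_by theta v l -> exists c1 l1, [/\ osc_by (transfers gs (q * n) v) c1,
    lip_by theta (transfers gs (q * n) v) l1 & c1 + b * l1 <= r0 ^+ q * (o + b * l)].
  move=> mg vo vl; elim: q => [|q IHq]; last first.
    have [c1 [l1 [vo1 vl1 H]]] := IHq.
    rewrite mulSnr transfersD.
    have [c2 [l2 [? ? H2]]] :=
      step (fun i => gs (q * n + i)%N) _ _ _ (fun i => mg _) vo1 vl1.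
    exists c2, l2; split => //; rewrite exprS -mulrA (le_trans H2)//.
    by rewrite ler_wpM2l// ltW.
  by exists o, l; split => //; rewrite expr0 mul1r.
(* The rate per step; the division by r0 in the final constant covers the steps after the last full
   block. *)
pose r := r0 `^ n%:R^-1.
have rn : r ^+ n = r0.
  rewrite -powR_mulrn ?powR_ge0// -powRrM mulVf ?powRr1 ?ltW//.
  by rewrite pnatr_eq0 -lt0n.
have rpos : 0 < r by exact: powR_gt0.
have r1 : r < 1.
  rewrite ltNge; apply/negP => r1.
  by move: r01; rewrite -rn ltNge exprn_ege1.
pose K0 := (1 + b) * (1 + b^-1 + C1).
exists (K0 / r0), r; split.
- have ? : 0 < b^-1 by rewrite invr_gt0.
  apply: divr_ge0; last exact: ltW.
  by rewrite /K0 mulr_ge0//; lra.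
- by rewrite rpos.
move=> gs v l m mg vl; have l0 := lip_by_ge0 theta01 vl.
have mg1 i : markov_weight theta gamma1 C (gs i) by exact: markov_weightW (mg i).
have [c1 [l1 [vo1 vl1 H]]] := blocks (m %/ n)%N gs v l l mg1 (lip_by_osc theta01 vl) vl.
have o0 := osc_by_ge0 vo1; have l0' := lip_by_ge0 theta01 vl1.
have rq : r0 ^+ (m %/ n) <= r ^+ m / r0.
  rewrite ler_pdivlMr// -exprSr -rn -exprM.
  rewrite ler_wiXn2l// ?ltW//.
  by rewrite mulnC {1}(divn_eq m n) mulSnr leq_add2l ltnW// ltn_mod.
have T0 : r0 ^+ (m %/ n) * (l + b * l) <= r ^+ m / r0 * ((1 + b) * l).
  rewrite (_ : l + b * l = (1 + b) * l); last by ring.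
  by rewrite ler_wpM2r// mulr_ge0//; lra.
set T := r ^+ m / r0 * ((1 + b) * l) in T0.
have HT := le_trans H T0.
have o1T : c1 <= T.
  have : 0 <= b * l1 by rewrite mulr_ge0// ltW.
  lra.
have l1T : l1 <= b^-1 * T.
  by rewrite ler_pdivlMl//; lra.
have T00 : 0 <= T by rewrite (le_trans o0).
have C1T : C1 * c1 <= C1 * T by rewrite ler_wpM2l//; lra.
have bT : 0 <= b^-1 * T by rewrite mulr_ge0// invr_ge0 ltW.
have -> : K0 / r0 * r ^+ m * l = T + b^-1 * T + C1 * T by rewrite /T /K0; ring.
have C1T0 : 0 <= C1 * T by rewrite mulr_ge0//; lra.
rewrite (divn_eq m n) transfersD; split.
- move=> x y; apply: le_trans (transfers_osc g10 _ (fun i => mg1 _) vo1 x y) _.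
  lra.
- apply: (lip_byW theta01 _ (transfers_lip theta01 g10 C0 _ _ vo1 vl1)) => //.
  have : theta ^+ (m %% n) * l1 <= l1.
    by rewrite ler_piMl// exprn_ile1// ltW.
  rewrite -/C1; lra.
Qed.

Lemma geometric_cauchy (z : nat -> R[i]) (K r : R) : 0 <= r < 1 ->
  (forall n m, (n <= m)%N -> normc (z m - z n) <= K * r ^+ n) ->
  exists c, forall n, normc (z n - c) <= 2 * K * r ^+ n.
Proof.
move=> /andP[r0 r1] H.
have K0 : 0 <= K by have := H 0%N 0%N (leqnn _); rewrite expr0 mulr1; apply: le_trans; exact: normc_ge0.
have real (u : nat -> R) : (forall n m, (n <= m)%N -> `|u m - u n| <= K * r ^+ n) ->
    exists c, forall n, `|u n - c| <= K * r ^+ n.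
  move=> Hu; have Kr : K * r ^+ n @[n --> \oo] --> 0.
    rewrite -[X in _ --> X](mulr0 K); apply: cvgMr.
    by apply: cvg_expr; rewrite ger0_norm.
  have /cauchy_cvgP cu : cauchy (u n @[n --> \oo]).
    apply/cauchyP => e e0.
    move/cvgrPdist_lt : Kr => /(_ e e0) [N _ /(_ N (leqnn _))].
    rewrite /= sub0r normrN ger0_norm ?mulr_ge0 ?exprn_ge0// => Ne.
    exists (u N), N => // m /= Nm; rewrite /ball /= distrC.
    by rewrite (le_lt_trans (Hu _ _ Nm)).
  exists (lim (u n @[n --> \oo])) => n; rewrite distrC.
  have cun : `|u m - u n| @[m --> \oo] --> `|lim (u n @[n --> \oo]) - u n|.
    by apply: cvg_norm; apply: cvgB => //; exact: cvg_cst.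
  rewrite -(cvg_lim _ cun)//; apply: limr_le; first exact/cvgP/cun.
  by exists n => // m /= nm; exact: Hu.
have [a Ha] : exists a, forall n, `|complex.Re (z n) - a| <= K * r ^+ n.
  apply: real => n m nm; rewrite (le_trans _ (H _ _ nm))//.
  by rewrite (le_trans _ (Re_le_normc _))// raddfB.
have [b Hb] : exists a, forall n, `|complex.Im (z n) - a| <= K * r ^+ n.
  apply: real => n m nm; rewrite (le_trans _ (H _ _ nm))//.
  by rewrite (le_trans _ (Im_le_normc _))// raddfB.
exists (a +i* b) => n; rewrite (le_trans (normc_le_ReIm _))//.
by rewrite !raddfB /= -mulrA mulr2n mulrDl mul1r lerD.
Qed.

End Gap.

(** * Eigenfunction and invariant functional *)

Section GeometricLimits.
Context (R : realType).

(** Inequalities are passed to the limit through this lemma: it is enough to have them up to a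
    geometrically small error. *)
Lemma le_geometric (a b K r : R) : 0 <= r < 1 ->
  (forall n, a <= b + K * r ^+ n) -> a <= b.
Proof.
move=> r01 H; rewrite leNgt; apply/negP => ba.
have K0 : 0 < K + 1.
  by have := H 0%N; rewrite expr0 mulr1; lra.
have e0 : 0 < (a - b) / (K + 1) by rewrite divr_gt0// subr_gt0.
have [n] := exprn_lt_eps r01 e0; rewrite ltr_pdivlMr// => Hn.
have := H n; have : 0 <= r ^+ n by rewrite exprn_ge0//; case/andP: r01.
lra.
Qed.

Lemma eq_geometric (a b K r : R) : 0 <= r < 1 ->
  (forall n, `|a - b| <= K * r ^+ n) -> a = b.
Proof.
move=> r01 H; apply/eqP; rewrite -subr_eq0 -normr_le0.
by apply: (le_geometric r01) => n; rewrite add0r; exact: H.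
Qed.

Lemma geometric_increments (u : nat -> R) (K r : R) : 0 <= r < 1 ->
  (forall n, `|u n.+1 - u n| <= K * r ^+ n) ->
  exists c, forall n, `|u n - c| <= 2 * (K / (1 - r)) * r ^+ n.
Proof.
move=> r01 H; have /andP[r0 r1] := r01.
have K0 : 0 <= K by have := H 0%N; rewrite expr0 mulr1; exact: le_trans.
have [c Hc] : exists c, forall n, normc ((u n)%:C - c) <= 2 * (K / (1 - r)) * r ^+ n.
  apply: geometric_cauchy => // n m /subnK <-; rewrite addnC.
  rewrite -raddfB normc_real.
  suff : `|u (n + (m - n))%N - u n| <= K / (1 - r) * (1 - r ^+ (m - n)) * r ^+ n.
    move=> /le_trans; apply; rewrite ler_wpM2r ?exprn_ge0// ler_piMr//.
      by rewrite divr_ge0// subr_ge0 ltW.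
    by rewrite gerBl exprn_ge0.
  elim: (m - n)%N => [|k IH]; first by rewrite addn0 subrr normr0 expr0 subrr mulr0 mul0r.
  rewrite addnS (_ : u _ - _ = (u (n + k).+1 - u (n + k)%N) + (u (n + k)%N - u n)); last by ring.
  rewrite (le_trans (ler_normD _ _))// (le_trans (lerD (H _) IH))//.
  rewrite le_eqVlt; apply/orP; left; apply/eqP.
  by rewrite exprD exprS; field; rewrite subr_eq0 gt_eqF.
exists (complex.Re c) => n; rewrite (le_trans _ (Hc n))//.
by rewrite (le_trans _ (Re_le_normc _))// raddfB.
Qed.

End GeometricLimits.

Section Eigenfunction.
Context (R : realType) (kappa : nat) (A : aperiodic_matrix kappa) (theta : R).
Context (theta01 : 0 < theta < 1).
Local Notation S := (shift_space A).
Local Notation sh := (@sft_shift kappa A).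
Local Notation d := (@d_theta R kappa A theta).
Implicit Types (x y z : S) (u v : S -> R).

Let th0 : 0 < theta. Proof. by case/andP: theta01. Qed.
Let th1 : theta < 1. Proof. by case/andP: theta01. Qed.

(** A cone condition on log u. Points with different first symbols are not compared, because their
    inverse branches differ. *)
Definition log_lip (B : R) u :=
  forall x y, sval x 0%N = sval y 0%N -> u x <= expR (B * d x y) * u y.

Lemma d_sym x y : d x y = d y x.
Proof.
suff H z w : d z w <= d w z by apply/eqP; rewrite eq_le !H.
case: (d_thetaP theta w z) => [->|m H _]; first by rewrite d_refl.
by apply: d_agree => // i im; rewrite H.
Qed.

Lemma expR_sub1_le (B t : R) : 0 <= B -> 0 <= t <= 1 ->
  expR (B * t) - 1 <= B * expR B * t.
Proof.
move=> B0 /andP[t0 t1].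
have H : 1 - B * t <= expR (- (B * t)) by exact: expR_ge1Dx.
have E : expR (- (B * t)) * expR (B * t) = 1 by rewrite mulrC expRxMexpNx_1.
have H2 : expR (B * t) <= expR B by rewrite ler_expR ler_piMr.
have Bt : 0 <= B * t by exact: mulr_ge0.
have H3 : (1 - B * t) * expR (B * t) <= 1.
  by rewrite -[leRHS]E ler_wpM2r// ltW ?expR_gt0.
have : B * t * expR (B * t) <= B * t * expR B by rewrite ler_wpM2l.
lra.
Qed.

Lemma log_lip_lip B U u : 0 <= B -> (forall x, 0 < u x <= U) -> log_lip B u ->
  lip_by theta (fun x => (u x)%:C) (U * (B * expR B + 1)).
Proof.
move=> B0 uU ul.
have U0 : 0 < U by have /andP[a b] := uU point; exact: lt_le_trans b.
have half x y : u x - u y <= U * (B * expR B + 1) * d x y.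
  have [xy|/eqP xy] := eqVneq (sval x 0%N) (sval y 0%N).
    have := expR_sub1_le B0 (_ : 0 <= d x y <= 1).
    rewrite d_ge0// d_le1// => /(_ isT) H.
    have := ul x y xy; have /andP[uy0 uyU] := uU y.
    have : u y * (expR (B * d x y) - 1) <= U * (B * expR B * d x y).
      apply: ler_pM => //; first exact: ltW.
      by rewrite subr_ge0 -expR0 ler_expR mulr_ge0 ?d_ge0.
    have : 0 <= U * d x y by rewrite mulr_ge0 ?d_ge0// ltW.
    lra.
  rewrite (d_head theta xy) mulr1.
  have /andP[uy0 _] := uU y; have /andP[_ uxU] := uU x.
  have : 0 <= U * (B * expR B) by rewrite !mulr_ge0 ?expR_ge0// ltW.
  lra.
move=> x y; rewrite -raddfB normc_real ler_norml half andbT.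
by rewrite lerNl opprB d_sym half.
Qed.

Context (F : S -> R) (LF BF : R).
Context (F_lip : forall x y, `|F x - F y| <= LF * d x y) (F_bound : forall x, `|F x| <= BF).

Let LF0 : 0 <= LF.
Proof.
apply: (@lip_by_ge0 _ _ A _ theta01 (fun x => (F x)%:C)) => x y.
by rewrite -raddfB normc_real.
Qed.

Let BF0 : 0 <= BF. Proof. exact: le_trans (F_bound point). Qed.

Local Notation ell := (transfer (fun y => expR (F y))).

Lemma expF_le x : expR (F x) <= expR BF.
Proof. by rewrite ler_expR (le_trans _ (F_bound x))// ler_norm. Qed.

Lemma expF_ge x : expR (- BF) <= expR (F x).
Proof. by rewrite ler_expR; have := F_bound x; rewrite ler_norml => /andP[]. Qed.

Lemma expF_lip x y : expR (F x) <= expR (LF * d x y) * expR (F y).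
Proof.
rewrite -expRD ler_expR -lerBlDr.
by rewrite (le_trans (ler_norm _)).
Qed.

Lemma exists_precedes x : exists a, precedes a x.
Proof.
have [M [M0 HM]] := exists_mixing_time A.
have [e _ eM] := HM (sval x 0%N) (sval x 0%N).
exists (sval e M.-1); apply/eqP.
by rewrite -eM -{2}(prednK M0); exact: (svalP e).
Qed.

Lemma transfer_pos u : (forall x, 0 < u x) -> forall x, 0 < ell u x.
Proof.
move=> u0 x; have [a ax] := exists_precedes x.
rewrite /transfer (bigD1 a)//= ltr_pwDl ?mulr_gt0 ?expR_gt0//.
by apply: sumr_ge0 => b _; rewrite mulr_ge0 ?expR_ge0// ltW.
Qed.

Lemma transfer_ge u x y : (forall x, 0 < u x) -> sh y = x -> expR (F y) * u y <= ell u x.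
Proof.
move=> u0 <-; rewrite /transfer (bigD1 (sval y 0%N)) ?precedes_shift//= scons_shift.
by rewrite lerDl sumr_ge0// => b _; rewrite mulr_ge0 ?expR_ge0// ltW.
Qed.

Lemma transfer_le u x (U : R) : (forall x, 0 < u x) -> (forall x, u x <= U) ->
  ell u x <= kappa%:R * expR BF * U.
Proof.
move=> u0 uU; rewrite (@le_trans _ _ (\sum_(a < kappa) expR BF * U))//.
  rewrite /transfer big_mkcond; apply: ler_sum => a _; case: ifP => _.
    by rewrite ler_pM ?expR_ge0 ?expF_le// ltW.
  by rewrite mulr_ge0 ?expR_ge0// (le_trans _ (uU point))// ltW.
by rewrite sumr_const card_ord -mulrA mulr_natl.
Qed.

(** Both exp F and u are evaluated at preimages, whose distance is [theta] times smaller. The map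
    sending B to [theta * (LF + B)] has the fixed point [B1] below, so the cone with constant [B1]
    is invariant. *)
Lemma transfer_log_lip B u : (forall x, 0 < u x) -> log_lip B u -> log_lip (theta * (LF + B)) (ell u).
Proof.
move=> u0 ul x y xy; have E s : precedes s y = precedes s x by rewrite /precedes xy.
rewrite /transfer [in leRHS](eq_bigl _ _ E) mulr_sumr; apply: ler_sum => a ax.
have ay : precedes a y by rewrite E.
have -> : expR (theta * (LF + B) * d x y) * (expR (F (scons a y)) * u (scons a y)) =
  (expR (LF * d (scons a x) (scons a y)) * expR (F (scons a y))) *
  (expR (B * d (scons a x) (scons a y)) * u (scons a y)).
  rewrite (d_scons theta ax ay) mulrACA -expRD.
  by congr (expR _ * _); ring.
apply: ler_pM; rewrite ?expR_ge0 ?expF_lip//; first exact: ltW.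
by apply: ul; rewrite !sval_scons.
Qed.

Let B1 := theta * LF / (1 - theta).

Let B10 : 0 <= B1. Proof. by rewrite divr_ge0 ?mulr_ge0 ?subr_ge0// ltW. Qed.

Let B1E : theta * (LF + B1) = B1.
Proof. by rewrite /B1; field; rewrite subr_eq0 gt_eqF. Qed.

Definition normalized u v : S -> R := fun y => expR (F y) * u y / v (sh y).

(** Two functions u and v are allowed, since u is not yet an eigenfunction when this is first used.
    The weight divides by [v (sh y)], and the shift expands distances by 1 / theta, whence the term
    [B1 / theta]. Pairs at distance at least [theta] are covered by the term [theta^-1], because the
    weights lie in [0, 1]. *)
Lemma normalized_markov u v E : (forall x, 0 < u x) -> (forall x, 0 < v x) ->
  (forall x, ell u x = v x) -> log_lip B1 u -> log_lip B1 v -> 0 < E ->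
  (forall y, v (sh y) <= E * u y) ->
  markov_weight theta (expR (- BF) / E)
    ((LF + B1 + B1 / theta) * expR (LF + B1 + B1 / theta) + theta^-1) (normalized u v).
Proof.
move=> u0 v0 uv ul vl E0 vE; set B2 := LF + B1 + B1 / theta.
have B20 : 0 <= B2 by rewrite !addr_ge0// divr_ge0// ltW.
have g0 y : 0 < normalized u v y by rewrite divr_gt0// mulr_gt0// expR_gt0.
have sum1 x : \sum_(a | precedes a x) normalized u v (scons a x) = 1.
  transitivity (ell u x / v x); last by rewrite uv mulfV// gt_eqF.
  by rewrite mulr_suml; apply: eq_bigr => a ax; rewrite /normalized shift_scons.
have g1 y : normalized u v y <= 1.
  rewrite -(sum1 (sh y)) (bigD1 (sval y 0%N)) ?precedes_shift//= scons_shift.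
  by rewrite lerDl sumr_ge0// => b _; exact: ltW.
have ti0 : 0 < theta^-1 by rewrite invr_gt0.
split => //.
  move=> y; rewrite /normalized ler_pdivlMr// mulrAC ler_pdivrMr// -mulrA.
  rewrite ler_pM ?expR_ge0 ?expF_ge//; first exact/ltW.
  by rewrite mulrC.
have half y z : normalized u v y - normalized u v z <= (B2 * expR B2 + theta^-1) * d y z.
  have BE0 : 0 <= B2 * expR B2 * d y z by rewrite !mulr_ge0 ?expR_ge0 ?d_ge0.
  have far : theta <= d y z ->
      normalized u v y - normalized u v z <= (B2 * expR B2 + theta^-1) * d y z.
    move=> td; have : 1 <= theta^-1 * d y z by rewrite mulrC ler_pdivlMr// mul1r.
    have := g1 y; have := ltW (g0 z); rewrite mulrDl; lra.
  have [yz|/eqP yz] := eqVneq (sval y 0%N) (sval z 0%N); last first.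
    by apply: far; rewrite (d_head theta yz) ltW.
  have ds : d (sh y) (sh z) = d y z / theta.
    by rewrite (d_tail theta yz) mulrAC mulfV ?mul1r// gt_eqF.
  have [yz1|/eqP yz1] := eqVneq (sval (sh y) 0%N) (sval (sh z) 0%N); last first.
    by apply: far; rewrite (d_tail theta yz) (d_head theta yz1) mulr1.
  have H : normalized u v y <= expR (B2 * d y z) * normalized u v z.
    rewrite /normalized mulrA ler_pdivrMr// -!mulrA mulrC.
    have -> : expR (B2 * d y z) * (expR (F z) * (u z * ((v (sh z))^-1 * v (sh y)))) =
      (expR (B1 * d y z) * u z) * (expR (LF * d y z) * expR (F z)) *
      (expR (B1 * d (sh y) (sh z)) * v (sh y) / v (sh z)).
      rewrite (_ : B2 * d y z = B1 * d y z + LF * d y z + B1 * d (sh y) (sh z)).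
        by rewrite !expRD; ring.
      by rewrite ds /B2; ring.
    rewrite -[leLHS]mulr1 ler_pM ?mulr_ge0 ?expR_ge0// ?ler_pM ?expR_ge0 ?expF_lip//.
    - exact: ltW.
    - exact: ltW.
    - exact: ul.
    - by rewrite ler_pdivlMr// mul1r d_sym vl.
  have e1 : expR (B2 * d y z) - 1 <= B2 * expR B2 * d y z.
    by apply: expR_sub1_le; rewrite // d_ge0 ?d_le1.
  have : (expR (B2 * d y z) - 1) * normalized u v z <= B2 * expR B2 * d y z * 1.
    apply: ler_pM => //; last exact: ltW.
    by rewrite subr_ge0 -expR0 ler_expR mulr_ge0 ?d_ge0.
  have : 0 <= theta^-1 * d y z by rewrite mulr_ge0 ?d_ge0// ltW.
  move: H; rewrite (mulrDl (B2 * _)); lra.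
move=> y z; rewrite -raddfB normc_real ler_norml half andbT.
by rewrite lerNl opprB d_sym half.
Qed.

Let phi n := iter n ell (fun=> 1).

Lemma phi_pos n x : 0 < phi n x.
Proof. by elim: n x => [|n IH] x; [exact: ltr01|exact: transfer_pos]. Qed.

Lemma phi_log_lip n : log_lip B1 (phi n).
Proof.
elim: n => [|n IH] x y xy.
  by rewrite /phi /= mulr1 -expR0 ler_expR mulr_ge0 ?d_ge0.
rewrite -B1E; exact: (transfer_log_lip (@phi_pos n) IH).
Qed.

Let E1 := kappa%:R * expR BF.

Lemma phi_growth n m x : (forall y, phi n y <= m) -> phi n.+1 x <= E1 * m.
Proof. by move=> H; apply: transfer_le => //; exact: phi_pos. Qed.

(** A branch of length M from the cylinder of z to y bounds [phi n z] by a constant times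
    [phi (n + M) y], for all z and y; conversely M steps multiply the supremum of [phi n] by at most
    [E1 ^+ M]. *)
Lemma phi_comparable : exists M D, 1 <= D /\ forall n x y, (M <= n)%N -> phi n x <= D * phi n y.
Proof.
have [M mixM] := exists_mixing_time A.
have back n m y w : iter m sh w = y -> expR (- BF) ^+ m * phi n w <= phi (n + m) y.
  elim: m y w => [|m IH] y w; first by move=> /= ->; rewrite expr0 mul1r addn0.
  rewrite iterS => wy; rewrite addnS.
  apply: le_trans (transfer_ge (@phi_pos _) wy).
  rewrite exprS -mulrA ler_pM ?mulr_ge0 ?exprn_ge0 ?expR_ge0 ?expF_ge//.
    exact/ltW/phi_pos.
  exact: IH.
have key n z y : phi n z <= expR B1 * expR BF ^+ M * phi (n + M) y.
  have [w wy wz] := mixing_preimage 0 y z mixM.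
  have := phi_log_lip n (esym (wz 0%N isT)); move=> /le_trans; apply.
  rewrite -mulrA ler_pM ?expR_ge0//; first exact/ltW/phi_pos.
    by rewrite ler_expR ler_piMr ?d_le1.
  rewrite -ler_pdivrMl ?exprn_gt0 ?expR_gt0// -exprVn -expRN.
  exact: back.
have grow n m x c : (forall y, phi n y <= c) -> phi (n + m) x <= E1 ^+ m * c.
  move=> H; elim: m x => [|m IH] x; first by rewrite expr0 mul1r addn0.
  by rewrite addnS exprS -mulrA; exact: phi_growth.
pose D := E1 ^+ M * (expR B1 * expR BF ^+ M).
exists M, (Num.max 1 D); split; first by rewrite le_max lexx.
move=> n x y /subnK <-; apply: (@le_trans _ _ (D * phi (n - M + M) y)).
  by rewrite -mulrA; apply: grow => z; exact: key.
by rewrite ler_wpM2r ?le_max ?lexx ?orbT//; exact/ltW/phi_pos.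
Qed.

(** No fixed point theorem is invoked. The ratios q j of consecutive iterates evolve under Markov
    operators, so the gap makes their oscillation decay geometrically. Hence the iterates divided by
    their value at one point converge geometrically, and the ratios converge to the eigenvalue. *)
Lemma eigenfunction : exists (lam : R) (h : S -> R) (D : R),
  [/\ 0 < lam, 1 <= D, forall x, D^-1 <= h x <= D, log_lip B1 h &
      forall x, ell h x = lam * h x].
Proof.
have [M [D [D1 HD]]] := phi_comparable.
have D0 : 0 < D by rewrite (lt_le_trans ltr01).
pose psi j := phi (M + j); have psi0 j x : 0 < psi j x by exact: phi_pos.
have psiD j x y : psi j x <= D * psi j y by apply: HD; rewrite leq_addr.
have psiS j x : ell (psi j) x = psi j.+1 x by rewrite /psi addnS.
have E10 : 0 < E1.
  have := lt_le_trans (@phi_pos 1 point) (@phi_growth 0 1 point (fun=> lexx _)).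
  by rewrite mulr1.
pose g j := normalized (psi j) (psi j.+1).
have mg j : markov_weight theta (expR (- BF) / (E1 * D))
    ((LF + B1 + B1 / theta) * expR (LF + B1 + B1 / theta) + theta^-1) (g j).
  apply: normalized_markov => //; try exact: phi_log_lip.
    by rewrite mulr_gt0.
  move=> y; rewrite -mulrA /psi addnS; apply: phi_growth => z.
  by apply: HD; rewrite leq_addr.
set gamma := expR (- BF) / _ in mg; set C := _ + theta^-1 in mg.
have gamma0 : 0 < gamma by rewrite divr_gt0 ?expR_gt0// mulr_gt0.
have C0 : 0 <= C.
  by rewrite addr_ge0 ?invr_ge0 ?(ltW th0)// mulr_ge0 ?expR_ge0// !addr_ge0// divr_ge0// ltW.
have [K [r [K0 r01 gap]]] := spectral_gap A theta01 gamma0 C0.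
have rho01 : 0 <= r < 1 by case/andP: r01 => /ltW -> ->.
pose q j x := psi j.+1 x / psi j x.
have q0 j x : 0 < q j x by rewrite divr_gt0.
have qU j x : q j x <= E1 * D.
  rewrite /q ler_pdivrMr// -mulrA /psi addnS; apply: phi_growth => z.
  by apply: HD; rewrite leq_addr.
(* The factors psi j cancel in g j * q j, so averaging q j with the weight g j gives q (j + 1). *)
have qE j x : (q j x)%:C = transfers g j (fun y => (q 0%N y)%:C) x.
  elim: j x => [//|j IH] x /=; rewrite /ctransfer /transfer.
  rewrite (eq_bigr (fun a => (g j (scons a x) * q j (scons a x))%:C)); last first.
    by move=> a _; rewrite -IH -rmorphM.
  rewrite -(rmorph_sum (@real_complex R)); congr (_%:C).
  rewrite /q -{1}psiS /transfer mulr_suml; apply: eq_bigr => a ax.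
  rewrite /g /normalized shift_scons//.
  have := psi0 j (scons a x); have := psi0 j.+1 x.
  by move=> p1 p2; field; rewrite !gt_eqF.
have [l0 ql] : exists l0, lip_by theta (fun y => (q 0%N y)%:C) l0.
  eexists; apply: (log_lip_lip (B := B1 + B1) (U := E1 * D)); first by rewrite addr_ge0.
    by move=> x; rewrite q0 qU.
  move=> x y xy; rewrite /q mulrDl expRD ler_pdivrMr//; set e := expR _.
  have a1 : psi 1%N x <= e * psi 1%N y by exact: phi_log_lip.
  have a2 : psi 0%N y <= e * psi 0%N x by rewrite /e d_sym; exact: phi_log_lip.
  rewrite (_ : _ * psi 0%N x = e * psi 1%N y * (e * psi 0%N x / psi 0%N y)); last by ring.
  rewrite (le_trans a1)// ler_peMr//.
    by rewrite mulr_ge0 ?expR_ge0// ltW.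
  by rewrite ler_pdivlMr// mul1r.
have qosc j x y : `|q j x - q j y| <= K * l0 * r ^+ j.
  have [H _] := gap g _ l0 j mg ql; have := H x y.
  by rewrite -!qE -raddfB normc_real mulrAC.
pose k j x := psi j x / psi j point.
have kD j x : D^-1 <= k j x <= D.
  by rewrite /k ler_pdivlMr// ler_pdivrMr// psiD andbT ler_pdivrMl.
have kpt j : k j point = 1 by rewrite /k mulfV// gt_eqF.
pose qm := expR (- BF) / D.
have qm0 : 0 < qm by rewrite divr_gt0// expR_gt0.
have qmq j x : qm <= q j x.
  rewrite /q ler_pdivlMr// -psiS; have [a ax] := exists_precedes x.
  rewrite (le_trans _ (transfer_ge (@phi_pos _) (shift_scons ax)))//.
  rewrite /qm -mulrA ler_pM ?expR_ge0 ?expF_ge//.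
    by rewrite mulr_ge0 ?invr_ge0 ?(ltW D0) ?(ltW (psi0 _ _)).
  by rewrite ler_pdivrMl//; exact: psiD.
have kinc x j : `|k j.+1 x - k j x| <= D / qm * (K * l0) * r ^+ j.
  have -> : k j.+1 x - k j x = k j x / q j point * (q j x - q j point).
    rewrite /k /q; have := psi0 j x; have := psi0 j point; have := psi0 j.+1 point.
    by move=> p1 p2 p3; field; rewrite !gt_eqF.
  have /andP[kx1 kx2] := kD j x.
  have kx0 : 0 < k j x by rewrite (lt_le_trans _ kx1)// invr_gt0.
  have H : `|k j x / q j point| <= D / qm.
    rewrite gtr0_norm ?divr_gt0//; apply: ler_pM => //.
    - exact: ltW.
    - by rewrite invr_ge0 ltW.
    - by rewrite lef_pV2 ?posrE.
  by rewrite normrM -(mulrA (D / qm)); apply: ler_pM.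
have /choice[h Hh] x := geometric_increments rho01 (kinc x).
set K2 := 2 * _ in Hh.
have hlow x j : k j x <= h x + K2 * r ^+ j.
  by have := Hh x j; rewrite ler_norml => /andP[_]; rewrite lerBlDl addrC.
have hupp x j : h x <= k j x + K2 * r ^+ j.
  by have := Hh x j; rewrite distrC ler_norml => /andP[_]; rewrite lerBlDl addrC.
have hD x : D^-1 <= h x <= D.
  apply/andP; split; apply: (le_geometric (K := K2) rho01) => j.
    by apply: le_trans (hlow x j); case/andP: (kD j x).
  by apply: le_trans (hupp x j) _; rewrite lerD2r; case/andP: (kD j x).
have h0 x : 0 < h x by case/andP: (hD x) => + _; apply: lt_le_trans; rewrite invr_gt0.
have ellk j x : ell (k j) x = q j point * k j.+1 x.
  transitivity (ell (psi j) x / psi j point).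
    by rewrite /transfer mulr_suml; apply: eq_bigr => a _; rewrite mulrA.
  rewrite psiS /q /k; have := psi0 j.+1 point; have := psi0 j point.
  by move=> p1 p2; field; rewrite !gt_eqF.
have ellh j x : `|ell (k j) x - ell h x| <= E1 * K2 * r ^+ j.
  have -> : ell (k j) x - ell h x =
      \sum_(a | precedes a x) expR (F (scons a x)) * (k j (scons a x) - h (scons a x)).
    by rewrite -sumrB; apply: eq_bigr => a _; rewrite mulrBr.
  rewrite (le_trans (ler_norm_sum _ _ _))// big_mkcond.
  rewrite (@le_trans _ _ (\sum_(a < kappa) expR BF * (K2 * r ^+ j)))//.
    apply: ler_sum => a _; case: ifP => _.
      by rewrite normrM ger0_norm ?expR_ge0// ler_pM ?expR_ge0 ?expF_le//.
    by rewrite mulr_ge0 ?expR_ge0// (le_trans _ (Hh point j)).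
  by rewrite sumr_const card_ord /E1 -[leLHS]mulr_natl !mulrA.
pose lam := ell h point.
have qlam j : `|q j point - lam| <= E1 * K2 * r ^+ j.
  by have := ellh j point; rewrite ellk kpt mulr1.
exists lam, h, D; split => //.
- exact: transfer_pos.
- move=> x y xy; apply: (le_geometric (K := (expR (B1 * d x y) + 1) * K2) rho01) => j.
  have e0 := expR_ge0 (B1 * d x y).
  have H1 := hupp x j; have H2 := hlow y j.
  have H3 : k j x <= expR (B1 * d x y) * k j y.
    by rewrite /k mulrA ler_pM2r ?invr_gt0// phi_log_lip.
  have : expR (B1 * d x y) * k j y <= expR (B1 * d x y) * (h y + K2 * r ^+ j) by rewrite ler_wpM2l.
  lra.
- move=> x; apply: (eq_geometric (K := E1 * K2 + E1 * D * (K2 * r) + E1 * K2 * D) rho01) => j.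
  have -> : ell h x - lam * h x = - (ell (k j) x - ell h x) +
     q j point * (k j.+1 x - h x) + (q j point - lam) * h x.
    by rewrite ellk; ring.
  rewrite (le_trans (ler_normD _ _))// ![in leRHS]mulrDl lerD//.
    rewrite (le_trans (ler_normD _ _))// normrN lerD// normrM gtr0_norm//.
    have := Hh x j.+1; rewrite exprS mulrA => H.
    by rewrite -[leRHS]mulrA ler_pM// ltW.
  rewrite normrM [leRHS]mulrAC ler_pM// gtr0_norm//.
  by case/andP: (hD x).
Qed.

End Eigenfunction.

Section InvariantFunctional.
Context (R : realType) (kappa : nat) (A : aperiodic_matrix kappa) (theta : R).
Context (theta01 : 0 < theta < 1).
Local Notation S := (shift_space A).
Local Notation d := (@d_theta R kappa A theta).
Implicit Types (x y : S) (v w : S -> R[i]).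

Let th0 : 0 < theta. Proof. by case/andP: theta01. Qed.
Let th1 : theta < 1. Proof. by case/andP: theta01. Qed.

Context (g : S -> R) (gamma C : R).
Context (gamma0 : 0 < gamma) (C0 : 0 <= C) (mg : markov_weight theta gamma C g).

Local Notation P := (ctransfer g).

Lemma iter_ctransferD n v w x :
  iter n P (fun x => v x + w x) x = iter n P v x + iter n P w x.
Proof. by rewrite /ctransfer !iter_transfer -big_split; apply: eq_bigr => y _; rewrite mulrDr. Qed.

Lemma iter_ctransferN n v x : iter n P (fun x => - v x) x = - iter n P v x.
Proof. by rewrite /ctransfer !iter_transfer -sumrN; apply: eq_bigr => y _; rewrite mulrN. Qed.

Lemma iter_ctransferZ n c v x : iter n P (fun x => c * v x) x = c * iter n P v x.
Proof. by rewrite /ctransfer !iter_transfer mulr_sumr; apply: eq_bigr => y _; rewrite mulrCA. Qed.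

Lemma iter_ctransfer_cst n c x : iter n P (fun=> c) x = c.
Proof.
elim: n x => [//|n IH] x; rewrite iterS.
by rewrite (_ : iter n P _ = fun=> c) ?(markov_cst _ _ mg)//; apply/funext.
Qed.

Lemma iter_ctransfer_bounded n v a : bounded_by v a -> bounded_by (iter n P v) a.
Proof.
move=> va; elim: n => [//|n IH]; rewrite iterS.
by apply: transfer_bounded => // x; exact: markov_norm mg x.
Qed.

Lemma iter_ctransfer_lip n v l : lip_by theta v l ->
  lip_by theta (iter n P v) (l + lip_gain kappa C / (1 - theta) * l).
Proof.
move=> vl; have l0 := lip_by_ge0 theta01 vl.
rewrite -transfers_cst.
have H := transfers_lip theta01 gamma0 C0 n (fun=> mg) (lip_by_osc theta01 vl) vl.
apply: (lip_byW theta01 _ H); rewrite lerD2r ler_piMl// exprn_ile1// ltW//.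
Qed.

(** The iterates of P flatten a Lipschitz function to a constant, which defines the invariant
    functional on Lipschitz functions before any measure is constructed. *)
Lemma exists_mean : exists (m : (S -> R[i]) -> R[i]) (K r : R),
  [/\ 0 <= K, 0 < r < 1 & forall v l n, lip_by theta v l ->
   (forall x, normc (iter n P v x - m v) <= K * r ^+ n * l) /\
   lip_by theta (iter n P v) (K * r ^+ n * l)].
Proof.
have [K [r [K0 r01 gap]]] := spectral_gap A theta01 gamma0 C0.
have rho01 : 0 <= r < 1 by case/andP: r01 => /ltW -> ->.
(* The predicate quantifies over l because the value picked for v must serve every Lipschitz
   constant of v. The 3 is one K for the oscillation and two for the limit at the base point. *)
pose Q v c := forall l n, lip_by theta v l -> forall x,
  normc (iter n P v x - c) <= 3 * K * r ^+ n * l.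
exists (fun v => xget 0 [set c | Q v c]), (3 * K), r; split => //.
  by rewrite mulr_ge0.
move=> v l n vl; have l0 := lip_by_ge0 theta01 vl; split; last first.
  have [_ H] := gap (fun=> g) v l n (fun=> mg) vl.
  rewrite -transfers_cst; apply: (lip_byW theta01 _ H).
  rewrite -!mulrA ler_peMl// ?mulr_ge0 ?exprn_ge0//; last by rewrite ler1n.
  by case/andP: rho01.
move=> x.
suff [c Qc] : exists c, Q v c by case: xgetP => [c' _ H|/(_ c)//]; exact: H.
have osc k l1 y z : lip_by theta v l1 ->
    normc (iter k P v y - iter k P v z) <= K * r ^+ k * l1.
  by move=> vl1; have [+ _] := gap (fun=> g) v l1 k (fun=> mg) vl1; rewrite transfers_cst; apply.
have cauchy l1 k k1 : lip_by theta v l1 -> (k <= k1)%N ->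
    normc (iter k1 P v point - iter k P v point) <= K * l1 * r ^+ k.
  move=> vl1 /subnK <-; rewrite iterD -[X in _ - X](iter_ctransfer_cst (k1 - k) _ point).
  pose u := fun y => iter k P v y - iter k P v point.
  have -> : iter (k1 - k) P (iter k P v) point -
      iter (k1 - k) P (fun=> iter k P v point) point = iter (k1 - k) P u point.
    by rewrite /u iter_ctransferD iter_ctransferN.
  apply: iter_ctransfer_bounded => y; rewrite mulrAC; exact: osc.
have [c Hc] := geometric_cauchy rho01 (fun k k1 => cauchy l k k1 vl).
exists c => l1 k vl1 y; have l10 := lip_by_ge0 theta01 vl1.
(* The limit found with l1 has to be identified with the limit found with l. *)
have Hc1 : normc (iter k P v point - c) <= 2 * (K * l1) * r ^+ k.
  have [c1 Hc1] := geometric_cauchy rho01 (fun k k1 => cauchy l1 k k1 vl1).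
  suff -> : c = c1 by exact: Hc1.
  apply/eqP; rewrite -subr_eq0; apply/eqP/ComplexField.Normc.eq0_normc.
  apply/eqP; rewrite eq_le normc_ge0 andbT.
  apply: (le_geometric (K := 2 * (K * l) + 2 * (K * l1)) rho01) => j.
  rewrite add0r (le_trans (normcB_triangle _ (iter j P v point) _))//.
  by rewrite mulrDl lerD// normcBC.
rewrite (le_trans (normcB_triangle _ (iter k P v point) _))//.
rewrite (le_trans (lerD (osc k l1 y point vl1) Hc1))//.
rewrite le_eqVlt; apply/orP; left; apply/eqP; ring.
Qed.

Context (m : (S -> R[i]) -> R[i]) (K r : R) (K0 : 0 <= K) (r01 : 0 < r < 1).
Context (m_gap : forall v l n, lip_by theta v l ->
   (forall x, normc (iter n P v x - m v) <= K * r ^+ n * l) /\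
   lip_by theta (iter n P v) (K * r ^+ n * l)).

Let rho01 : 0 <= r < 1. Proof. by case/andP: r01 => /ltW -> ->. Qed.

Lemma mean_unique v l c K1 : lip_by theta v l ->
  (forall n, normc (iter n P v point - c) <= K1 * r ^+ n) -> m v = c.
Proof.
move=> vl H; apply/eqP; rewrite -subr_eq0; apply/eqP/ComplexField.Normc.eq0_normc.
apply/eqP; rewrite eq_le normc_ge0 andbT.
apply: (le_geometric (K := K * l + K1) rho01) => j.
rewrite add0r (le_trans (normcB_triangle _ (iter j P v point) _))//.
rewrite mulrDl lerD// normcBC mulrAC.
by have [] := m_gap j vl.
Qed.

Lemma meanD v w a b : lip_by theta v a -> lip_by theta w b ->
  m (fun x => v x + w x) = m v + m w.
Proof.
move=> va wb; apply: (mean_unique (K1 := K * a + K * b) (lip_byD va wb)) => n.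
rewrite iter_ctransferD opprD addrACA (le_trans (normc_triangle _ _))//.
rewrite mulrDl (mulrAC K a) (mulrAC K b) lerD//.
  by have [H _] := m_gap n va; exact: H.
by have [H _] := m_gap n wb; exact: H.
Qed.

Lemma meanZ c v a : lip_by theta v a -> m (fun x => c * v x) = c * m v.
Proof.
move=> va; have cva : lip_by theta (fun x => c * v x) (normc c * a).
  by move=> x y; rewrite -mulrBr normcM -mulrA ler_wpM2l ?normc_ge0.
apply: (mean_unique (K1 := normc c * (K * a)) cva) => n.
rewrite iter_ctransferZ -mulrBr normcM -mulrA ler_wpM2l ?normc_ge0//.
by rewrite mulrAC; have [H _] := m_gap n va; exact: H.
Qed.

Lemma meanN v a : lip_by theta v a -> m (fun x => - v x) = - m v.
Proof.
move=> va; rewrite -[RHS]mulN1r -(meanZ _ va); congr m.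
by apply/funext => x; rewrite mulN1r.
Qed.

Lemma mean_cst c : m (fun=> c) = c.
Proof.
apply: (mean_unique (K1 := 0) (lip_by_cst theta c)) => n.
by rewrite iter_ctransfer_cst subrr ComplexField.Normc.normc0 mul0r.
Qed.

Lemma ctransfer_lip v l : lip_by theta v l -> exists l1, lip_by theta (P v) l1.
Proof. by move=> vl; eexists; exact: (iter_ctransfer_lip 1 vl). Qed.

Lemma mean_transfer v l : lip_by theta v l -> m (P v) = m v.
Proof.
move=> vl; have [l1 Pl] := ctransfer_lip vl.
apply: (mean_unique (K1 := K * l * r) Pl) => n; rewrite -iterSr.
have [H _] := m_gap n.+1 vl; rewrite (le_trans (H _))// exprS.
by rewrite le_eqVlt; apply/orP; left; apply/eqP; ring.
Qed.

Lemma mean_bounded v l a : lip_by theta v l -> bounded_by v a -> normc (m v) <= a.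
Proof.
move=> vl va; apply: (le_geometric (K := K * l) rho01) => n.
have [H _] := m_gap n vl; have := H point; rewrite normcBC => Hn.
have := normc_triangle (m v - iter n P v point) (iter n P v point).
rewrite subrK => /le_trans; apply; rewrite addrC mulrAC lerD//.
exact: iter_ctransfer_bounded.
Qed.

Lemma iter_ctransfer_Re_ge n v a x : (forall y, a <= complex.Re (v y)) ->
  a <= complex.Re (iter n P v x).
Proof.
have [g1 g2 _] := mg.
move=> va; elim: n x => [//|n IH] x; rewrite iterS /ctransfer /transfer raddf_sum.
rewrite -[leLHS]mul1r -(g1 x) mulr_suml; apply: ler_sum => b _.
rewrite -/(ctransfer g); case: (iter n P v _) (IH (scons b x)) => p q /= pa.
by rewrite mul0r subr0 ler_wpM2l// (le_trans _ (g2 _))// ltW.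
Qed.

Lemma mean_Re_ge v l a : lip_by theta v l -> (forall y, a <= complex.Re (v y)) ->
  a <= complex.Re (m v).
Proof.
move=> vl va; apply: (le_geometric (K := K * l) rho01) => n.
have H := iter_ctransfer_Re_ge n point va.
have [Hm _] := m_gap n vl; have := le_trans (Re_le_normc _) (Hm point).
rewrite raddfB /= ler_norml => /andP[_]; rewrite mulrAC; lra.
Qed.

(** Multiplication by [- 'i] turns the imaginary part into the real one. Applied to exp(i u f) - 1,
    this is where positivity of f is exploited at small u. *)
Lemma mean_Im_ge v l a : lip_by theta v l -> (forall y, a <= complex.Im (v y)) ->
  a <= complex.Im (m v).
Proof.
move=> vl va; have -> : complex.Im (m v) = complex.Re (m (fun x => - 'i * v x)).
  by rewrite (meanZ _ vl); case: (m v) => p q /=; ring.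
apply: (@mean_Re_ge _ (normc (- 'i : R[i]) * l)).
  by move=> x y; rewrite -mulrBr normcM -mulrA ler_wpM2l ?normc_ge0.
by move=> y; have := va y; case: (v y) => p q /=; rewrite (_ : _ - _ = q)//; ring.
Qed.

End InvariantFunctional.

(** * Twisted operators at bounded frequencies *)

Section TwistedOperator.
Context (R : realType) (kappa : nat) (A : aperiodic_matrix kappa) (theta : R).
Context (theta01 : 0 < theta < 1).
Local Notation S := (shift_space A).
Local Notation sh := (@sft_shift kappa A).
Local Notation d := (@d_theta R kappa A theta).
Implicit Types (x y : S) (v w : S -> R[i]).

Let th0 : 0 < theta. Proof. by case/andP: theta01. Qed.
Let th1 : theta < 1. Proof. by case/andP: theta01. Qed.

Definition both_by v (K : R) := bounded_by v K /\ lip_by theta v K.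

Lemma both_by_ge0 v K : both_by v K -> 0 <= K.
Proof. by case=> /bounded_by_ge0. Qed.

Lemma both_byW v K K1 : K <= K1 -> both_by v K -> both_by v K1.
Proof. by move=> KK [v1 v2]; split; [exact: bounded_byW v1|exact: lip_byW v2]. Qed.

Lemma both_by_closed v a b r : 0 <= r < 1 ->
  (forall n, both_by v (a + b * r ^+ n)) -> both_by v a.
Proof.
move=> r01 H; split=> [x|x y].
  by apply: (le_geometric (K := b) r01) => n; have [+ _] := H n; apply.
apply: (le_geometric (K := b * d x y) r01) => n.
by have [_ +] := H n => /(_ x y); rewrite mulrDl [_ * _ ^+ n * _]mulrAC.
Qed.

(** Removes a bound K0 that is finite but uncontrolled: iterating K -> a + K / 2 from K0 converges
    to 2 a. *)
Lemma both_by_absorb v a K0 : 0 <= a -> both_by v K0 ->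
  (forall K, both_by v K -> both_by v (a + K / 2)) -> both_by v (2 * a).
Proof.
move=> a0 vK0 H; have K00 := both_by_ge0 vK0.
apply: (both_by_closed (b := K0) (r := 2^-1)).
  by rewrite invr_ge0 ler0n invf_lt1// ltr1n.
elim=> [|n IH]; first by apply: both_byW vK0; rewrite expr0; lra.
by have := H _ IH; apply: both_byW; rewrite exprS; lra.
Qed.

Context (g f : S -> R) (gamma C fm fM Lf : R).
Context (gamma0 : 0 < gamma) (C0 : 0 <= C) (mg : markov_weight theta gamma C g).
Context (fm0 : 0 < fm) (f_range : forall x, fm <= f x <= fM).
Context (f_lip : forall x y, `|f x - f y| <= Lf * d x y).

Local Notation P := (ctransfer g).

Definition twist (u : R) : S -> R[i] := fun y => (g y)%:C * cis (u * f y).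
Local Notation Pu u := (transfer (twist u)).

Let Lf0 : 0 <= Lf.
Proof.
apply: (@lip_by_ge0 _ _ A _ theta01 (fun x => (f x)%:C)) => x y.
by rewrite -raddfB normc_real.
Qed.

Let fM0 : 0 < fM.
Proof. by have /andP[a b] := f_range point; have := fm0; lra. Qed.

Lemma twistE u v x : Pu u v x = P (fun y => cis (u * f y) * v y) x.
Proof. by apply: transfer_ext => y; rewrite mulrA. Qed.

Lemma twist_norm u x : \sum_(s | precedes s x) normc (twist u (scons s x)) <= 1.
Proof.
rewrite (le_trans _ (markov_norm gamma0 mg x))//; apply: ler_sum => s _.
by rewrite normcM normc_cis mulr1.
Qed.

Lemma cis_f_lip u : lip_by theta (fun y => cis (u * f y)) (2 * `|u| * Lf).
Proof.
move=> x y; rewrite (le_trans (cis_lip _ _))// -mulrBr normrM -!mulrA.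
by rewrite ler_wpM2l// ler_wpM2l.
Qed.

Lemma g_le1 y : g y <= 1.
Proof.
have [g1 g2 _] := mg.
rewrite -(g1 (sh y)) (bigD1 (sval y 0%N)) ?precedes_shift//= scons_shift.
by rewrite lerDl sumr_ge0// => b _; apply: le_trans (g2 _); exact: ltW.
Qed.

Lemma g_ge0 y : 0 < g y.
Proof. by have [_ g2 _] := mg; exact: lt_le_trans (g2 y). Qed.

Lemma twist_lip u : lip_by theta (twist u) (C + 2 * `|u| * Lf).
Proof.
have [_ _ gC] := mg.
have g1 : bounded_by (fun y => (g y)%:C) 1.
  by move=> y; rewrite normc_real gtr0_norm ?g_ge0 ?g_le1.
have c1 : bounded_by (fun y => cis (u * f y)) 1.
  by move=> y; rewrite normc_cis.
have := lip_byM g1 gC c1 (cis_f_lip u).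
by rewrite mul1r mulr1 addrC.
Qed.

Definition twist_gain (u : R) := kappa%:R * (C + 2 * `|u| * Lf) + 2.

Lemma twist_gain_ge0 u : 0 <= twist_gain u.
Proof. by rewrite addr_ge0// mulr_ge0// addr_ge0// !mulr_ge0. Qed.

Lemma twist_step u v a b : bounded_by v a -> lip_by theta v b ->
  bounded_by (Pu u v) a /\ lip_by theta (Pu u v) (theta * b + twist_gain u * a).
Proof.
move=> va vb; split; first exact: (transfer_bounded (@twist_norm u)).
apply: transfer_lip => //; first exact: (@twist_norm u).
- exact: twist_lip.
- by rewrite addr_ge0// !mulr_ge0.
- exact: lip_by_ge0 vb.
Qed.

Definition twist_const (u : R) := 1 + twist_gain u / (1 - theta).

Lemma iter_twist_both u v K n : both_by v K ->
  both_by (iter n (Pu u) v) (twist_const u * K).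
Proof.
move=> vK; have K0 := both_by_ge0 vK; have G0 := twist_gain_ge0 u.
have Gt : 0 <= twist_gain u / (1 - theta) by rewrite divr_ge0// subr_ge0 ltW.
suff [H1 H2] : bounded_by (iter n (Pu u) v) K /\
    lip_by theta (iter n (Pu u) v) (twist_const u * K).
  by split=> //; apply: bounded_byW H1; rewrite ler_peMl// /twist_const; lra.
elim: n => [|n [IH1 IH2]].
  case: vK => v1 v2; split=> //; apply: (lip_byW theta01 _ v2).
  by rewrite ler_peMl// /twist_const; lra.
have [H1 H2] := twist_step u IH1 IH2; split; first exact: H1.
apply: (lip_byW theta01 _ H2); rewrite /twist_const.
have : twist_gain u / (1 - theta) * (1 - theta) = twist_gain u.
  by rewrite mulfVK// subr_eq0 gt_eqF.
move: (twist_gain u / _) Gt => q q0 <-.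
have : theta * K <= K by rewrite ler_piMl// ltW.
lra.
Qed.

Lemma sin_ge_half (t : R) : 0 <= t <= 2^-1 -> t / 2 <= sin t.
Proof.
move=> /andP[t0 t1].
have cs : {within `[0, t], continuous (@sin R)}.
  by apply: derivable_within_continuous => b _; exact: ex_derive.
have [c ct E] := MVT_segment t0 (fun b _ => is_derive_sin b) cs.
move: E; rewrite sin0 !subr0 => ->; rewrite mulrC ler_wpM2r//.
have := @bounded_derive_lipschitz R cos (fun b : R => - sin b) c 0.
have dc (b : R) : is_derive b (1 : R) cos (- sin b) by exact: is_derive_cos.
have sc (b : R) : `|- sin b| <= 1 by rewrite normrN sin_max.
move=> /(_ dc sc); rewrite cos0 subr0 ler_norml => /andP[+ _].
move: ct; rewrite in_itv /= => /andP[c0 c1]; rewrite ger0_norm//; lra.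
Qed.

(** Perturbation of u = 0. With e = exp(i u f) - 1, of size u, the equation reads v - P v = P (e v)
    + w, and the invariant functional m gives m (e v) + m w = 0. By the gap v is close to its mean
    c, so c * m e is known up to small errors. Since f > 0, |m e| >= u fm / 2, and dividing by it
    costs 1 / u. *)
Lemma apriori_small : exists eta Ca : R, [/\ 0 < eta, 0 < Ca &
  forall u v w s K0, 0 < u <= eta -> both_by v K0 -> both_by w s ->
    (forall x, v x = Pu u v x + w x) -> both_by v (Ca * (s / u))].
Proof.
have [m [K [r [K_ge0 r01 gap]]]] := exists_mean theta01 gamma0 C0 mg.
have rho01 : 0 <= r < 1 by case/andP: r01 => /ltW -> ->.
have r1 : r < 1 by case/andP: r01.
have ri : 0 < 1 - r by rewrite subr_gt0.
pose c1 := 2 * (fM + Lf).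
have c10 : 0 < c1 by rewrite /c1; have := fM0; have := Lf0; lra.
pose G := lip_gain kappa C.
have G0 : 0 <= G by exact: lip_gain_ge0.
pose c2 := K / (1 - r).
have c20 : 0 <= c2 by rewrite divr_ge0// ltW.
pose c3 := (1 + G) * c1.
have c30 : 0 < c3 by rewrite mulr_gt0//; lra.
pose c4 := 2 / fm * (1 + 2 * fM * c2) + c2.
pose c5 := (2 / fm * (2 * fM * c2) + c2) * c3.
have fmi : 0 < 2 / fm by rewrite divr_gt0.
have fMc2 : 0 <= 2 * fM * c2 by apply: mulr_ge0 => //; apply: mulr_ge0 => //; exact: ltW.
have c40 : 0 <= c4 by rewrite addr_ge0// mulr_ge0 ?(ltW fmi)// addr_ge0.
have c50 : 0 <= c5.
  by rewrite mulr_ge0 ?(ltW c30)// addr_ge0// mulr_ge0// ltW.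
(* The three bounds give u <= 1, keep u f in the range of [sin_ge_half], and make the coefficient
   [c5 * u] of Q at most 1/2, as [both_by_absorb] requires. *)
pose eta := Num.min (Num.min 1 (2 * fM)^-1) (2 * c5 + 1)^-1.
have eta0 : 0 < eta.
  by rewrite !lt_min ltr01 !invr_gt0 /=; have := fM0; lra.
exists eta, (2 * (c4 + 1)); split => //; first by lra.
move=> u v w s K1 /andP[u0 ueta] vK1 ws vE.
have s0 := both_by_ge0 ws.
have u1 : u <= 1 by apply: le_trans ueta _; rewrite !ge_min lexx.
have ufM : u * fM <= 2^-1.
  rewrite -ler_pdivlMr//; apply: le_trans ueta _.
  by rewrite !ge_min -invfM lexx orbT.
have uc5 : c5 * u <= 2^-1.
  have : u <= (2 * c5 + 1)^-1 by apply: le_trans ueta _; rewrite !ge_min lexx orbT.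
  rewrite -[_^-1]div1r ler_pdivlMr; last by lra.
  by have := u0; nra.
suff step Q : both_by v Q -> both_by v (c4 * (s / u) + Q / 2).
  have su0 : 0 <= s / u by rewrite divr_ge0// ltW.
  apply: both_byW (both_by_absorb _ vK1 step); last by rewrite mulr_ge0.
  by rewrite -mulrA ler_wpM2l// ler_wpM2r//; lra.
move=> vQ; have Q0 := both_by_ge0 vQ; have [vQ1 vQ2] := vQ; have [ws1 ws2] := ws.
pose e := fun y => cis (u * f y) - 1.
have eb : bounded_by e (2 * (u * fM)).
  move=> y; rewrite /e -cis0 (le_trans (cis_lip _ _))// subr0 ler_wpM2l//.
  have /andP[fy1 fy2] := f_range y.
  by rewrite ger0_norm ?mulr_ge0 ?ler_wpM2l// ?ltW// (lt_le_trans fm0).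
have el : lip_by theta e (2 * (u * Lf)).
  move=> x y; have := cis_f_lip u x y.
  by rewrite gtr0_norm// -(mulrA 2) /e opprB addrA subrK.
pose q := fun y => e y * v y.
have qb : bounded_by q (2 * (u * fM) * Q) by exact: bounded_byM.
have ql : lip_by theta q (c1 * u * Q).
  apply: (lip_byW theta01 _ (lip_byM eb el vQ1 vQ2)).
  by rewrite /c1 le_eqVlt; apply/orP; left; apply/eqP; ring.
have vE1 x : v x - P v x = P q x + w x.
  rewrite {1}vE twistE /q /e (_ : (fun y => cis (u * f y) * v y) =
    fun y => v y + (cis (u * f y) - 1) * v y).
    by rewrite /ctransfer transferD; ring.
  by apply/funext => y; ring.
pose w1 := fun x => P q x + w x; pose Lw := c3 * u * Q + s.
have c3u : 0 <= c3 * u by rewrite mulr_ge0 ?(ltW c30) ?(ltW u0).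
have Lw0 : 0 <= Lw by rewrite addr_ge0// (mulr_ge0 c3u).
have Pql : lip_by theta (P q) (c3 * u * Q).
  have := markov_lip theta01 gamma0 C0 mg (lip_by_osc theta01 ql) ql.
  apply: lip_byW => //; rewrite /c3 -/G.
  have : theta * (c1 * u * Q) <= c1 * u * Q by rewrite ler_piMl ?(ltW th1)// mulr_ge0// mulr_ge0 ?(ltW c10) ?(ltW u0).
  lra.
have w1l : lip_by theta w1 Lw by exact: lip_byD.
have [Pvl PvL] := ctransfer_lip theta01 gamma0 C0 mg vQ2.
have NPv : lip_by theta (fun x => - P v x) Pvl by exact: lip_byN.
(* w1 = v - P v has mean zero by invariance, so its iterates under P decay and can be summed. *)
have mw1 : m w1 = 0.
  have -> : w1 = fun x => v x + - P v x by apply/funext => x; rewrite /w1 -vE1.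
  rewrite (meanD r01 gap vQ2 NPv) (meanN r01 gap PvL).
  by rewrite (mean_transfer theta01 gamma0 C0 mg r01 gap vQ2) subrr.
have incr x n : iter n P v x - iter n.+1 P v x = iter n P w1 x.
  rewrite iterSr -iter_ctransferN -iter_ctransferD; congr (iter n P _ x).
  by apply/funext => z; rewrite vE1.
have tele n : (forall x, normc (v x - iter n P v x) <= c2 * (1 - r ^+ n) * Lw) /\
    lip_by theta (fun x => v x - iter n P v x) (c2 * (1 - r ^+ n) * Lw).
  elim: n => [|n [IH1 IH2]].
    split=> [x|x y]; rewrite /= !subrr ComplexField.Normc.normc0 mulr0 mul0r//.
    by rewrite mul0r.
  have E x : v x - iter n.+1 P v x = (v x - iter n P v x) + iter n P w1 x.
    by rewrite -incr addrA subrK.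
  have [G1 G2] := gap w1 Lw n w1l.
  have -> : c2 * (1 - r ^+ n.+1) * Lw = c2 * (1 - r ^+ n) * Lw + K * r ^+ n * Lw.
    by rewrite /c2 exprS; field; rewrite gt_eqF.
  split=> [x|].
    rewrite E (le_trans (normc_triangle _ _))// lerD//.
    by have := G1 x; rewrite mw1 subr0.
  by have := lip_byD IH2 G2; congr lip_by; apply/funext => x; rewrite -E.
(* The telescoped sums tend to v - m v, whose size is thus governed by Lw, the Lipschitz constant of
   w1. *)
pose c := m v.
have vc x : normc (v x - c) <= c2 * Lw.
  apply: (le_geometric (K := K * Q) rho01) => n.
  have [H1 _] := tele n; have [H2 _] := gap v Q n vQ2.
  rewrite (le_trans (normcB_triangle _ (iter n P v x) _))//.
  rewrite lerD//; last by rewrite mulrAC.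
  rewrite (le_trans (H1 x))// -mulrA ler_wpM2l// ler_piMl//.
  by rewrite gerBl exprn_ge0//; case/andP: rho01.
have vl : lip_by theta v (c2 * Lw).
  move=> x y; apply: (le_geometric (K := K * Q * d x y) rho01) => n.
  have [_ H1] := tele n; have [_ H2] := gap v Q n vQ2.
  have -> : v x - v y = (v x - iter n P v x - (v y - iter n P v y)) +
     (iter n P v x - iter n P v y) by ring.
  rewrite (le_trans (normc_triangle _ _))// lerD//.
    rewrite (le_trans (H1 x y))// ler_wpM2r ?d_ge0// -mulrA ler_wpM2l// ler_piMl//.
    by rewrite gerBl exprn_ge0//; case/andP: rho01.
  by rewrite (le_trans (H2 x y))// -!mulrA (mulrCA (r ^+ n)) [in leLHS](mulrC (r ^+ n)) !mulrA.
have mq : m q + m w = 0.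
  rewrite -(mean_transfer theta01 gamma0 C0 mg r01 gap ql).
  by rewrite -(meanD r01 gap Pql ws2).
have mw : normc (m w) <= s by exact: (mean_bounded gamma0 mg r01 gap ws2 ws1).
pose q2 := fun y => e y * (v y - c).
have vcl : lip_by theta (fun y => v y - c) (c2 * Lw + 0).
  by apply: lip_byD => //; exact: lip_by_cst.
have q2l := lip_byM eb el vc vcl.
have q2b : bounded_by q2 (2 * (u * fM) * (c2 * Lw)) by exact: bounded_byM.
have mq2 := mean_bounded gamma0 mg r01 gap q2l q2b.
(* Split e v = e (v - c) + c e: the first part is small because v - c is, the second determines
   c. *)
have qE : m q = m q2 + c * m e.
  have cel : lip_by theta (fun x => c * e x) (normc c * (2 * (u * Lf))).
    by move=> x y; rewrite -mulrBr normcM -mulrA ler_wpM2l ?normc_ge0.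
  rewrite -(meanZ r01 gap c el) -(meanD r01 gap q2l cel).
  by congr m; apply/funext => y; rewrite /q /q2; ring.
have me : u * (fm / 2) <= normc (m e).
  apply: le_trans (le_trans (ler_norm _) (Im_le_normc _)).
  apply: (mean_Im_ge gamma0 mg r01 gap el) => y.
  have /andP[fy1 fy2] := f_range y.
  rewrite /e raddfB /= subr0; apply: (@le_trans _ _ (u * f y / 2)).
    by rewrite mulrA ler_wpM2r// ler_wpM2l// ltW.
  apply: sin_ge_half; rewrite mulr_ge0 ?(ltW u0)//=.
    by rewrite (le_trans _ ufM)// ler_wpM2l// ltW.
  by rewrite (le_trans _ fy1)// ltW.
have cb : normc c <= 2 / fm * (s / u + 2 * fM * c2 * Lw).
  have : normc c * (u * (fm / 2)) <= s + 2 * (u * fM) * (c2 * Lw).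
    apply: (@le_trans _ _ (normc (c * m e))).
      by rewrite normcM ler_wpM2l ?normc_ge0.
    have -> : c * m e = - m w + - m q2.
      by apply/eqP; rewrite -subr_eq0; apply/eqP; rewrite -mq qE; ring.
    by rewrite (le_trans (normc_triangle _ _))// !normc_opp lerD.
  have -> : 2 / fm * (s / u + 2 * fM * c2 * Lw) =
     (s + 2 * (u * fM) * (c2 * Lw)) / (u * (fm / 2)).
    by field; rewrite !gt_eqF.
  by rewrite ler_pdivlMr// mulr_gt0// divr_gt0.
have Lwb : Lw <= c3 * (u * Q) + s / u.
  by rewrite /Lw mulrA lerD2l ler_pdivlMr// ler_piMr.
have bound : normc c + c2 * Lw <= c4 * (s / u) + Q / 2.
  have : 2 / fm * (2 * fM * c2) * Lw + c2 * Lw <=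
      (2 / fm * (2 * fM * c2) + c2) * (c3 * (u * Q) + s / u).
    rewrite -mulrDl ler_wpM2l// addr_ge0// mulr_ge0// ltW//.
  have : c5 * u * Q <= 2^-1 * Q by rewrite ler_wpM2r.
  rewrite /c5 /c4; move: cb; lra.
split.
  move=> x; apply: le_trans bound; rewrite addrC.
  by have := normc_triangle (v x - c) c; rewrite subrK => /le_trans; apply; rewrite lerD2r.
apply: (lip_byW theta01 _ vl); apply: le_trans bound.
by rewrite lerDr normc_ge0.
Qed.

End TwistedOperator.

Section ComplexPowers.
Context (R : realType).
Implicit Types (z w : R[i]).

Lemma cisX (t : R) k : cis t ^+ k = cis (k%:R * t).
Proof.
elim: k => [|k IH]; first by rewrite expr0 mul0r cis0.
by rewrite exprS IH -cisD -natr1; congr cis; ring.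
Qed.

Lemma normc_subX_le k z w : normc z <= 1 -> normc w <= 1 ->
  normc (z ^+ k - w ^+ k) <= k%:R * normc (z - w).
Proof.
move=> z1 w1; elim: k => [|k IH].
  by rewrite !expr0 subrr ComplexField.Normc.normc0 mul0r.
have -> : z ^+ k.+1 - w ^+ k.+1 = z * (z ^+ k - w ^+ k) + (z - w) * w ^+ k.
  by rewrite !exprS; ring.
rewrite (le_trans (normc_triangle _ _))// !normcM -natr1 mulrDl mul1r lerD//.
  by rewrite (le_trans _ IH)// ler_piMl ?normc_ge0.
by rewrite ler_piMr ?normc_ge0// normcX exprn_ile1// normc_ge0.
Qed.

Lemma normc_sqr z : normc z ^+ 2 = complex.Re z ^+ 2 + complex.Im z ^+ 2.
Proof. by case: z => a b /=; rewrite sqr_sqrtr// addr_ge0// sqr_ge0. Qed.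

(** If a mean of points of the unit disc has modulus close to 1, this identity forces every point
    whose weight is bounded below to be close to the mean. *)
Lemma variance (I : finType) (Q : pred I) (p : I -> R) (z : I -> R[i]) w :
  \sum_(i | Q i) p i = 1 -> \sum_(i | Q i) (p i)%:C * z i = w ->
  \sum_(i | Q i) p i * normc (z i - w) ^+ 2 =
  \sum_(i | Q i) p i * normc (z i) ^+ 2 - normc w ^+ 2.
Proof.
move=> p1 pw.
have var1 (a : I -> R) b : \sum_(i | Q i) p i * a i = b ->
    \sum_(i | Q i) p i * (a i - b) ^+ 2 = \sum_(i | Q i) p i * a i ^+ 2 - b ^+ 2.
  move=> ab.
  transitivity (\sum_(i | Q i) (p i * a i ^+ 2 - (2 * b) * (p i * a i) + p i * b ^+ 2)).
    by apply: eq_bigr => i _; ring.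
  by rewrite big_split sumrB /= -mulr_sumr -mulr_suml ab p1; ring.
have Rw : \sum_(i | Q i) p i * complex.Re (z i) = complex.Re w.
  rewrite -pw raddf_sum; apply: eq_bigr => i _.
  by case: (z i) => a b /=; rewrite mul0r subr0.
have Iw : \sum_(i | Q i) p i * complex.Im (z i) = complex.Im w.
  rewrite -pw raddf_sum; apply: eq_bigr => i _.
  by case: (z i) => a b /=; rewrite mul0r addr0.
transitivity (\sum_(i | Q i) (p i * (complex.Re (z i) - complex.Re w) ^+ 2 +
   p i * (complex.Im (z i) - complex.Im w) ^+ 2)).
  by apply: eq_bigr => i _; rewrite normc_sqr !raddfB mulrDr.
rewrite big_split /= (var1 _ _ Rw) (var1 _ _ Iw) normc_sqr.
under [X in _ = X - _]eq_bigr do rewrite normc_sqr mulrDr.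
by rewrite big_split /=; ring.
Qed.

End ComplexPowers.

(** * Frequencies in a compact range *)

Section CompactFrequencies.
Context (R : realType) (kappa : nat) (A : aperiodic_matrix kappa) (theta : R).
Context (theta01 : 0 < theta < 1).
Local Notation S := (shift_space A).
Local Notation sh := (@sft_shift kappa A).
Local Notation d := (@d_theta R kappa A theta).
Implicit Types (x y : S) (v w : S -> R[i]).

Let th0 : 0 < theta. Proof. by case/andP: theta01. Qed.
Let th1 : theta < 1. Proof. by case/andP: theta01. Qed.

Context (g f : S -> R) (gamma C Lf : R).
Context (gamma0 : 0 < gamma) (C0 : 0 <= C) (mg : markov_weight theta gamma C g).
Context (f_lip : forall x y, `|f x - f y| <= Lf * d x y).

Local Notation P := (ctransfer g).
Local Notation Pu u := (transfer (twist g f u)).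

Context (a0 r : R) (a00 : 0 < a0) (r01 : 0 < r < 1).
Context (decay : forall a1, exists E, forall u v K n, a0 <= u <= a1 ->
  both_by theta v K -> bounded_by (iter n (Pu u) v) (E * r ^+ n * K)).

Let Lf0 : 0 <= Lf.
Proof.
apply: (@lip_by_ge0 _ _ A _ theta01 (fun x => (f x)%:C)) => x y.
by rewrite -raddfB normc_real.
Qed.

Lemma cocycle_norm u n y : normc (cocycle (twist g f u) n y) = cocycle g n y.
Proof.
elim: n y => [|n IH] y.
  by rewrite /cocycle !big_ord0 ComplexField.Normc.normc1.
rewrite !cocycleS normcM IH /twist normcM normc_cis mulr1 normc_real.
by rewrite gtr0_norm// (g_ge0 gamma0 mg).
Qed.

Lemma cocycle_sum n x : \sum_(y <- preimages n x) cocycle g n y = 1.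
Proof.
elim: n x => [|n IH] x; first by rewrite /= big_seq1 /cocycle big_ord0.
rewrite big_preimagesS -[RHS](IH x); apply: eq_bigr => y _.
have [g1 _ _] := mg; rewrite -[RHS]mul1r -(g1 y) mulr_suml.
by apply: eq_bigr => a ay; rewrite cocycleS shift_scons.
Qed.

Lemma cocycle_ge n y : gamma ^+ n <= cocycle g n y.
Proof.
elim: n y => [|n IH] y; first by rewrite /cocycle big_ord0 expr0.
rewrite cocycleS exprS ler_pM ?exprn_ge0 ?(ltW gamma0)//.
by have [_ + _] := mg; apply.
Qed.

Lemma twist_gainW u : 0 <= u <= a0 -> twist_gain kappa C Lf u <= twist_gain kappa C Lf a0.
Proof.
move=> /andP[u0 ua]; rewrite /twist_gain lerD2r ler_wpM2l// lerD2l ler_wpM2r//.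
by rewrite ler_wpM2l// !ger0_norm// ltW.
Qed.

Let G := twist_gain kappa C Lf a0.

Let G0 : 0 <= G.
Proof. by rewrite /G /twist_gain addr_ge0// mulr_ge0// addr_ge0// !mulr_ge0. Qed.

(** The Lipschitz constant of a solution is controlled by its sup norm: iterating the Lasota-Yorke
    bound along v = Pu v + w makes the initial Q disappear. *)
Lemma lip_bootstrap u v w b s Q : 0 <= u <= a0 -> bounded_by v b -> lip_by theta v Q ->
  both_by theta w s -> (forall x, v x = Pu u v x + w x) ->
  lip_by theta v ((G * b + s) / (1 - theta)).
Proof.
move=> ua vb vQ [_ ws] vE.
have b0 := bounded_by_ge0 vb.
have Q0 := lip_by_ge0 theta01 vQ.
set a := _ / _; have aE : theta * a + (G * b + s) = a.
  by rewrite /a; field; rewrite subr_eq0 gt_eqF.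
have s0 := lip_by_ge0 theta01 ws.
have a_ge0 : 0 <= a by rewrite divr_ge0 ?subr_ge0 ?(ltW th1)// addr_ge0// mulr_ge0.
have H n : lip_by theta v (a + Q * theta ^+ n).
  elim: n => [|n IH].
    by apply: (lip_byW theta01 _ vQ); rewrite expr0; lra.
  have [_ H1] := twist_step theta01 gamma0 C0 mg f_lip u vb IH.
  have H2 := lip_byD H1 ws => x y.
  have := lip_byW theta01 (_ : _ <= a + Q * theta ^+ n.+1) H2.
  rewrite {1}vE [in v y]vE; apply.
  rewrite exprS -{2}aE.
  have : twist_gain kappa C Lf u * b <= G * b by rewrite ler_wpM2r ?twist_gainW.
  lra.
move=> x y; apply: (le_geometric (K := Q * d x y) (r := theta)).
  by rewrite th1 ltW.
by move=> n; have := H n x y; rewrite mulrDl [_ * _ ^+ n * _]mulrAC.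
Qed.

(* If v is almost fixed by the operator twisted by u then |v| is almost constant
   and exp(i u f) v is close to v o shift; hence v ^ k is almost fixed by the
   operator twisted by k u, which is impossible as soon as k u >= a0. *)
Lemma no_almost_fixed eta : 0 < eta -> exists tau : R, [/\ 0 < tau, tau <= 1 &
  forall u v w Q x0, eta <= u <= a0 -> bounded_by v 1 -> lip_by theta v Q ->
    both_by theta w tau -> (forall x, v x = Pu u v x + w x) ->
    1 - tau <= normc (v x0) -> False].
Proof.
move=> eta0; have [M mixM] := exists_mixing_time A.
pose l1 := (G + 1) / (1 - theta).
have l10 : 0 <= l1 by rewrite divr_ge0 ?subr_ge0 ?(ltW th1)// addr_ge0.
(* k u >= a0 for every u >= eta, while k u <= k a0 stays in a bounded range, on which [decay] is
   uniform. *)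
pose k := (Num.truncn (a0 / eta)).+1.
have keta : a0 <= k%:R * eta.
  by rewrite -ler_pdivrMr// ltW// truncnS_gt.
have k1 : 1 <= k%:R :> R by rewrite ler1n.
have [E HE] := decay (k%:R * a0).
have rho01 : 0 <= r < 1 by case/andP: r01 => /ltW -> ->.
(* n makes the n-th iterate of v ^ k under the operator twisted by k u at most 1/8. *)
have [n Hn] : exists n, r ^+ n < (8 * (`|E| + 1) * (1 + k%:R * l1))^-1.
  apply: exprn_lt_eps => //.
  have hE : 0 < `|E| + 1 by rewrite ltr_wpDl.
  have hk : 0 < 1 + k%:R * l1 by rewrite ltr_pwDl// mulr_ge0.
  by rewrite invr_gt0; apply: mulr_gt0 => //; apply: mulr_gt0.
(* The thresholds are chosen backwards. tau3 bounds the one-step phase error, so that n steps on the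
   k-th power lose at most 1/8; tau2 forces this phase error through the variance identity; tau
   makes |v| at least 1 - tau2 everywhere, by pulling the value at x0 back along q steps. *)
pose tau3 := (8 * n%:R * k%:R + 8)^-1 : R.
have t3p : 0 < 8 * n%:R * k%:R + 8 :> R by rewrite ltr_wpDl// !mulr_ge0.
have tau30 : 0 < tau3 by rewrite invr_gt0.
have tau3n : n%:R * (k%:R * tau3) <= 8^-1.
  rewrite /tau3 mulrA ler_pdivrMr//; lra.
have tau31 : tau3 <= 1.
  rewrite /tau3 invf_le1//; have : 0 <= 8 * n%:R * k%:R :> R by rewrite !mulr_ge0.
  lra.
pose tau2 := gamma * tau3 ^+ 2 / 16.
have tau20 : 0 < tau2 by rewrite !mulr_gt0// exprn_gt0.
have gamma1 : gamma <= 1.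
  have [_ g2 _] := mg; exact: le_trans (g2 point) (g_le1 gamma0 mg _).
have [N HN] : exists N, theta ^+ N < tau2 / (2 * (l1 + 1)).
  apply: exprn_lt_eps; first by rewrite th1 ltW.
  by rewrite divr_gt0// mulr_gt0// ltr_wpDl.
pose q := (N + M)%N; pose gq := gamma ^+ q.
have gq0 : 0 < gq by exact: exprn_gt0.
pose tau := Num.min (gq * tau2 / (2 * (q%:R + 1))) (Num.min tau2 (2 * k%:R)^-1).
have q10 : 0 < 2 * (q%:R + 1) :> R by rewrite mulr_gt0// ltr_wpDl.
have tau0 : 0 < tau.
  have h1 : 0 < gq * tau2 / (2 * (q%:R + 1)) by apply: divr_gt0 => //; exact: mulr_gt0.
  have h2 : 0 < (2 * k%:R)^-1 :> R by rewrite invr_gt0 mulr_gt0// (lt_le_trans ltr01).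
  by rewrite !lt_min h1 tau20 h2.
have tauq : (q%:R + 1) * tau <= gq * tau2 / 2.
  have : tau <= gq * tau2 / (2 * (q%:R + 1)) by rewrite ge_min lexx.
  rewrite ler_pdivlMr//; lra.
have tau2_le : tau <= tau2 by rewrite !ge_min lexx orbT.
have tauk : k%:R * tau <= 2^-1.
  have : tau <= (2 * k%:R)^-1 by rewrite !ge_min lexx !orbT.
  by rewrite -[_^-1]div1r ler_pdivlMr ?mulr_gt0 ?(lt_le_trans ltr01)//; lra.
have tau2_16 : tau2 <= 16^-1 * tau3.
  rewrite /tau2 mulrC ler_wpM2l// expr2 mulrA ler_piMl ?(ltW tau30)//.
  by rewrite mulr_ile1 ?(ltW gamma0) ?(ltW tau30).
exists tau; split => //; first by lra.
move=> u v w Q x0 /andP[eu ua] v1 vQ wt vE vx0.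
have u0 : 0 < u by exact: lt_le_trans eu.
have uab : 0 <= u <= a0 by rewrite ltW.
have [wt1 wt2] := wt.
have vl : lip_by theta v l1.
  apply: (lip_byW theta01 _ (lip_bootstrap uab v1 vQ wt vE)).
  by rewrite ler_wpM2r ?invr_ge0 ?subr_ge0 ?(ltW th1)// mulr1 lerD2l; lra.
have vsum j x : normc (v x - iter j (Pu u) v x) <= j%:R * tau.
  elim: j x => [|j IH] x; first by rewrite subrr ComplexField.Normc.normc0 mul0r.
  have -> : v x - iter j.+1 (Pu u) v x =
      Pu u (fun y => v y - iter j (Pu u) v y) x + w x.
    by rewrite {1}vE iterS transferB; ring.
  rewrite (le_trans (normc_triangle _ _))// -natr1 mulrDl mul1r lerD//.
  exact: (transfer_bounded (twist_norm f gamma0 mg u) IH).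
(* The q-step average of |v| at x0 is nearly 1 and no value exceeds 1; a single preimage carries
   mass at least gq, so its modulus is nearly 1 too. *)
have vpre y : iter q sh y = x0 -> 1 - tau2 / 2 <= normc (v y).
  move=> yx0; have yin : y \in preimages q x0 by rewrite mem_preimages yx0.
  have H1 : normc (iter q (Pu u) v x0) <= 1 - cocycle g q y * (1 - normc (v y)).
    rewrite iter_transfer (le_trans (normc_sum _ _ _))//.
    have := cocycle_sum q x0.
    rewrite !(bigD1_seq y)//= ?preimages_uniq// normcM cocycle_norm.
    have : \sum_(i <- preimages q x0 | i != y) normc (cocycle (twist g f u) q i * v i) <=
       \sum_(i <- preimages q x0 | i != y) cocycle g q i.
      apply: ler_sum => i _; rewrite normcM cocycle_norm ler_piMr//.
      by rewrite (le_trans _ (cocycle_ge _ _))// exprn_ge0// ltW.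
    lra.
  have H2 := vsum q x0; have H3 := normc_triangle (v x0 - iter q (Pu u) v x0) (iter q (Pu u) v x0).
  rewrite subrK in H3.
  have H4 : gq * (1 - normc (v y)) <= cocycle g q y * (1 - normc (v y)).
    by rewrite ler_wpM2r ?subr_ge0// cocycle_ge.
  have : gq * (1 - normc (v y)) <= gq * (tau2 / 2) by lra.
  by rewrite ler_pM2l//; lra.
have vbig x : 1 - tau2 <= normc (v x).
  have [y yx0 yx] := mixing_preimage N x0 x mixM.
  have H1 := vpre y yx0; have := vl y x.
  have H2 : l1 * d y x <= tau2 / 2.
    have dN : d y x <= theta ^+ N by apply: d_agree => // i iN; rewrite yx// ltnW.
    apply: (@le_trans _ _ (l1 * (tau2 / (2 * (l1 + 1))))).
      by rewrite ler_wpM2l// (le_trans dN)// ltW.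
    have l1p : 0 < l1 + 1 by rewrite ltr_wpDl.
    rewrite (_ : l1 * _ = tau2 / 2 * (l1 / (l1 + 1))); last first.
      by field; rewrite gt_eqF.
    have t2 : 0 <= tau2 / 2 by move: tau20; lra.
    by rewrite ler_piMr// ler_pdivrMr// mul1r lerDl.
  have := normc_triangle (v y - v x) (v x); rewrite subrK; lra.
have phase x b : precedes b x ->
    normc (cis (u * f (scons b x)) * v (scons b x) - v x) <= tau3.
  move=> bx; pose z a := cis (u * f (scons a x)) * v (scons a x).
  have z1 a : normc (z a) <= 1 by rewrite normcM normc_cis mul1r.
  have [g1 g2 _] := mg.
  pose zeta := v x - w x.
  have zE : \sum_(a | precedes a x) (g (scons a x))%:C * z a = zeta.
    by rewrite /zeta {1}vE addrK; apply: eq_bigr => a _; rewrite mulrA.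
  have var := variance (g1 x) zE.
  have zeta_big : 1 - tau2 - tau <= normc zeta.
    have := normc_triangle zeta (w x); rewrite subrK.
    have := vbig x; have := wt1 x; lra.
  have sq : 1 - 2 * (tau2 + tau) <= normc zeta ^+ 2.
    have : (1 - tau2 - tau) ^+ 2 <= normc zeta ^+ 2.
      by rewrite ler_sqr ?nnegrE ?normc_ge0//; lra.
    have : 0 <= (tau2 + tau) ^+ 2 by exact: sqr_ge0.
    rewrite !expr2; lra.
  have S1 : \sum_(a | precedes a x) g (scons a x) * normc (z a) ^+ 2 <= 1.
    rewrite -[leRHS](g1 x); apply: ler_sum => a _; rewrite ler_piMr//.
      exact: le_trans (ltW gamma0) (g2 _).
    by rewrite exprn_ile1// normc_ge0.
  have S2 : g (scons b x) * normc (z b - zeta) ^+ 2 <= 4 * tau2.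
    apply: (@le_trans _ _ (\sum_(a | precedes a x) g (scons a x) * normc (z a - zeta) ^+ 2)).
      rewrite (bigD1 b)//= lerDl sumr_ge0// => a _.
      by rewrite mulr_ge0 ?exprn_ge0 ?normc_ge0// (le_trans (ltW gamma0)).
    by rewrite var; lra.
  have S3 : gamma * normc (z b - zeta) ^+ 2 <= gamma * (tau3 / 2) ^+ 2.
    apply: (@le_trans _ _ (4 * tau2)); last by rewrite /tau2 !expr2; lra.
    by rewrite (le_trans _ S2)// ler_wpM2r ?exprn_ge0 ?normc_ge0.
  have S4 : normc (z b - zeta) <= tau3 / 2.
    by move: S3; rewrite ler_pM2l// ler_sqr ?nnegrE ?normc_ge0 ?divr_ge0 ?(ltW tau30).
  rewrite (le_trans (normcB_triangle _ zeta _))//.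
  have : normc (zeta - v x) <= tau by rewrite /zeta addrAC subrr sub0r normc_opp.
  move: S4; rewrite -/(z b); lra.
pose vk x := v x ^+ k; pose ku := k%:R * u.
have fixed x : normc (Pu ku vk x - vk x) <= k%:R * tau3.
  have [g1 g2 _] := mg.
  have -> : Pu ku vk x - vk x = \sum_(a | precedes a x) (g (scons a x))%:C *
      ((cis (u * f (scons a x)) * v (scons a x)) ^+ k - v x ^+ k).
    rewrite (eq_bigr (fun a => twist g f ku (scons a x) * vk (scons a x) -
       (g (scons a x))%:C * vk x)).
      by rewrite sumrB -mulr_suml -(rmorph_sum (@real_complex R)) g1 mul1r.
    by move=> a _; rewrite mulrBr exprMn cisX /twist /ku /vk !mulrA.
  rewrite (le_trans (normc_sum _ _ _))//.
  apply: (@le_trans _ _ (\sum_(a | precedes a x) g (scons a x) * (k%:R * tau3))).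
    2: by rewrite -mulr_suml g1 mul1r.
  apply: ler_sum => a ax; have ga0 : 0 <= g (scons a x) by exact: le_trans (ltW gamma0) (g2 _).
  rewrite normcM normc_real ger0_norm// ler_wpM2l//.
  have z1 : normc (cis (u * f (scons a x)) * v (scons a x)) <= 1.
    by rewrite normcM normc_cis mul1r.
  apply: le_trans (normc_subX_le k z1 (v1 x)) _.
  by rewrite ler_wpM2l// phase.
have iterfixed j x : normc (iter j (Pu ku) vk x - vk x) <= j%:R * (k%:R * tau3).
  elim: j x => [|j IH] x; first by rewrite subrr ComplexField.Normc.normc0 mul0r.
  have -> : iter j.+1 (Pu ku) vk x - vk x =
      Pu ku (fun y => iter j (Pu ku) vk y - vk y) x + (Pu ku vk x - vk x).
    by rewrite iterS transferB; ring.
  rewrite (le_trans (normc_triangle _ _))// -natr1 mulrDl mul1r lerD//.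
  exact: (transfer_bounded (twist_norm f gamma0 mg ku) IH).
have vkK : both_by theta vk (1 + k%:R * l1).
  have kl0 : 0 <= k%:R * l1 by rewrite mulr_ge0.
  split.
    by move=> x; rewrite normcX (le_trans (exprn_ile1 _ (normc_ge0 _) (v1 x)))// lerDl.
  by apply: (lip_byW theta01 _ (lip_byX k v1 vl)); rewrite lerDr.
have kua : a0 <= ku <= k%:R * a0.
  by rewrite /ku (le_trans keta) ?ler_wpM2l//.
have dec := HE ku vk _ n kua vkK x0.
have small : E * r ^+ n * (1 + k%:R * l1) <= 8^-1.
  have kl0 : 0 < 1 + k%:R * l1 by rewrite ltr_pwDl// mulr_ge0.
  move: Hn; rewrite -[_^-1]div1r ltr_pdivlMr; last first.
    by rewrite !mulr_gt0// ltr_wpDl.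
  have : E * (r ^+ n * (1 + k%:R * l1)) <= (`|E| + 1) * (r ^+ n * (1 + k%:R * l1)).
    rewrite ler_wpM2r//; last by rewrite (le_trans (ler_norm E))// lerDl.
    by rewrite mulr_ge0 ?exprn_ge0 ?(ltW kl0)//; case/andP: rho01.
  lra.
(* Contradiction: v ^ k has modulus at least 1/2 at x0, whereas its n-th iterate is at most 1/8 and
   differs from it by at most 1/8. *)
have big : 2^-1 <= normc (vk x0).
  have := normc_subX_le k (_ : normc 1 <= 1) (_ : normc (normc (v x0))%:C <= 1).
  rewrite ComplexField.Normc.normc1 expr1n normc_real ger0_norm ?normc_ge0// => /(_ (lexx _) (v1 x0)).
  rewrite -rmorphXn -(rmorph1 (@real_complex R)) -!rmorphB !normc_real.
  rewrite (ger0_norm (_ : 0 <= 1 - normc (v x0))) ?subr_ge0// => H.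
  have := le_trans (ler_norm _) H; rewrite -normcX -/(vk x0).
  have : k%:R * (1 - normc (v x0)) <= k%:R * tau by rewrite ler_wpM2l//; lra.
  lra.
have := normc_triangle (iter n (Pu ku) vk x0) (- (iter n (Pu ku) vk x0 - vk x0)).
rewrite normc_opp opprB addrC subrK.
have := iterfixed n x0; lra.
Qed.

(** By homogeneity: if the sup norm V of v exceeded s / tau, then v / V would be almost fixed in the
    sense just excluded. The Lipschitz part follows from [lip_bootstrap]. *)
Lemma apriori_compact eta : 0 < eta -> exists2 Ca : R, 0 < Ca &
  forall u v w s K0, eta <= u <= a0 -> both_by theta v K0 -> both_by theta w s ->
    (forall x, v x = Pu u v x + w x) -> both_by theta v (Ca * s).
Proof.
move=> eta0; have [tau [tau0 tau1 H]] := no_almost_fixed eta0.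
pose Ca := (G / tau + 1) / (1 - theta) + tau^-1.
have Gt : 0 <= (G / tau + 1) / (1 - theta).
  by rewrite divr_ge0 ?subr_ge0 ?(ltW th1)// addr_ge0// divr_ge0// ltW.
have ti : 0 < tau^-1 by rewrite invr_gt0.
exists Ca; first by rewrite ltr_wpDl.
move=> u v w s K0 /andP[eu ua] vK0 ws vE.
have s0 := both_by_ge0 ws.
have uab : 0 <= u <= a0 by rewrite ua andbT (le_trans _ eu)// ltW.
suff vb : bounded_by v (s / tau).
  split.
    by apply: bounded_byW vb; rewrite mulrC ler_wpM2r// lerDr.
  apply: (lip_byW theta01 _ (lip_bootstrap uab vb vK0.2 ws vE)).
  rewrite [leLHS](_ : _ = (G / tau + 1) / (1 - theta) * s); last by ring.
  by rewrite ler_wpM2r// lerDl ltW.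
pose V := sup [set normc (v x) | x in [set: S]].
have Vsup : has_sup [set normc (v x) | x in [set: S]].
  split; first by exists (normc (v point)), point.
  by exists K0 => _ [x _ <-]; exact: vK0.1.
have vV x : normc (v x) <= V by apply: (ub_le_sup Vsup.2); exists x.
have V0 : 0 <= V by rewrite (le_trans _ (vV point))// normc_ge0.
have [sV|Vs] := leP (tau * V) s.
  move=> x; rewrite (le_trans (vV x))// ler_pdivlMr// mulrC//.
exfalso; have Vp : 0 < V.
  by rewrite lt_neqAle V0 andbT; apply: contraTneq Vs => <-; rewrite mulr0 -leNgt.
have [_ [x0 _ <-] vx0] := sup_adherent (mulr_gt0 tau0 Vp) Vsup.
pose c : R[i] := (V^-1)%:C.
have nc : normc c = V^-1 by rewrite normc_real gtr0_norm ?invr_gt0.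
apply: (H u (fun x => c * v x) (fun x => c * w x) (V^-1 * K0) x0).
- by rewrite eu.
- by move=> x; rewrite normcM nc mulrC ler_pdivrMr// mul1r.
- by move=> x y; rewrite -mulrBr normcM nc -mulrA ler_wpM2l ?invr_ge0 ?(ltW Vp)//; exact: vK0.2.
- split=> [x|x y]; rewrite -?mulrBr normcM nc.
    by rewrite mulrC ler_pdivrMr// (le_trans (ws.1 x))// ltW.
  rewrite mulrC ler_pdivrMr// (le_trans (ws.2 x y))// mulrAC ler_wpM2r ?d_ge0// ltW//.
- move=> x; rewrite {1}vE mulrDr; congr (_ + _).
  by rewrite /transfer mulr_sumr; apply: eq_bigr => a _; rewrite mulrCA.
- rewrite normcM nc mulrC ler_pdivlMr//; move: vx0; rewrite -/V; lra.
Qed.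

End CompactFrequencies.

(** * Periodic orbits *)

Section PoissonKernel.
Context (R : realType).
Implicit Types (e y u : R).

(* The integral over u >= 0 of exp(- e u) cos(u y); the bounds below work with
   the antiderivative poisson_prim and no integral is taken. *)
Definition poisson e y : R := e / (e ^+ 2 + y ^+ 2).

Definition poisson_prim e y u : R :=
  expR (- (e * u)) * (y * sin (u * y) - e * cos (u * y)) / (e ^+ 2 + y ^+ 2).

Lemma poisson_ge0 e y : 0 < e -> 0 < poisson e y.
Proof. by move=> e0; rewrite divr_gt0// ltr_wpDr ?sqr_ge0// exprn_gt0. Qed.

Lemma poisson_prim0 e y : poisson_prim e y 0 = - poisson e y.
Proof.
by rewrite /poisson_prim mulr0 oppr0 expR0 mul0r sin0 cos0 mulr0 sub0r mulr1 mul1r mulNr.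
Qed.

Lemma is_derive_poisson_prim e y u : 0 < e ->
  is_derive u (1 : R) (poisson_prim e y) (expR (- (e * u)) * cos (u * y)).
Proof.
move=> e0; rewrite /poisson_prim; apply: is_derive_eq.
have : e ^+ 2 + y ^+ 2 != 0 by rewrite gt_eqF// ltr_wpDr ?sqr_ge0// exprn_gt0.
rewrite /GRing.scale /=; move=> ?; field; done.
Qed.

Lemma poisson_prim_le e y u : 0 < e ->
  `|poisson_prim e y u| <= (`|y| + e) / (e ^+ 2 + y ^+ 2) * expR (- (e * u)).
Proof.
move=> e0; have p0 : 0 < e ^+ 2 + y ^+ 2 by rewrite ltr_wpDr ?sqr_ge0// exprn_gt0.
rewrite /poisson_prim !normrM (gtr0_norm (expR_gt0 _)) (@ger0_norm _ (_ ^-1)) ?invr_ge0 ?(ltW p0)//.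
rewrite -mulrA [leRHS]mulrC ler_wpM2l ?expR_ge0// ler_wpM2r ?invr_ge0 ?(ltW p0)//.
rewrite (le_trans (ler_normB _ _))// !normrM (gtr0_norm e0) lerD//.
  by rewrite ler_piMr// sin_max.
by rewrite ler_piMr ?(ltW e0)// cos_max.
Qed.

Lemma derive_ge0_le (phi phi' : R -> R) (N : R) :
  (forall u, is_derive u (1 : R) phi (phi' u)) -> (forall u, 0 <= u -> 0 <= phi' u) ->
  0 <= N -> phi 0 <= phi N.
Proof.
move=> dphi phi0 N0.
have cf : {within `[0, N], continuous phi}.
  by apply: derivable_within_continuous => x _; exact: ex_derive.
have [c cN E] := MVT_segment N0 (fun x _ => dphi x) cf.
move: cN; rewrite in_itv /= => /andP[c0 _].
by rewrite -subr_ge0 E subr0 mulr_ge0// phi0.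
Qed.

(** G and B are antiderivatives of the weighted cosine sum and of its majorant: B - G and B + G are
    nondecreasing on u >= 0, and G tends to 0 at infinity. The parameter k covers one kernel (k = 0)
    and a difference of two (k = 1). *)
Lemma kernel_bound (I : Type) (s : seq I) (c y : I -> R) (e1 e2 k A1 A2 A3 b1 b2 b3 : R) :
  0 < e1 -> 0 < e2 -> 0 <= A1 -> 0 <= A2 -> 0 <= A3 -> 0 < b1 -> 0 < b2 -> 0 < b3 ->
  (forall u, 0 <= u ->
    `|expR (- (e1 * u)) - k * expR (- (e2 * u))| * `|\sum_(j <- s) c j * cos (u * y j)| <=
    A1 * expR (- (b1 * u)) + A2 * expR (- (b2 * u)) + A3 * expR (- (b3 * u))) ->
  `|\sum_(j <- s) c j * (poisson e1 (y j) - k * poisson e2 (y j))| <=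
    A1 / b1 + A2 / b2 + A3 / b3.
Proof.
move=> e10 e20 A10 A20 A30 b10 b20 b30 H.
pose G u := \sum_(j <- s) c j * (poisson_prim e1 (y j) u - k * poisson_prim e2 (y j) u).
pose G' u := (expR (- (e1 * u)) - k * expR (- (e2 * u))) * \sum_(j <- s) c j * cos (u * y j).
pose B u := - (A1 / b1 * expR (- (b1 * u)) + A2 / b2 * expR (- (b2 * u)) + A3 / b3 * expR (- (b3 * u))).
pose B' u := A1 * expR (- (b1 * u)) + A2 * expR (- (b2 * u)) + A3 * expR (- (b3 * u)).
have dG u : is_derive u (1 : R) G (G' u).
  rewrite /G /G' mulr_sumr; elim: s {H G G'} => [|j s IH].
    rewrite (_ : (fun _ => _) = cst 0); last by apply/funext => v; rewrite big_nil.
    by rewrite big_nil; exact: is_derive_cst.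
  rewrite big_cons (_ : (fun _ => _) = (fun u => c j * (poisson_prim e1 (y j) u -
      k * poisson_prim e2 (y j) u)) + (fun u => \sum_(j0 <- s) c j0 * (poisson_prim e1 (y j0) u -
      k * poisson_prim e2 (y j0) u))); last first.
    by apply/funext => v; rewrite big_cons.
  apply: is_deriveD.
  have D1 := is_derive_poisson_prim (y j) u e10.
  have D2 := is_derive_poisson_prim (y j) u e20.
  have D3 := is_deriveZ (c j) (is_deriveB D1 (is_deriveZ k D2)).
  apply: is_derive_eq D3 _.
  by rewrite /GRing.scale /=; ring.
have dB u : is_derive u (1 : R) B (B' u).
  rewrite /B /B'; apply: is_derive_eq.
  rewrite /GRing.scale /=; field; rewrite !gt_eqF//.
have GB u : 0 <= u -> `|G' u| <= B' u by move=> u0; rewrite /G' normrM; exact: H.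
have B0 : B 0 = - (A1 / b1 + A2 / b2 + A3 / b3).
  by rewrite /B !mulr0 oppr0 expR0 !mulr1.
have Bneg u : B u <= 0.
  by rewrite /B oppr_le0 !addr_ge0// mulr_ge0 ?expR_ge0// divr_ge0// ltW.
have main N : 0 <= N -> `|G 0| <= A1 / b1 + A2 / b2 + A3 / b3 + `|G N|.
  move=> N0.
  have m1 : (B - G) 0 <= (B - G) N.
    apply: (@derive_ge0_le _ (fun u => B' u - G' u)) => // u u0.
    by rewrite subr_ge0 (le_trans (ler_norm _))// GB.
  have m2 : (B + G) 0 <= (B + G) N.
    apply: (@derive_ge0_le _ (fun u => B' u + G' u)) => // u u0.
    by rewrite -lerBlDr sub0r (le_trans _ (GB u u0))// -normrN ler_norm.
  move: m1 m2; rewrite /= !fctE B0 => m1 m2.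
  have := ler_norm (G N); have := ler_norm (- G N); rewrite normrN.
  have := Bneg N; rewrite ler_norml; move: m1 m2; lra.
have G0 : G 0 = - \sum_(j <- s) c j * (poisson e1 (y j) - k * poisson e2 (y j)).
  rewrite /G -sumrN; apply: eq_bigr => j _; rewrite !poisson_prim0; ring.
rewrite -normrN -G0.
pose r := Num.max (expR (- e1)) (expR (- e2)).
have r01 : 0 <= r < 1.
  by rewrite le_max expR_ge0 /= gt_max !expR_lt1 !oppr_lt0 e10.
pose M := \sum_(j <- s) `|c j| * ((`|y j| + e1) / (e1 ^+ 2 + y j ^+ 2) +
   `|k| * ((`|y j| + e2) / (e2 ^+ 2 + y j ^+ 2))).
apply: (le_geometric (K := M) r01) => n.
apply: (le_trans (main n%:R _)) => //; rewrite lerD2l /G.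
rewrite (le_trans (ler_norm_sum _ _ _))// /M mulr_suml; apply: ler_sum => j _.
rewrite normrM -mulrA ler_wpM2l// (le_trans (ler_normB _ _))// mulrDl.
have er e : 0 < e -> expR (- e) <= r -> expR (- (e * n%:R)) <= r ^+ n.
  move=> e0 er; rewrite -mulNr expRM_natr.
  by rewrite lerXn2r ?nnegrE ?expR_ge0//; case/andP: r01.
have c0 e z : 0 < e -> 0 <= (`|z| + e) / (e ^+ 2 + z ^+ 2).
  by move=> e0; rewrite divr_ge0 ?addr_ge0 ?sqr_ge0// ltW.
rewrite lerD//.
  rewrite (le_trans (poisson_prim_le _ _ e10))// ler_wpM2l ?c0// er//.
  by rewrite le_max lexx.
rewrite normrM -mulrA ler_wpM2l// (le_trans (poisson_prim_le _ _ e20))// ler_wpM2l ?c0// er//.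
by rewrite le_max lexx orbT.
Qed.

End PoissonKernel.

Section RuelleOperators.
Context (R : realType) (kappa : nat) (A : aperiodic_matrix kappa) (theta : R).
Context (theta01 : 0 < theta < 1).
Local Notation S := (shift_space A).
Local Notation sh := (@sft_shift kappa A).
Local Notation d := (@d_theta R kappa A theta).
Implicit Types (x y : S) (v w : S -> R[i]) (f : S -> R).

Lemma ruelle_opE (G v : S -> R[i]) : ruelle_op G v = transfer (fun y => cexp (G y)) v.
Proof.
apply/funext => x; rewrite /ruelle_op.
have -> : [set eta | sh eta = x] = [set` preimages 1 x].
  have M y : (y \in preimages 1 x) = (sh y == x) by exact: mem_preimages.
  apply/seteqP; split=> y H.
    by rewrite -[_ y]/(is_true (y \in preimages 1 x)) M; apply/eqP.
  by move: H; rewrite -[_ y]/(is_true (y \in preimages 1 x)) M => /eqP.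
by rewrite -fsbig_seq ?preimages_uniq// big_preimages1.
Qed.

Lemma cexp_real_mul (t u r : R) :
  cexp ((t +i* u) * r%:C) = (expR (t * r))%:C * cis (u * r).
Proof.
have -> : (t +i* u) * r%:C = (t * r) +i* (u * r).
  by apply/eqP; rewrite eq_complex /= !mulr0 subr0 add0r !eqxx.
by [].
Qed.

Lemma birkhoffS f n x : birkhoff f n.+1 x = f x + birkhoff f n (sh x).
Proof.
rewrite /birkhoff big_ord_recl; congr (_ + _); apply: eq_bigr => j _.
by rewrite lift0 iterSr.
Qed.

Lemma birkhoff0 f x : birkhoff f 0 x = 0.
Proof. exact: big_ord0. Qed.

Lemma birkhoffD f n m x : birkhoff f (n + m) x = birkhoff f n x + birkhoff f m (iter n sh x).
Proof.
elim: n x => [|n IH] x; first by rewrite birkhoff0 add0r.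
by rewrite addSn !birkhoffS IH addrA iterSr.
Qed.

Lemma birkhoffZ f c n x : birkhoff (fun y => c * f y) n x = c * birkhoff f n x.
Proof. by rewrite /birkhoff mulr_sumr. Qed.

Lemma cocycle_scaled f t u n x :
  cocycle (fun y => cexp (scaled_fun t u f y)) n x = cexp ((t +i* u) * (birkhoff f n x)%:C).
Proof.
elim: n x => [|n IH] x.
  by rewrite /cocycle big_ord0 birkhoff0 cexp_real_mul !mulr0 expR0 cis0 mulr1.
rewrite cocycleS IH /scaled_fun !cexp_real_mul birkhoffS !mulrDr expRD cisD.
by rewrite rmorphM /=; ring.
Qed.

Lemma cocycle_expR (F : S -> R) n x :
  cocycle (fun y => expR (F y)) n x = expR (birkhoff F n x).
Proof.
elim: n x => [|n IH] x; first by rewrite /cocycle big_ord0 birkhoff0 expR0.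
by rewrite cocycleS IH birkhoffS expRD.
Qed.

Lemma sup_norm_le v a : bounded_by v a -> (sup_norm v <= a%:E)%E.
Proof. by move=> va; apply: ub_ereal_sup => _ [x _ <-]; rewrite lee_fin. Qed.

Lemma sup_norm_ge v x : ((normc (v x))%:E <= sup_norm v)%E.
Proof. by apply: ereal_sup_ubound; exists x. Qed.

Lemma lip_const_le v b : lip_by theta v b -> (lip_const theta v <= b%:E)%E.
Proof.
move=> vb; have b0 := lip_by_ge0 theta01 vb.
apply: ub_ereal_sup => _ [[x y] _ <-] /=; rewrite lee_fin.
have := d_ge0 theta01 x y; rewrite le_eqVlt => /predU1P[<-|d0].
  by rewrite invr0 mulr0.
by rewrite ler_pdivrMr.
Qed.

Lemma lip_const_ge0 v : (0%E <= lip_const theta v)%E.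
Proof.
apply: ereal_sup_ubound; exists (point, point) => //=.
by rewrite subrr ComplexField.Normc.normc0 mul0r.
Qed.

Lemma sup_norm_ge0 v : (0%E <= sup_norm v)%E.
Proof. by apply: le_trans (sup_norm_ge v point); rewrite lee_fin normc_ge0. Qed.

Lemma lip_by_F_theta v b : lip_by theta v b -> F_theta theta v.
Proof. by move=> vb; exists b. Qed.

Lemma norm_theta_u_le v a b u : bounded_by v a -> lip_by theta v b ->
  (norm_theta_u theta u v <= (a + `|u|^-1 * b)%:E)%E.
Proof.
move=> va vb; rewrite /norm_theta_u EFinD EFinM; apply: leeD; first exact: sup_norm_le.
by apply: lee_wpmul2l; [rewrite lee_fin invr_ge0|exact: lip_const_le].
Qed.

Lemma norm_theta_u_ge v x u : ((normc (v x))%:E <= norm_theta_u theta u v)%E.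
Proof.
rewrite (le_trans (sup_norm_ge v x))// /norm_theta_u leeDl//.
by apply: mule_ge0; rewrite ?lip_const_ge0// lee_fin invr_ge0.
Qed.

Lemma norm_theta_u_le_norm_theta v u : 1 <= `|u| ->
  (norm_theta_u theta u v <= norm_theta theta v)%E.
Proof.
move=> u1; rewrite /norm_theta_u /norm_theta leeD2l//.
rewrite -[leRHS]mul1e; apply: lee_wpmul2r; first exact: lip_const_ge0.
by rewrite lee_fin invf_le1// (lt_le_trans ltr01).
Qed.

Lemma norm_theta_le_norm_theta_u v u : 1 <= `|u| ->
  (norm_theta theta v <= `|u|%:E * norm_theta_u theta u v)%E.
Proof.
move=> u1; have u0 : 0 < `|u| by rewrite (lt_le_trans ltr01).
rewrite /norm_theta_u ge0_muleDr ?sup_norm_ge0//; last first.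
  by apply: mule_ge0; rewrite ?lip_const_ge0// lee_fin invr_ge0.
rewrite muleA -EFinM divff ?gt_eqF// mul1e leeD2r//.
by rewrite -[leLHS]mul1e; apply: lee_wpmul2r; rewrite ?sup_norm_ge0// lee_fin.
Qed.

Section Estimate.
Context (f : S -> R) (Pf eps a0 rho Aeps : R).
Context (est : contraction_estimate theta f Pf eps a0 rho Aeps).
Local Notation Lu u := (ruelle_op (scaled_fun (- Pf) u f)).

Lemma iter_ruelleZ u n (c : R[i]) v x :
  iter n (Lu u) (fun y => c * v y) x = c * iter n (Lu u) v x.
Proof.
rewrite (_ : Lu u = transfer (fun y => cexp (scaled_fun (- Pf) u f y))); last first.
  by apply/funext => w; rewrite ruelle_opE.
by rewrite !iter_transfer mulr_sumr; apply: eq_bigr => y _; rewrite mulrCA.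
Qed.

(** The operator norm only sees vectors of the unit ball; since |u| >= 1, dividing by 2 K brings v
    into it. For K = 0 the vector vanishes and linearity is used instead. *)
Lemma contraction_bounded u n v K : a0 <= `|u| -> 1 <= `|u| -> both_by theta v K ->
  bounded_by (iter n (Lu u) v) (2 * K * (Aeps * rho ^+ n * `|u| `^ eps)).
Proof.
move=> au u1 [vb vl] x; have K0 := bounded_by_ge0 vb.
have [K00|Kn0] := eqVneq K 0.
  have -> : v = fun y => 0 * v y.
    apply/funext => y; rewrite mul0r; apply: ComplexField.Normc.eq0_normc.
    by apply/eqP; rewrite eq_le normc_ge0 andbT -K00.
  by rewrite iter_ruelleZ mul0r ComplexField.Normc.normc0 K00 mulr0 mul0r.
have Kp : 0 < 2 * K by rewrite mulr_gt0// lt_neqAle eq_sym Kn0.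
pose c : R[i] := (2 * K)^-1%:C; pose w y := c * v y.
have nc : normc c = (2 * K)^-1 by rewrite normc_real gtr0_norm ?invr_gt0.
have wb : bounded_by w 2^-1.
  move=> y; rewrite normcM nc mulrC ler_pdivrMr// (le_trans (vb y))//; lra.
have wl : lip_by theta w 2^-1.
  move=> y z; rewrite -mulrBr normcM nc mulrC ler_pdivrMr//.
  by rewrite (le_trans (vl y z))// mulrAC mulrA mulVf// mul1r.
have w1 : (norm_theta_u theta u w <= 1)%E.
  rewrite (le_trans (norm_theta_u_le u wb wl))// lee_fin.
  have : `|u|^-1 <= 1 by rewrite invf_le1// (lt_le_trans ltr01).
  lra.
have := est n au; set T := iter n _ => H.
have : (norm_theta_u theta u (T w) <= (Aeps * rho ^+ n * `|u| `^ eps)%:E)%E.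
  apply: le_trans H; apply: ereal_sup_ubound; exists w => //; split => //.
  exact: lip_by_F_theta wl.
move=> /(le_trans (norm_theta_u_ge _ x u)); rewrite lee_fin /w /T iter_ruelleZ normcM nc.
by rewrite mulrC ler_pdivrMr// mulrC.
Qed.

(** The factor |u| is the price of the unweighted norm, which is the one in Ruelle's Lemma. *)
Lemma contraction_op_norm u n : a0 <= `|u| -> 1 <= `|u| ->
  (op_norm theta (norm_theta theta) (iter n (Lu u)) <=
   (`|u| * (Aeps * rho ^+ n * `|u| `^ eps))%:E)%E.
Proof.
move=> au u1; apply: ub_ereal_sup => _ [v [vF v1] <-].
rewrite (le_trans (norm_theta_le_norm_theta_u _ u1))// EFinM.
apply: lee_wpmul2l; first by rewrite lee_fin.
apply: le_trans (est n au); apply: ereal_sup_ubound; exists v => //; split => //.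
by rewrite (le_trans _ v1)// norm_theta_u_le_norm_theta.
Qed.

End Estimate.

Definition periodic_sum (f : S -> R) (Pf u : R) (m : nat) : R[i] :=
  \sum_(xi \in [set xi | iter m sh xi = xi]) cexp ((- Pf +i* u) * (birkhoff f m xi)%:C).

Lemma indic_both i : both_by theta (@cylinder_indic R _ A i) 1.
Proof.
have b x : normc (@cylinder_indic R _ A i x) <= 1.
  rewrite /cylinder_indic; case: eqP => _.
    by rewrite ComplexField.Normc.normc1.
  by rewrite ComplexField.Normc.normc0.
split=> // x y; have [xy|/eqP xy] := eqVneq (sval x 0%N) (sval y 0%N).
  by rewrite /cylinder_indic xy subrr ComplexField.Normc.normc0 mulr_ge0 ?d_ge0.
rewrite (d_head theta xy) mulr1 /cylinder_indic.
case: eqP => [E1|_]; case: eqP => [E2|_]; rewrite ?subr0 ?sub0r ?normc_opp ?subrr.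
- by rewrite ComplexField.Normc.normc0.
- by rewrite ComplexField.Normc.normc1.
- by rewrite ComplexField.Normc.normc1.
- by rewrite ComplexField.Normc.normc0.
Qed.

(** Every term of the sum in Ruelle's Lemma has size rho ^ m, whence m rho ^ m; u ^ 2 combines the
    factor in that lemma with the one of [contraction_op_norm]. *)
Lemma high_frequency (f : S -> R) (Pf eps a0 rho Aeps rho1 : R) (x : 'I_kappa -> S) :
  contraction_estimate theta f Pf eps a0 rho Aeps -> 0 < Aeps -> 1 <= a0 -> 0 < eps ->
  ruelle_lemma_constant theta f x rho1 -> 0 < rho1 < rho -> rho < 1 ->
  pressure theta (fun xi => - Pf * f xi) = 0%E ->
  exists2 Ch, 0 < Ch & forall u m, (2 <= m)%N -> a0 <= u ->
    normc (periodic_sum f Pf u m) <= Ch * m%:R * rho ^+ m * (u ^+ 2 * u `^ eps).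
Proof.
move=> est Ae a01 eps0 rl /andP[r10 r1r] r1 P0.
have rho0 : 0 < rho by exact: lt_trans r1r.
(* With this tolerance rho1 ^ j * exp(j e1) = rho ^ j exactly, the pressure being 0; it is positive
   because rho1 < rho. *)
pose e1 := ln (rho / rho1).
have e10 : 0 < e1 by rewrite ln_gt0// ltr_pdivlMr// mul1r.
have rE : rho1 * expR e1 = rho.
  by rewrite /e1 lnK ?posrE ?divr_gt0// mulrC divfK// gt_eqF.
have aP : 0 < `|Pf| + 1 by rewrite ltr_wpDl.
have a0p : 0 < a0 by rewrite (lt_le_trans ltr01).
have [Cr Cr0 HC] := rl (`|Pf| + 1) a0 e1 aP a0p e10.
exists (Cr * Aeps + 2 * kappa%:R * Aeps).
  by rewrite ltr_pwDl ?mulr_gt0// !mulr_ge0// ltW.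
move=> u m m2 au; have u0 : 0 < u by exact: lt_le_trans au.
have u1 : 1 <= u by exact: le_trans au.
have nu : `|u| = u by rewrite gtr0_norm.
have au' : a0 <= `|u| by rewrite nu.
have u1' : 1 <= `|u| by rewrite nu.
have m1 : 1 <= m%:R :> R by rewrite ler1n (leq_trans _ m2).
have tP : `|- Pf| <= `|Pf| + 1 by rewrite normrN lerDl.
have := HC m (- Pf) u m2 tP au'; rewrite -/(periodic_sum f Pf u m) nu.
set Sx := \sum_(i < kappa) _ => H.
have Sx_le : normc Sx <= 2 * kappa%:R * Aeps * (rho ^+ m * u `^ eps).
  rewrite (le_trans (normc_sum _ _ _))//.
  rewrite (@le_trans _ _ (\sum_(i < kappa) 2 * 1 * (Aeps * rho ^+ m * u `^ eps)))//.
    apply: ler_sum => i _; have := contraction_bounded est m au' u1' (indic_both i) (x i).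
    by rewrite nu.
  rewrite sumr_const card_ord -[leLHS]mulr_natl le_eqVlt; apply/orP; left; apply/eqP.
  by ring.
have E_le : normc (periodic_sum f Pf u m - Sx) <= Cr * u * (m%:R * (u * Aeps * rho ^+ m * u `^ eps)).
  rewrite -lee_fin; apply: (le_trans H); rewrite [leRHS]EFinM.
  apply: lee_wpmul2l; first by rewrite lee_fin mulr_ge0// ltW.
  rewrite (@le_trans _ _ (\sum_(2 <= j < m.+1) (u * Aeps * rho ^+ m * u `^ eps)%:E)%E)//.
    rewrite big_nat [leRHS]big_nat; apply: lee_sum => j /andP[j2 jm].
    rewrite P0 adde0 -EFinM /= -muleA -EFinM.
    have Hop := contraction_op_norm est (m - j) au' u1'; rewrite nu in Hop.
    apply: (@le_trans _ _ ((u * (Aeps * rho ^+ (m - j) * u `^ eps))%:E * (rho1 ^+ j * expR (j%:R * e1))%:E)%E).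
      by apply: lee_wpmul2r => //; rewrite lee_fin mulr_ge0 ?expR_ge0 ?exprn_ge0// ltW.
    rewrite -EFinM lee_fin expRM_natl -exprMn rE le_eqVlt; apply/orP; left; apply/eqP.
    by rewrite -[in RHS](subnK (jm : (j <= m)%N)) exprD; ring.
  rewrite sumEFin lee_fin big_const_nat iter_addr_0 -[leLHS]mulr_natl ler_wpM2r//.
    by rewrite !mulr_ge0 ?powR_ge0 ?exprn_ge0// ltW.
  by rewrite ler_nat leq_subLR add2n leqnSn.
have := normc_triangle (periodic_sum f Pf u m - Sx) Sx; rewrite subrK => /le_trans; apply.
rewrite (le_trans (lerD E_le Sx_le))//.
set q := rho ^+ m * u `^ eps.
have q0 : 0 <= q by rewrite mulr_ge0 ?powR_ge0 ?exprn_ge0// ltW.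
have -> : Cr * u * (m%:R * (u * Aeps * rho ^+ m * u `^ eps)) = Cr * Aeps * (m%:R * u ^+ 2 * q).
  by rewrite /q; ring.
have -> : (Cr * Aeps + 2 * kappa%:R * Aeps) * m%:R * rho ^+ m * (u ^+ 2 * u `^ eps) =
   Cr * Aeps * (m%:R * u ^+ 2 * q) + 2 * kappa%:R * Aeps * (m%:R * u ^+ 2 * q).
  by rewrite /q; ring.
rewrite lerD2l ler_wpM2l//; first by rewrite !mulr_ge0// ltW.
rewrite ler_peMl// -[leLHS]mulr1 ler_pM// exprn_ege1//.
Qed.

End RuelleOperators.

(** * From periodic points to preimages *)

Section Words.
Context (kappa : nat) (A : aperiodic_matrix kappa).
Local Notation S := (shift_space A).
Local Notation sh := (@sft_shift kappa A).
Implicit Types (x y z : S).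

Definition word n x : {ffun 'I_n -> 'I_kappa} := [ffun i : 'I_n => sval x i].

Lemma wordP n x y : word n x = word n y <->
  forall i, (i < n)%N -> sval x i = sval y i.
Proof.
split=> [E i ni|H]; last by apply/ffunP => i; rewrite !ffunE H.
by have /ffunP/(_ (Ordinal ni)) := E; rewrite !ffunE.
Qed.

(* Junk value when no point starts with w. *)
Definition representative n (w : {ffun 'I_n -> 'I_kappa}) : S :=
  xget point [set z | word n z = w].

Lemma word_representative n x : word n (representative (word n x)) = word n x.
Proof. by rewrite /representative; case: xgetP => [y _ //|/(_ x)/(_ erefl)]. Qed.

Lemma word_eqW n m x y : (n <= m)%N -> word m x = word m y -> word n x = word n y.
Proof.
by move=> nm /wordP H; apply/wordP => i ni; apply: H; exact: leq_trans nm.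
Qed.

Definition periodic_points m : seq S := finmap.enum_fset (fset_set [set x | iter m sh x = x]).

Lemma mem_periodic_points m x : (0 < m)%N ->
  (x \in periodic_points m) = (iter m sh x == x).
Proof.
move=> m0; rewrite /periodic_points in_fset_set; last exact: finite_periodic.
by apply/idP/eqP; rewrite inE.
Qed.

Lemma periodic_points_uniq m : uniq (periodic_points m).
Proof. exact: finmap.fset_uniq. Qed.

(** For x of period m, this agrees with x on m + n symbols and is a preimage of order m of a point
    that depends only on the first n symbols of x. *)
Definition tail_swap m n x : S := splice m x (representative (word n x)).

Lemma representative_head n x : (0 < n)%N ->
  sval (representative (word n x)) 0%N = sval x 0%N.
Proof. by move=> n0; apply: (wordP n _ _).1 => //; exact: word_representative. Qed.

Lemma tail_swap_agree m n x : (0 < n)%N -> iter m sh x = x ->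
  forall i, (i < m + n)%N -> sval (tail_swap m n x) i = sval x i.
Proof.
move=> n0 xm i imn.
have xh : sval x m = sval (representative (word n x)) 0%N.
  by rewrite representative_head// -[in RHS]xm sval_iter_shift addn0.
rewrite /tail_swap sval_splice//; case: ltnP => // mi.
have -> : sval (representative (word n x)) (i - m)%N = sval x (i - m)%N.
  by apply: (wordP n _ _).1; [exact: word_representative|lia].
by rewrite -[in LHS]xm sval_iter_shift subnKC.
Qed.

(** The swap is a bijection from the points of period m onto the preimages of the representatives
    that start with the same word; its inverse is [periodize]. No term is lost, so periodic sums and
    preimage sums can be compared term by term. *)
Lemma big_tail_swap (V : nmodType) m n (phi : S -> V) : (0 < n)%N -> (n <= m)%N ->
  \sum_(x <- periodic_points m) phi (tail_swap m n x) =
  \sum_(w : {ffun 'I_n -> 'I_kappa})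
    \sum_(y <- preimages m (representative w) | word n y == w) phi y.
Proof.
move=> n0 nm; have m0 : (0 < m)%N by exact: leq_trans nm.
rewrite (partition_big (word n) predT)//=; apply: eq_bigr => w _.
rewrite -[RHS]big_filter -[LHS]big_filter -(big_map (tail_swap m n) predT phi).
apply: perm_big; apply: uniq_perm.
- rewrite map_inj_in_uniq ?filter_uniq ?periodic_points_uniq// => x y.
  rewrite !mem_filter !mem_periodic_points// => /andP[_ /eqP xm] /andP[_ /eqP ym] E.
  apply: shift_space_ext => i; rewrite (sval_per _ xm) (sval_per _ ym).
  have im : (i %% m < m + n)%N by rewrite ltn_addr// ltn_mod.
  by rewrite -(tail_swap_agree n0 xm im) E (tail_swap_agree n0 ym im).
- by rewrite filter_uniq// preimages_uniq.
move=> y; apply/mapP/idP => [[x]|].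
  rewrite !mem_filter !mem_periodic_points// => /andP[/eqP <- /eqP xm] ->.
  have xh : sval x m = sval (representative (word n x)) 0%N.
    by rewrite representative_head// -[in RHS]xm sval_iter_shift addn0.
  rewrite mem_preimages /tail_swap iter_shift_splice// eqxx andbT.
  apply/eqP/wordP => i ni; apply: (@tail_swap_agree m n) => //.
  by rewrite ltn_addl.
rewrite mem_filter mem_preimages => /andP[/eqP <- /eqP ym].
have yh : sval y m = sval y 0%N.
  by rewrite -[in RHS](representative_head y n0) -ym sval_iter_shift addn0.
have pa i : (i <= m)%N -> sval (periodize m y) i = sval y i.
  move=> im; rewrite sval_periodize//; case: (ltngtP i m) im => // [im _|-> _].
    by rewrite modn_small.
  by rewrite modnn yh.
have pp : word n (periodize m y) = word n y.
  by apply/wordP => i ni; rewrite pa// ltnW// (leq_trans ni).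
exists (periodize m y).
  by rewrite mem_filter mem_periodic_points// pp eqxx /=; apply/eqP/periodize_per.
apply: shift_space_ext => i; rewrite /tail_swap pp sval_splice.
  case: ltnP => [im|mi]; first by rewrite pa// ltnW.
  by rewrite -ym sval_iter_shift subnKC.
by rewrite pa// yh representative_head.
Qed.

End Words.

Section PeriodicComparison.
Context (R : realType) (kappa : nat) (A : aperiodic_matrix kappa) (theta : R).
Context (theta01 : 0 < theta < 1).
Local Notation S := (shift_space A).
Local Notation sh := (@sft_shift kappa A).
Local Notation d := (@d_theta R kappa A theta).
Implicit Types (x y z : S).

Let th0 : 0 < theta. Proof. by case/andP: theta01. Qed.
Let th1 : theta < 1. Proof. by case/andP: theta01. Qed.

Lemma birkhoff_agree (f : S -> R) Lf n k x y : (forall x y, `|f x - f y| <= Lf * d x y) ->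
  (forall i, (i < n + k)%N -> sval x i = sval y i) ->
  `|birkhoff f n x - birkhoff f n y| <= Lf * theta ^+ k / (1 - theta).
Proof.
move=> fl; have Lf0 : 0 <= Lf.
  apply: (@lip_by_ge0 _ _ A _ theta01 (fun x => (f x)%:C)) => a b.
  by rewrite -raddfB normc_real.
have ti : 0 < 1 - theta by rewrite subr_gt0.
suff H : (forall i, (i < n + k)%N -> sval x i = sval y i) ->
  `|birkhoff f n x - birkhoff f n y| <= Lf * theta ^+ k / (1 - theta) * (1 - theta ^+ n).
  move=> /H /le_trans; apply; rewrite ler_piMr ?gerBl ?exprn_ge0 ?(ltW th0)//.
  by rewrite divr_ge0 ?(ltW ti)// mulr_ge0// exprn_ge0// ltW.
elim: n x y => [|n IH] x y xy.
  by rewrite !birkhoff0 subrr normr0 expr0 subrr mulr0.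
rewrite !birkhoffS opprD addrACA (le_trans (ler_normD _ _))//.
have H1 : `|f x - f y| <= Lf * theta ^+ k * theta ^+ n.
  rewrite (le_trans (fl _ _))// -mulrA -exprD ler_wpM2l//.
  by apply: d_agree => // i ik; apply: xy; lia.
have H2 := IH (sh x) (sh y) (fun i ik => xy i.+1 ik).
rewrite (le_trans (lerD H1 H2))// le_eqVlt; apply/orP; left; apply/eqP.
by rewrite exprS; field; rewrite gt_eqF.
Qed.

Lemma word_indic_both n (w : {ffun 'I_n -> 'I_kappa}) :
  both_by theta (fun y => (word n y == w)%:R : R[i]) (theta ^+ n)^-1.
Proof.
have tn0 : 0 < theta ^+ n by exact: exprn_gt0.
have tn1 : 1 <= (theta ^+ n)^-1 by rewrite invf_ge1// exprn_ile1// ltW.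
have b (c : bool) : normc (c%:R : R[i]) <= 1.
  by case: c; rewrite ?ComplexField.Normc.normc1 ?ComplexField.Normc.normc0.
split=> [x|x y]; first exact: le_trans (b _) tn1.
have [dn|dn] := ltP (d x y) (theta ^+ n).
  have -> : word n x = word n y.
    by apply/wordP => i ni; apply: (d_lt_agree theta01 dn); exact: ltnW.
  by rewrite subrr ComplexField.Normc.normc0 mulr_ge0 ?d_ge0// invr_ge0 ltW.
apply: (@le_trans _ _ 1).
  by case: eqP => _; case: eqP => _;
    rewrite ?subr0 ?sub0r ?normc_opp ?subrr ?ComplexField.Normc.normc1 ?ComplexField.Normc.normc0.
by rewrite ler_pdivlMl// mulr1.
Qed.

Context (f : S -> R) (Pf Lf fm fM : R).
Context (f_lip : forall x y, `|f x - f y| <= Lf * d x y).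
Context (fm0 : 0 < fm) (f_range : forall x, fm <= f x <= fM).
Local Notation F := (fun y => - Pf * f y).
Local Notation ell := (transfer (fun y => expR (F y))).
Context (h : S -> R) (D : R) (D1 : 1 <= D) (hD : forall x, D^-1 <= h x <= D).
Context (hE : forall x, ell h x = h x).

Let D0 : 0 < D. Proof. exact: lt_le_trans ltr01 D1. Qed.
Let Lf0 : 0 <= Lf.
Proof.
apply: (@lip_by_ge0 _ _ A _ theta01 (fun x => (f x)%:C)) => a b.
by rewrite -raddfB normc_real.
Qed.

Let h0 x : 0 < h x.
Proof. by case/andP: (hD x) => + _; apply: lt_le_trans; rewrite invr_gt0. Qed.

Let ti : 0 < 1 - theta. Proof. by rewrite subr_gt0. Qed.

Definition orbit_weight m x : R := expR (- Pf * birkhoff f m x).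

Lemma orbit_weight_gt0 m x : 0 < orbit_weight m x. Proof. exact: expR_gt0. Qed.

(** Conservation because the eigenvalue is 1; it keeps all orbit sums bounded in m. *)
Lemma preimage_weight_h m x :
  \sum_(y <- preimages m x) orbit_weight m y * h y = h x.
Proof.
have <- : iter m ell h x = h x.
  elim: m x => [//|m IH] x; rewrite iterS -[RHS]hE; apply: eq_bigr => a _.
  by rewrite IH.
rewrite iter_transfer; apply: eq_bigr => y _.
by rewrite cocycle_expR birkhoffZ.
Qed.

Lemma preimage_weight m x : \sum_(y <- preimages m x) orbit_weight m y <= D ^+ 2.
Proof.
apply: (@le_trans _ _ (D * h x)); last first.
  by rewrite expr2 ler_wpM2l ?(ltW D0)//; case/andP: (hD x).
rewrite -(preimage_weight_h m x) mulr_sumr; apply: ler_sum => y _.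
rewrite mulrCA ler_peMr ?(ltW (orbit_weight_gt0 _ _))//.
by case/andP: (hD y) => + _; rewrite -ler_pdivrMl// mulr1.
Qed.

Let delta := Lf / (1 - theta).
Let delta0 : 0 <= delta. Proof. by rewrite divr_ge0// ltW. Qed.

Lemma birkhoff_swap m n x : (0 < n)%N -> iter m sh x = x ->
  `|birkhoff f m (tail_swap m n x) - birkhoff f m x| <= delta * theta ^+ n.
Proof.
move=> n0 xm; rewrite /delta mulrAC; apply: birkhoff_agree => //.
exact: tail_swap_agree.
Qed.

Lemma orbit_weight_close m x y e : `|birkhoff f m x - birkhoff f m y| <= e ->
  orbit_weight m x <= expR (`|Pf| * e) * orbit_weight m y.
Proof.
move=> xy; rewrite /orbit_weight -expRD ler_expR.
have : - Pf * (birkhoff f m x - birkhoff f m y) <= `|Pf| * e.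
  by rewrite (le_trans (ler_norm _))// normrM normrN ler_wpM2l.
by rewrite mulrBr; lra.
Qed.

Let cw := expR (`|Pf| * delta).
Let cw0 : 0 < cw. Proof. exact: expR_gt0. Qed.

Lemma exprn_le1 n : theta ^+ n <= 1. Proof. by rewrite exprn_ile1// ltW. Qed.

Lemma swap_weight m n x : (0 < n)%N -> iter m sh x = x ->
  orbit_weight m x <= cw * orbit_weight m (tail_swap m n x) /\
  orbit_weight m (tail_swap m n x) <= cw * orbit_weight m x.
Proof.
move=> n0 xm; have H := birkhoff_swap n0 xm.
have H1 : `|birkhoff f m (tail_swap m n x) - birkhoff f m x| <= delta.
  by rewrite (le_trans H)// ler_piMr// exprn_le1.
by split; apply: orbit_weight_close => //; rewrite distrC.
Qed.

Definition Zbound := cw * (kappa%:R * D ^+ 2).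

(** Swapping with words of length 1 leaves kappa base points, each with a preimage sum of at most
    [D ^+ 2]; [cw] bounds the change of the weights. *)
Lemma periodic_weight m : (0 < m)%N ->
  \sum_(x <- periodic_points A m) orbit_weight m x <= Zbound.
Proof.
move=> m0.
apply: (@le_trans _ _ (cw * \sum_(x <- periodic_points A m) orbit_weight m (tail_swap m 1 x))).
  rewrite mulr_sumr big_seq [leRHS]big_seq; apply: ler_sum => x.
  by rewrite mem_periodic_points// => /eqP xm; have [] := swap_weight (ltn0Sn 0) xm.
rewrite /Zbound ler_wpM2l ?(ltW cw0)// big_tail_swap//.
apply: (@le_trans _ _ (\sum_(w : {ffun 'I_1 -> 'I_kappa}) D ^+ 2)).
  apply: ler_sum => w _; rewrite (le_trans _ (preimage_weight m (representative A w)))//.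
  rewrite big_mkcond; apply: ler_sum => y _; case: ifP => // _.
  exact/ltW/orbit_weight_gt0.
by rewrite sumr_const card_ffun !card_ord expn1 mulr_natl.
Qed.

Lemma swap_weight_sum m n : (0 < n)%N -> (0 < m)%N ->
  \sum_(x <- periodic_points A m) orbit_weight m (tail_swap m n x) <= cw * Zbound.
Proof.
move=> n0 m0.
rewrite (le_trans _ (ler_wpM2l (ltW cw0) (periodic_weight m0)))//.
rewrite mulr_sumr big_seq [leRHS]big_seq; apply: ler_sum => x.
by rewrite mem_periodic_points// => /eqP xm; have [] := swap_weight n0 xm.
Qed.

Lemma periodic_sumE u m : (0 < m)%N -> periodic_sum f Pf u m =
  \sum_(x <- periodic_points A m) (orbit_weight m x)%:C * cis (u * birkhoff f m x).
Proof.
move=> m0; rewrite /periodic_sum fsbig_finite; last exact: finite_periodic.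
by apply: eq_bigr => x _; rewrite cexp_real_mul.
Qed.

Lemma normc_weighted_sum (s : seq S) u m : 
  normc (\sum_(x <- s) (orbit_weight m x)%:C * cis (u * birkhoff f m x)) <=
  \sum_(x <- s) orbit_weight m x.
Proof.
rewrite (le_trans (normc_sum _ _ _))//; apply: ler_sum => x _.
by rewrite normcM normc_cis mulr1 normc_real gtr0_norm// orbit_weight_gt0.
Qed.

Lemma periodic_sum_le u m : (0 < m)%N -> normc (periodic_sum f Pf u m) <= Zbound.
Proof.
by move=> m0; rewrite periodic_sumE// (le_trans (normc_weighted_sum _ _ _))// periodic_weight.
Qed.

(* The swapped orbits are exactly the preimages counted by the iterates of the
   transfer operator applied to indicators of cylinders of length n. *)
Definition word_sum n u m : R[i] :=
  \sum_(w : {ffun 'I_n -> 'I_kappa})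
     iter m (transfer (fun y => cexp (scaled_fun (- Pf) u f y)))
       (fun y => (word n y == w)%:R) (representative A w).

Definition swap_const := (`|Pf| * delta * expR (`|Pf| * delta) + 2 * delta) * (cw * Zbound).

(** The Birkhoff sums of an orbit and of its swap differ by O(theta ^ n). This changes the weight by
    a factor close to 1 and the phase by |u| times the difference, whence [1 + |u|]. *)
Lemma periodic_sum_word_sum n u m : (0 < n)%N -> (n <= m)%N ->
  normc (periodic_sum f Pf u m - word_sum n u m) <= swap_const * (1 + `|u|) * theta ^+ n.
Proof.
move=> n0 nm; have m0 : (0 < m)%N by exact: leq_trans nm.
pose phi y := (orbit_weight m y)%:C * cis (u * birkhoff f m y).
have -> : word_sum n u m = \sum_(x <- periodic_points A m) phi (tail_swap m n x).
  rewrite big_tail_swap//; apply: eq_bigr => w _; rewrite iter_transfer [RHS]big_mkcond.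
  apply: eq_bigr => y _; rewrite cocycle_scaled cexp_real_mul -/(orbit_weight m y) -/(phi y).
  by case: ifP; rewrite ?mulr1 ?mulr0.
rewrite periodic_sumE// -sumrB (le_trans (normc_sum _ _ _))//.
pose cs := `|Pf| * delta * expR (`|Pf| * delta) + 2 * delta.
have cs0 : 0 <= `|Pf| * delta * expR (`|Pf| * delta).
  by rewrite mulr_ge0 ?expR_ge0// mulr_ge0.
have tn0 : 0 <= theta ^+ n by rewrite exprn_ge0// ltW.
apply: (@le_trans _ _ (\sum_(x <- periodic_points A m)
    cs * (1 + `|u|) * theta ^+ n * orbit_weight m (tail_swap m n x))); last first.
  have csp : 0 <= cs by rewrite addr_ge0// mulr_ge0.
  rewrite -mulr_sumr /swap_const -/cs.
  rewrite [leRHS](_ : _ = cs * (1 + `|u|) * theta ^+ n * (cw * Zbound)); last by ring.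
  apply: ler_wpM2l; last exact: swap_weight_sum.
  by rewrite mulr_ge0// mulr_ge0// addr_ge0.
rewrite big_seq [leRHS]big_seq; apply: ler_sum => x.
rewrite mem_periodic_points// => /eqP xm.
set y := tail_swap m n x; have yx := birkhoff_swap n0 xm; rewrite -/y in yx.
set bx := birkhoff f m x in yx *; set by_ := birkhoff f m y in yx *.
have -> : (orbit_weight m x)%:C * cis (u * bx) - phi y =
  ((orbit_weight m x)%:C - (orbit_weight m y)%:C) * cis (u * bx) +
  (orbit_weight m y)%:C * (cis (u * bx) - cis (u * by_)).
  by rewrite /phi -/by_; ring.
rewrite (le_trans (normc_triangle _ _))// !normcM normc_cis mulr1 -rmorphB !normc_real.
have wy0 := orbit_weight_gt0 m y.
have P1 : `|orbit_weight m x - orbit_weight m y| <=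
    `|Pf| * delta * expR (`|Pf| * delta) * theta ^+ n * orbit_weight m y.
  have Pd : 0 <= `|Pf| * delta by rewrite mulr_ge0.
  have e1 := expR_sub1_le Pd (_ : 0 <= theta ^+ n <= 1).
  rewrite tn0 exprn_le1 in e1; have {}e1 := e1 isT.
  have w1 := orbit_weight_close yx; rewrite -/y in w1.
  have w2 : orbit_weight m x <= expR (`|Pf| * (delta * theta ^+ n)) * orbit_weight m y.
    by apply: orbit_weight_close; rewrite distrC.
  have ex : expR (- (`|Pf| * (delta * theta ^+ n))) >= 1 - `|Pf| * (delta * theta ^+ n).
    exact: expR_ge1Dx.
  have w3 : expR (- (`|Pf| * (delta * theta ^+ n))) * orbit_weight m y <= orbit_weight m x.
    by rewrite -ler_pdivlMl ?expR_gt0// -expRN opprK.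
  have E : (expR (`|Pf| * (delta * theta ^+ n)) - 1) * orbit_weight m y <=
     `|Pf| * delta * expR (`|Pf| * delta) * theta ^+ n * orbit_weight m y.
    by rewrite ler_pM2r// mulrA.
  have E2 : `|Pf| * (delta * theta ^+ n) <= `|Pf| * delta * expR (`|Pf| * delta) * theta ^+ n.
    by rewrite mulrA ler_wpM2r// ler_peMr// -expR0 ler_expR.
  have E3 : `|Pf| * (delta * theta ^+ n) * orbit_weight m y <=
      `|Pf| * delta * expR (`|Pf| * delta) * theta ^+ n * orbit_weight m y.
    by rewrite ler_pM2r.
  have E4 : (1 - `|Pf| * (delta * theta ^+ n)) * orbit_weight m y <= orbit_weight m x.
    by rewrite (le_trans _ w3)// ler_pM2r.
  by rewrite ler_norml; apply/andP; split; lra.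
have P2 : normc (cis (u * bx) - cis (u * by_)) <= 2 * (`|u| * (delta * theta ^+ n)).
  rewrite (le_trans (cis_lip _ _))// -mulrBr normrM ler_wpM2l// ler_wpM2l//.
  by rewrite distrC.
rewrite (gtr0_norm wy0).
have P3 := ler_wpM2l (ltW wy0) P2.
rewrite (le_trans (lerD P1 P3))// /cs.
set w := orbit_weight m y in wy0 *; set t := theta ^+ n in tn0 *.
set c := `|Pf| * delta * expR _ in cs0 *.
have H1 : 0 <= c * `|u| * t * w by exact: mulr_ge0 (mulr_ge0 (mulr_ge0 cs0 (normr_ge0 u)) tn0) (ltW wy0).
have H2 : 0 <= 2 * delta * t * w by exact: mulr_ge0 (mulr_ge0 (mulr_ge0 (ler0n _ 2) delta0) tn0) (ltW wy0).
lra.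
Qed.

End PeriodicComparison.

Section AveragingTimes.
Context (s l r : nat).

(* The times over which the orbit sums are averaged: a block of l consecutive
   times, convolved k times with a block of length r; each convolution gains a factor
   C / (u r) in the Fourier transform at a frequency u > 0. *)
Fixpoint times k : seq nat :=
  if k is k'.+1 then [seq (m + i)%N | m <- times k', i <- iota 0 r] else iota s l.

Lemma size_times k : size (times k) = (l * r ^ k)%N.
Proof.
elim: k => [|k IH] /=; first by rewrite size_iota expn0 muln1.
by rewrite size_allpairs IH size_iota -mulnA expnSr.
Qed.

Lemma times_range k m : m \in times k -> (s <= m < s + l + k * r)%N.
Proof.
elim: k m => [|k IH] m /=; first by rewrite mem_iota mul0n addn0.
move=> /allpairsP[[m1 i] /= [/IH + + ->]]; rewrite mem_iota add0n /=; nia.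
Qed.

Lemma big_timesS (V : nmodType) k (b : nat -> V) :
  \sum_(m <- times k.+1) b m = \sum_(i < r) \sum_(m <- times k) b (m + i)%N.
Proof.
rewrite /= big_allpairs_dep /= exchange_big /=.
by rewrite -(big_mkord xpredT (fun i => \sum_(m <- times k) b (m + i)%N)) /index_iota subn0.
Qed.

(** A time m with s + k r <= m < s + l arises from each of the r ^ k choices of offsets: the
    multiplicity has a flat top. *)
Lemma times_plateau (R : realType) k (b : nat -> R) : (forall m, 0 <= b m) ->
  r%:R ^+ k * \sum_(s + k * r <= m < s + l) b m <= \sum_(m <- times k) b m.
Proof.
elim: k b => [|k IH] b b0.
  by rewrite expr0 mul1r mul0n addn0 /= /index_iota addKn.
rewrite big_timesS exprS -mulrA -[X in X%:R * _]card_ord mulr_natl -sumr_const.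
apply: ler_sum => i _; apply: le_trans (IH (fun m => b (m + i)%N) (fun m => b0 _)).
rewrite ler_wpM2l ?exprn_ge0//.
have [le|gt] := leqP (s + l) (s + k.+1 * r); first by rewrite big_geq// sumr_ge0.
have ir := ltn_ord i.
rewrite -[leRHS]/(\sum_(s + k * r <= m < s + l) b (m + i)%N).
have -> : \sum_(s + k * r <= m < s + l) b (m + i)%N =
   \sum_(s + k * r + i <= m < s + l + i) b m.
  by rewrite [RHS]big_addn addnK; apply: eq_bigr.
rewrite (@big_cat_nat _ _ _ (s + k.+1 * r) _ (s + l + i)) /=; [|nia|lia].
rewrite (@big_cat_nat _ _ _ (s + l) (s + k.+1 * r) (s + l + i)) /=; [|lia|lia].
by rewrite addrCA lerDl addr_ge0// sumr_ge0.
Qed.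

End AveragingTimes.

Section Renewal.
Context (R : realType) (kappa : nat) (A : aperiodic_matrix kappa) (theta : R).
Context (theta01 : 0 < theta < 1).
Local Notation S := (shift_space A).
Local Notation sh := (@sft_shift kappa A).
Local Notation d := (@d_theta R kappa A theta).
Implicit Types (x y z : S).

Let th0 : 0 < theta. Proof. by case/andP: theta01. Qed.
Let th1 : theta < 1. Proof. by case/andP: theta01. Qed.

Context (f : S -> R) (Pf Lf fm fM : R).
Context (f_lip : forall x y, `|f x - f y| <= Lf * d x y).
Context (fm0 : 0 < fm) (f_range : forall x, fm <= f x <= fM).
Local Notation F := (fun y => - Pf * f y).
Local Notation ell := (transfer (fun y => expR (F y))).
Local Notation W := (orbit_weight f Pf).
Context (h : S -> R) (D : R) (D1 : 1 <= D) (hD : forall x, D^-1 <= h x <= D).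
Context (hE : forall x, ell h x = h x).

Let D0 : 0 < D. Proof. exact: lt_le_trans ltr01 D1. Qed.

Let h0 x : 0 < h x.
Proof. by case/andP: (hD x) => + _; apply: lt_le_trans; rewrite invr_gt0. Qed.

Lemma birkhoff_range n x : n%:R * fm <= birkhoff f n x <= n%:R * fM.
Proof.
elim: n x => [|n IH] x; first by rewrite birkhoff0 !mul0r lexx.
rewrite birkhoffS -natr1 !mulrDl !mul1r.
by have /andP[a b] := f_range x; have /andP[c e] := IH (sh x); apply/andP; split; lra.
Qed.

(* First passage: an orbit of preimages starts below T and ends above it, and
   the step that crosses T lands in [T, T + fM]. *)
Lemma first_passage x T J : 0 < T -> T <= J%:R * fm ->
  D^-1 ^+ 2 <= \sum_(1 <= j < J.+1)
     \sum_(t <- preimages j x | T <= birkhoff f j t <= T + fM) W j t.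
Proof.
move=> T0 TJ.
pose Q j := \sum_(t <- preimages j x | birkhoff f j t < T) W j t * h t.
pose C j := \sum_(t <- preimages j x | T <= birkhoff f j t <= T + fM) W j t * h t.
have Q0 : Q 0%N = h x.
  by rewrite /Q big_mkcond /= big_seq1 birkhoff0 T0 /orbit_weight birkhoff0 mulr0 expR0 mul1r.
have QJ : Q J = 0.
  rewrite /Q big1// => t; rewrite ltNge => /negP[]; rewrite (le_trans TJ)//.
  by case/andP: (birkhoff_range J t).
have step j : Q j - Q j.+1 <= C j.+1.
  rewrite lerBlDr /Q /C.
  rewrite [X in X <= _]big_mkcond [X in X + _]big_mkcond [X in _ + X]big_mkcond.
  rewrite -big_split big_preimagesS.
  apply: ler_sum => t _.
  have -> : (if birkhoff f j t < T then W j t * h t else 0) =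
     \sum_(a | precedes a t) (if birkhoff f j t < T then W j.+1 (scons a t) * h (scons a t) else 0).
    case: ifP => _; last by rewrite big1.
    rewrite -hE /transfer mulr_sumr; apply: eq_bigr => a at_.
    by rewrite /orbit_weight birkhoffS shift_scons// mulrDr expRD; ring.
  apply: ler_sum => a at_; rewrite birkhoffS shift_scons//.
  have /andP[fa1 fa2] := f_range (scons a t).
  have w0 : 0 <= W j.+1 (scons a t) * h (scons a t) by rewrite mulr_ge0 ?expR_ge0 ?ltW.
  set w := W _ _ * _ in w0 *.
  case: ifP => [b1|_]; last first.
    by rewrite addr_ge0//; case: ifP.
  have [b2|b2] := ltP (f (scons a t) + birkhoff f j t) T.
    by rewrite /= add0r.
  by rewrite /= (_ : _ <= T + fM) ?addr0//; lra.
have tele : h x <= \sum_(1 <= j < J.+1) C j.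
  have -> : h x = Q 0%N - Q J by rewrite Q0 QJ subr0.
  elim: J {TJ QJ} => [|J IH].
    by rewrite subrr big_geq.
  rewrite big_nat_recr//=; have := step J; move: IH; lra.
have Cle j : C j <= D * \sum_(t <- preimages j x | T <= birkhoff f j t <= T + fM) W j t.
  rewrite /C mulr_sumr; apply: ler_sum => t _; rewrite mulrC ler_wpM2r ?expR_ge0//.
  by case/andP: (hD t).
have : h x <= D * \sum_(1 <= j < J.+1) \sum_(t <- preimages j x | T <= birkhoff f j t <= T + fM) W j t.
  by rewrite (le_trans tele)// mulr_sumr; apply: ler_sum => j _.
rewrite -ler_pdivrMl// => /(le_trans _); apply.
by rewrite expr2 ler_wpM2l ?invr_ge0 ?(ltW D0)//; case/andP: (hD x).
Qed.

(** Each first-passage preimage of x0 is closed up to a periodic orbit by a connecting path of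
    length M. This changes the Birkhoff sum, hence the weight, by a bounded amount, uniformly in
    T. *)
Lemma renewal_lower : exists (c0 C0 : R) (M : nat), 0 < c0 /\
  forall T J, 0 < T -> T <= J%:R * fm ->
  c0 <= \sum_(1 <= j < J.+1)
    \sum_(x <- periodic_points A (j + M) | `|birkhoff f (j + M) x - T| <= C0) W (j + M) x.
Proof.
have [M [M0 HM]] := exists_mixing_time A.
pose x0 : S := point.
have HM2 i : exists e : S, sval e 0%N = sval x0 0%N /\ sval e M = i.
  by have [e ? ?] := HM (sval x0 0%N) i; exists e.
have [e He] := choice HM2.
pose C1 := Lf / (1 - theta) + M%:R * fM.
pose C0 := C1 + fM.
pose c1 := expR (`|Pf| * C1).
exists (c1^-1 * D^-1 ^+ 2), C0, M; split.
  by rewrite mulr_gt0 ?invr_gt0 ?expR_gt0// exprn_gt0// invr_gt0.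
move=> T J T0 TJ; rewrite ler_pdivrMl ?expR_gt0//.
rewrite (le_trans (first_passage x0 T0 TJ))// mulr_sumr big_nat [leRHS]big_nat.
apply: ler_sum => j /andP[j1 _].
pose y t := splice j t (e (sval t 0%N)); pose z t := periodize (j + M) (y t).
have jM : (0 < j + M)%N by rewrite addn_gt0 j1.
have tj t : iter j sh t = x0 -> sval t j = sval (e (sval t 0%N)) 0%N.
  by move=> tx; have [-> _] := He (sval t 0%N); rewrite -tx sval_iter_shift addn0.
have y0 t : iter j sh t = x0 -> sval (y t) (j + M)%N = sval (y t) 0%N.
  move=> tx; have [_ eM] := He (sval t 0%N).
  rewrite /y !sval_splice ?tj// j1 ltnNge leq_addr /= addKn.
  exact: eM.
have zt t i : iter j sh t = x0 -> (i < j)%N -> sval (z t) i = sval t i.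
  move=> tx ij; rewrite /z sval_periodize ?y0// modn_small ?ltn_addr//.
  by rewrite /y sval_splice ?tj// ij.
have zb t : iter j sh t = x0 -> `|birkhoff f (j + M) (z t) - birkhoff f j t| <= C1.
  move=> tx; rewrite birkhoffD addrAC (le_trans (ler_normD _ _))// lerD//.
    rewrite -[Lf]mulr1 -(expr0 theta); apply: (birkhoff_agree theta01) => // i.
    by rewrite addn0; exact: zt.
  have /andP[a b] := birkhoff_range M (iter j sh (z t)).
  by rewrite ger0_norm// (le_trans _ a)// mulr_ge0// ltW.
(* z t remembers the first j symbols of t, and the later symbols of t are those of x0. *)
have zinj : {in preimages j x0 &, injective z}.
  move=> t t1; rewrite !mem_preimages => /eqP tx /eqP t1x E.
  apply: shift_space_ext => i; have [ij|ji] := ltnP i j.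
    by rewrite -(zt t)// -(zt t1)// E.
  by rewrite -(subnKC ji) -!sval_iter_shift tx t1x.
set s1 := [seq t <- preimages j x0 | T <= birkhoff f j t <= T + fM].
rewrite -[leLHS]big_filter -/s1.
apply: (@le_trans _ _ (c1 * \sum_(u <- [seq z t | t <- s1]) W (j + M) u)).
  rewrite big_map mulr_sumr big_seq [leRHS]big_seq; apply: ler_sum => t.
  rewrite mem_filter mem_preimages => /andP[_ /eqP tx].
  rewrite /orbit_weight -expRD ler_expR.
  have : - Pf * (birkhoff f j t - birkhoff f (j + M) (z t)) <= `|Pf| * C1.
    by rewrite (le_trans (ler_norm _))// normrM normrN ler_wpM2l// distrC zb.
  by rewrite mulrBr; lra.
rewrite ler_wpM2l ?expR_ge0// -[leRHS]big_filter.
have sub : {subset [seq z t | t <- s1] <=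
    [seq u <- periodic_points A (j + M) | `|birkhoff f (j + M) u - T| <= C0]}.
  move=> u /mapP[t]; rewrite !mem_filter mem_preimages => /andP[/andP[b1 b2] /eqP tx] ->.
  rewrite mem_periodic_points// periodize_per ?y0// eqxx andbT.
  have := zb t tx; rewrite /C0 !ler_norml => /andP[a1 a2]; apply/andP; split.
    have /andP[fx1 fx2] := f_range x0; lra.
  lra.
have un : uniq [seq z t | t <- s1].
  rewrite map_inj_in_uniq ?filter_uniq ?preimages_uniq// => t t1.
  by rewrite !mem_filter => /andP[_ a] /andP[_ b]; exact: zinj.
rewrite [leRHS](bigID (fun u => u \in [seq z t | t <- s1]))/=.
rewrite -[X in _ <= X + _]big_filter.
have -> : \sum_(i <- [seq u <- [seq u <- periodic_points A (j + M) | `|birkhoff f (j + M) u - T| <= C0] |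
     u \in [seq z t | t <- s1]]) W (j + M) i = \sum_(u <- [seq z t | t <- s1]) W (j + M) u.
  apply: perm_big; apply: uniq_perm => //.
    by rewrite !filter_uniq// periodic_points_uniq.
  move=> u; rewrite mem_filter; apply/andP/idP => [[]//|us]; split => //.
  exact: sub.
by rewrite lerDl sumr_ge0// => u _; exact: expR_ge0.
Qed.

End Renewal.

(** * Averaged orbit sums at middle frequencies *)

Section MidFrequency.
Context (R : realType) (kappa : nat) (A : aperiodic_matrix kappa) (theta : R).
Context (theta01 : 0 < theta < 1).
Local Notation S := (shift_space A).
Local Notation sh := (@sft_shift kappa A).
Local Notation d := (@d_theta R kappa A theta).
Implicit Types (x y z : S) (v w : S -> R[i]).

Let th0 : 0 < theta. Proof. by case/andP: theta01. Qed.
Let th1 : theta < 1. Proof. by case/andP: theta01. Qed.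

Context (f : S -> R) (Pf Lf fm fM : R).
Context (f_lip : forall x y, `|f x - f y| <= Lf * d x y).
Context (fm0 : 0 < fm) (f_range : forall x, fm <= f x <= fM).
Local Notation F := (fun y => - Pf * f y).
Local Notation ell := (transfer (fun y => expR (F y))).
Context (h : S -> R) (D Bh : R) (D1 : 1 <= D) (hD : forall x, D^-1 <= h x <= D).
Context (Bh0 : 0 <= Bh) (h_log : log_lip theta Bh h).
Context (hE : forall x, ell h x = h x).
Local Notation g := (normalized F h h).
Context (gamma C : R) (gamma0 : 0 < gamma) (C0 : 0 <= C) (mg : markov_weight theta gamma C g).
Context (eps a0 rho Aeps : R) (Aeps0 : 0 < Aeps) (rho01 : 0 < rho < 1) (eps0 : 0 < eps).
Context (est : contraction_estimate theta f Pf eps a0 rho Aeps) (a01 : 1 <= a0).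

Local Notation T u := (transfer (fun y => cexp (scaled_fun (- Pf) u f y))).
Local Notation Pu u := (transfer (twist g f u)).

Let D0 : 0 < D. Proof. exact: lt_le_trans ltr01 D1. Qed.

Let h0 x : 0 < h x.
Proof. by case/andP: (hD x) => + _; apply: lt_le_trans; rewrite invr_gt0. Qed.

Let hV x : (h x)%:C * ((h x)^-1)%:C = 1 :> R[i].
Proof. by rewrite -rmorphM mulfV ?rmorph1// gt_eqF. Qed.

(** Conjugation by h turns the Ruelle operators into twists of a Markov operator, whose iterates do
    not increase sup norms. *)
Lemma transfer_conj u v x : T u (fun y => (h y)%:C * v y) x = (h x)%:C * Pu u v x.
Proof.
rewrite /transfer mulr_sumr; apply: eq_bigr => a ax.
rewrite /scaled_fun cexp_real_mul /twist /normalized shift_scons// !rmorphM /=.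
rewrite -[LHS]mul1r -(hV x); ring.
Qed.

Lemma iter_transfer_conj n u v x :
  iter n (T u) (fun y => (h y)%:C * v y) x = (h x)%:C * iter n (Pu u) v x.
Proof.
elim: n x => [//|n IH] x; rewrite iterS -transfer_conj; congr (T u _ x).
by apply/funext => y.
Qed.

Let h_both : exists2 Kh, 0 <= Kh & both_by theta (fun y => (h y)%:C) Kh.
Proof.
have hl := log_lip_lip theta01 Bh0 (U := D) (u := h) _ h_log.
have {}hl := hl (fun x => _).
exists (D * (Bh * expR Bh + 1)).
  by rewrite mulr_ge0 ?(ltW D0)// addr_ge0// mulr_ge0// expR_ge0.
split; last by apply: hl => x; rewrite h0; case/andP: (hD x).
move=> x; rewrite normc_real gtr0_norm//.
case/andP: (hD x) => _ /le_trans; apply.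
by rewrite ler_peMr ?(ltW D0)// lerDr mulr_ge0// expR_ge0.
Qed.

Let hinv_both : exists2 Kh, 0 <= Kh & both_by theta (fun y => ((h y)^-1)%:C) Kh.
Proof.
exists (D * (Bh * expR Bh + 1)).
  by rewrite mulr_ge0 ?(ltW D0)// addr_ge0// mulr_ge0// expR_ge0.
have hiD x : (h x)^-1 <= D.
  by rewrite -[D]invrK lef_pV2 ?posrE ?invr_gt0//; case/andP: (hD x).
split.
  move=> x; rewrite normc_real gtr0_norm ?invr_gt0// (le_trans (hiD x))//.
  by rewrite ler_peMr ?(ltW D0)// lerDr mulr_ge0// expR_ge0.
apply: (log_lip_lip theta01 Bh0 (U := D)); first by move=> x; rewrite invr_gt0 h0 hiD.
move=> x y xy; rewrite ler_pdivlMr ?h0// -ler_pdivlMl ?invr_gt0 ?h0// invrK mulrC (d_sym theta01).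
exact: (h_log (esym xy)).
Qed.

Lemma both_byM v w a b : both_by theta v a -> both_by theta w b ->
  both_by theta (fun y => v y * w y) (2 * a * b).
Proof.
move=> [va vl] [wa wl]; have a_ge0 := bounded_by_ge0 va; have b_ge0 := bounded_by_ge0 wa.
split.
  apply: bounded_byW (bounded_byM va wa); rewrite -mulrA.
  by have := mulr_ge0 a_ge0 b_ge0; lra.
apply: (lip_byW theta01 _ (lip_byM va vl wa wl)).
by rewrite -mulrA le_eqVlt; apply/orP; left; apply/eqP; ring.
Qed.

Lemma twist_decay a1 : exists E, forall u v K n, a0 <= u <= a1 -> both_by theta v K ->
  bounded_by (iter n (Pu u) v) (E * rho ^+ n * K).
Proof.
have [Kh Kh0 hK] := h_both.
exists (D * (4 * Kh * (Aeps * a1 `^ eps))) => u v K n /andP[au ua] vK x.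
have K0 := both_by_ge0 vK.
have u1 : 1 <= u by exact: le_trans au.
have u0 : 0 < u by exact: lt_le_trans u1.
have nu : `|u| = u by rewrite gtr0_norm.
have au1 : a0 <= `|u| by rewrite nu.
have u11 : 1 <= `|u| by rewrite nu.
have := contraction_bounded theta01 est n au1 u11 (both_byM hK vK) x.
rewrite nu; rewrite (_ : ruelle_op _ = T u); last first.
  by apply/funext => w; rewrite ruelle_opE.
rewrite iter_transfer_conj normcM normc_real gtr0_norm// => H.
have -> : normc (iter n (Pu u) v x) = (h x)^-1 * (h x * normc (iter n (Pu u) v x)).
  by rewrite mulrA mulVf ?mul1r// gt_eqF.
have hiD : (h x)^-1 <= D.
  by rewrite -[D]invrK lef_pV2 ?posrE ?invr_gt0//; case/andP: (hD x).
rewrite -!mulrA ler_pM ?invr_ge0 ?mulr_ge0 ?normc_ge0 ?(ltW (h0 x))//.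
rewrite (le_trans H)//.
have P1 : u `^ eps <= a1 `^ eps.
  by rewrite ge0_ler_powR ?nnegrE ?(ltW eps0) ?(ltW u0)// (le_trans _ ua)// ltW.
have P2 : 0 <= 4 * Kh * K * Aeps * rho ^+ n.
  rewrite !mulr_ge0 ?exprn_ge0 ?(ltW Aeps0)//; by case/andP: rho01 => /ltW.
have := ler_wpM2l P2 P1; lra.
Qed.

(** For u >= eta the estimate has no 1 / u; it is rewritten with s / u at the cost of a factor a0,
    so that one bound covers all 0 < u <= a0. *)
Lemma apriori : exists2 Cb, 0 < Cb & forall u v w s K0, 0 < u <= a0 ->
  both_by theta v K0 -> both_by theta w s -> (forall x, v x = Pu u v x + w x) ->
  both_by theta v (Cb * (s / u)).
Proof.
have [eta [C1 [eta0 C10 H1]]] := apriori_small theta01 gamma0 C0 mg fm0 f_range f_lip.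
have a00 : 0 < a0 by exact: lt_le_trans a01.
have [C2 C20 H2] := apriori_compact theta01 gamma0 C0 mg f_lip a00 rho01 twist_decay eta0.
exists (C1 + C2 * a0); first by rewrite addr_gt0// mulr_gt0.
move=> u v w s K0 /andP[u0 ua] vK ws vE.
have s0 := both_by_ge0 ws.
have su : 0 <= s / u by rewrite divr_ge0// ltW.
have [ue|eu] := leP u eta.
  apply: both_byW (H1 u v w s K0 _ vK ws vE) => //; last by rewrite u0.
  by rewrite ler_wpM2r// lerDl mulr_ge0// ltW.
apply: both_byW (H2 u v w s K0 _ vK ws vE) => //; last by rewrite ltW.
rewrite mulrDl (@le_trans _ _ (C2 * a0 * (s / u)))//; last by rewrite lerDr mulr_ge0// ltW.
rewrite -mulrA ler_wpM2l ?(ltW C20)// mulrCA ler_peMr//.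
by rewrite ler_pdivlMr// mul1r.
Qed.

Definition timed_sum s l r k u v : S -> R[i] :=
  fun x => \sum_(m <- times s l r k) iter m (Pu u) v x.

Lemma iter_twist_sum (I : Type) (q : seq I) n u (G : I -> S -> R[i]) x :
  iter n (Pu u) (fun y => \sum_(j <- q) G j y) x = \sum_(j <- q) iter n (Pu u) (G j) x.
Proof.
under [RHS]eq_bigr do rewrite iter_transfer.
rewrite iter_transfer [RHS]exchange_big /=; apply: eq_bigr => y _.
by rewrite mulr_sumr.
Qed.

Lemma both_by_sum (I : Type) (q : seq I) (G : I -> S -> R[i]) K :
  (forall j, both_by theta (G j) K) ->
  both_by theta (fun y => \sum_(j <- q) G j y) ((size q)%:R * K).
Proof.
move=> GK; elim: q => [|j q [IH1 IH2]].
  rewrite mul0r; split=> [x|x y]; rewrite !big_nil ?subrr ComplexField.Normc.normc0//.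
  by rewrite mul0r.
rewrite /= -natr1 mulrDl mul1r addrC.
split=> [x|x y]; rewrite !big_cons; have [Gj1 Gj2] := GK j.
  by rewrite (le_trans (normc_triangle _ _))// lerD.
rewrite opprD addrACA mulrDl (le_trans (normc_triangle _ _))// lerD//.
Qed.

(** Averaging over a block solves a resolvent equation: V' = sum of Pu^i V over i < r satisfies V' =
    Pu V' + (V - Pu^r V). Inverting 1 - Pu bounds V' by C / u times V, where the trivial bound would
    be r times V; each convolution gains this once. *)
Lemma timed_sum_bound : exists2 Cm, 0 < Cm & forall s l r k u v K, 0 < u <= a0 ->
  both_by theta v K -> both_by theta (timed_sum s l r k u v) ((Cm / u) ^+ k * (l%:R * (Cm * K))).
Proof.
have [Cb Cb0 H] := apriori.
pose tc := twist_const kappa theta C Lf a0.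
have Lf0 : 0 <= Lf.
  apply: (@lip_by_ge0 _ _ A _ theta01 (fun x => (f x)%:C)) => a b.
  by rewrite -raddfB normc_real.
have tcle u : 0 < u <= a0 -> twist_const kappa theta C Lf u <= tc.
  move=> /andP[u0 ua]; rewrite /tc /twist_const lerD2l ler_wpM2r ?invr_ge0 ?subr_ge0 ?(ltW th1)//.
  rewrite /twist_gain lerD2r ler_wpM2l// lerD2l ler_wpM2r// ler_wpM2l//.
  by rewrite !ger0_norm// ?(ltW u0)// (le_trans _ a01).
have tc0 : 0 <= tc.
  rewrite /tc /twist_const addr_ge0// divr_ge0 ?subr_ge0 ?(ltW th1)//.
  by rewrite /twist_gain addr_ge0// mulr_ge0// addr_ge0// !mulr_ge0.
pose Cm := Num.max (Cb * (1 + tc)) (tc + 1).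
have Cm1 : Cb * (1 + tc) <= Cm by rewrite le_max lexx.
have Cm2 : tc <= Cm by rewrite le_max lerDl ler01 orbT.
have Cm0 : 0 < Cm by rewrite lt_max ltr_wpDl ?orbT.
exists Cm => // s l r k u v K ua vK; have K0 := both_by_ge0 vK.
have u0 : 0 < u by case/andP: ua.
have itK n w Q : both_by theta w Q -> both_by theta (iter n (Pu u) w) (tc * Q).
  move=> wQ; apply: both_byW (iter_twist_both theta01 gamma0 C0 mg f_lip u n wQ) => //.
  by rewrite ler_wpM2r ?tcle// (both_by_ge0 wQ).
elim: k => [|k IH].
  rewrite expr0 mul1r /timed_sum /= -{2}(size_iota s l); apply: both_by_sum => m.
  by apply: both_byW (itK m v K vK) => //; rewrite ler_wpM2r.
set V := timed_sum s l r k u v in IH; set Q := _ * _ in IH.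
have Q0 := both_by_ge0 IH.
pose w x := V x - iter r (Pu u) V x.
have VE x : timed_sum s l r k.+1 u v x = \sum_(i < r) iter i (Pu u) V x.
  rewrite /timed_sum big_timesS; apply: eq_bigr => i _.
  by rewrite iter_twist_sum; apply: eq_bigr => m _; rewrite addnC iterD.
have step x : timed_sum s l r k.+1 u v x = Pu u (timed_sum s l r k.+1 u v) x + w x.
  have -> : Pu u (timed_sum s l r k.+1 u v) x = \sum_(i < r) iter i.+1 (Pu u) V x.
    rewrite (_ : timed_sum s l r k.+1 u v = fun x => \sum_(i < r) iter i (Pu u) V x); last exact/funext.
    by rewrite transfer_sum; apply: eq_bigr => i _; rewrite iterS.
  rewrite VE /w.
  have tele q : \sum_(i < q) iter i (Pu u) V x =
      \sum_(i < q) iter i.+1 (Pu u) V x + (V x - iter q (Pu u) V x).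
    elim: q => [|q IHq]; first by rewrite !big_ord0 add0r subrr.
    by rewrite !big_ord_recr /= IHq; ring.
  exact: tele.
have wK : both_by theta w ((1 + tc) * Q).
  rewrite mulrDl mul1r; have [I1 I2] := IH; have [J1 J2] := itK r V Q IH.
  by split; [exact: bounded_byD I1 (bounded_byN J1)|exact: lip_byD I2 (lip_byN J2)].
have V1K : exists K1, both_by theta (timed_sum s l r k.+1 u v) K1.
  exists (r%:R * (tc * Q)); rewrite (_ : timed_sum s l r k.+1 u v =
    fun x => \sum_(i <- iota 0 r) iter i (Pu u) V x).
    by rewrite -{2}(size_iota 0 r); apply: both_by_sum => i; exact: itK.
  by apply/funext => x; rewrite VE -(big_mkord xpredT (fun i => iter i (Pu u) V x)) /index_iota subn0.
have [K1 V1] := V1K.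
apply: both_byW (H u _ _ _ _ ua V1 wK step) => //.
have -> : (Cm / u) ^+ k.+1 * (l%:R * (Cm * K)) = Cm * (Q / u).
  by rewrite exprS /Q; ring.
have -> : Cb * ((1 + tc) * Q / u) = Cb * (1 + tc) * (Q / u) by ring.
by rewrite ler_wpM2r// divr_ge0// ltW.
Qed.

(** The first term is the error of replacing periodic points by preimages. In the second, kappa ^ n
    counts the words and theta ^ (- n) is the Lipschitz constant of the indicator of a cylinder. *)
Lemma mid_frequency : exists2 Cm, 0 < Cm & forall s l r k n u, 0 < u <= a0 ->
  (0 < n)%N -> (n <= s)%N -> (0 < r)%N ->
  normc (\sum_(m <- times s l r k) periodic_sum f Pf u m) <=
  r%:R ^+ k * l%:R * (Cm * theta ^+ n + (kappa%:R / theta) ^+ n * Cm * (Cm / (u * r%:R)) ^+ k).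
Proof.
have [C1 C10 H] := timed_sum_bound.
have [Kh Kh0 hK] := hinv_both.
pose Cw := 2 * Kh * C1 * D.
have Cw0 : 0 <= Cw by rewrite /Cw !mulr_ge0// ltW.
pose sc := swap_const kappa theta Pf Lf D.
have Lf0 : 0 <= Lf.
  apply: (@lip_by_ge0 _ _ A _ theta01 (fun x => (f x)%:C)) => a b.
  by rewrite -raddfB normc_real.
have dl0 : 0 <= Lf / (1 - theta) by rewrite divr_ge0// subr_ge0 ltW.
have sc0 : 0 <= sc.
  rewrite /sc /swap_const /Zbound; apply: mulr_ge0.
    apply: addr_ge0; last exact: mulr_ge0 (ler0n _ 2) dl0.
    exact: mulr_ge0 (mulr_ge0 (normr_ge0 _) dl0) (expR_ge0 _).
  rewrite mulr_ge0 ?expR_ge0// mulr_ge0 ?expR_ge0// mulr_ge0// exprn_ge0//.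
  exact: ltW.
have a00 : 0 <= a0 by exact: le_trans a01.
pose Cm := sc * (1 + a0) + Cw + C1.
have sa0 : 0 <= sc * (1 + a0) by rewrite mulr_ge0// addr_ge0.
exists Cm; first by rewrite ltr_wpDl// addr_ge0.
move=> s l r k n u ua n0 ns r0; have /andP[u0 ua0] := ua.
have tn0 : 0 < theta ^+ n by exact: exprn_gt0.
have rk0 : 0 < r%:R ^+ k :> R by rewrite exprn_gt0// ltr0n.
have rr0 : 0 < r%:R :> R by rewrite ltr0n.
pose q := times s l r k.
have -> : \sum_(m <- q) periodic_sum f Pf u m =
   \sum_(m <- q) (periodic_sum f Pf u m - word_sum f Pf n u m) + \sum_(m <- q) word_sum f Pf n u m.
  by rewrite -big_split; apply: eq_bigr => m _ /=; rewrite subrK.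
rewrite (le_trans (normc_triangle _ _))// mulrDr; apply: lerD.
  rewrite (le_trans (normc_sum _ _ _))//.
  apply: (@le_trans _ _ (\sum_(m <- q) Cm * theta ^+ n)).
    rewrite big_seq [leRHS]big_seq; apply: ler_sum => m /times_range /andP[sm _].
    rewrite (le_trans (periodic_sum_word_sum theta01 f_lip D1 hD hE u n0 (leq_trans ns sm)))//.
    rewrite ler_wpM2r ?(ltW tn0)// -/sc gtr0_norm// /Cm -addrA.
    rewrite (@le_trans _ _ (sc * (1 + a0)))//; last by rewrite lerDl addr_ge0// ltW.
    by rewrite ler_wpM2l// lerD2l.
  rewrite big_const_seq count_predT iter_addr_0 size_times -[leLHS]mulr_natl natrM natrX.
  by rewrite (mulrC l%:R).
have -> : \sum_(m <- q) word_sum f Pf n u m = \sum_(w : {ffun 'I_n -> 'I_kappa})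
    (h (representative A w))%:C * timed_sum s l r k u
      (fun y => (word n y == w)%:R * ((h y)^-1)%:C) (representative A w).
  rewrite /word_sum exchange_big /=; apply: eq_bigr => w _.
  rewrite /timed_sum mulr_sumr; apply: eq_bigr => m _.
  rewrite -iter_transfer_conj; congr (iter m _ _ _).
  by apply/funext => y; rewrite mulrCA hV mulr1.
rewrite (le_trans (normc_sum _ _ _))//.
apply: (@le_trans _ _ (\sum_(w : {ffun 'I_n -> 'I_kappa})
    D * ((C1 / u) ^+ k * (l%:R * (C1 * (2 * (theta ^+ n)^-1 * Kh)))))).
  apply: ler_sum => w _; rewrite normcM normc_real gtr0_norm//.
  apply: ler_pM; rewrite ?normc_ge0 ?(ltW (h0 _))//; first by case/andP: (hD (representative A w)).
  have [Hb _] := H s l r k u _ _ ua (both_byM (word_indic_both A theta01 w) hK).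
  exact: Hb.
rewrite sumr_const card_ffun !card_ord -[leLHS]mulr_natl natrX.
have -> : (C1 / u) ^+ k = r%:R ^+ k * (C1 / (u * r%:R)) ^+ k.
  by rewrite -exprMn; congr (_ ^+ k); field; rewrite !gt_eqF.
have P1 : (C1 / (u * r%:R)) ^+ k <= (Cm / (u * r%:R)) ^+ k.
  have C1Cm : C1 <= Cm by rewrite lerDr addr_ge0.
  rewrite lerXn2r ?nnegrE ?divr_ge0 ?mulr_ge0 ?(ltW u0) ?(ltW rr0) ?(ltW C10) ?(le_trans (ltW C10))//.
  by rewrite ler_wpM2r// invr_ge0 mulr_ge0 ?(ltW u0) ?(ltW rr0).
have P2 : Cw <= Cm by rewrite /Cm addrAC lerDr addr_ge0// ltW.
have -> : kappa%:R ^+ n * (D * (r%:R ^+ k * (C1 / (u * r%:R)) ^+ k *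
    (l%:R * (C1 * (2 * (theta ^+ n)^-1 * Kh))))) =
   (r%:R ^+ k * l%:R) * ((kappa%:R / theta) ^+ n * Cw * (C1 / (u * r%:R)) ^+ k).
  by rewrite /Cw (expr_div_n (kappa%:R : R) theta n); set X := (C1 / _) ^+ k; ring.
rewrite ler_wpM2l ?mulr_ge0 ?(ltW rk0)//.
have X0 : 0 <= (kappa%:R / theta) ^+ n by rewrite exprn_ge0// divr_ge0// ltW.
have Y0 : 0 <= (C1 / (u * r%:R)) ^+ k.
  by rewrite exprn_ge0// divr_ge0 ?(ltW C10)// mulr_ge0 ?(ltW u0) ?(ltW rr0).
apply: ler_pM => //; first exact: mulr_ge0 X0 Cw0.
exact: ler_wpM2l.
Qed.

End MidFrequency.

(** * Counting *)

Section Asymptotics.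
Context (R : realType).
Implicit Types (c C e u x y : R).

Lemma exp_ge_pow y : 0 <= y -> y ^+ 2 * (1 + y) <= 56 * expR (y / 2).
Proof.
move=> y0; have y20 : 0 <= y / 2 by rewrite divr_ge0.
have H1 := expR_ge1Dxn 1 y20; have H2 := expR_ge1Dxn 2 y20.
have F2 : (2`!)%:R = 2 :> R by [].
have F3 : (3`!)%:R = 6 :> R by [].
rewrite F2 in H1; rewrite F3 in H2; move: H1 H2; rewrite !exprMn !exprVn.
have -> : 2 ^+ 2 = 4 :> R by rewrite -natrX.
have -> : 2 ^+ 3 = 8 :> R by rewrite -natrX.
rewrite (_ : y ^+ 2 * (1 + y) = y ^+ 2 + y ^+ 3); last by rewrite !exprS expr0; ring.
lra.
Qed.

Lemma powR_le_1D eps x : 0 < eps <= 1 -> 0 <= x -> x `^ eps <= 1 + x.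
Proof.
move=> /andP[e0 e1] x0; have [x1|x1] := leP x 1.
  rewrite (@le_trans _ _ (1 `^ eps))//.
    by rewrite ge0_ler_powR ?nnegrE// ltW.
  by rewrite powR1 lerDl.
rewrite (@le_trans _ _ (x `^ 1))//; last by rewrite powRr1// lerDr.
by rewrite ler_powR// ltW.
Qed.

(** Half of the exponential absorbs u ^ 2 u ^ eps. By homogeneity in e u this leaves e ^ (- 2 -
    eps), and integrating the other half later adds one more 1 / e. *)
Lemma high_term eps e u : 0 < eps <= 1 -> 0 < e -> 0 <= u ->
  expR (- (e * u)) * (u ^+ 2 * u `^ eps) <= 56 * (e ^- 2 * e `^ (- eps)) * expR (- (e / 2 * u)).
Proof.
move=> eps01 e0 u0; have eu0 : 0 <= e * u by rewrite mulr_ge0// ltW.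
have P : u `^ eps = e `^ (- eps) * (e * u) `^ eps.
  rewrite powRM ?(ltW e0)// mulrA -powRD; last by apply/implyP => _; rewrite gt_eqF.
  by rewrite addNr powRr0 mul1r.
have H := powR_le_1D eps01 eu0; have H2 := exp_ge_pow eu0.
have ee0 : 0 <= e `^ (- eps) by exact: powR_ge0.
have -> : u ^+ 2 = e ^- 2 * (e * u) ^+ 2.
  by rewrite exprMn mulrA mulVf ?mul1r// expf_eq0 gt_eqF.
rewrite P; have -> : expR (- (e * u)) * (e ^- 2 * (e * u) ^+ 2 * (e `^ (- eps) * (e * u) `^ eps)) =
  (e ^- 2 * e `^ (- eps)) * (expR (- (e * u)) * ((e * u) ^+ 2 * (e * u) `^ eps)) by ring.
have -> : 56 * (e ^- 2 * e `^ (- eps)) * expR (- (e / 2 * u)) =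
  (e ^- 2 * e `^ (- eps)) * (expR (- (e * u)) * (56 * expR (e * u / 2))).
  rewrite [X in _ = _ * X]mulrCA -expRD (_ : - (e * u) + e * u / 2 = - (e / 2 * u)); last by lra.
  by ring.
rewrite ler_wpM2l ?mulr_ge0 ?invr_ge0 ?exprn_ge0 ?(ltW e0)//.
rewrite ler_wpM2l ?expR_ge0// (le_trans _ H2)// ler_wpM2l// exprn_ge0//.
Qed.

Lemma near_le_linear C c : 0 < c -> \forall n \near \oo, C <= c * n%:R.
Proof.
move=> c0; exists (Num.truncn (`|C| / c)).+1 => // n /= Hn.
rewrite (le_trans (ler_norm C))// mulrC -ler_pdivrMr//.
by rewrite (le_trans (ltW (truncnS_gt _)))// ler_nat.
Qed.

Lemma near_exp_small C c e p : 0 < c -> 0 < e ->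
  \forall n \near \oo, C * n%:R ^+ p * expR (- (c * n%:R)) <= e.
Proof.
move=> c0 e0.
pose K := (`|C| * (p.+1)`!%:R / c ^+ p.+1).
have cp0 : 0 < c ^+ p.+1 by exact: exprn_gt0.
have K0 : 0 <= K by rewrite divr_ge0 ?mulr_ge0// ltW.
near=> n.
have n0 : 0 < n%:R :> R by near: n; exists 1%N => // n /=; rewrite ltr0n.
have cn : 0 <= c * n%:R by rewrite mulr_ge0// ltW.
have := expR_ge1Dxn p cn => H.
have fp : 0 < (p.+1)`!%:R :> R by rewrite ltr0n fact_gt0.
have H1 : (c * n%:R) ^+ p.+1 / (p.+1)`!%:R <= expR (c * n%:R).
  by rewrite (le_trans _ H)// lerDr.
have Kn : K <= e * n%:R by near: n; exact: near_le_linear.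
rewrite expRN ler_pdivrMr ?expR_gt0//.
apply: le_trans (ler_wpM2l (ltW e0) H1).
apply: (@le_trans _ _ (`|C| * n%:R ^+ p)).
  by rewrite ler_wpM2r ?exprn_ge0// ler_norm.
rewrite exprMn (exprS n%:R p).
have -> : e * (c ^+ p.+1 * (n%:R * n%:R ^+ p) / (p.+1)`!%:R) =
    e * n%:R * (c ^+ p.+1 / (p.+1)`!%:R) * n%:R ^+ p.
  by set cp := c ^+ p.+1; set N := n%:R ^+ p; ring.
rewrite ler_wpM2r ?exprn_ge0//.
apply: (@le_trans _ _ (K * (c ^+ p.+1 / (p.+1)`!%:R))).
  rewrite /K (_ : _ / _ * _ = `|C|)//; set cp := c ^+ p.+1 in cp0 *.
  by field; rewrite !gt_eqF.
by rewrite ler_wpM2r// divr_ge0// ltW.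
Unshelve. all: by end_near. Qed.

Lemma near_sqrt_small C e : 0 < e -> \forall n \near \oo, C / Num.sqrt n%:R <= e.
Proof.
move=> e0; near=> n.
have n0 : 0 < n%:R :> R by near: n; exists 1%N => // n /=; rewrite ltr0n.
rewrite ler_pdivrMr ?sqrtr_gt0// -ler_pdivrMl//.
rewrite (le_trans (ler_norm _))// -sqrtr_sqr ler_wsqrtr//.
near: n; have := @near_le_linear ((e^-1 * C) ^+ 2) 1 ltr01.
by apply: filterS => n; rewrite mul1r.
Unshelve. all: by end_near. Qed.

Lemma near_ln_small e C : 0 < e -> 0 < C ->
  \forall n \near \oo, ln (C * n%:R) / n%:R <= e.
Proof.
move=> e0 C0; near=> n.
have n0 : 0 < n%:R :> R by near: n; exists 1%N => // n /=; rewrite ltr0n.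
rewrite ler_pdivrMr// -[leRHS]expRK ler_ln ?posrE ?mulr_gt0 ?expR_gt0//.
have : C * n%:R ^+ 1 * expR (- (e * n%:R)) <= 1 by near: n; exact: near_exp_small.
by rewrite expRN expr1 ler_pdivrMr ?expR_gt0// mul1r.
Unshelve. all: by end_near. Qed.

End Asymptotics.

Section OrbitKernel.
Context (R : realType) (kappa : nat) (A : aperiodic_matrix kappa) (theta : R).
Context (theta01 : 0 < theta < 1).
Local Notation S := (shift_space A).
Implicit Types (x y z : S).

Let th0 : 0 < theta. Proof. by case/andP: theta01. Qed.
Let th1 : theta < 1. Proof. by case/andP: theta01. Qed.

Context (f : S -> R) (Pf : R).
Local Notation W := (orbit_weight f Pf).

Definition orbit_kernel (q : seq nat) (e Tb : R) : R :=
  \sum_(m <- q) \sum_(x <- periodic_points A m) W m x * poisson e (birkhoff f m x - Tb).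

Definition orbit_fourier (q : seq nat) (u : R) : R[i] :=
  \sum_(m <- q) periodic_sum f Pf u m.

(** Centring the kernel at Tb multiplies the whole Fourier sum by one factor of modulus 1, so the
    bound is uniform in Tb. *)
Lemma orbit_kernel_bound (q : seq nat) (Tb e1 e2 k A1 A2 A3 b1 b2 b3 : R) :
  (forall m, m \in q -> (0 < m)%N) ->
  0 < e1 -> 0 < e2 -> 0 <= A1 -> 0 <= A2 -> 0 <= A3 -> 0 < b1 -> 0 < b2 -> 0 < b3 ->
  (forall u, 0 <= u ->
    `|expR (- (e1 * u)) - k * expR (- (e2 * u))| * normc (orbit_fourier q u) <=
    A1 * expR (- (b1 * u)) + A2 * expR (- (b2 * u)) + A3 * expR (- (b3 * u))) ->
  `|orbit_kernel q e1 Tb - k * orbit_kernel q e2 Tb| <= A1 / b1 + A2 / b2 + A3 / b3.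
Proof.
move=> q0 e10 e20 A10 A20 A30 b10 b20 b30 H.
pose s := [seq (m, x) | m <- q, x <- periodic_points A m].
pose c (j : nat * S) := W j.1 j.2; pose y (j : nat * S) := birkhoff f j.1 j.2 - Tb.
have sE (G : nat * S -> R) : \sum_(j <- s) G j = \sum_(m <- q) \sum_(x <- periodic_points A m) G (m, x).
  by rewrite big_allpairs_dep.
have -> : orbit_kernel q e1 Tb - k * orbit_kernel q e2 Tb =
    \sum_(j <- s) c j * (poisson e1 (y j) - k * poisson e2 (y j)).
  rewrite sE /orbit_kernel mulr_sumr -sumrB; apply: eq_bigr => m _.
  by rewrite mulr_sumr -sumrB; apply: eq_bigr => x _; rewrite /c /y /=; ring.
apply: kernel_bound => // u u0; apply: le_trans (H u u0).
rewrite ler_wpM2l//.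
have -> : \sum_(j <- s) c j * cos (u * y j) = complex.Re (cis (- (u * Tb)) * orbit_fourier q u).
  rewrite sE /orbit_fourier mulr_sumr raddf_sum big_seq [RHS]big_seq; apply: eq_bigr => m mq.
  rewrite periodic_sumE ?q0// mulr_sumr raddf_sum; apply: eq_bigr => x _.
  rewrite mulrCA -cisD /c /y /= mul0r subr0; congr (_ * cos _); ring.
by rewrite (le_trans (Re_le_normc _))// normcM normc_cis mul1r.
Qed.

Context (eps a0 rho Zb Cm Ch : R).
Context (eps01 : 0 < eps <= 1) (rho01 : 0 < rho < 1) (a01 : 1 <= a0).
Context (Zb0 : 0 <= Zb) (Cm0 : 0 < Cm) (Ch0 : 0 < Ch).
Context (trivial_bound : forall u m, (0 < m)%N -> normc (periodic_sum f Pf u m) <= Zb).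
Context (mid_bound : forall s l r k n u, 0 < u <= a0 -> (0 < n)%N -> (n <= s)%N -> (0 < r)%N ->
  normc (\sum_(m <- times s l r k) periodic_sum f Pf u m) <=
  r%:R ^+ k * l%:R * (Cm * theta ^+ n + (kappa%:R / theta) ^+ n * Cm * (Cm / (u * r%:R)) ^+ k)).
Context (high_bound : forall u m, (2 <= m)%N -> a0 <= u ->
  normc (periodic_sum f Pf u m) <= Ch * m%:R * rho ^+ m * (u ^+ 2 * u `^ eps)).

Let a00 : 0 < a0. Proof. exact: lt_le_trans a01. Qed.

Section Fixed.
Context (s l r k : nat) (s2 : (2 <= s)%N) (r1 : (0 < r)%N).
Local Notation q := (times s l r k).

Let Rk : R := r%:R ^+ k.
Let Rk0 : 0 < Rk. Proof. by rewrite exprn_gt0// ltr0n. Qed.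

Lemma times_pos m : m \in q -> (0 < m)%N.
Proof. by move=> /times_range /andP[sm _]; exact: leq_trans (leq_trans (ltnW s2) sm). Qed.

Lemma sum_times_const (c : R) : \sum_(m <- q) c = Rk * l%:R * c.
Proof.
by rewrite big_const_seq count_predT iter_addr_0 size_times -[LHS]mulr_natl natrM natrX mulrC (mulrC l%:R) mulrC.
Qed.

Lemma fourier_trivial u : normc (orbit_fourier q u) <= Rk * l%:R * Zb.
Proof.
rewrite (le_trans (normc_sum _ _ _))// -sum_times_const.
by rewrite big_seq [leRHS]big_seq; apply: ler_sum => m /times_pos m0; exact: trivial_bound.
Qed.

Definition high_const := Ch * (s + l + k * r)%:R * rho ^+ s.

Lemma fourier_high u : a0 <= u ->
  normc (orbit_fourier q u) <= Rk * l%:R * high_const * (u ^+ 2 * u `^ eps).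
Proof.
move=> au; rewrite (le_trans (normc_sum _ _ _))// -mulrA -sum_times_const.
rewrite big_seq [leRHS]big_seq; apply: ler_sum => m /times_range /andP[sm ml].
have rho0 : 0 <= rho by case/andP: rho01 => /ltW.
have X0 : 0 <= u ^+ 2 * u `^ eps.
  by rewrite mulr_ge0 ?powR_ge0// exprn_ge0// (le_trans (ltW a00)).
rewrite (le_trans (high_bound (leq_trans s2 sm) au))// ler_wpM2r// /high_const.
rewrite ler_pM ?exprn_ge0 ?mulr_ge0 ?(ltW Ch0)//.
  by rewrite ler_wpM2l ?(ltW Ch0)// ler_nat ltnW.
by rewrite ler_wiXn2l//; case/andP: rho01 => _ /ltW.
Qed.

(** The constant of [fourier_high_exp], per averaged time, divided by its rate e / 2: hence 112 = 2
    * 56 and the third power of 1 / e. *)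
Definition high_total (e : R) := 112 * high_const * (e ^- 3 * e `^ (- eps)).

Lemma high_const_ge0 : 0 <= high_const.
Proof.
rewrite /high_const mulr_ge0// ?mulr_ge0// ?(ltW Ch0)// exprn_ge0//.
by case/andP: rho01 => /ltW.
Qed.

Lemma fourier_high_exp e u : 0 < e -> a0 <= u ->
  expR (- (e * u)) * normc (orbit_fourier q u) <=
  Rk * l%:R * high_const * (56 * (e ^- 2 * e `^ (- eps))) * expR (- (e / 2 * u)).
Proof.
move=> e0 au; have u0 : 0 <= u by rewrite (le_trans (ltW a00)).
have X0 : 0 <= Rk * l%:R * high_const.
  by rewrite mulr_ge0 ?high_const_ge0// mulr_ge0// ltW.
have H := ler_wpM2l (expR_ge0 (- (e * u))) (fourier_high au).
apply: (le_trans H); rewrite mulrCA -[leRHS]mulrA ler_wpM2l//.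
exact: high_term.
Qed.

Let high_int e : 0 < e -> high_const * (56 * (e ^- 2 * e `^ (- eps))) / (e / 2) = high_total e.
Proof. by move=> e0; rewrite /high_total; field; rewrite gt_eqF. Qed.

(** A bound on 0 <= v <= b is turned into an exponential bound of rate 1 / b, the form that
    [kernel_bound] takes. *)
Lemma expR1_ge1 (v b : R) : 0 < b -> v <= b -> 1 <= expR 1 * expR (- (b^-1 * v)).
Proof.
move=> b0 vb; rewrite -expRD -[leLHS]expR0 ler_expR subr_ge0.
by rewrite mulrC ler_pdivrMr// mul1r.
Qed.

(** Below a0 only the trivial bound is used. This costs a factor l, of order n later on, which is
    harmless for an upper bound. *)
Lemma orbit_kernel_le e Tb : 0 < e -> 
  orbit_kernel q e Tb <= Rk * l%:R * (expR 1 * a0 * Zb + high_total e).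
Proof.
move=> e0; have RkL : 0 <= Rk * l%:R by rewrite mulr_ge0// ltW.
have E : e ^- 2 * e `^ (- eps) >= 0 by rewrite mulr_ge0 ?powR_ge0// invr_ge0 exprn_ge0// ltW.
have A20 : 0 <= Rk * l%:R * Zb * expR 1 by rewrite mulr_ge0 ?expR_ge0// mulr_ge0.
have A30 : 0 <= Rk * l%:R * high_const * (56 * (e ^- 2 * e `^ (- eps))).
  by rewrite mulr_ge0 ?(mulr_ge0 RkL high_const_ge0)// mulr_ge0.
have ai : 0 < a0^-1 by rewrite invr_gt0.
have e2 : 0 < e / 2 by rewrite divr_gt0.
have := orbit_kernel_bound (q := q) Tb (k := 0) (A1 := 0) (b1 := 1) times_pos e0 ltr01 (lexx 0) A20 A30 ltr01 ai e2.
move=> H.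
have -> : Rk * l%:R * (expR 1 * a0 * Zb + high_total e) =
   0 / 1 + Rk * l%:R * Zb * expR 1 / a0^-1 +
   Rk * l%:R * high_const * (56 * (e ^- 2 * e `^ (- eps))) / (e / 2).
  by rewrite -(high_int e0) invrK; ring.
have -> : orbit_kernel q e Tb = orbit_kernel q e Tb - 0 * orbit_kernel q 1 Tb by ring.
apply: le_trans (ler_norm _) (H _).
move=> u u0; rewrite !mul0r subr0 add0r (ger0_norm (expR_ge0 _)).
have [ua|au] := leP u a0.
  apply: (@le_trans _ _ (Rk * l%:R * Zb * expR 1 * expR (- (a0^-1 * u)))); last first.
    by rewrite lerDl mulr_ge0// expR_ge0.
  rewrite -mulrA [leLHS]mulrC ler_pM ?normc_ge0 ?expR_ge0 ?fourier_trivial//.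
  rewrite (le_trans _ (expR1_ge1 a00 ua))//.
  by rewrite -[leRHS]expR0 ler_expR oppr_le0 mulr_ge0// ltW.
apply: le_trans (fourier_high_exp e0 (ltW au)) _.
by rewrite lerDr mulr_ge0// expR_ge0.
Qed.

Definition mid_const (n : nat) (u0 : R) :=
  Cm * theta ^+ n + (kappa%:R / theta) ^+ n * Cm * (Cm / (u0 * r%:R)) ^+ k.

Lemma mid_const_ge0 n u0 : 0 < u0 -> 0 <= mid_const n u0.
Proof.
move=> u00; rewrite /mid_const addr_ge0//.
  by rewrite mulr_ge0 ?(ltW Cm0)// exprn_ge0// ltW.
rewrite mulr_ge0 ?exprn_ge0 ?divr_ge0 ?mulr_ge0 ?(ltW Cm0) ?(ltW u00)//.
by rewrite exprn_ge0// divr_ge0// ltW.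
Qed.

(** One summand for each range of u. On [0, u0] the exponentials differ by at most u, which after
    integration gives [u0 ^+ 2]. *)
Lemma orbit_kernel_diff e Tb u0 n : 0 < e <= 1 -> 0 < u0 <= a0 -> (0 < n)%N -> (n <= s)%N ->
  `|orbit_kernel q e Tb - orbit_kernel q 1 Tb| <=
  Rk * l%:R * (expR 1 * (u0 ^+ 2 * Zb + a0 * mid_const n u0) + high_total e).
Proof.
move=> /andP[e0 e1] /andP[u00 u0a] n0 ns.
have RkL : 0 <= Rk * l%:R by rewrite mulr_ge0// ltW.
have E : e ^- 2 * e `^ (- eps) >= 0 by rewrite mulr_ge0 ?powR_ge0// invr_ge0 exprn_ge0// ltW.
have Mid0 := mid_const_ge0 n u00.
have RM : 0 <= Rk * l%:R * mid_const n u0 by rewrite mulr_ge0.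
have RZ : 0 <= Rk * l%:R * Zb by rewrite mulr_ge0.
have A10 : 0 <= u0 * (Rk * l%:R * Zb) * expR 1.
  by rewrite mulr_ge0 ?expR_ge0// mulr_ge0// ltW.
have A20 : 0 <= Rk * l%:R * mid_const n u0 * expR 1 by rewrite mulr_ge0 ?expR_ge0.
have A30 : 0 <= Rk * l%:R * high_const * (56 * (e ^- 2 * e `^ (- eps))).
  by rewrite mulr_ge0 ?(mulr_ge0 RkL high_const_ge0)// mulr_ge0.
have ai : 0 < a0^-1 by rewrite invr_gt0.
have ui : 0 < u0^-1 by rewrite invr_gt0.
have e2 : 0 < e / 2 by rewrite divr_gt0.
have := orbit_kernel_bound (q := q) Tb (k := 1) times_pos e0 ltr01 A10 A20 A30 ui ai e2.
rewrite mul1r => H.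
have -> : Rk * l%:R * (expR 1 * (u0 ^+ 2 * Zb + a0 * mid_const n u0) + high_total e) =
  u0 * (Rk * l%:R * Zb) * expR 1 / u0^-1 + Rk * l%:R * mid_const n u0 * expR 1 / a0^-1 +
   Rk * l%:R * high_const * (56 * (e ^- 2 * e `^ (- eps))) / (e / 2).
  by rewrite -(high_int e0) !invrK; ring.
apply: H => u u_ge0; rewrite !mul1r.
have d0 : 0 <= expR (- (e * u)) - expR (- u).
  by rewrite subr_ge0 ler_expR lerN2 ler_piMl.
have d1 : expR (- (e * u)) <= 1 by rewrite -[leRHS]expR0 ler_expR oppr_le0 mulr_ge0// ltW.
have eu0 := expR_ge0 (- u).
have N0 := normc_ge0 (orbit_fourier q u).
rewrite (ger0_norm d0).
set a1 := _ * expR (- (u0^-1 * u)); set a2 := _ * expR (- (a0^-1 * u)); set a3 := _ * expR (- (e / 2 * u)).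
have a10 : 0 <= a1 by rewrite mulr_ge0// expR_ge0.
have a20 : 0 <= a2 by rewrite mulr_ge0// expR_ge0.
have a30 : 0 <= a3 by rewrite mulr_ge0// expR_ge0.
have [uu|uu] := leP u u0.
  suff : (expR (- (e * u)) - expR (- u)) * normc (orbit_fourier q u) <= a1 by lra.
  have du : expR (- (e * u)) - expR (- u) <= u0.
    by have := expR_ge1Dx (- u); lra.
  have P1 := ler_pM d0 N0 du (fourier_trivial u).
  have P2 : 1 <= expR 1 * expR (- (u0^-1 * u)) by exact: expR1_ge1.
  apply: (le_trans P1); rewrite /a1 -[leRHS]mulrA.
  rewrite -[leLHS]mulr1; apply: ler_wpM2l => //.
  exact: mulr_ge0 (ltW u00) RZ.
have [ua|au] := leP u a0.
  suff : (expR (- (e * u)) - expR (- u)) * normc (orbit_fourier q u) <= a2 by lra.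
  have up : 0 < u <= a0 by rewrite ua andbT (lt_trans u00).
  have FM : normc (orbit_fourier q u) <= Rk * l%:R * mid_const n u0.
    apply: (le_trans (mid_bound l k up n0 ns r1)); rewrite -/Rk ler_wpM2l//.
    rewrite /mid_const lerD2l ler_wpM2l//.
      by rewrite mulr_ge0 ?(ltW Cm0)// exprn_ge0// divr_ge0// ltW.
    have rr : 0 < r%:R :> R by rewrite ltr0n.
    have u0r : 0 < u0 * r%:R by rewrite mulr_gt0.
    have ur : 0 < u * r%:R by rewrite mulr_gt0// (lt_trans u00).
    rewrite lerXn2r ?nnegrE ?divr_ge0 ?(ltW Cm0) ?(ltW u0r) ?(ltW ur)//.
    by rewrite ler_wpM2l ?(ltW Cm0)// lef_pV2 ?posrE// ler_wpM2r ?(ltW rr)// ltW.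
  rewrite /a2 -mulrA [leLHS]mulrC ler_pM//.
  by rewrite (le_trans _ (expR1_ge1 a00 ua))//; lra.
suff : (expR (- (e * u)) - expR (- u)) * normc (orbit_fourier q u) <= a3 by lra.
apply: le_trans (fourier_high_exp e0 (ltW au)).
by rewrite ler_wpM2r//; lra.
Qed.

End Fixed.

End OrbitKernel.

Lemma ler_sum_subset (R : realType) (I : eqType) (s1 s2 : seq I) (G : I -> R) :
  uniq s1 -> uniq s2 -> (forall i, 0 <= G i) ->
  (forall i, i \in s1 -> i \notin s2 -> G i = 0) ->
  \sum_(i <- s1) G i <= \sum_(i <- s2) G i.
Proof.
move=> u1 u2 G0 H.
have -> : \sum_(i <- s1) G i = \sum_(i <- s1 | i \in s2) G i.
  rewrite big_seq [RHS]big_mkcond [RHS]big_seq; apply: eq_bigr => i i1.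
  by case: ifPn => // i2; exact: H.
rewrite -big_filter (perm_big [seq i <- s2 | i \in s1]); last first.
  apply: uniq_perm; rewrite ?filter_uniq// => i.
  by rewrite !mem_filter andbC.
rewrite big_filter [leLHS]big_mkcond; apply: ler_sum => i _.
by case: ifP.
Qed.

Section KernelOne.
Context (R : realType) (kappa : nat) (A : aperiodic_matrix kappa) (theta : R).
Local Notation S := (shift_space A).
Context (f : S -> R) (Pf fm fM c0 C0 : R) (M : nat).
Local Notation W := (orbit_weight f Pf).
Context (fm0 : 0 < fm) (f_range : forall x, fm <= f x <= fM).
Context (renewal : forall T J, 0 < T -> T <= J%:R * fm ->
  c0 <= \sum_(1 <= j < J.+1)
    \sum_(x <- periodic_points A (j + M) | `|birkhoff f (j + M) x - T| <= C0) W (j + M) x).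

(** As f lies between fm and fM, an orbit with Birkhoff sum near T has a period of order T; the two
    inequalities place it on the plateau of the averaging. *)
Lemma close_times s l r k m (x : S) T B : (s + k * r)%:R * fM + B < T -> T + B < (s + l)%:R * fm ->
  `|birkhoff f m x - T| <= B -> (s + k * r <= m < s + l)%N.
Proof.
move=> H1 H2; rewrite ler_distlC => /andP[b1 b2].
have /andP[r1 r2] := birkhoff_range f_range m x.
have fM0 : 0 < fM by case/andP: (f_range point) => a b; exact: lt_le_trans (lt_le_trans fm0 a) b.
apply/andP; split; rewrite leqNgt; apply/negP => mm.
  have : m%:R * fM <= (s + k * r)%:R * fM by rewrite ler_wpM2r ?(ltW fM0)// ler_nat ltnW.
  lra.
have : (s + l)%:R * fm <= m%:R * fm by rewrite ler_wpM2r ?(ltW fm0)// ler_nat.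
lra.
Qed.

(** On the renewal window the kernel of scale 1 is at least 1 / (1 + C0 ^ 2), and all periods
    occurring there are on the plateau, hence counted r ^ k times. *)
Lemma kernel_one_lower s l r k T : 0 < T -> 
  (s + k * r)%:R * fM + C0 < T -> T + C0 < (s + l)%:R * fm ->
  r%:R ^+ k * (c0 / (1 + C0 ^+ 2)) <= orbit_kernel f Pf (times s l r k) 1 T.
Proof.
move=> T0 H1 H2.
have p0 m x : 0 <= W m x * poisson 1 (birkhoff f m x - T).
  by rewrite mulr_ge0 ?expR_ge0// ltW// poisson_ge0.
apply: le_trans (times_plateau s l r k _); last by move=> m; apply: sumr_ge0 => x _; exact: p0.
apply: ler_wpM2l; first by rewrite exprn_ge0.
pose b m := \sum_(x <- periodic_points A m | `|birkhoff f m x - T| <= C0) W m x.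
have b0 m : 0 <= b m by apply: sumr_ge0 => x _; exact: expR_ge0.
have D0 : 0 < 1 + C0 ^+ 2 by rewrite ltr_pwDl// sqr_ge0.
apply: (@le_trans _ _ (\sum_(s + k * r <= m < s + l) b m / (1 + C0 ^+ 2))); last first.
  apply: ler_sum => m _; rewrite /b mulr_suml [leLHS]big_mkcond.
  apply: ler_sum => x _; case: ifP => // bx.
  rewrite ler_wpM2l ?expR_ge0// /poisson expr1n mul1r lef_pV2 ?posrE//; last first.
    by rewrite ltr_pwDl// sqr_ge0.
  have C00 : 0 <= C0 by exact: le_trans bx.
  by rewrite lerD2l -(ger0_norm (sqr_ge0 (_ - T))) normrX lerXn2r ?nnegrE.
rewrite -mulr_suml ler_wpM2r ?invr_ge0 ?(ltW D0)//.
pose J := Num.truncn (T / fm).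
have TJ : T <= J.+1%:R * fm by rewrite -ler_pdivrMr// ltW// truncnS_gt.
apply: le_trans (renewal T0 TJ) _.
have := big_addn 1 (J.+2 + M) M xpredT b; rewrite addnK => <-.
apply: ler_sum_subset => //; rewrite ?iota_uniq// => m _; rewrite mem_index_iota => nm.
rewrite /b big1// => x bx; case/negP: nm; exact: close_times bx.
Qed.

End KernelOne.

Section Scales.
Context (R : realType).
Implicit Types (n : nat).

Definition scale (c : R) n := (Num.truncn (c * n%:R)).+1.

Lemma scale_bounds c n : 0 <= c -> c * n%:R < (scale c n)%:R <= c * n%:R + 1.
Proof.
move=> c0; rewrite truncnS_gt /= /scale -addn1 natrD lerD2r.
by rewrite truncn_le// mulr_ge0.
Qed.

(** The least exponent that reaches n ^ (- 2). The reverse bound keeps (kappa / theta) ^ j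
    polynomial in n. *)
Lemma min_power (theta : R) n : 0 < theta < 1 -> (0 < n)%N ->
  exists2 j, (0 < j)%N & theta ^+ j <= n%:R ^- 2 /\ theta * n%:R ^- 2 <= theta ^+ j.
Proof.
move=> th n0; have [th0 th1] := andP th.
have nV : 0 < n%:R ^- 2 :> R by rewrite invr_gt0 exprn_gt0// ltr0n.
have ex : exists j, theta ^+ j.+1 <= n%:R ^- 2.
  have th2 : 0 <= theta < 1 by rewrite (ltW th0).
  have [j Hj] := exprn_lt_eps th2 nV; exists j; apply: le_trans (ltW Hj).
  by rewrite exprS ler_piMl ?exprn_ge0 ?ltW.
case: (ex_minnP ex) => j Hj Hmin; exists j.+1 => //; split => //.
rewrite (exprS theta) ler_pM2l//; case: j Hj Hmin => [|j] Hj Hmin.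
  by rewrite expr0 invf_le1 ?exprn_gt0 ?ltr0n// -natrX ler1n expn_gt0 n0.
by rewrite leNgt; apply/negP => /ltW /Hmin; rewrite ltnn.
Qed.

End Scales.

Section KernelAsymptotics.
Context (R : realType) (kappa : nat) (A : aperiodic_matrix kappa) (theta : R).
Context (theta01 : 0 < theta < 1).
Local Notation S := (shift_space A).
Context (f : S -> R) (Pf fm fM c0 C0 : R) (M : nat).
Local Notation W := (orbit_weight f Pf).
Context (fm0 : 0 < fm) (f_range : forall x, fm <= f x <= fM) (c00 : 0 < c0).
Context (renewal : forall T J, 0 < T -> T <= J%:R * fm ->
  c0 <= \sum_(1 <= j < J.+1)
    \sum_(x <- periodic_points A (j + M) | `|birkhoff f (j + M) x - T| <= C0) W (j + M) x).
Context (eps a0 rho Zb Cm Ch : R).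
Context (eps01 : 0 < eps <= 1) (rho01 : 0 < rho < 1) (a01 : 1 <= a0).
Context (Zb0 : 0 <= Zb) (Cm0 : 0 < Cm) (Ch0 : 0 < Ch).
Context (trivial_bound : forall u m, (0 < m)%N -> normc (periodic_sum f Pf u m) <= Zb).
Context (mid_bound : forall s l r k n u, 0 < u <= a0 -> (0 < n)%N -> (n <= s)%N -> (0 < r)%N ->
  normc (\sum_(m <- times s l r k) periodic_sum f Pf u m) <=
  r%:R ^+ k * l%:R * (Cm * theta ^+ n + (kappa%:R / theta) ^+ n * Cm * (Cm / (u * r%:R)) ^+ k)).
Context (high_bound : forall u m, (2 <= m)%N -> a0 <= u ->
  normc (periodic_sum f Pf u m) <= Ch * m%:R * rho ^+ m * (u ^+ 2 * u `^ eps)).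
Context (sg g2 Cl : R) (sg0 : 0 < sg) (g20 : 0 < g2) (Cl0 : 0 < Cl).
Context (Q : nat) (thQ : kappa%:R / theta <= theta ^- Q).
Local Notation k := (4 * Q + 4)%N.
Local Notation s := (scale sg).
Local Notation r := (scale g2).
Local Notation l := (scale Cl).

Let th0 : 0 < theta. Proof. by case/andP: theta01. Qed.
Let a00 : 0 < a0. Proof. exact: lt_le_trans a01. Qed.

Lemma scale_le (c : R) n : 0 < c -> (0 < n)%N -> (scale c n)%:R <= (c + 1) * n%:R.
Proof.
move=> cp n0; have /andP[_ H] := scale_bounds n (ltW cp).
by rewrite (le_trans H)// mulrDl mul1r lerD2l ler1n.
Qed.

Lemma near_scale_ge (c : R) j : 0 < c -> \forall n \near \oo, (j <= scale c n)%N.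
Proof.
move=> cp; have := near_le_linear j%:R cp; apply: filterS => n H.
have /andP[b _] := scale_bounds n (ltW cp).
by rewrite -(ler_nat R) (le_trans H)// ltW.
Qed.

(** The decay exp(ln rho * sg * n), due to the lengths of the periods, beats the loss exp((3 + eps)
    * de * n) due to the small scale. *)
Lemma high_total_small de : (3 + eps) * de < - (ln rho * sg) ->
  exists2 c, 0 < c & exists K, forall n, (0 < n)%N ->
    high_total eps rho Ch (s n) (l n) (r n) k (expR (- (de * n%:R))) <= K * n%:R * expR (- (c * n%:R)).
Proof.
move=> Hde; exists (- (ln rho * sg) - (3 + eps) * de); first by rewrite subr_gt0.
exists (112 * (Ch * ((sg + 1) + (Cl + 1) + k%:R * (g2 + 1)))) => n n0.
have [r0 r1] := andP rho01.
have S1 : (s n + l n + k * r n)%:R <= ((sg + 1) + (Cl + 1) + k%:R * (g2 + 1)) * n%:R.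
  have E := ler_wpM2l (ler0n R k) (scale_le g20 n0).
  have := scale_le sg0 n0; have := scale_le Cl0 n0; move: E.
  rewrite natrD natrD natrM; move: (k%:R : R) => kk; lra.
have S2 : rho ^+ s n <= expR (ln rho * sg * n%:R).
  rewrite -{1}(lnK (x := rho)) ?posrE// -expRM_natl ler_expR -mulrA [leLHS]mulrC ler_wnM2l//.
    by rewrite ln_le0// ltW.
  by rewrite ltW//; case/andP: (scale_bounds n (ltW sg0)).
have S3 : expR (- (de * n%:R)) ^- 3 * expR (- (de * n%:R)) `^ (- eps) = expR ((3 + eps) * de * n%:R).
  rewrite -expRM -expRM_natl -expRN -expRD; congr expR; ring.
rewrite /high_total /high_const S3.
have -> : - ((- (ln rho * sg) - (3 + eps) * de) * n%:R) =
  ln rho * sg * n%:R + (3 + eps) * de * n%:R by ring.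
have P := ler_pM (ler0n R _) (exprn_ge0 (s n) (ltW r0)) S1 S2.
have C112 : 0 <= 112 * Ch by rewrite mulr_ge0// ltW.
have := ler_wpM2r (expR_ge0 ((3 + eps) * de * n%:R)) (ler_wpM2l C112 P).
rewrite expRD; move: (k%:R : R) ((_ + _ + _)%:R : R) => kk N.
by move=> H; apply: le_trans (le_trans _ H) _; rewrite le_eqVlt; apply/orP; left; apply/eqP; ring.
Qed.

Lemma kernel_upper de : (3 + eps) * de < - (ln rho * sg) ->
  exists2 C2, 0 < C2 & \forall n \near \oo, forall T,
    orbit_kernel f Pf (times (s n) (l n) (r n) k) (expR (- (de * n%:R))) T <= (r n)%:R ^+ k * (C2 * n%:R).
Proof.
move=> /high_total_small[c cp [K HK]].
have B0 : 0 <= expR 1 * a0 * Zb by rewrite mulr_ge0// mulr_ge0 ?expR_ge0// ltW.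
exists ((Cl + 1) * (expR 1 * a0 * Zb + 1)); first by apply: mulr_gt0; [exact: addr_gt0|exact: ltr_wpDl].
near=> n => T; have n0 : (0 < n)%N by near: n; exists 1%N.
have s2 : (2 <= s n)%N by near: n; exact: near_scale_ge.
have K1 : K * n%:R ^+ 1 * expR (- (c * n%:R)) <= 1 by near: n; exact: near_exp_small.
rewrite expr1 in K1.
have H := orbit_kernel_le eps01 rho01 a01 Zb0 Ch0 trivial_bound high_bound (s := s n) (l n) (r := r n) k s2 (ltn0Sn _) T (expR_gt0 (- (de * n%:R))).
apply: (le_trans H); rewrite -mulrA ler_wpM2l ?exprn_ge0// [leRHS]mulrAC.
have h0 := high_const_ge0 rho01 Ch0 (s n) (l n) (r n) k.
apply: ler_pM => //; last by rewrite lerD2l (le_trans (HK n n0)).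
  apply: addr_ge0 => //; rewrite /high_total; apply: mulr_ge0; first exact: mulr_ge0.
  by rewrite mulr_ge0 ?powR_ge0// invr_ge0 exprn_ge0// expR_ge0.
exact: scale_le.
Unshelve. all: by end_near. Qed.

(** This fixes k = 4 Q + 4. The factor (kappa / theta) ^ j is at most of order n ^ (2 Q); at the
    frequency eta / sqrt n one averaging gains the order n ^ (- 1/2), so k of them give n ^ (- 2 Q -
    2). *)
Lemma mid_const_small eta : 0 < eta -> exists K, forall n, (0 < n)%N ->
  exists2 j, (0 < j)%N & theta * n%:R ^- 2 <= theta ^+ j /\
    mid_const kappa theta Cm (r n) k j (eta / Num.sqrt n%:R) <= K * n%:R ^- 2.
Proof.
move=> eta0; pose X := Cm / (eta * g2).
exists (Cm + theta ^- Q * Cm * X ^+ k) => n n0.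
have [j j0 [j1 j2]] := min_power theta01 n0; exists j => //; split => //.
have nR : 0 < n%:R :> R by rewrite ltr0n.
have sq0 : 0 < Num.sqrt n%:R :> R by rewrite sqrtr_gt0.
have n2 : 0 < n%:R ^+ 2 :> R by rewrite exprn_gt0.
rewrite /mid_const mulrDl lerD//; first by rewrite ler_wpM2l// ltW.
have T1 : (kappa%:R / theta) ^+ j <= theta ^- Q * (n%:R ^+ 2) ^+ Q.
  apply: (@le_trans _ _ ((theta ^- Q) ^+ j)).
    by rewrite lerXn2r ?nnegrE ?divr_ge0 ?invr_ge0 ?exprn_ge0 ?(ltW th0).
  rewrite -exprVn exprAC -exprMn.
  have V0 : 0 < theta ^+ j by rewrite exprn_gt0.
  have V1 : theta^-1 ^+ j <= theta^-1 * n%:R ^+ 2.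
    rewrite exprVn -[X in _ <= _ * X]invrK -invfM lef_pV2 ?posrE ?mulr_gt0 ?invr_gt0//.
  rewrite lerXn2r// nnegrE.
    by rewrite exprn_ge0// invr_ge0 ltW.
  by rewrite mulr_ge0 ?invr_ge0 ?exprn_ge0 ?(ltW th0).
have T2 : (Cm / (eta / Num.sqrt n%:R * (r n)%:R)) ^+ k <= X ^+ k * ((n%:R ^+ 2) ^+ Q * n%:R ^+ 2)^-1.
  have -> : (n%:R ^+ 2) ^+ Q * n%:R ^+ 2 = Num.sqrt n%:R ^+ k :> R.
    have /esym := sqr_sqrtr (ltW nR); move: (Num.sqrt n%:R) => t ->.
    rewrite -(exprM t) -(exprM t) -exprD; congr (_ ^+ _); lia.
  rewrite -exprVn -exprMn.
  have rn : 0 < (r n)%:R :> R by rewrite ltr0n.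
  have d1 : 0 < eta / Num.sqrt n%:R * (r n)%:R by rewrite mulr_gt0// divr_gt0.
  rewrite lerXn2r ?nnegrE ?mulr_ge0 ?divr_ge0 ?invr_ge0 ?(ltW d1) ?(ltW Cm0) ?(ltW sq0) ?mulr_ge0 ?(ltW eta0) ?(ltW g20)//.
  rewrite /X -[leRHS]mulrA ler_wpM2l ?(ltW Cm0)// -invfM lef_pV2 ?posrE ?mulr_gt0 ?invr_gt0//.
  have /andP[rb _] := scale_bounds n (ltW g20).
  rewrite -[leRHS]mulrA -[leLHS]mulrA ler_wpM2l ?(ltW eta0)//.
  rewrite [leRHS]mulrC ler_pdivlMr// -mulrA -expr2 sqr_sqrtr ?(ltW nR)//.
  exact: ltW.
apply: (@le_trans _ _ ((theta ^- Q * (n%:R ^+ 2) ^+ Q) * Cm * (X ^+ k * ((n%:R ^+ 2) ^+ Q * n%:R ^+ 2)^-1))).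
  apply: ler_pM => //.
  - by rewrite mulr_ge0 ?exprn_ge0 ?divr_ge0 ?(ltW Cm0) ?(ltW th0).
  - by rewrite exprn_ge0// divr_ge0 ?mulr_ge0 ?divr_ge0 ?(ltW Cm0) ?(ltW eta0) ?(ltW sq0).
  by rewrite ler_wpM2r// ltW.
rewrite invfM le_eqVlt; apply/orP; left; apply/eqP.
have : (n%:R ^+ 2) ^+ Q != 0 :> R by rewrite expf_neq0// gt_eqF.
move: (theta ^- Q) (X ^+ k) ((n%:R ^+ 2) ^+ Q) (n%:R ^- 2 : R) => a1 a2 a3 a4 a30.
by field.
Qed.

(** The kernel at the small scale is compared with the kernel at scale 1, bounded below by renewal;
    the three ranges of frequency each take at most a quarter of that bound. *)
Lemma kernel_lower de alpha B0 : 0 < de -> (3 + eps) * de < - (ln rho * sg) -> 0 < alpha ->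
  (sg + k%:R * g2) * fM < alpha -> alpha < Cl * fm ->
  exists2 c2, 0 < c2 & \forall n \near \oo, forall T, `|T - n%:R * alpha| <= B0 ->
    (r n)%:R ^+ k * c2 <= orbit_kernel f Pf (times (s n) (l n) (r n) k) (expR (- (de * n%:R))) T.
Proof.
move=> de0 /high_total_small[c cp [K HK]] al0 al1 al2.
pose c1 := c0 / (1 + C0 ^+ 2).
have c10 : 0 < c1 by rewrite divr_gt0// ltr_pwDl// sqr_ge0.
have E1 : 0 < (Cl + 1) * expR 1 by rewrite mulr_gt0 ?addr_gt0 ?expR_gt0.
(* The low range contributes l u0 ^ 2 with l of order n and u0 = eta / sqrt n, which does not decay
   in n; only a small eta brings it below c1 / 4. *)
pose xi := c1 / (4 * ((Cl + 1) * expR 1) * (Zb + 1)).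
have xi0 : 0 < xi.
  by apply: divr_gt0 => //; apply: mulr_gt0; [exact: mulr_gt0|exact: ltr_wpDl].
pose eta := Num.min 1 xi.
have eta0 : 0 < eta by rewrite lt_min ltr01.
have [Km HKm] := mid_const_small eta0.
exists (c1 / 4); first by rewrite divr_gt0.
have fM0 : 0 < fM by case/andP: (f_range point) => a b; exact: lt_le_trans (lt_le_trans fm0 a) b.
near=> n => T; rewrite ler_distl => /andP[T1 T2]; have n0 : (0 < n)%N by near: n; exists 1%N.
have nR : 0 < n%:R :> R by rewrite ltr0n.
have s2 : (2 <= s n)%N by near: n; exact: near_scale_ge.
have [rS1 rS2] := andP (scale_bounds n (ltW g20)).
have [sS1 sS2] := andP (scale_bounds n (ltW sg0)).
have [lS1 lS2] := andP (scale_bounds n (ltW Cl0)).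
have T0 : 0 < T.
  apply: lt_le_trans T1.
  suff : B0 + 1 <= alpha * n%:R by rewrite mulrC; lra.
  by near: n; exact: near_le_linear.
have H1 : (s n + k * r n)%:R * fM + C0 < T.
  apply: lt_le_trans T1.
  have : B0 + C0 + (1 + k%:R) * fM + 1 <= (alpha - (sg + k%:R * g2) * fM) * n%:R.
    by near: n; apply: near_le_linear; rewrite subr_gt0.
  have X1 : (s n + k * r n)%:R * fM <= (sg * n%:R + 1 + k%:R * (g2 * n%:R + 1)) * fM.
    by rewrite ler_wpM2r ?(ltW fM0)// natrD natrM lerD// ler_wpM2l.
  move=> X2; apply: le_lt_trans (lerD X1 (lexx C0)) _.
  set kk := k%:R in X2 *; lra.
have H2 : T + C0 < (s n + l n)%:R * fm.
  apply: le_lt_trans (lerD T2 (lexx C0)) _.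
  have : B0 + C0 + 1 <= (Cl * fm - alpha) * n%:R.
    by near: n; apply: near_le_linear; rewrite subr_gt0.
  have X1 : Cl * n%:R * fm <= (s n + l n)%:R * fm.
    by rewrite ler_wpM2r ?(ltW fm0)// natrD; apply: le_trans (ltW lS1) _; rewrite lerDr.
  move=> X2; apply: lt_le_trans X1; lra.
have L1 := kernel_one_lower fm0 f_range renewal T0 H1 H2.
have [j j0 [j1 j2]] := HKm n n0.
(* j is of order ln n and s of order n, so words of length j fit into all the periods used. *)
have js : (j <= s n)%N.
  rewrite leqNgt; apply/negP => sj.
  have : (theta * n%:R ^- 2 <= expR (ln theta * (sg * n%:R))).
    apply: (le_trans j1); rewrite -{1}(lnK (x := theta)) ?posrE// -expRM_natl ler_expR mulrC.
    apply: ler_wnM2l; first by rewrite ln_le0// ltW//; case/andP: theta01.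
    by rewrite (le_trans (ltW sS1))// ler_nat ltnW.
  apply/negP; rewrite -ltNge; set Y := expR _.
  have : 2 / theta * n%:R ^+ 2 * expR (- (- (ln theta * sg) * n%:R)) <= 1.
    near: n; apply: near_exp_small => //.
    by rewrite oppr_gt0 nmulr_rlt0// ln_lt0// th0; case/andP: theta01.
  rewrite mulNr opprK -(mulrA (ln theta)) -/Y -mulrA => HY.
  rewrite ltr_pdivlMr ?exprn_gt0// mulrC.
  have : theta^-1 * (n%:R ^+ 2 * Y) <= 2^-1 by move: HY; rewrite -mulrA; lra.
  by rewrite ler_pdivrMl//; move: th0; lra.
have u0 : 0 < eta / Num.sqrt n%:R <= a0.
  rewrite divr_gt0 ?sqrtr_gt0//=.
  by near: n; exact: near_sqrt_small.
have ed : 0 < expR (- (de * n%:R)) <= 1.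
  by rewrite expR_gt0 -[leRHS]expR0 ler_expR oppr_le0 mulr_ge0// ltW.
have D := orbit_kernel_diff theta01 eps01 rho01 a01 Zb0 Cm0 Ch0 trivial_bound mid_bound high_bound
   (l n) (r := r n) k s2 (ltn0Sn _) T ed u0 j0 js.
have L2 : (l n)%:R * (expR 1 * ((eta / Num.sqrt n%:R) ^+ 2 * Zb + a0 * mid_const kappa theta Cm (r n) k j (eta / Num.sqrt n%:R)) + 
    high_total eps rho Ch (s n) (l n) (r n) k (expR (- (de * n%:R)))) <= 3 / 4 * c1.
  have lC := scale_le Cl0 n0.
  have M1 : (Cl + 1) * expR 1 * a0 * Km <= c1 / 4 * n%:R.
    by near: n; apply: near_le_linear; rewrite divr_gt0.
  have M2 : (Cl + 1) * K * n%:R ^+ 2 * expR (- (c * n%:R)) <= c1 / 4.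
    by near: n; apply: near_exp_small => //; rewrite divr_gt0.
  have M3 : eta ^+ 2 <= xi.
    rewrite (le_trans (_ : _ <= eta))// ?ge_min ?lexx ?orbT// expr2 ler_piMr ?(ltW eta0)//.
    by rewrite ge_min lexx.
  have M4 : (eta / Num.sqrt n%:R) ^+ 2 = eta ^+ 2 / n%:R.
    by rewrite exprMn exprVn sqr_sqrtr// ltW.
  rewrite M4; have hi := HK n n0; move: j2 hi M2.
  set mid := mid_const _ _ _ _ _ _ _; set hgh := high_total _ _ _ _ _ _ _ _; set ex := expR (- (c * _)).
  move=> j2 hi M2.
  have ln0 : 0 <= (l n)%:R :> R by [].
  have P1 : (l n)%:R * (expR 1 * (eta ^+ 2 / n%:R * Zb)) <= c1 / 4.
    apply: (@le_trans _ _ ((Cl + 1) * n%:R * (expR 1 * (xi / n%:R * Zb)))).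
      apply: ler_pM => //.
        by rewrite mulr_ge0 ?expR_ge0// mulr_ge0// divr_ge0// sqr_ge0.
      by rewrite ler_wpM2l ?expR_ge0// ler_wpM2r// ler_wpM2r// invr_ge0.
    have -> : (Cl + 1) * n%:R * (expR 1 * (xi / n%:R * Zb)) = (Cl + 1) * expR 1 * xi * Zb.
      by move: nR; set N := n%:R => nR; field; rewrite gt_eqF.
    have -> : c1 / 4 = (Cl + 1) * expR 1 * xi * (Zb + 1).
      rewrite /xi; move: E1; set E := expR 1 => E1.
      have Z1 : 0 < Zb + 1 by rewrite ltr_wpDl.
      by field; rewrite (gt_eqF Z1) (gt_eqF (expR_gt0 1)) gt_eqF// addr_gt0.
    by rewrite ler_wpM2l ?lerDl// mulr_ge0 ?(ltW E1) ?(ltW xi0).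
  have P2 : (l n)%:R * (expR 1 * (a0 * mid)) <= c1 / 4.
    apply: (@le_trans _ _ ((Cl + 1) * n%:R * (expR 1 * (a0 * (Km * n%:R ^- 2))))).
      apply: ler_pM => //.
        rewrite mulr_ge0 ?expR_ge0// mulr_ge0 ?(ltW a00)//.
        by apply: mid_const_ge0 => //; case/andP: u0.
      by rewrite ler_wpM2l ?expR_ge0// ler_wpM2l// ltW.
    move: M1; rewrite -ler_pdivrMr//; apply: le_trans.
    by rewrite le_eqVlt; apply/orP; left; apply/eqP; field; rewrite gt_eqF.
  have P3 : (l n)%:R * hgh <= c1 / 4.
    apply: le_trans (ler_wpM2l ln0 hi) _; apply: le_trans M2.
    have Kx : 0 <= K * n%:R * ex.
      apply: le_trans hi; rewrite /hgh /high_total; apply: mulr_ge0.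
        by apply: mulr_ge0 => //; exact: high_const_ge0 rho01 Ch0 _ _ _ _.
      by rewrite mulr_ge0 ?powR_ge0// invr_ge0 exprn_ge0// expR_ge0.
    apply: le_trans (ler_wpM2r Kx lC) _.
    by rewrite le_eqVlt; apply/orP; left; apply/eqP; ring.
  move: P1 P2 P3; lra.
move: D; rewrite ler_norml lerBrDr => /andP[D _].
apply: le_trans D; rewrite addrC lerBrDr; apply: le_trans L1.
rewrite -mulrA -mulrDr ler_wpM2l ?exprn_ge0// -/c1; move: L2; set hh := high_total _ _ _ _ _ _ _ _; lra.
Unshelve. all: by end_near. Qed.

End KernelAsymptotics.

(** * From kernel sums to the number of orbits *)

Section WindowCount.
Context (R : realType) (kappa : nat) (A : aperiodic_matrix kappa).
Local Notation S := (shift_space A).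
Local Notation sh := (@sft_shift kappa A).
Context (f : S -> R) (Pf fm fM : R).
Local Notation W := (orbit_weight f Pf).
Context (fm0 : 0 < fm) (f_range : forall x, fm <= f x <= fM).
Context (s l r k : nat) (T B : R).
Context (s1 : (0 < s)%N).
Context (HT1 : (s + k * r)%:R * fM + B < T) (HT2 : T + B < (s + l)%:R * fm).

Definition window_set : set S := [set x | exists m,
  [/\ (1 <= m)%N, iter m sh x = x & `|birkhoff f m x - T| <= B]].

Let listing := flatten [seq [seq x <- periodic_points A m | `|birkhoff f m x - T| <= B]
  | m <- index_iota (s + k * r) (s + l)].

Lemma mem_window x : window_set x -> x \in listing.
Proof.
move=> [m [m0 mx bx]]; apply/flattenP.
exists [seq x <- periodic_points A m | `|birkhoff f m x - T| <= B].
  apply/mapP; exists m => //; rewrite mem_index_iota.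
  exact: (close_times fm0 f_range HT1 HT2 bx).
by rewrite mem_filter bx mem_periodic_points//; apply/eqP.
Qed.

Lemma window_finite : finite_set window_set.
Proof.
apply: (@sub_finite_set _ _ [set` listing]); last exact: finite_seq.
by move=> x /mem_window.
Qed.

Definition window_card : nat := size (finmap.enum_fset (fset_set window_set)).

Let enumE x : (x \in finmap.enum_fset (fset_set window_set)) = (x \in window_set).
Proof. exact: in_fset_set window_finite x. Qed.

(** A point may occur under several of its periods, so the sum over periods bounds the number of
    points only from above; the reverse estimate uses one period at a time. *)
Lemma window_card_le :
  (window_card <= \sum_(s + k * r <= m < s + l)
    count (fun x => (`|birkhoff f m x - T| <= B)%R) (periodic_points A m))%N.
Proof.
have H : (window_card <= size listing)%N.
  apply: uniq_leq_size; first exact: finmap.fset_uniq.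
  by move=> x; rewrite enumE inE; exact: mem_window.
apply: leq_trans H _; rewrite /listing size_flatten /shape -map_comp sumnE big_map.
by apply: leq_sum => m _ /=; rewrite size_filter.
Qed.

Lemma window_card_ge m : (0 < m)%N ->
  (count (fun x => (`|birkhoff f m x - T| <= B)%R) (periodic_points A m) <= window_card)%N.
Proof.
move=> m0; rewrite -size_filter; apply: uniq_leq_size.
  by rewrite filter_uniq// finmap.fset_uniq.
move=> x; rewrite mem_filter mem_periodic_points// => /andP[bx /eqP mx].
by rewrite enumE inE; exists m.
Qed.

Let sum_count (q : seq S) (P : pred S) (c : R) :
  \sum_(x <- q | P x) c = (count P q)%:R * c.
Proof. by rewrite big_const_seq iter_addr_0 mulr_natl. Qed.

Context (e vr : R) (e0 : 0 < e) (vr0 : 0 < vr) (BE : B = vr * e).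

Let weight_window m x : `|birkhoff f m x - T| <= B ->
  expR (- Pf * T - `|Pf| * B) <= W m x <= expR (- Pf * T + `|Pf| * B).
Proof.
move=> bx; rewrite !ler_expR.
have E : - Pf * birkhoff f m x - - Pf * T = - Pf * (birkhoff f m x - T) by ring.
have H : `|- Pf * (birkhoff f m x - T)| <= `|Pf| * B.
  by rewrite normrM normrN ler_wpM2l.
move: H; rewrite -E ler_norml => /andP[h1 h2]; apply/andP; split; lra.
Qed.

(** In the window the kernel is at least 1 / (e (1 + vr ^ 2)), and all periods of the window lie on
    the plateau. *)
Lemma window_count_upper :
  r%:R ^+ k * (window_card%:R * (expR (- Pf * T - `|Pf| * B) / (e * (1 + vr ^+ 2)))) <=
  orbit_kernel f Pf (times s l r k) e T.
Proof.
have p0 m x : 0 <= W m x * poisson e (birkhoff f m x - T).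
  by rewrite mulr_ge0 ?expR_ge0// ltW// poisson_ge0.
apply: le_trans (times_plateau s l r k _); last by move=> m; apply: sumr_ge0 => x _; exact: p0.
apply: ler_wpM2l; first by rewrite exprn_ge0.
set c := _ / _; have c0 : 0 <= c.
  by rewrite divr_ge0 ?expR_ge0// mulr_ge0 ?(ltW e0)// addr_ge0// sqr_ge0.
apply: (@le_trans _ _ ((\sum_(s + k * r <= m < s + l)
    count (fun x => (`|birkhoff f m x - T| <= B)%R) (periodic_points A m))%:R * c)).
  by rewrite ler_wpM2r// ler_nat window_card_le.
rewrite natr_sum mulr_suml; apply: ler_sum => m _.
rewrite -sum_count [leLHS]big_mkcond; apply: ler_sum => x _.
case: ifP => // bx; have /andP[w1 _] := weight_window bx.
apply: ler_pM => //; rewrite ?expR_ge0//.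
  by rewrite invr_ge0 mulr_ge0 ?(ltW e0)// addr_ge0// sqr_ge0.
have y2 : (birkhoff f m x - T) ^+ 2 <= (vr * e) ^+ 2.
  by rewrite -(ger0_norm (sqr_ge0 (_ - T))) normrX lerXn2r ?nnegrE -?BE// (le_trans _ bx).
rewrite /poisson; set y := birkhoff f m x - T in y2 *.
have d0 : 0 < e ^+ 2 + y ^+ 2 by rewrite ltr_pwDl ?exprn_gt0// sqr_ge0.
have d1 : 0 < e * (1 + vr ^+ 2) by rewrite mulr_gt0// ltr_pwDl// sqr_ge0.
rewrite ler_pdivlMr// mulrC ler_pdivrMr//.
have -> : e * (e * (1 + vr ^+ 2)) = e ^+ 2 + (vr * e) ^+ 2 by ring.
by rewrite lerD2l.
Qed.

(** In the window the kernel at scale e' is at most 1 / e'. Off the window |y| > vr e, so that K_e'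
    <= (e' / e) (1 + vr ^ (- 2)) K_e, and the tail is charged to the scale e. *)
Lemma window_count_lower e' : 0 < e' -> 
  orbit_kernel f Pf (times s l r k) e' T <=
  r%:R ^+ k * (l%:R * (window_card%:R * (expR (- Pf * T + `|Pf| * B) / e'))) +
  e' / e * (1 + vr ^- 2) * orbit_kernel f Pf (times s l r k) e T.
Proof.
move=> e'0; set E := expR (_ + _).
have -> : r%:R ^+ k * (l%:R * (window_card%:R * (E / e'))) =
    \sum_(m <- times s l r k) window_card%:R * (E / e').
  by rewrite big_const_seq count_predT iter_addr_0 size_times -[RHS]mulr_natl natrM natrX mulrA (mulrC l%:R).
have Ee : 0 <= E / e' by rewrite divr_ge0 ?expR_ge0// ltW.
rewrite /orbit_kernel mulr_sumr -big_split big_seq [leRHS]big_seq.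
apply: ler_sum => m /times_range /andP[sm _].
have m0 : (0 < m)%N by exact: leq_trans s1 sm.
apply: (@le_trans _ _ ((count (fun x => (`|birkhoff f m x - T| <= B)%R) (periodic_points A m))%:R * (E / e') +
  e' / e * (1 + vr ^- 2) * \sum_(x <- periodic_points A m) W m x * poisson e (birkhoff f m x - T))); last first.
  by rewrite lerD2r ler_wpM2r// ler_nat window_card_ge.
rewrite -sum_count mulr_sumr [X in _ <= X + _]big_mkcond -big_split; apply: ler_sum => x _ /=.
have W0 : 0 <= W m x := expR_ge0 _.
have c0 : 0 <= e' / e * (1 + vr ^- 2).
  by rewrite mulr_ge0 ?divr_ge0 ?(ltW e0) ?(ltW e'0)// addr_ge0// invr_ge0 sqr_ge0.
have p0 : 0 <= poisson e (birkhoff f m x - T) by rewrite ltW// poisson_ge0.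
case: ifP => bx.
  apply: (@le_trans _ _ (E / e')); last first.
    by rewrite lerDl; apply: (mulr_ge0 c0); exact: mulr_ge0 W0 p0.
  have /andP[_ w2] := weight_window bx.
  apply: ler_pM => //; first by rewrite ltW// poisson_ge0.
  rewrite /poisson ler_pdivrMr; last by rewrite ltr_pwDl ?exprn_gt0// sqr_ge0.
  by rewrite mulrDr (expr2 e') mulrA mulVf ?gt_eqF// mul1r lerDl mulr_ge0 ?sqr_ge0// invr_ge0 ltW.
rewrite add0r [leRHS]mulrCA ler_wpM2l//.
have {bx} : B < `|birkhoff f m x - T| by rewrite ltNge bx.
rewrite /poisson; move: (birkhoff f m x - T) => y By.
have B0 : 0 < B by rewrite BE mulr_gt0.
have y2 : (vr * e) ^+ 2 <= y ^+ 2.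
  by rewrite -BE -(ger0_norm (sqr_ge0 y)) normrX lerXn2r ?nnegrE ?(ltW B0)// ltW.
have y0 : 0 < y ^+ 2 by apply: lt_le_trans y2; rewrite exprn_gt0// mulr_gt0.
have e2 : 0 < e ^+ 2 by rewrite exprn_gt0.
have d0 : 0 < e ^+ 2 + y ^+ 2 by rewrite ltr_wpDl// ltW.
apply: (@le_trans _ _ (e' / y ^+ 2)).
  by rewrite ler_wpM2l ?(ltW e'0)// lef_pV2 ?posrE// ?ltr_wpDl ?sqr_ge0// lerDr sqr_ge0.
have -> : e' / e * (1 + vr ^- 2) * (e / (e ^+ 2 + y ^+ 2)) = e' * ((1 + vr ^- 2) / (e ^+ 2 + y ^+ 2)).
  by field; rewrite !gt_eqF.
rewrite ler_wpM2l ?(ltW e'0)// ler_pdivlMr// mulrC ler_pdivrMr// mulrDl mul1r addrC lerD2l.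
by rewrite -ler_pdivrMl ?invr_gt0 ?exprn_gt0// invrK -exprMn.
Qed.

End WindowCount.

Section CountRate.
Context (R : realType) (kappa : nat) (A : aperiodic_matrix kappa).
Local Notation S := (shift_space A).
Context (f : S -> R) (Pf fm fM alpha z p q delta gmax : R).
Context (fm0 : 0 < fm) (f_range : forall x, fm <= f x <= fM).
Context (sg g2 Cl : R) (sg0 : 0 < sg) (g20 : 0 < g2) (Cl0 : 0 < Cl) (k : nat).
Context (al0 : 0 < alpha) (al1 : (sg + k%:R * g2) * fM < alpha) (al2 : alpha < Cl * fm).
Context (pq : p < q) (delta0 : 0 < delta).
Local Notation s := (scale sg).
Local Notation r := (scale g2).
Local Notation l := (scale Cl).
Context (C2 : R) (C20 : 0 < C2) (upper : \forall n \near \oo, forall T,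
  orbit_kernel f Pf (times (s n) (l n) (r n) k) (expR (- (delta * n%:R))) T <= (r n)%:R ^+ k * (C2 * n%:R)).
Context (gmax0 : 0 < gmax) (lower : forall gam B0, 0 < gam <= gmax -> exists2 c2, 0 < c2 &
  \forall n \near \oo, forall T, `|T - n%:R * alpha| <= B0 ->
    (r n)%:R ^+ k * c2 <= orbit_kernel f Pf (times (s n) (l n) (r n) k) (expR (- ((delta + gam) * n%:R))) T).

Let e n : R := expR (- (delta * n%:R)).
(** The window is described by its midpoint, at which the kernel is centred, and its half-width
    [B n]. *)
Let T n : R := z + n%:R * alpha + (p + q) / 2 * e n.
Let vr : R := (q - p) / 2.
Let B n : R := vr * e n.
Let vr0 : 0 < vr. Proof. by rewrite divr_gt0// subr_gt0. Qed.
Let B0 : R := `|z| + `|p + q| / 2.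

Local Notation card n := (window_card f (T n) (B n)).

Let e_gt0 n : 0 < e n. Proof. exact: expR_gt0. Qed.
Let e_le1 n : e n <= 1.
Proof. by rewrite -[leRHS]expR0 ler_expR oppr_le0 mulr_ge0// ltW. Qed.

Let T_near n : `|T n - n%:R * alpha| <= B0.
Proof.
have -> : T n - n%:R * alpha = z + (p + q) / 2 * e n by rewrite /T; ring.
rewrite (le_trans (ler_normD _ _))// lerD2l !normrM (gtr0_norm (e_gt0 n)).
by rewrite (ger0_norm (_ : 0 <= 2^-1 :> R))// ler_piMr// mulr_ge0// invr_ge0.
Qed.

Let B_le n : 0 <= B n <= vr.
Proof. by rewrite mulr_ge0 ?(ltW vr0) ?(ltW (e_gt0 _))//= ler_piMr ?(ltW vr0). Qed.

Lemma near_window_times : \forall n \near \oo,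
  [/\ (0 < s n)%N, (s n + k * r n)%:R * fM + B n < T n & T n + B n < (s n + l n)%:R * fm].
Proof.
have fM0 : 0 < fM by case/andP: (f_range point) => a b; exact: lt_le_trans (lt_le_trans fm0 a) b.
near=> n.
have [rS1 rS2] := andP (scale_bounds n (ltW g20)).
have [sS1 sS2] := andP (scale_bounds n (ltW sg0)).
have [lS1 lS2] := andP (scale_bounds n (ltW Cl0)).
have [b1 b2] := andP (B_le n).
have := T_near n; rewrite ler_norml => /andP[T1 T2]; split => //.
  have : B0 + vr + (1 + k%:R) * fM + 1 <= (alpha - (sg + k%:R * g2) * fM) * n%:R.
    by near: n; apply: near_le_linear; rewrite subr_gt0.
  have X1 : (s n + k * r n)%:R * fM <= (sg * n%:R + 1 + k%:R * (g2 * n%:R + 1)) * fM.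
    by rewrite ler_wpM2r ?(ltW fM0)// natrD natrM lerD// ler_wpM2l.
  move=> X2; apply: le_lt_trans (lerD X1 (lexx (B n))) _.
  set kk := k%:R in X2 *; lra.
have : B0 + vr + 1 <= (Cl * fm - alpha) * n%:R.
  by near: n; apply: near_le_linear; rewrite subr_gt0.
have X1 : Cl * n%:R * fm <= (s n + l n)%:R * fm.
  by rewrite ler_wpM2r ?(ltW fm0)// natrD; apply: le_trans (ltW lS1) _; rewrite lerDr.
move=> X2; apply: lt_le_trans X1; lra.
Unshelve. all: by end_near. Qed.

Let PfT n : `|- Pf * T n + Pf * alpha * n%:R| <= `|Pf| * B0.
Proof.
have -> : - Pf * T n + Pf * alpha * n%:R = - Pf * (T n - n%:R * alpha) by ring.
by rewrite normrM normrN ler_wpM2l.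
Qed.

Let PfB n : `|Pf| * B n <= `|Pf| * vr.
Proof. by rewrite ler_wpM2l//; case/andP: (B_le n). Qed.

Lemma card_upper : exists2 C, 0 < C & \forall n \near \oo,
  (card n)%:R <= C * n%:R * expR ((Pf * alpha - delta) * n%:R).
Proof.
pose E := expR (`|Pf| * B0 + `|Pf| * vr); pose D := 1 + vr ^+ 2.
have D0 : 0 < D by rewrite ltr_pwDl// sqr_ge0.
exists (C2 * D * E); first by rewrite mulr_gt0 ?expR_gt0// mulr_gt0.
near=> n; have [] : [/\ (0 < s n)%N, (s n + k * r n)%:R * fM + B n < T n & T n + B n < (s n + l n)%:R * fm].
  by near: n; exact: near_window_times.
move=> s1 H1 H2.
have U : forall T, orbit_kernel f Pf (times (s n) (l n) (r n) k) (expR (- (delta * n%:R))) T <= (r n)%:R ^+ k * (C2 * n%:R).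
  by near: n.
have := le_trans (window_count_upper Pf fm0 f_range H1 H2 (e_gt0 n) (vr := vr) erefl) (U (T n)).
rewrite ler_pM2l ?exprn_gt0 ?ltr0n// -/D => H.
have c0 : 0 < expR (- Pf * T n - `|Pf| * B n) / (e n * D) by rewrite divr_gt0 ?expR_gt0// mulr_gt0.
move: H; rewrite -ler_pdivlMr// => H; apply: (le_trans H).
rewrite invfM invrK -expRN.
have -> : C2 * D * E * n%:R * expR ((Pf * alpha - delta) * n%:R) =
  C2 * n%:R * (expR (Pf * alpha * n%:R + (`|Pf| * B0 + `|Pf| * vr)) * (e n * D)).
  rewrite /e expRD -/E mulrBl expRD; ring.
have P0 : 0 <= C2 * n%:R by rewrite mulr_ge0// ltW.
rewrite ler_wpM2l// ler_wpM2r ?mulr_ge0 ?(ltW (e_gt0 n)) ?(ltW D0)// ler_expR.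
have := PfT n; rewrite ler_norml => /andP[h1 h2]; have := PfB n; lra.
Unshelve. all: by end_near. Qed.

(** The tail carries exp(- gam n) against the upper bound C2 n at the scale e, so it falls below
    half of the lower bound at the smaller scale; the other half must come from the window. *)
Lemma card_lower gam : 0 < gam <= gmax -> exists2 c, 0 < c & \forall n \near \oo,
  c * expR ((Pf * alpha - delta - gam) * n%:R) <= (card n)%:R * n%:R.
Proof.
move=> gg; have [gam0 _] := andP gg; have [c2 c20 low] := lower B0 gg.
pose E := expR (`|Pf| * B0 + `|Pf| * vr).
have Cl1 : 0 < Cl + 1 by exact: addr_gt0.
exists (c2 / 2 / (Cl + 1) / E); first by rewrite !divr_gt0 ?expR_gt0.
near=> n; have [] : [/\ (0 < s n)%N, (s n + k * r n)%:R * fM + B n < T n & T n + B n < (s n + l n)%:R * fm].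
  by near: n; exact: near_window_times.
move=> s1 H1 H2; have n0 : (0 < n)%N by near: n; exists 1%N.
have nR : 0 < n%:R :> R by rewrite ltr0n.
have U : forall T, orbit_kernel f Pf (times (s n) (l n) (r n) k) (expR (- (delta * n%:R))) T <= (r n)%:R ^+ k * (C2 * n%:R).
  by near: n.
have L : forall T, `|T - n%:R * alpha| <= B0 ->
    (r n)%:R ^+ k * c2 <= orbit_kernel f Pf (times (s n) (l n) (r n) k) (expR (- ((delta + gam) * n%:R))) T.
  by near: n.
pose e' := expR (- ((delta + gam) * n%:R)).
have e'0 : 0 < e' := expR_gt0 _.
have Rk : 0 < (r n)%:R ^+ k :> R by rewrite exprn_gt0 ?ltr0n.
have := le_trans (L _ (T_near n)) (window_count_lower Pf fm0 f_range s1 H1 H2 (e_gt0 n) vr0 erefl e'0).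
have ee' : e' / e n = expR (- (gam * n%:R)).
  by rewrite /e' /e -expRN -expRD; congr expR; ring.
have S0 : 0 <= e' / e n * (1 + vr ^- 2).
  by rewrite mulr_ge0 ?divr_ge0 ?(ltW e'0) ?(ltW (e_gt0 n))// addr_ge0// invr_ge0 sqr_ge0.
have small : (1 + vr ^- 2) * C2 * n%:R ^+ 1 * expR (- (gam * n%:R)) <= c2 / 2.
  by near: n; apply: near_exp_small => //; rewrite divr_gt0.
move=> H; have := le_trans H (lerD (lexx _) (ler_wpM2l S0 (U (T n)))).
rewrite [e' / e n * _ * _]mulrCA -mulrDr ler_pM2l// ee'.
have -> : expR (- (gam * n%:R)) * (1 + vr ^- 2) * (C2 * n%:R) =
  (1 + vr ^- 2) * C2 * n%:R ^+ 1 * expR (- (gam * n%:R)) by rewrite expr1; ring.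
set G := _ * (_ * (_ / e')); move=> H3.
have {H3} : c2 / 2 <= G by lra.
rewrite /G => {}H.
have lC : (l n)%:R <= (Cl + 1) * n%:R by exact: scale_le.
have W1 : expR (- Pf * T n + `|Pf| * B n) / e' <= E * expR (- ((Pf * alpha - delta - gam) * n%:R)).
  rewrite /e' -expRN -!expRD ler_expR.
  have := PfT n; rewrite ler_norml => /andP[h1 h2]; have := PfB n; lra.
have W2 : c2 / 2 <= (Cl + 1) * n%:R * ((card n)%:R * (E * expR (- ((Pf * alpha - delta - gam) * n%:R)))).
  apply: (le_trans H); apply: ler_pM => //; last by rewrite ler_wpM2l.
  by rewrite mulr_ge0// divr_ge0 ?expR_ge0// ltW.
rewrite -ler_pdivlMr ?expR_gt0// -[X in _ <= _ * X]expRN.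
rewrite ler_pdivrMr ?expR_gt0// ler_pdivrMr//.
apply: (le_trans W2); rewrite le_eqVlt; apply/orP; left; apply/eqP; ring.
Unshelve. all: by end_near. Qed.

Lemma count_rate_cvg :
  count_rate f alpha z p q delta n @[n --> \oo] --> (Pf * alpha - delta)%:E.
Proof.
have [C C0 up] := card_upper.
have rateE : \forall n \near \oo, count_rate f alpha z p q delta n = (ln (card n)%:R / n%:R)%:E.
  have gmm : 0 < gmax <= gmax by rewrite gmax0 lexx.
  have [c c0 lo] := card_lower gmm.
  near=> n; have [] : [/\ (0 < s n)%N, (s n + k * r n)%:R * fM + B n < T n & T n + B n < (s n + l n)%:R * fm].
    by near: n; exact: near_window_times.
  move=> s1 H1 H2; have n0 : (0 < n)%N by near: n; exists 1%N.
  have nR : 0 < n%:R :> R by rewrite ltr0n.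
  have low : c * expR ((Pf * alpha - delta - gmax) * n%:R) <= (card n)%:R * n%:R.
    by near: n.
  have card0 : 0 < (card n)%:R :> R.
    rewrite -(pmulr_lgt0 _ nR); apply: lt_le_trans low.
    by rewrite mulr_gt0 ?expR_gt0.
  have fin := window_finite fm0 f_range H1 H2.
  rewrite /count_rate; have -> : orbit_count f alpha z p q (e n) n = (card n)%:R%:E.
    rewrite /orbit_count; have -> : [set xi : S | exists m : nat,
      [/\ (1 <= m)%N, iter m (@sft_shift _ A) xi = xi &
        z + n%:R * alpha + p * e n <= birkhoff f m xi
          <= z + n%:R * alpha + q * e n]] = window_set f (T n) (B n).
      apply/seteqP; split => x [m [m0 mx bx]]; exists m; split => //; move: bx; rewrite ler_distl /B /T /vr.
        move=> /andP[b1 b2]; apply/andP; split; lra.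
      move=> /andP[b1 b2]; apply/andP; split; lra.
    by rewrite /counting asboolT.
  by rewrite lne_EFin// -EFinM mulrC.
apply: (@cvg_trans _ ((ln (card n)%:R / n%:R)%:E @[n --> \oo])).
  by apply: near_eq_cvg; apply: filterS rateE => n ->.
apply: cvg_EFin; first by apply: nearW.
apply/cvgrPdist_le => xi xi0.
(* The loss gam in the exponent takes half of the tolerance xi; the other half is for the
   logarithmic terms. *)
pose gam := Num.min gmax (xi / 2).
have gg : 0 < gam <= gmax by rewrite lt_min gmax0 divr_gt0//= ge_min lexx.
have gx : gam <= xi / 2 by rewrite ge_min lexx orbT.
have [gam0 _] := andP gg.
have [c c0 lo] := card_lower gg.
near=> n; have n0 : (0 < n)%N by near: n; exists 1%N.
have nR : 0 < n%:R :> R by rewrite ltr0n.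
have low : c * expR ((Pf * alpha - delta - gam) * n%:R) <= (card n)%:R * n%:R by near: n.
have upp : (card n)%:R <= C * n%:R * expR ((Pf * alpha - delta) * n%:R) by near: n.
have card0 : 0 < (card n)%:R :> R.
  rewrite -(pmulr_lgt0 _ nR); apply: lt_le_trans low.
  by rewrite mulr_gt0 ?expR_gt0.
have s1 : ln (C * n%:R) / n%:R <= xi by near: n; exact: near_ln_small.
have s2 : ln (c^-1 * n%:R) / n%:R <= xi / 2.
  by near: n; apply: near_ln_small; rewrite ?divr_gt0// invr_gt0.
have up2 : ln (card n)%:R <= ln (C * n%:R) + (Pf * alpha - delta) * n%:R.
  rewrite -[X in _ + X]expRK -lnM ?posrE ?expR_gt0 ?mulr_gt0//.
  by rewrite ler_ln ?posrE ?mulr_gt0 ?expR_gt0.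
have lo2 : (Pf * alpha - delta - gam) * n%:R <= ln (card n)%:R + ln (c^-1 * n%:R).
  rewrite -[leLHS]expRK -lnM ?posrE ?mulr_gt0 ?invr_gt0// ler_ln ?posrE ?expR_gt0 ?mulr_gt0 ?invr_gt0//.
  by rewrite mulrCA -ler_pdivrMl ?invr_gt0// invrK.
rewrite /= ler_distlC; apply/andP; split.
  rewrite ler_pdivlMr//.
  move: s2; rewrite ler_pdivrMr// => s2.
  have : gam * n%:R <= xi / 2 * n%:R by rewrite ler_wpM2r.
  lra.
rewrite ler_pdivrMr//.
move: s1; rewrite ler_pdivrMr// => s1.
lra.
Unshelve. all: by end_near. Qed.

End CountRate.

(** * Gibbs measure *)

Section CylindricalSets.
Context (kappa : nat) (A : aperiodic_matrix kappa).
Local Notation S := (shift_space A).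
Implicit Types (x y : S) (B : set S).

Definition cylindrical n B := forall x y, word n x = word n y -> B x -> B y.

Definition clopen_cylinder B := exists n, cylindrical n B.

Lemma cylindricalW n m B : (n <= m)%N -> cylindrical n B -> cylindrical m B.
Proof. by move=> nm H x y E; apply: H; exact: word_eqW nm E. Qed.

Lemma cylinder0 : clopen_cylinder set0. Proof. by exists 0%N. Qed.

Lemma cylinderT : clopen_cylinder setT. Proof. by exists 0%N. Qed.

Lemma cylinderC B : clopen_cylinder B -> clopen_cylinder (~` B).
Proof. by move=> [n H]; exists n => x y E Bx By; apply: Bx; exact: H (esym E) By. Qed.

Lemma cylinderU B1 B2 : clopen_cylinder B1 -> clopen_cylinder B2 -> clopen_cylinder (B1 `|` B2).
Proof.
move=> [n1 H1] [n2 H2]; exists (maxn n1 n2) => x y E [Bx|Bx]; [left|right].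
  exact: cylindricalW (leq_maxl _ _) H1 _ _ E Bx.
exact: cylindricalW (leq_maxr _ _) H2 _ _ E Bx.
Qed.

Lemma cylinderI B1 B2 : clopen_cylinder B1 -> clopen_cylinder B2 -> clopen_cylinder (B1 `&` B2).
Proof.
move=> H1 H2; rewrite -[B1 `&` B2]setCK setCI; apply: cylinderC.
by apply: cylinderU; exact: cylinderC.
Qed.

Lemma cylinder_word n (w : {ffun 'I_n -> 'I_kappa}) : clopen_cylinder [set x | word n x = w].
Proof. by exists n => x y /= ->. Qed.

(** Compactness through an ultrafilter on the indices: a coordinate has finitely many possible
    values, so one of them is taken along the ultrafilter. *)
Lemma cluster_point (u : nat -> S) :
  exists x, forall n N, exists2 m, (N <= m)%N & word n (u m) = word n x.
Proof.
have [U [UU HU]] := @ultraFilterLemma nat \oo _.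
have FU : Filter U by exact: @filter_filter.
have ex j : exists a, U [set m | sval (u m) j = a].
  apply: contrapT => H.
  have F a : U (~` [set m | sval (u m) j = a]).
    by case: (@in_ultra_setVsetC _ U [set m | sval (u m) j = a] UU) => // Ha; case: H; exists a.
  have G : U (fun m => forall a, sval (u m) j <> a) by exact: filter_forall F.
  by have /filter_ex[m /(_ _ erefl)] := G.
have [y Hy] := choice ex.
have adm : admissible A y.
  move=> j; have := @filterI _ U FU _ _ (Hy j) (Hy j.+1).
  move=> /filter_ex[m [/= <- <-]].
  exact: (svalP (u m)).
exists (exist _ y adm) => n N.
have G : U (fun m => forall i : 'I_n, sval (u m) i = y i).
  by apply: filter_forall => i; exact: Hy.
have GN : U (fun m => (N <= m)%N) by apply: HU; exists N.
have := @filterI _ U FU _ _ G GN; move=> /filter_ex[m [/= Hm Nm]].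
by exists m => //; apply/wordP => i ni; exact: (Hm (Ordinal ni)).
Qed.

(** Otherwise choose for each N a point of B outside the first N sets. A cluster point lies in B,
    hence in some F i, and then so does a chosen point of index beyond i. *)
Lemma cylinder_compact B (F : (set S)^nat) : clopen_cylinder B -> (forall i, clopen_cylinder (F i)) ->
  B `<=` \bigcup_i F i -> exists N, B `<=` \bigcup_(i in `I_N) F i.
Proof.
move=> [n HB] HF BF; apply: contrapT => H.
have ex N : exists x, B x /\ forall i, (i < N)%N -> ~ F i x.
  apply: contrapT => HN; apply: H; exists N => x Bx; apply: contrapT => nF.
  by apply: HN; exists x; split => // i iN Fi; apply: nF; exists i.
have [u Hu] := choice ex.
have [x Hx] := cluster_point u.
have [m _ E] := Hx n 0%N.
have [i _ Fi] := BF x (HB _ _ E (Hu m).1).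
have [k Hk] := HF i; have [m' im' E'] := Hx k i.+1.
exact: (Hu m').2 i im' (Hk _ _ (esym E') Fi).
Qed.

(* A copy of the shift space whose measurable sets are the clopen cylinders:
   by compactness every finitely additive content on them is a premeasure. *)
Definition cylinder_space : Type := S.

End CylindricalSets.

HB.instance Definition _ kappa (A : aperiodic_matrix kappa) := Pointed.on (cylinder_space A).
HB.instance Definition _ kappa (A : aperiodic_matrix kappa) :=
  @isAlgebraOfSets.Build default_measure_display (cylinder_space A) (@clopen_cylinder kappa A)
    (cylinder0 A) (@cylinderU kappa A) (@cylinderC kappa A).

Section CylinderMeasure.
Context (R : realType) (kappa : nat) (A : aperiodic_matrix kappa) (theta : R).
Context (theta01 : 0 < theta < 1).
Local Notation S := (shift_space A).
Local Notation BS := (borel_shift A theta).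

Let th0 : 0 < theta. Proof. by case/andP: theta01. Qed.
Let th1 : theta < 1. Proof. by case/andP: theta01. Qed.

(** An open set is the countable union over n of the points whose n-cylinder it contains. *)
Lemma open_measurable_cylinders (U : set S) : d_theta_open theta U ->
  <<s (@clopen_cylinder kappa A) >> U.
Proof.
move=> oU.
have -> : U = \bigcup_n [set x | forall y, word n x = word n y -> U y].
  apply/seteqP; split => [x Ux|x [n _ H]]; last exact: H.
  have [e e0 He] := oU x Ux.
  have th : 0 <= theta < 1 by rewrite (ltW th0).
  have [n Hn] := exprn_lt_eps th e0; exists n => // y /wordP E.
  by apply: He; apply: le_lt_trans Hn; exact: d_agree.
apply: (@bigcupT_measurable _ (g_sigma_algebraType (@clopen_cylinder kappa A))) => n.
apply: sub_sigma_algebra; exists n => x y E H z Ez; apply: H; by rewrite E.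
Qed.

Lemma borel_cylinders (B : set S) : (measurable : set (set BS)) B -> <<s (@clopen_cylinder kappa A) >> B.
Proof.
apply: smallest_sub; first exact: smallest_sigma_algebra.
exact: open_measurable_cylinders.
Qed.

Lemma cylinder_open (B : set S) : clopen_cylinder B -> d_theta_open theta B.
Proof.
move=> [n H] x Bx; exists (theta ^+ n); first exact: exprn_gt0.
by move=> y xy; apply: H Bx; apply/wordP => i ni; apply: (d_lt_agree theta01 xy); exact: ltnW.
Qed.

Lemma cylinder_measurable (B : set S) : clopen_cylinder B -> (measurable : set (set BS)) B.
Proof. by move=> /cylinder_open oB; exact: sub_sigma_algebra. Qed.

Lemma exists_measure (gm : set S -> R) :
  (forall B, clopen_cylinder B -> 0 <= gm B) ->
  (forall B1 B2, clopen_cylinder B1 -> clopen_cylinder B2 -> B1 `&` B2 = set0 ->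
    gm (B1 `|` B2) = gm B1 + gm B2) -> gm setT = 1 ->
  exists nu : probability BS R, forall B, clopen_cylinder B -> nu B = (gm B)%:E.
Proof.
move=> gm_ge0 gmU gm1.
have gm0 : gm set0 = 0.
  have := gmU _ _ (cylinder0 A) (cylinder0 A); rewrite setI0 setU0 => /(_ erefl).
  by rewrite -[LHS]addr0 => /addrI.
pose mu0 (B : set (cylinder_space A)) : \bar R := (if `[< clopen_cylinder B >] then gm B else 0)%:E.
have mu0E B : clopen_cylinder B -> mu0 B = (gm B)%:E by rewrite /mu0 => H; rewrite asboolT.
have m0 : mu0 set0 = 0%E by rewrite -[RHS]/(0%:E) -gm0; exact: mu0E (cylinder0 A).
have m_ge0 B : (0 <= mu0 B)%E by rewrite /mu0 lee_fin; case: asboolP => // /gm_ge0.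
have clopen_bigcup (F : (set S)^nat) N : (forall i, clopen_cylinder (F i)) ->
    clopen_cylinder (\bigcup_(i in `I_N) F i).
  move=> HF; elim: N => [|N IH]; first by rewrite II0 bigcup_set0; exact: cylinder0.
  by rewrite IIS bigcup_setU bigcup_set1; exact: cylinderU.
have sumE (F : (set S)^nat) N : (forall i, clopen_cylinder (F i)) -> trivIset setT F ->
    \sum_(0 <= i < N) mu0 (F i) = (gm (\bigcup_(i in `I_N) F i))%:E.
  move=> HF tF; elim: N => [|N IH]; first by rewrite big_geq// II0 bigcup_set0 gm0.
  have dis : (\bigcup_(i in `I_N) F i) `&` F N = set0.
    apply/seteqP; split => // x [[i /= iN Fi] FN].
    have E := (trivIsetP.1 tF) i N I I (negbT (ltn_eqF iN)).
    by have : (F i `&` F N) x by []; rewrite E.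
  rewrite big_nat_recr//= IH (mu0E _ (HF N)) IIS bigcup_setU bigcup_set1.
  by rewrite (gmU _ _ (clopen_bigcup F N HF) (HF N) dis) EFinD.
(* By compactness a disjoint union that is itself a cylinder is exhausted by finitely many of its
   terms, so countable additivity is finite additivity. *)
have m_add : semi_sigma_additive mu0.
  move=> F HF tF HU; have [N HN] := cylinder_compact HU HF (fun x => id).
  apply: cvg_near_cst; exists N => // n /= Nn.
  rewrite sumE// mu0E//; congr (gm _)%:E; apply/seteqP; split => x.
    by move=> [i _ Fi]; exists i.
  by move=> /HN [i iN Fi]; exists i => //=; exact: leq_trans iN Nn.
pose mu : {measure set (cylinder_space A) -> \bar R} :=
  HB.pack mu0 (isMeasure.Build _ _ _ mu0 m0 m_ge0 m_add).
pose nu0 : {measure set (g_sigma_algebraType (@measurable _ (cylinder_space A))) -> \bar R} := measure_extension mu.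
have nu0E B : clopen_cylinder B -> nu0 B = (gm B)%:E.
  by move=> HB; transitivity (mu B); [exact: measurable_mu_extE|exact: mu0E].
(* The extension lives on the sigma-algebra generated by the cylinders; the Borel sets belong to
   it. *)
pose nu1 (B : set BS) : \bar R := nu0 B.
have n0 : nu1 set0 = 0%E by exact: measure0.
have n_ge0 B : (0 <= nu1 B)%E by exact: measure_ge0.
have n_add : semi_sigma_additive nu1.
  move=> F HF tF HU; apply: (measure_semi_sigma_additive (s := nu0)) => //.
    by move=> i; exact: borel_cylinders.
  exact: borel_cylinders.
have n1 : nu1 setT = 1%E by rewrite /nu1 nu0E ?gm1//; exact: cylinderT.
pose M := isMeasure.Build _ _ _ nu1 n0 n_ge0 n_add.
pose nu2 : {measure set BS -> \bar R} := HB.pack nu1 M.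
pose nu : probability BS R := HB.pack nu1 nu2 (Measure_isProbability.Build _ _ _ nu2 n1).
by exists nu => B /nu0E.
Qed.

End CylinderMeasure.

Section GibbsMeasure.
Context (R : realType) (kappa : nat) (A : aperiodic_matrix kappa) (theta : R).
Context (theta01 : 0 < theta < 1).
Local Notation S := (shift_space A).
Local Notation sh := (@sft_shift kappa A).
Local Notation d := (@d_theta R kappa A theta).
Local Notation BS := (borel_shift A theta).
Implicit Types (x y z : S).

Let th0 : 0 < theta. Proof. by case/andP: theta01. Qed.
Let th1 : theta < 1. Proof. by case/andP: theta01. Qed.

Lemma shift_cylinder (B : set S) : clopen_cylinder B -> clopen_cylinder (sh @^-1` B).
Proof.
move=> [n H]; exists n.+1 => x y /wordP E; apply: H; apply/wordP => i ni.
exact: E.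
Qed.

Lemma measurable_shift : measurable_fun [set: BS] (sh : BS -> BS).
Proof.
apply: (@measurability _ _ BS BS setT (sh : BS -> BS) (@d_theta_open R kappa A theta)) => //.
move=> _ [B oB <-]; rewrite setTI; apply: sub_sigma_algebra => x Bx.
have [e e0 He] := oB _ Bx; exists (theta * e); first by rewrite mulr_gt0.
move=> y xy; apply: He.
have H : d (sh x) (sh y) <= d x y / theta by have := d_iter theta01 1 x y; rewrite expr1.
by apply: le_lt_trans H _; rewrite ltr_pdivrMr// mulrC.
Qed.

(** Cylinders are stable under intersection and generate the Borel sets, so two finite measures that
    agree on them coincide. *)
Lemma invariant_cylinder (nu : probability BS R) :
  (forall B, clopen_cylinder B -> nu (sh @^-1` B) = nu B) -> shift_invariant nu.
Proof.
move=> H B mB.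
pose nu' (X : set BS) : \bar R := nu (sh @^-1` X).
have mpre (X : set BS) : measurable X -> measurable (sh @^-1` X : set BS).
  by move=> mX; rewrite -[_ @^-1` _]setTI; exact: measurable_shift.
have n0 : nu' set0 = 0%E by rewrite /nu' preimage_set0 measure0.
have n_ge0 X : (0 <= nu' X)%E by rewrite /nu' measure_ge0.
have n_add : semi_sigma_additive nu'.
  move=> X mX tX mUX; rewrite /nu' preimage_bigcup.
  apply: measure_semi_sigma_additive.
  - by move=> n; exact: mpre.
  - apply/trivIsetP => /= i j _ _ ij; rewrite -preimage_setI.
    by move/trivIsetP : tX => /(_ _ _ _ _ ij) ->//; rewrite preimage_set0.
  - by rewrite -preimage_bigcup; exact: mpre.
pose nu1 : {measure set BS -> \bar R} := HB.pack nu' (isMeasure.Build _ _ _ nu' n0 n_ge0 n_add).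
pose nu2 : {measure set BS -> \bar R} := nu.
suff : nu1 B = nu2 B by [].
have mE : (measurable : set (set BS)) = <<s (@clopen_cylinder kappa A) >>.
  apply/seteqP; split => X; first exact: borel_cylinders.
  apply: smallest_sub; first exact: smallest_sigma_algebra.
  by move=> Y cY; exact: cylinder_measurable theta01 _ cY.
have cI : setI_closed (@clopen_cylinder kappa A) by move=> X Y cX cY; exact: (cylinderI cX cY).
have cT (k : nat) : clopen_cylinder (setT : set S) by exact: cylinderT.
have cv : \bigcup_(k : nat) (setT : set S) = setT by rewrite bigcup_const//; exists 0%N.
have eq X : clopen_cylinder X -> nu1 X = nu2 X by exact: H.
have fin (k : nat) : (nu1 (setT : set S) < +oo)%E.
  have -> : nu1 setT = nu setT by [].
  by rewrite probability_setT ltry.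
exact: (@measure_unique _ _ BS _ (fun=> setT) mE cI cT cv nu1 nu2 eq fin B mB).
Qed.

Definition indic_of (B : set S) x : R[i] := (x \in B)%:R.

Lemma indic_lip n B : cylindrical n B -> lip_by theta (indic_of B) (theta ^+ n)^-1.
Proof.
move=> H x y; have tn0 : 0 < theta ^+ n by exact: exprn_gt0.
have [dxy|dxy] := ltP (d x y) (theta ^+ n).
  have E : word n x = word n y by apply/wordP => i ni; apply: (d_lt_agree theta01 dxy); exact: ltnW.
  have xy : (x \in B) = (y \in B).
    by apply/idP/idP; rewrite !inE; apply: H.
  by rewrite /indic_of xy subrr ComplexField.Normc.normc0 mulr_ge0 ?d_ge0// invr_ge0 ltW.
apply: (@le_trans _ _ 1); last by rewrite mulrC ler_pdivlMr// mul1r.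
by rewrite /indic_of; case: (x \in B); case: (y \in B);
  rewrite ?subrr ?subr0 ?sub0r ?normcN ?ComplexField.Normc.normc0 ?ComplexField.Normc.normc1.
Qed.

Lemma cylinder_lip B : clopen_cylinder B -> exists l, lip_by theta (indic_of B) l.
Proof. by move=> [n /indic_lip H]; exists (theta ^+ n)^-1. Qed.

Section Mean.
Context (g : S -> R) (gamma C : R).
Context (gamma0 : 0 < gamma) (C0 : 0 <= C) (mg : markov_weight theta gamma C g).
Local Notation P := (ctransfer g).
Context (m : (S -> R[i]) -> R[i]) (K r : R) (r01 : 0 < r < 1).
Context (m_gap : forall v l n, lip_by theta v l ->
   (forall x, normc (iter n P v x - m v) <= K * r ^+ n * l) /\
   lip_by theta (iter n P v) (K * r ^+ n * l)).

Definition mean_of (B : set S) : R := complex.Re (m (indic_of B)).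

Lemma mean_of_ge0 B : clopen_cylinder B -> 0 <= mean_of B.
Proof.
move=> /cylinder_lip[l Bl]; rewrite /mean_of; apply: (mean_Re_ge gamma0 mg r01 m_gap Bl) => y.
by rewrite /indic_of; case: (y \in B).
Qed.

Lemma mean_ofU B1 B2 : clopen_cylinder B1 -> clopen_cylinder B2 -> B1 `&` B2 = set0 ->
  mean_of (B1 `|` B2) = mean_of B1 + mean_of B2.
Proof.
move=> /cylinder_lip[l1 H1] /cylinder_lip[l2 H2] dis; rewrite /mean_of -raddfD.
rewrite -(meanD r01 m_gap H1 H2); congr (complex.Re (m _)); apply/funext => x.
rewrite /indic_of in_setU; have : ~ (B1 `&` B2) x by rewrite dis.
case: (boolP (x \in B1)) => [/set_mem b1|_]; case: (boolP (x \in B2)) => [/set_mem b2|_] //= H.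
- by case: H.
- by rewrite addr0.
- by rewrite add0r.
- by rewrite addr0.
Qed.

Lemma mean_ofT : mean_of setT = 1.
Proof.
rewrite /mean_of (_ : indic_of setT = fun=> 1) ?(mean_cst mg r01 m_gap)//.
by apply/funext => x; rewrite /indic_of in_setT.
Qed.

(** The weights over a fibre sum to 1, so P maps the indicator of the preimage of B to that of B;
    invariance of the functional under P becomes invariance of the measure under the shift. *)
Lemma mean_of_shift B : clopen_cylinder B -> mean_of (sh @^-1` B) = mean_of B.
Proof.
move=> cB; have [l Bl] := cylinder_lip (shift_cylinder cB).
rewrite /mean_of -(mean_transfer theta01 gamma0 C0 mg r01 m_gap Bl); congr (complex.Re (m _)).
apply/funext => x; rewrite /ctransfer /transfer.
have [g1 _ _] := mg.
transitivity (\sum_(a | precedes a x) (g (scons a x))%:C * indic_of B x).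
  apply: eq_bigr => a ax; congr (_ * _); rewrite /indic_of; congr (_%:R); congr nat_of_bool.
  by apply/idP/idP; rewrite !inE /preimage /= shift_scons.
by rewrite -mulr_suml -raddf_sum g1 mul1r.
Qed.

Lemma mean_iter n v l : lip_by theta v l -> m (iter n P v) = m v.
Proof.
move=> vl; elim: n => [//|n IH]; rewrite iterS.
by rewrite (mean_transfer theta01 gamma0 C0 mg r01 m_gap (iter_ctransfer_lip theta01 gamma0 C0 mg n vl)).
Qed.

Lemma mean_of_ge n B a : clopen_cylinder B ->
  (forall x, a <= complex.Re (iter n P (indic_of B) x)) -> a <= mean_of B.
Proof.
move=> /cylinder_lip[l Bl] H; rewrite /mean_of -(mean_iter n Bl).
have Pl := iter_ctransfer_lip theta01 gamma0 C0 mg n Bl.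
by apply: (mean_Re_ge gamma0 mg r01 m_gap Pl) => y; exact: H.
Qed.

Lemma mean_of_le n B b : clopen_cylinder B ->
  (forall x, complex.Re (iter n P (indic_of B) x) <= b) -> mean_of B <= b.
Proof.
move=> /cylinder_lip[l Bl] H; rewrite /mean_of -(mean_iter n Bl).
have Pl := iter_ctransfer_lip theta01 gamma0 C0 mg n Bl.
rewrite -lerN2 -raddfN -(meanN r01 m_gap Pl).
apply: (mean_Re_ge gamma0 mg r01 m_gap (v := fun x => - _) (l := l + lip_gain kappa C / (1 - theta) * l)).
  by move=> x y; rewrite -opprD normcN; exact: Pl.
by move=> y; rewrite raddfN lerN2; exact: H.
Qed.

Lemma iter_indic n B x : complex.Re (iter n P (indic_of B) x) =
  \sum_(y <- preimages n x | y \in B) cocycle g n y.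
Proof.
rewrite /ctransfer iter_transfer raddf_sum [RHS]big_mkcond; apply: eq_bigr => y _.
have -> : cocycle (fun y => (g y)%:C) n y = (cocycle g n y)%:C.
  by rewrite /cocycle rmorph_prod.
by rewrite /indic_of; case: (y \in B); rewrite ?mulr1 ?mulr0.
Qed.

End Mean.

Context (F : S -> R) (LF BF : R).
Context (F_lip : forall x y, `|F x - F y| <= LF * d x y) (F_bound : forall x, `|F x| <= BF).
Context (lam : R) (h : S -> R) (D : R) (lam0 : 0 < lam) (D1 : 1 <= D).
Context (hD : forall x, D^-1 <= h x <= D) (h_log : log_lip theta (theta * LF / (1 - theta)) h).
Context (hE : forall x, transfer (fun y => expR (F y)) h x = lam * h x).
Local Notation g := (normalized F h (fun x => lam * h x)).

Let D0 : 0 < D. Proof. exact: lt_le_trans ltr01 D1. Qed.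

Let h0 x : 0 < h x.
Proof. by case/andP: (hD x) => + _; apply: lt_le_trans; rewrite invr_gt0. Qed.

Let LF0 : 0 <= LF.
Proof.
apply: (@lip_by_ge0 _ _ A _ theta01 (fun x => (F x)%:C)) => x y.
by rewrite -raddfB normc_real.
Qed.

Lemma cocycle_normalized n y :
  cocycle g n y = expR (birkhoff F n y) * h y / (lam ^+ n * h (iter n sh y)).
Proof.
elim: n y => [|n IH] y.
  by rewrite /cocycle big_ord0 birkhoff0 expR0 expr0 !mul1r divff// gt_eqF.
rewrite cocycleS IH birkhoffS expRD exprS -iterSr /normalized.
have hn := h0 (iter n.+1 sh y); have hs := h0 (sh y).
have ln : 0 < lam ^+ n by exact: exprn_gt0.
field; by rewrite !gt_eqF.
Qed.

Lemma gibbs_markov : exists gamma C, [/\ 0 < gamma, 0 <= C & markov_weight theta gamma C g].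
Proof.
have E0 : 0 < lam * D ^+ 2 by rewrite mulr_gt0// exprn_gt0.
have lh0 x : 0 < lam * h x by rewrite mulr_gt0.
have lh : log_lip theta (theta * LF / (1 - theta)) (fun x => lam * h x).
  by move=> x y xy; rewrite mulrCA ler_wpM2l ?(ltW lam0)//; exact: h_log.
have hh y : lam * h (sh y) <= lam * D ^+ 2 * h y.
  rewrite -mulrA ler_wpM2l ?(ltW lam0)//.
  have /andP[_ a] := hD (sh y); have /andP[b _] := hD y.
  apply: (le_trans a); rewrite expr2 -mulrA ler_peMr ?(ltW D0)//.
  by rewrite -ler_pdivrMl// mulr1.
have := normalized_markov theta01 F_lip F_bound h0 lh0 hE h_log lh E0 hh.
set gam := _ / _; set CC := _ + _ => H; exists gam, CC; split => //.
  by rewrite divr_gt0// expR_gt0.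
have B1 : 0 <= theta * LF / (1 - theta) by rewrite divr_ge0 ?mulr_ge0 ?subr_ge0 ?(ltW th0) ?(ltW th1).
rewrite addr_ge0 ?invr_ge0 ?(ltW th0)// mulr_ge0 ?expR_ge0//.
by rewrite !addr_ge0// divr_ge0// ltW.
Qed.

(** The mass of a cylinder is the mean of an iterate of its indicator, a cocycle sum over the
    preimages lying in it. At most one preimage of order n lies there, and at least one of order n +
    M; h and the variation of F along the cylinder cost constants. *)
Lemma gibbs_measure : exists nu : probability BS R, shift_invariant nu /\
  exists c C, [/\ 0 < c, 0 < C & forall n x,
    c * (expR (birkhoff F n x) / lam ^+ n) <= fine (nu [set z | word n z = word n x])
      <= C * (expR (birkhoff F n x) / lam ^+ n)].
Proof.
have [gamma [C [gamma0 C0 mg]]] := gibbs_markov.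
have [m [K [r [K0 r01 gap]]]] := exists_mean theta01 gamma0 C0 mg.
have [nu Hnu] := exists_measure theta01 (mean_of_ge0 gamma0 mg r01 gap) (mean_ofU r01 gap) (mean_ofT mg r01 gap).
exists nu; split.
  apply: invariant_cylinder => B cB; rewrite !Hnu//; last exact: shift_cylinder.
  by rewrite (mean_of_shift gamma0 C0 mg r01 gap).
have [M mixM] := exists_mixing_time A.
pose Ld := LF / (1 - theta).
have agree n x y : word n x = word n y -> `|birkhoff F n x - birkhoff F n y| <= Ld.
  move=> /wordP E; have := @birkhoff_agree _ _ _ _ theta01 F LF n 0 x y F_lip.
  by rewrite addn0 expr0 mulr1; exact.
exists (D ^- 2 * expR (- Ld) * expR (- (M%:R * BF)) / lam ^+ M), (D ^+ 2 * expR Ld); split.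
- by rewrite divr_gt0 ?exprn_gt0// mulr_gt0 ?expR_gt0// mulr_gt0 ?expR_gt0// invr_gt0 exprn_gt0.
- by rewrite mulr_gt0 ?expR_gt0// exprn_gt0.
move=> n x; have cW := cylinder_word A (word n x); rewrite Hnu//=.
set W := [set z | word n z = word n x].
have ln j : 0 < lam ^+ j by exact: exprn_gt0.
have coc0 j y : 0 <= cocycle g j y.
  by rewrite cocycle_normalized divr_ge0 ?mulr_ge0 ?expR_ge0 ?(ltW (h0 _)) ?(ltW (ln _)).
have hx x1 x2 : D ^- 2 <= h x1 / h x2 <= D ^+ 2.
  have /andP[a1 a2] := hD x1; have /andP[b1 b2] := hD x2.
  have Dp : 0 <= D^-1 by rewrite invr_ge0 ltW.
  apply/andP; split.
    by rewrite expr2 invfM ler_pM// lef_pV2 ?posrE.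
  rewrite expr2 ler_pM ?invr_ge0 ?(ltW (h0 _))//.
  by rewrite -[leRHS]invrK lef_pV2 ?posrE ?invr_gt0.
have cocE j y : cocycle g j y = expR (birkhoff F j y) / lam ^+ j * (h y / h (iter j sh y)).
  rewrite cocycle_normalized; have := ln j; have := h0 (iter j sh y) => u1 u2.
  by field; rewrite !gt_eqF.
have birk_ge j y : - (j%:R * BF) <= birkhoff F j y.
  elim: j y => [|j IH] y; first by rewrite birkhoff0 mul0r oppr0.
  rewrite birkhoffS -natr1; have := IH (sh y); have := F_bound y.
  by rewrite ler_norml => /andP[+ _]; lra.
apply/andP; split.
  apply: (mean_of_ge gamma0 C0 mg r01 gap (n := n + M) cW) => y.
  rewrite iter_indic.
  have [w wy wx] := mixing_preimage n y x mixM.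
  have wW : word n w = word n x by apply/wordP => i ni; apply: wx; exact: ltnW.
  have win : w \in preimages (n + M) y by rewrite mem_preimages; apply/eqP.
  have wIn : w \in W by rewrite inE.
  rewrite big_mkcond (bigD1_seq w) ?preimages_uniq//= wIn.
  apply: (@le_trans _ _ (cocycle g (n + M) w)); last first.
    by rewrite lerDl; apply: sumr_ge0 => y' _; case: ifP.
  rewrite cocE; have /andP[q1 _] := hx w (iter (n + M) sh w).
  have -> : D ^- 2 * expR (- Ld) * expR (- (M%:R * BF)) / lam ^+ M * (expR (birkhoff F n x) / lam ^+ n) =
      expR (birkhoff F n x - Ld - M%:R * BF) / lam ^+ (n + M) * D ^- 2.
    rewrite exprD !expRD; have := ln n; have := ln M => u1 u2.
    by field; rewrite !gt_eqF.
  apply: ler_pM => //.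
  - by rewrite divr_ge0 ?expR_ge0// ltW.
  - by rewrite invr_ge0 exprn_ge0// ltW.
  rewrite ler_wpM2r ?invr_ge0 ?(ltW (ln _))// ler_expR birkhoffD.
  have := birk_ge M (iter n sh w).
  have := agree n _ _ wW; rewrite ler_norml => /andP[z1 z2]; lra.
apply: (mean_of_le gamma0 C0 mg r01 gap (n := n) cW) => y.
rewrite iter_indic -big_filter.
have : uniq [seq y' <- preimages n y | y' \in W] by rewrite filter_uniq// preimages_uniq.
have : forall y', y' \in [seq y' <- preimages n y | y' \in W] -> iter n sh y' = y /\ word n y' = word n x.
  by move=> y'; rewrite mem_filter mem_preimages => /andP[/set_mem w1 /eqP w2].
case: [seq _ <- _ | _] => [|y1 [|y2 q]] H /=.
- move=> _; rewrite big_nil mulr_ge0 ?divr_ge0 ?expR_ge0 ?(ltW (ln _))//.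
  by rewrite mulr_ge0 ?expR_ge0// exprn_ge0// ltW.
- move=> _; rewrite big_seq1 cocE; have /andP[_ q1] := hx y1 (iter n sh y1).
  have [_ w1] := H y1 (mem_head _ _).
  have -> : D ^+ 2 * expR Ld * (expR (birkhoff F n x) / lam ^+ n) =
      expR (birkhoff F n x + Ld) / lam ^+ n * D ^+ 2 by rewrite expRD; ring.
  apply: ler_pM => //.
  - by rewrite divr_ge0 ?expR_ge0// ltW.
  - by rewrite divr_ge0// ltW.
  rewrite ler_wpM2r ?invr_ge0 ?(ltW (ln _))// ler_expR.
  by have := agree n _ _ w1; rewrite ler_norml => /andP[z1 z2]; lra.
have [v1 w1] := H y1 (mem_head _ _).
have [|v2 w2] := H y2; first by rewrite !inE eqxx orbT.
have y12 : y1 = y2.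
  apply: shift_space_ext => i; have [ni|ni] := ltnP i n.
    by apply: (wordP n _ _).1 ni; rewrite w1 w2.
  by rewrite -(subnKC ni) -!sval_iter_shift v1 v2.
by rewrite y12 inE eqxx.
Qed.

End GibbsMeasure.

(** * Entropy *)

Section Expectation.
Context (R : realType) (disp : measure_display) (T : measurableType disp) (mu : probability T R).
Implicit Types (X Y : T -> R) (B : set T).

Definition bounded_measurable X :=
  measurable_fun setT X /\ exists M, forall x, `|X x| <= M.

Lemma bounded_measurable_integrable X : bounded_measurable X -> mu.-integrable setT (EFin \o X).
Proof.
move=> [mX [M XM]]; apply: measurable_bounded_integrable => //.
  by rewrite -ge0_fin_numE//; exact: fin_num_measure.
exists M; split; first by rewrite num_real.
by move=> N /ltW MN x _ /=; exact: le_trans (XM x) MN.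
Qed.

Lemma bounded_measurable_cst (r : R) : bounded_measurable (fun=> r).
Proof. by split; [exact: measurable_cst|exists `|r|]. Qed.

Lemma bounded_measurableD X Y : bounded_measurable X -> bounded_measurable Y ->
  bounded_measurable (fun x => X x + Y x).
Proof.
move=> [mX [M XM]] [mY [N YN]]; split; first exact: measurable_funD.
by exists (M + N) => x; rewrite (le_trans (ler_normD _ _))// lerD.
Qed.

Lemma bounded_measurableZ (r : R) X : bounded_measurable X -> bounded_measurable (fun x => r * X x).
Proof.
move=> [mX [M XM]]; split; first by apply: measurable_funM => //; exact: measurable_cst.
by exists (`|r| * M) => x; rewrite normrM ler_wpM2l.
Qed.

Lemma bounded_measurable_sum (I : Type) (s : seq I) (X : I -> T -> R) :
  (forall i, bounded_measurable (X i)) -> bounded_measurable (fun x => \sum_(i <- s) X i x).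
Proof.
move=> HX; elim: s => [|i s IH].
  rewrite (_ : (fun _ => _) = fun=> 0); first exact: bounded_measurable_cst.
  by apply/funext => x; rewrite big_nil.
rewrite (_ : (fun _ => _) = fun x => X i x + \sum_(i <- s) X i x).
  exact: bounded_measurableD.
by apply/funext => x; rewrite big_cons.
Qed.

Lemma bounded_measurable_indic B : measurable B -> bounded_measurable (\1_B : T -> R).
Proof.
move=> mB; split; first exact: measurable_indic.
by exists 1 => x; rewrite indicE; case: (x \in B); rewrite ?normr1 ?normr0.
Qed.

Definition expect X : R := Rintegral mu setT X.

Lemma expectD X Y : bounded_measurable X -> bounded_measurable Y ->
  expect (fun x => X x + Y x) = expect X + expect Y.
Proof. by move=> /bounded_measurable_integrable iX /bounded_measurable_integrable iY; exact: RintegralD. Qed.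

Lemma expectZ (r : R) X : bounded_measurable X -> expect (fun x => r * X x) = r * expect X.
Proof. by move=> /bounded_measurable_integrable iX; exact: RintegralZl. Qed.

Lemma expect_cst (r : R) : expect (fun=> r) = r.
Proof.
rewrite /expect Rintegral_cst// -[RHS]mulr1.
exact: (congr1 (fun t => r * fine t) (probability_setT mu)).
Qed.

Lemma expect_sum (I : Type) (s : seq I) (X : I -> T -> R) : (forall i, bounded_measurable (X i)) ->
  expect (fun x => \sum_(i <- s) X i x) = \sum_(i <- s) expect (X i).
Proof.
move=> HX; elim: s => [|i s IH].
  rewrite big_nil (_ : (fun _ => _) = fun=> 0) ?expect_cst//.
  by apply/funext => x; rewrite big_nil.
rewrite big_cons -IH -expectD//; last exact: bounded_measurable_sum.
by congr expect; apply/funext => x; rewrite big_cons.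
Qed.

Lemma expect_le X Y : bounded_measurable X -> bounded_measurable Y ->
  (forall x, X x <= Y x) -> expect X <= expect Y.
Proof.
move=> /bounded_measurable_integrable iX /bounded_measurable_integrable iY XY.
by apply: le_Rintegral => // x _; exact: XY.
Qed.

Lemma expect_indic B : measurable B -> expect \1_B = fine (mu B).
Proof. by move=> mB; rewrite /expect /Rintegral integral_indic// setIT. Qed.

Lemma expect_EFin X : bounded_measurable X -> (\int[mu]_x (X x)%:E)%E = (expect X)%:E.
Proof.
move=> /bounded_measurable_integrable iX; rewrite /expect /Rintegral fineK//.
exact: integrable_fin_num.
Qed.

Section Dynamics.
Context (S : T -> T) (mS : measurable_fun setT S) (invS : invariant_measure S mu).

Lemma measurable_iter n : measurable_fun setT (iter n S).
Proof. by elim: n => [|n IH]; [exact: measurable_id|exact: measurableT_comp mS IH]. Qed.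

Lemma bounded_measurable_comp X n : bounded_measurable X -> bounded_measurable (fun x => X (iter n S x)).
Proof.
move=> [mX [M XM]]; split; last by exists M => x.
exact: measurableT_comp mX (measurable_iter n).
Qed.

Lemma expect_comp X : bounded_measurable X -> expect (fun x => X (S x)) = expect X.
Proof.
move=> bX; have [mX _] := bX; have iX := bounded_measurable_integrable bX.
rewrite /expect /Rintegral; congr fine.
have mu_eq (B : set T) : measurable B -> pushforward mu S B = mu B by exact: invS.
have mXE : measurable_fun setT (EFin \o X) by exact/measurable_EFinP.
have iXS : mu.-integrable setT ((EFin \o X) \o S).
  exact: (bounded_measurable_integrable (bounded_measurable_comp 1 bX)).
rewrite -[LHS](@integral_pushforward _ _ _ _ _ S mS mu setT (EFin \o X))//.
apply: eq_measure_integral => B mB _; exact: mu_eq.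
Qed.

Lemma expect_iter X n : bounded_measurable X -> expect (fun x => X (iter n S x)) = expect X.
Proof.
move=> bX; elim: n => [//|n IH]; rewrite -IH.
rewrite -(expect_comp (bounded_measurable_comp n bX)); congr expect.
by apply/funext => x; rewrite iterSr.
Qed.

Definition ergodic_sum X n x := \sum_(j < n) X (iter j S x).

Lemma bounded_measurable_ergodic X n : bounded_measurable X -> bounded_measurable (ergodic_sum X n).
Proof. by move=> bX; apply: bounded_measurable_sum => j; exact: bounded_measurable_comp. Qed.

Lemma expect_ergodic X n : bounded_measurable X -> expect (ergodic_sum X n) = n%:R * expect X.
Proof.
move=> bX; rewrite /ergodic_sum expect_sum; last by move=> j; exact: bounded_measurable_comp.
under eq_bigr do rewrite expect_iter//.
by rewrite sumr_const card_ord mulr_natl.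
Qed.

End Dynamics.

Section Entropy.
Context (S : T -> T) (mS : measurable_fun setT S) (k : nat) (c : T -> 'I_k).
Context (mc : forall i, measurable (c @^-1` [set i])).

Definition itinerary n x : {ffun 'I_n -> 'I_k} := [ffun j : 'I_n => c (iter j S x)].

Definition cell n (w : {ffun 'I_n -> 'I_k}) : set T := [set x | forall j : 'I_n, c (iter j S x) = w j].

Lemma cellP n w x : cell w x <-> itinerary n x = w.
Proof.
split=> [H|<- j]; first by apply/ffunP => j; rewrite ffunE.
by rewrite ffunE.
Qed.

Lemma measurable_cell n (w : {ffun 'I_n -> 'I_k}) : measurable (cell w).
Proof.
have -> : cell w = \bigcap_(j : 'I_n) ((iter j S) @^-1` (c @^-1` [set w j])).
  by apply/seteqP; split => x H j => [_|]; exact: H.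
apply: fin_bigcap_measurable => // j _.
by rewrite -[_ @^-1` _]setTI; apply: measurable_iter.
Qed.

Lemma sum_cell n (G : {ffun 'I_n -> 'I_k} -> R) x :
  \sum_w G w * \1_(cell w) x = G (itinerary n x).
Proof.
rewrite (bigD1 (itinerary n x))//= indicE mem_set ?mulr1; last exact/cellP.
rewrite big1 ?addr0// => w wx; rewrite indicE memNset ?mulr0//.
by move=> /cellP xw; rewrite xw eqxx in wx.
Qed.

Definition cell_mass n (w : {ffun 'I_n -> 'I_k}) : R := fine (mu (cell w)).

Lemma cell_mass_ge0 n (w : {ffun 'I_n -> 'I_k}) : 0 <= cell_mass w.
Proof. by rewrite fine_ge0. Qed.

Lemma expect_cell n (G : {ffun 'I_n -> 'I_k} -> R) :
  bounded_measurable (fun x => G (itinerary n x)) /\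
  expect (fun x => G (itinerary n x)) = \sum_w cell_mass w * G w.
Proof.
have bI w : bounded_measurable (fun x => G w * \1_(cell (n := n) w) x).
  by apply: bounded_measurableZ; apply: bounded_measurable_indic; exact: measurable_cell.
have -> : (fun x => G (itinerary n x)) = fun x => \sum_w G w * \1_(cell w) x.
  by apply/funext => x; rewrite sum_cell.
split; first exact: bounded_measurable_sum.
rewrite expect_sum//; apply: eq_bigr => w _.
rewrite expectZ; last by apply: bounded_measurable_indic; exact: measurable_cell.
by rewrite [RHS]mulrC; congr (_ * _); apply: expect_indic; exact: measurable_cell.
Qed.

Lemma sum_cell_mass n : \sum_(w : {ffun 'I_n -> 'I_k}) cell_mass w = 1.
Proof.
rewrite -(expect_cst 1); have [_ ->] := expect_cell (n := n) (fun=> 1).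
by apply: eq_bigr => w _; rewrite mulr1.
Qed.

Lemma join_entropyE n : join_entropy S mu c n = - \sum_(w : {ffun 'I_n -> 'I_k}) cell_mass w * ln (cell_mass w).
Proof. by []. Qed.

(** Gibbs' inequality, from ln t <= t - 1. The comparison law is given through a function q on
    points, because ln (Q w) carries no information on words that no point realizes. *)
Lemma join_entropy_le n (Q : {ffun 'I_n -> 'I_k} -> R) (q : T -> R) :
  (forall w, 0 <= Q w) -> \sum_w Q w <= 1 -> bounded_measurable q ->
  (forall x, expR (q x) <= Q (itinerary n x)) -> join_entropy S mu c n <= - expect q.
Proof.
move=> Q0 Q1 bq qQ; rewrite join_entropyE.
have [bQ EQ] := expect_cell (fun w => ln (Q w)).
have : expect q <= expect (fun x => ln (Q (itinerary n x))).
  apply: expect_le => // x; rewrite -[leLHS]expRK ler_ln ?posrE ?expR_gt0//.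
  exact: lt_le_trans (expR_gt0 _) (qQ x).
rewrite EQ => H; rewrite lerN2; apply: (le_trans H).
suff : \sum_w cell_mass w * ln (Q w) <= \sum_w (cell_mass w * ln (cell_mass w) + (Q w - cell_mass w)).
  by rewrite big_split sumrB sum_cell_mass /=; lra.
apply: ler_sum => w _; have [P0|P0] := eqVneq (cell_mass w) 0.
  by rewrite P0 !mul0r add0r subr0.
have Pp : 0 < cell_mass w by rewrite lt_neqAle eq_sym P0 cell_mass_ge0.
have Qp : 0 < Q w.
  have /set0P[x /cellP <-] : cell w != set0.
    by apply: contra_neq P0 => E; rewrite /cell_mass E measure0.
  exact: lt_le_trans (expR_gt0 _) (qQ x).
rewrite -lerBlDl -mulrBr -ln_div ?posrE//.
have PQ : 0 < Q w / cell_mass w by rewrite divr_gt0.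
have := le_ln1Dx (x := Q w / cell_mass w - 1); rewrite addrCA subrr addr0 => L.
have {}L : ln (Q w / cell_mass w) <= Q w / cell_mass w - 1 by apply: L; lra.
have := ler_wpM2l (ltW Pp) L.
by rewrite mulrBr mulr1 mulrCA divff ?mulr1.
Qed.

Lemma join_entropy_ge n (q : T -> R) : bounded_measurable q ->
  (forall x, 0 < cell_mass (itinerary n x) <= expR (q x)) -> - expect q <= join_entropy S mu c n.
Proof.
move=> bq H; rewrite join_entropyE lerN2.
have [bP EP] := expect_cell (n := n) (fun w => ln (cell_mass w)).
rewrite -EP; apply: expect_le => // x; have /andP[P0 Pq] := H x.
by rewrite -[leRHS]expRK ler_ln ?posrE ?expR_gt0.
Qed.

End Entropy.

End Expectation.

Section PressureBounds.
Context (R : realType) (kappa : nat) (A : aperiodic_matrix kappa) (theta : R).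
Context (theta01 : 0 < theta < 1).
Local Notation S := (shift_space A).
Local Notation sh := (@sft_shift kappa A).
Local Notation d := (@d_theta R kappa A theta).
Local Notation BS := (borel_shift A theta).
Implicit Types (x y z : S).

Let th0 : 0 < theta. Proof. by case/andP: theta01. Qed.
Let th1 : theta < 1. Proof. by case/andP: theta01. Qed.

Lemma lipschitz_measurable (X : S -> R) (L : R) : (forall x y, `|X x - X y| <= L * d x y) ->
  measurable_fun [set: BS] (X : BS -> R).
Proof.
move=> XL.
apply: (@measurability _ _ BS _ setT (X : BS -> R) _ (RGenOInfty.measurableE R)).
move=> _ [_ [a ->] <-]; rewrite setTI; apply: sub_sigma_algebra => x /=.
rewrite in_itv /= andbT => ax.
have L1 : 0 < `|L| + 1 by rewrite ltr_wpDl.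
exists ((X x - a) / (`|L| + 1)); first by rewrite divr_gt0// subr_gt0.
move=> y xy; rewrite /preimage /= in_itv /= andbT.
have := XL x y; rewrite ler_norml => /andP[_ H].
move: xy; rewrite ltr_pdivlMr// mulrC => xy.
have : L * d x y <= (`|L| + 1) * d x y.
  by rewrite ler_wpM2r ?d_ge0// (le_trans (ler_norm _))// lerDl.
lra.
Qed.

Lemma lipschitz_bounded_measurable (X : S -> R) (L M : R) : (forall x y, `|X x - X y| <= L * d x y) ->
  (forall x, `|X x| <= M) -> bounded_measurable (X : BS -> R).
Proof. by move=> XL XM; split; [exact: lipschitz_measurable XL|exists M]. Qed.

Context (F : S -> R) (LF BF : R).
Context (F_lip : forall x y, `|F x - F y| <= LF * d x y) (F_bound : forall x, `|F x| <= BF).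
Context (lam : R) (h : S -> R) (D : R) (lam0 : 0 < lam) (D1 : 1 <= D).
Context (hD : forall x, D^-1 <= h x <= D) (h_log : log_lip theta (theta * LF / (1 - theta)) h).
Context (hE : forall x, transfer (fun y => expR (F y)) h x = lam * h x).

Let F_bm : bounded_measurable (F : BS -> R) := lipschitz_bounded_measurable F_lip F_bound.

Lemma cvg_linear_rate (H : nat -> R) (a K : R) : (forall n, `|H n - n%:R * a| <= K) ->
  (n%:R^-1 * H n)%:E @[n --> \oo] --> a%:E.
Proof.
move=> HK; apply: cvg_EFin; first exact: nearW.
apply/cvgrPdist_le => e e0; near=> n.
have n0 : 0 < n%:R :> R by near: n; exists 1%N => // n /=; rewrite ltr0n.
have Kn : K <= e * n%:R by near: n; exact: near_le_linear.
rewrite /= -(ler_pM2r n0) -[X in _ * X <= _](gtr0_norm n0) -normrM.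
rewrite mulrBl mulrAC mulVf ?gt_eqF// mul1r distrC (mulrC a).
exact: le_trans Kn.
Unshelve. all: by end_near. Qed.

(** For the Gibbs measure and the partition by first symbols the cells are cylinders, whose masses
    are known up to constants; the entropy rate is therefore ln lam minus the mean of F. *)
Lemma ln_le_pressure : ((ln lam)%:E <= pressure theta F)%E.
Proof.
have [nu [inv [c [C [c0 C0 bounds]]]]] := gibbs_measure theta01 F_lip F_bound lam0 D1 hD h_log hE.
pose lab (x : BS) : 'I_kappa := sval x 0%N.
have mlab i : measurable (lab @^-1` [set i] : set BS).
  apply: cylinder_measurable => //; exists 1%N => x y /wordP/(_ 0%N isT) E.
  by rewrite /preimage /= /lab => <-.
have mS : measurable_fun [set: BS] (sh : BS -> BS) by exact: measurable_shift.
have cellE n x : cell (sh : BS -> BS) lab (itinerary (sh : BS -> BS) lab n x) = [set z | word n z = word n x].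
  apply/seteqP; split => z.
    move=> H; apply/wordP => i ni; have := H (Ordinal ni).
    by rewrite ffunE /lab /= !sval_iter_shift !addn0.
  by move=> /wordP H j; rewrite ffunE /lab !sval_iter_shift !addn0; exact: H.
pose Phi := expect nu (F : BS -> R).
have ln0 n : 0 < lam ^+ n by exact: exprn_gt0.
pose q (b : R) n (x : BS) := ln b + (- (n%:R * ln lam)) + birkhoff F n x.
have qE b n x : 0 < b -> expR (q b n x) = b * (expR (birkhoff F n x) / lam ^+ n).
  move=> b0; rewrite /q !expRD lnK ?posrE// expRN expRM_natl lnK ?posrE//; ring.
have bq b n : bounded_measurable (q b n).
  apply: bounded_measurableD; first exact: bounded_measurable_cst.
  exact: (bounded_measurable_ergodic mS n F_bm).
have Eq b n : expect nu (q b n) = ln b - n%:R * ln lam + n%:R * Phi.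
  rewrite /q expectD; [|exact: bounded_measurable_cst|exact: (bounded_measurable_ergodic mS n F_bm)].
  by rewrite expect_cst (expect_ergodic mS inv n F_bm).
have mass n x : cell_mass nu (sh : BS -> BS) lab (itinerary (sh : BS -> BS) lab n x) =
    fine (nu [set z | word n z = word n x]) by rewrite /cell_mass cellE.
have up n : - expect nu (q C n) <= join_entropy (sh : BS -> BS) nu lab n.
  apply: join_entropy_ge => // x; rewrite mass qE//; have /andP[b1 ->] := bounds n x.
  by rewrite andbT (lt_le_trans _ b1)// mulr_gt0// divr_gt0 ?expR_gt0.
have low n : join_entropy (sh : BS -> BS) nu lab n <= - expect nu (q c n).
  apply: (@join_entropy_le _ _ BS nu _ mS _ _ mlab n (@cell_mass _ _ BS nu (sh : BS -> BS) _ lab n)) => //.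
  - by move=> w; exact: cell_mass_ge0.
  - by rewrite sum_cell_mass.
  by move=> x; rewrite mass qE//; case/andP: (bounds n x).
have ent : partition_entropy (sh : BS -> BS) nu lab = (ln lam - Phi)%:E.
  apply: cvg_lim => //; apply: (@cvg_linear_rate _ _ (`|ln c| + `|ln C|)) => n.
  have := up n; have := low n; rewrite !Eq => h1 h2.
  have := ler_norm (ln c); have := ler_norm (- ln c); have := ler_norm (ln C); have := ler_norm (- ln C).
  rewrite !normrN ler_norml => u1 u2 u3 u4; apply/andP; split; lra.
apply: (@le_trans _ _ (shift_entropy nu + \int[nu]_xi (F xi)%:E)%E); last first.
  by apply: ereal_sup_ubound; exists nu.
rewrite (expect_EFin nu F_bm) -/Phi.
have -> : (ln lam)%:E = ((ln lam - Phi)%:E + Phi%:E)%E by rewrite -EFinD subrK.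
apply: leeD => //; rewrite -ent; apply: ereal_sup_ubound.
by exists kappa, lab; split.
Qed.

End PressureBounds.

(** * Approximating finite partitions by cylinders *)

Section Approximation.
Context (R : realType) (kappa : nat) (A : aperiodic_matrix kappa) (theta : R).
Context (theta01 : 0 < theta < 1).
Local Notation S := (shift_space A).
Local Notation BS := (borel_shift A theta).
Context (mu : probability BS R).

Local Notation mass X := (fine (mu X)).

Lemma mass_le (X Y : set BS) : measurable X -> measurable Y -> X `<=` Y -> mass X <= mass Y.
Proof.
move=> mX mY XY; apply: fine_le; [exact: fin_num_measure|exact: fin_num_measure|].
by apply: le_measure => //; rewrite inE.
Qed.

Lemma massU (X Y : set BS) : measurable X -> measurable Y -> mass (X `|` Y) <= mass X + mass Y.
Proof.
move=> mX mY; rewrite -fineD ?fin_num_measure//; apply: fine_le.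
- by rewrite fin_num_measure//; exact: measurableU.
- by rewrite fin_numD !fin_num_measure.
- exact: measureU2.
Qed.

Definition sym_diff (X Y : set BS) : set BS := (X `\` Y) `|` (Y `\` X).

Lemma measurable_sym_diff (X Y : set BS) : measurable X -> measurable Y -> measurable (sym_diff X Y).
Proof. by move=> mX mY; apply: measurableU; exact: measurableD. Qed.

Definition approximable (B : set S) := (measurable : set (set BS)) B /\
  forall e : R, 0 < e -> exists2 B', clopen_cylinder B' & mass (sym_diff B B') <= e.

Let mC (B : set S) : clopen_cylinder B -> (measurable : set (set BS)) B.
Proof. exact: cylinder_measurable. Qed.

(** Truncate the union at N by continuity of the measure, then approximate the N sets with total
    error e / 2. *)
Lemma approximable_bigcup (B : (set S)^nat) : (forall i, approximable (B i)) ->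
  approximable (\bigcup_i B i).
Proof.
move=> HB; have mB i : (measurable : set (set BS)) (B i) by case: (HB i).
have mU : (measurable : set (set BS)) (\bigcup_i B i) by exact: bigcupT_measurable.
split => // e e0.
pose U n : set BS := \bigcup_(i < n) B i.
have mUn n : measurable (U n) by exact: bigcup_measurable.
have UE : \bigcup_n U n = \bigcup_i B i.
  apply/seteqP; split => x; first by move=> [n _ [i _ Bx]]; exists i.
  by move=> [i _ Bx]; exists i.+1 => //; exists i => /=.
have cv : mu \o U @ \oo --> mu (\bigcup_n U n).
  apply: nondecreasing_cvg_mu => //; first by rewrite UE.
  by apply/nondecreasing_seqP => n; apply/subsetPset => x [i /= ni Bx]; exists i => //=; exact: ltnW.
have {}cv : mass (U n) @[n --> \oo] --> mass (\bigcup_i B i).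
  by apply: fine_cvg; rewrite fineK ?fin_num_measure// -UE; exact: cv.
have e2 : 0 < e / 2 by exact: divr_gt0.
have /cvgrPdist_le/(_ _ e2)[N _ /(_ N (leqnn _))] := cv.
rewrite /= => HN.
have ed : 0 < e / 2 / N.+1%:R by rewrite divr_gt0.
have ex i : exists B', clopen_cylinder B' /\ mass (sym_diff (B i) B') <= e / 2 / N.+1%:R.
  by have [B' cB' HB'] := (HB i).2 _ ed; exists B'.
have [B' HB'] := choice ex.
pose U' n : set BS := \bigcup_(i < n) B' i.
have cU' n : clopen_cylinder (U' n).
  elim: n => [|n IH]; first by rewrite /U' II0 bigcup_set0; exact: cylinder0.
  by rewrite /U' IIS bigcup_setU bigcup_set1; apply: cylinderU => //; exact: (HB' n).1.
exists (U' N) => //.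
have sumB n : mass (sym_diff (U n) (U' n)) <= n%:R * (e / 2 / N.+1%:R).
  elim: n => [|n IH].
    by rewrite mul0r /sym_diff /U /U' II0 !bigcup_set0 setD0 setU0 measure0.
  apply: (@le_trans _ _ (mass (sym_diff (U n) (U' n) `|` sym_diff (B n) (B' n)))).
    apply: mass_le.
    - by apply: measurable_sym_diff => //; exact: mC.
    - by apply: measurableU; apply: measurable_sym_diff => //; apply: mC => //; exact: (HB' n).1.
    rewrite /sym_diff /U /U' IIS !bigcup_setU !bigcup_set1 => x /=.
    by move=> [[[u|b] /not_orP[u' b']]|[[u|b] /not_orP[u' b']]]; tauto.
  apply: le_trans (massU _ _) _.
  - by apply: measurable_sym_diff => //; exact: mC.
  - by apply: measurable_sym_diff => //; apply: mC; exact: (HB' n).1.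
  by rewrite -natr1 mulrDl mul1r lerD//; exact: (HB' n).2.
have mE : (measurable : set (set BS)) ((\bigcup_i B i) `\` U N) by exact: measurableD.
apply: (@le_trans _ _ (mass (((\bigcup_i B i) `\` U N) `|` sym_diff (U N) (U' N)))).
  apply: mass_le.
  - by apply: measurable_sym_diff => //; exact: mC.
  - by apply: measurableU => //; apply: measurable_sym_diff => //; exact: mC.
  move=> x [[Bx nU']|[U'x nB]].
    by have [ux|nu] := pselect (U N x); [right; left|left].
  by right; right; split => // -[i _ Bx]; apply: nB; exists i.
apply: le_trans (massU _ _) _ => //; first by apply: measurable_sym_diff => //; exact: mC.
rewrite [leRHS](_ : e = e / 2 + e / 2); last by rewrite -splitr.
apply: lerD.
  have -> : mass ((\bigcup_i B i) `\` U N) = mass (\bigcup_i B i) - mass (U N).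
    rewrite measureD//; last by rewrite -ge0_fin_numE//; exact: fin_num_measure.
    rewrite (_ : (\bigcup_i B i) `&` U N = U N); last first.
      by apply: setIidr => x [i _ Bx]; exists i.
    by rewrite fineB// fin_num_measure.
  by rewrite (le_trans (ler_norm _)).
apply: (le_trans (sumB N)); rewrite mulrCA ler_piMr ?(ltW e2)//.
by rewrite ler_pdivrMr// mul1r ler_nat.
Qed.

Lemma measurable_approximable (B : set S) : (measurable : set (set BS)) B -> approximable B.
Proof.
move=> /(borel_cylinders theta01).
apply: smallest_sub; last first.
  move=> X cX; split; first exact: mC.
  move=> e e0; exists X => //.
  by rewrite /sym_diff !setDv setU0 measure0 ltW.
split.
- split => // e e0; exists set0; first exact: cylinder0.
  by rewrite /sym_diff !setDv setU0 measure0 ltW.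
- move=> X [mX HX]; rewrite setTD; split; first exact: measurableC.
  move=> e e0; have [X' cX' H] := HX e e0; exists (~` X'); first exact: cylinderC.
  apply: le_trans H; rewrite /sym_diff !setDE !setCK setUC.
  by rewrite (setIC _ X') (setIC _ X).
- exact: approximable_bigcup.
Qed.

(** Each label set is approximated by a cylinder, and c' reads the label of a cylinder containing
    the point, with a default if there is none. Where c and c' differ, the point lies in one of the
    k symmetric differences. *)
Lemma label_approx (k : nat) (c : BS -> 'I_k) (e : R) : (forall i, measurable (c @^-1` [set i])) -> 0 < e ->
  exists J (c' : S -> 'I_k), [/\ forall x y, word J x = word J y -> c' x = c' y,
    measurable ([set x | c x <> c' x] : set BS) & mass [set x | c x <> c' x] <= e].
Proof.
move=> mc e0.
have k0 : 0 < k%:R :> R by rewrite ltr0n; case: (c point) => a; exact: leq_trans.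
have ek : 0 < e / k%:R by exact: divr_gt0.
have ex (i : 'I_k) : exists B', clopen_cylinder B' /\ mass (sym_diff (c @^-1` [set i]) B') <= e / k%:R.
  by have [_ /(_ _ ek)[B' cB' HB']] := measurable_approximable (mc i); exists B'.
have [B' HB'] := choice ex.
have [n Hn] := choice (fun i => (HB' i).1).
pose J := \max_(i < k) n i.
pose c' x : 'I_k := odflt (c point) [pick i | x \in B' i].
have cJ x y : word J x = word J y -> c' x = c' y.
  move=> E; rewrite /c'; congr (odflt _ _); apply: eq_pick => i.
  have H := cylindricalW (leq_bigmax i) (Hn i).
  by apply/idP/idP => /set_mem Bx; apply/mem_set; [exact: H E Bx|exact: H (esym E) Bx].
have mB' i : (measurable : set (set BS)) (B' i) by apply: mC; exact: (HB' i).1.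
have mc' i : (measurable : set (set BS)) (c' @^-1` [set i]).
  by apply: mC; exists J => x y /cJ E; rewrite /preimage /= E.
have DE : [set x | c x <> c' x] = \bigcup_(i : 'I_k) ((c @^-1` [set i]) `\` (c' @^-1` [set i])).
  apply/seteqP; split => x; first by move=> H; exists (c x) => //; split => //= E; exact: H.
  by move=> [i _ [/= <- H]] E; apply: H.
have mD : measurable ([set x | c x <> c' x] : set BS).
  by rewrite DE; apply: fin_bigcup_measurable => // i _; exact: measurableD.
exists J, c'; split => //.
pose V (j : nat) : set BS := \bigcup_(i in [set i : 'I_k | (i < j)%N]) sym_diff (c @^-1` [set i]) (B' i).
have mV j : measurable (V j).
  by apply: fin_bigcup_measurable => // i _; apply: measurable_sym_diff.
have V_le j : (j <= k)%N -> mass (V j) <= j%:R * (e / k%:R).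
  elim: j => [|j IH] jk.
    by rewrite mul0r (_ : V 0%N = set0) ?measure0//; apply/seteqP; split => // x [].
  pose ij := Ordinal jk.
  apply: (@le_trans _ _ (mass (V j `|` sym_diff (c @^-1` [set ij]) (B' ij)))).
    apply: mass_le => //.
      by apply: measurableU => //; exact: measurable_sym_diff.
    move=> x [i /=]; rewrite ltnS leq_eqVlt => /orP[/eqP ie|ij'] H; last by left; exists i.
    by right; rewrite (_ : ij = i)//; apply: val_inj.
  apply: le_trans (massU _ _) _ => //; first exact: measurable_sym_diff.
  by rewrite -natr1 mulrDl mul1r lerD ?IH ?(ltnW jk)//; exact: (HB' ij).2.
have -> : e = k%:R * (e / k%:R) by rewrite mulrC divfK// gt_eqF.
apply: le_trans (V_le k (leqnn _)); apply: mass_le => // x /= cx.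
have [Bx|nB] := pselect (B' (c x) x); last first.
  by exists (c x) => /=; [exact: ltn_ord|left].
move: cx; rewrite /c'; case: pickP => [i /set_mem Bi /= ci|/(_ (c x))]; last by rewrite mem_set.
by exists i => /=; [exact: ltn_ord|right; split => //= E; apply: ci].
Qed.

End Approximation.

Section EntropyBound.
Context (R : realType) (kappa : nat) (A : aperiodic_matrix kappa) (theta : R).
Context (theta01 : 0 < theta < 1).
Local Notation S := (shift_space A).
Local Notation sh := (@sft_shift kappa A).
Local Notation d := (@d_theta R kappa A theta).
Local Notation BS := (borel_shift A theta).
Implicit Types (x y z : S).

Context (F : S -> R) (LF BF : R).
Context (F_lip : forall x y, `|F x - F y| <= LF * d x y) (F_bound : forall x, `|F x| <= BF).
Context (lam : R) (h : S -> R) (D : R) (lam0 : 0 < lam) (D1 : 1 <= D).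
Context (hD : forall x, D^-1 <= h x <= D) (h_log : log_lip theta (theta * LF / (1 - theta)) h).
Context (hE : forall x, transfer (fun y => expR (F y)) h x = lam * h x).
Context (mu : probability BS R) (inv : shift_invariant mu).

Let F_bm : bounded_measurable (F : BS -> R) := lipschitz_bounded_measurable theta01 F_lip F_bound.
Let mS : measurable_fun [set: BS] (sh : BS -> BS) := measurable_shift theta01.
Local Notation shB := (sh : BS -> BS).
Local Notation Phi := (expect mu (F : BS -> R)).

(* The joint law of the label sequence is compared with the law obtained by
   reading the labels c' off a Gibbs-distributed word through a memoryless
   channel, which errs with probability 1 - expR (- eta / 2). *)
Lemma join_entropy_linear (k : nat) (c : BS -> 'I_k) (eta : R) :
  (forall i, measurable (c @^-1` [set i])) -> 0 < eta ->
  exists K, forall n, join_entropy shB mu c n <= n%:R * (ln lam - Phi + eta) + K.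
Proof.
move=> mc eta0.
have [nu [_ [cg [Cg [cg0 Cg0 bounds]]]]] := gibbs_measure theta01 F_lip F_bound lam0 D1 hD h_log hE.
pose lab (x : BS) : 'I_kappa := sval x 0%N.
have mlab i : measurable (lab @^-1` [set i] : set BS).
  apply: cylinder_measurable => //; exists 1%N => x y /wordP/(_ 0%N isT) E.
  by rewrite /preimage /= /lab => <-.
have cellE n x : cell shB lab (word n x) = [set z | word n z = word n x].
  apply/seteqP; split => z.
    move=> H; apply/wordP => i ni; have := H (Ordinal ni).
    by rewrite ffunE /lab /= !sval_iter_shift !addn0.
  by move=> /wordP H j; rewrite ffunE /lab !sval_iter_shift !addn0; exact: H.
have k0 : 0 < k%:R :> R by rewrite ltr0n; case: (c point) => a; exact: leq_trans.
(* The correct label has probability s and each wrong one er = (1 - s) / k, so the probabilities sum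
   to at most 1 and none vanishes. *)
pose s := expR (- (eta / 2)); pose er := (1 - s) / k%:R.
have e20 : 0 < eta / 2 by exact: divr_gt0.
have s0 : 0 < s := expR_gt0 _.
have s1 : s < 1 by rewrite -[ltRHS]expR0 ltr_expR oppr_lt0.
have er0 : 0 < er by rewrite divr_gt0// subr_gt0.
pose L := ln er + eta / 2.
(* The set of wrong labels is so small that its contribution to the mean of psi is at most eta / 2,
   however large |L| is. *)
have e0 : 0 < eta / 2 / (`|L| + 1) by rewrite divr_gt0// ltr_wpDl.
have [J [c' [cJ mD HD]]] := label_approx theta01 mu mc e0.
pose psi (x : BS) : R := - (eta / 2) + L * \1_[set x | c x <> c' x] x.
pose pw (i i' : 'I_k) : R := if i == i' then s else er.
have pw0 i i' : 0 <= pw i i' by rewrite /pw; case: ifP => _; exact: ltW.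
have psiE x : expR (psi x) = pw (c x) (c' x).
  rewrite /psi /pw indicE; case: eqP => H.
    by rewrite memNset ?mulr0 ?addr0//=; move=> /(_ H).
  by rewrite mem_set// mulr1 /L addrCA [- _ + _]addrC subrr addr0 lnK.
have bI : bounded_measurable (\1_[set x | c x <> c' x] : BS -> R) by exact: bounded_measurable_indic.
have bpsi : bounded_measurable psi.
  by apply: bounded_measurableD; [exact: bounded_measurable_cst|exact: bounded_measurableZ].
have Epsi : - eta <= expect mu psi.
  rewrite /psi expectD ?expect_cst ?expectZ ?expect_indic//; last 2 first.
    exact: bounded_measurable_cst.
    exact: bounded_measurableZ.
  set p := fine _; have p0 : 0 <= p by rewrite fine_ge0.
  have : `|L * p| <= eta / 2.
    rewrite normrM (ger0_norm p0).
    apply: (@le_trans _ _ ((`|L| + 1) * (eta / 2 / (`|L| + 1)))).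
      by apply: ler_pM => //; rewrite lerDl.
    by rewrite mulrC divfK// gt_eqF// ltr_wpDl.
  by rewrite ler_norml => /andP[+ _]; lra.
exists (J%:R * (ln lam - Phi) - ln cg) => n.
pose p (a : {ffun 'I_(n + J) -> 'I_kappa}) := cell_mass nu shB lab a.
(* The Gibbs mass of a word of length n + J times the channel probabilities; the J extra symbols
   make the labels c' at all n times functions of the word. *)
pose Q (W : {ffun 'I_n -> 'I_k}) : R :=
  \sum_a p a * \prod_(j < n) pw (W j) (c' (iter j sh (representative A a))).
pose q (x : BS) := (ln cg + - ((n + J)%:R * ln lam) + birkhoff F (n + J) x) + ergodic_sum shB psi n x.
have bq1 : bounded_measurable (fun x : BS => ln cg + - ((n + J)%:R * ln lam) + birkhoff F (n + J) x).
  apply: bounded_measurableD; first exact: bounded_measurable_cst.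
  exact: (bounded_measurable_ergodic mS (n + J) F_bm).
have bq : bounded_measurable q.
  by apply: bounded_measurableD => //; exact: bounded_measurable_ergodic.
have Eq : expect mu q = ln cg - (n + J)%:R * ln lam + (n + J)%:R * Phi + n%:R * expect mu psi.
  rewrite /q expectD//; last exact: bounded_measurable_ergodic.
  rewrite (expect_ergodic mS inv n bpsi) expectD; last 2 first.
    exact: bounded_measurable_cst.
    exact: (bounded_measurable_ergodic mS (n + J) F_bm).
  by rewrite expect_cst (expect_ergodic mS inv (n + J) F_bm).
have p0 a : 0 <= p a by exact: cell_mass_ge0.
have Q0 W : 0 <= Q W.
  by apply: sumr_ge0 => a _; apply: mulr_ge0 => //; apply: prodr_ge0 => j _.
have Q1 : \sum_W Q W <= 1.
  rewrite /Q exchange_big /= -[leRHS](sum_cell_mass nu mS mlab (n + J)).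
  apply: ler_sum => a _; rewrite -mulr_sumr ler_piMr//.
  rewrite -(bigA_distr_bigA (fun (j : 'I_n) i => pw i (c' (iter j sh (representative A a))))).
  apply: prodr_ile1 => j _; rewrite sumr_ge0//=.
  set i' := c' _; rewrite (bigD1 i')//= {1}/pw eqxx.
  have : \sum_(i < k | i != i') pw i i' <= \sum_(i < k) er.
    rewrite big_mkcond; apply: ler_sum => i _; case: ifP => [ii|_]; last exact: ltW.
    by rewrite /pw (negbTE ii).
  rewrite sumr_const card_ord -mulr_natl /er mulrC divfK ?gt_eqF//; lra.
have qQ x : expR (q x) <= Q (itinerary shB c n x).
  rewrite /Q (bigD1 (word (n + J) x))//=.
  apply: ler_wpDr; first by apply: sumr_ge0 => a _; apply: mulr_ge0 => //; apply: prodr_ge0 => j _.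
  have -> : expR (q x) = cg * (expR (birkhoff F (n + J) x) / lam ^+ (n + J)) *
      \prod_(j < n) expR (psi (iter j sh x)).
    have E : expR (ergodic_sum shB psi n x) = \prod_(j < n) expR (psi (iter j sh x)) by exact: expR_sum.
    rewrite -E /q !expRD lnK ?posrE// expRN expRM_natl lnK ?posrE//.
    by move: (lam ^+ _) (expR (birkhoff _ _ _)) (expR (ergodic_sum _ _ _ _)) => u1 u2 u3; ring.
  have -> : \prod_(j < n) pw (itinerary shB c n x j) (c' (iter j sh (representative A (word (n + J) x)))) =
      \prod_(j < n) expR (psi (iter j sh x)).
    apply: eq_bigr => j _; rewrite psiE ffunE; congr (pw _ _); apply: cJ; apply/wordP => i iJ.
    rewrite !sval_iter_shift; apply: (wordP (n + J) _ _).1; first exact: word_representative.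
    by rewrite -addnS leq_add// ltnW.
  apply: ler_wpM2r; first by apply: prodr_ge0 => j _; exact: expR_ge0.
  by rewrite /p /cell_mass cellE; case/andP: (bounds (n + J)%N x).
have H : join_entropy shB mu c n <= - expect mu q by exact: (@join_entropy_le _ _ BS mu _ mS _ _ mc n Q q Q0 Q1 bq qQ).
apply: (le_trans H); rewrite Eq.
have := ler_wpM2l (ler0n R n) Epsi; rewrite natrD; lra.
Qed.

Lemma entropy_rate_le (k : nat) (c : BS -> 'I_k) (eta : R) :
  (forall i, measurable (c @^-1` [set i])) -> 0 < eta ->
  \forall n \near \oo, n%:R^-1 * join_entropy shB mu c n <= ln lam - Phi + eta.
Proof.
move=> mc eta0; have [K HK] := join_entropy_linear mc (divr_gt0 eta0 (ltr0n R 2)).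
near=> n; have n0 : 0 < n%:R :> R by near: n; exists 1%N => // n /=; rewrite ltr0n.
have Kn : K <= eta / 2 * n%:R by near: n; apply: near_le_linear; exact: divr_gt0.
rewrite mulrC ler_pdivrMr//; apply: (le_trans (HK n)); lra.
Unshelve. all: by end_near. Qed.

Lemma entropy_le : (shift_entropy mu <= (ln lam - Phi)%:E)%E.
Proof.
(* Needed because [limn] of a divergent sequence is the default value 0, which the bound must also
   dominate. The one-cell partition, of entropy 0, gives the sign. *)
have pos : 0 <= ln lam - Phi.
  apply/ler_addgt0Pl => eta eta0.
  pose c (x : BS) : 'I_1 := ord0.
  have mc i : measurable (c @^-1` [set i] : set BS).
    by rewrite (_ : _ @^-1` _ = setT)//; apply/seteqP; split => // x _; rewrite /preimage /= (ord1 i).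
  have [N _ /(_ N (leqnn _))] := entropy_rate_le mc eta0.
  rewrite join_entropyE (bigD1 [ffun=> ord0])//= big1 ?addr0; last first.
    by move=> w /eqP []; apply/ffunP => j; rewrite ffunE [LHS]ord1.
  have -> : cell_mass mu shB c (n := N) [ffun=> ord0] = 1.
    rewrite /cell_mass (_ : cell _ _ _ = setT) ?probability_setT//.
    by apply/seteqP; split => // x _ j; rewrite [LHS]ord1 ffunE.
  by rewrite ln1 mulr0 oppr0 mulr0 addrC.
apply: ge_ereal_sup => _ [k [c [mc ->]]].
rewrite /partition_entropy.
have [cv|ncv] := pselect (cvgn (fun n => (n%:R^-1 * join_entropy shB mu c n)%:E)).
  apply/lee_addgt0Pr => eta eta0; apply: lime_le => //.
  have := entropy_rate_le mc eta0; apply: filterS => n H.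
  by rewrite -EFinD lee_fin.
by rewrite (dvgP ncv) lee_fin.
Qed.

End EntropyBound.

(** * Proof of the theorem *)

Section LowerBound.
Context (R : realType) (kappa : nat) (A : aperiodic_matrix kappa) (theta : R).
Context (theta01 : 0 < theta < 1).
Local Notation S := (shift_space A).
Local Notation d := (@d_theta R kappa A theta).

(** Otherwise points with f < 1 / (n + 1) would have a cluster point, near which f exceeds half of
    its positive value there. *)
Lemma positive_lower_bound (f : S -> R) (L : R) : (forall x y, `|f x - f y| <= L * d x y) ->
  (forall x, 0 < f x) -> exists2 m, 0 < m & forall x, m <= f x.
Proof.
move=> fL f0; apply: contrapT => H.
have [th0 th1] := andP theta01.
have ex (n : nat) : exists x, f x < n.+1%:R^-1.
  apply: contrapT => Hn; apply: H; exists n.+1%:R^-1; first by rewrite invr_gt0.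
  by move=> x; rewrite leNgt; apply/negP => Hx; apply: Hn; exists x.
have [u Hu] := choice ex.
have [x Hx] := cluster_point u.
have L1 : 0 < `|L| + 1 by rewrite ltr_wpDl.
have e0 : 0 < f x / 2 / (`|L| + 1) by rewrite !divr_gt0.
have th : 0 <= theta < 1 by rewrite (ltW th0).
have [n Hn] := exprn_lt_eps th e0.
pose N := Num.truncn (f x / 2)^-1.
have [m Nm /wordP E] := Hx n N.
have dx : d (u m) x <= theta ^+ n by exact: d_agree.
have := fL (u m) x; rewrite ler_norml => /andP[H1 _].
have H2 : L * d (u m) x <= f x / 2.
  apply: (@le_trans _ _ ((`|L| + 1) * d (u m) x)).
    by rewrite ler_wpM2r ?d_ge0// (le_trans (ler_norm _))// lerDl.
  by rewrite mulrC -ler_pdivlMr// (le_trans dx)// ltW.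
have H3 : m.+1%:R^-1 < f x / 2.
  have fx2 : 0 < f x / 2 by rewrite divr_gt0.
  rewrite -[ltRHS]invrK ltf_pV2 ?posrE ?invr_gt0//.
  by apply: lt_le_trans (truncnS_gt _) _; rewrite ler_nat.
have := lt_trans (Hu m) H3; rewrite ltNge => /negP; apply; lra.
Qed.

End LowerBound.

Lemma contraction_estimateW (R : realType) (kappa : nat) (A : aperiodic_matrix kappa)
    (theta : R) (f : shift_space A -> R) (Pf eps a0 a1 rho Aeps : R) : a0 <= a1 ->
  contraction_estimate theta f Pf eps a0 rho Aeps -> contraction_estimate theta f Pf eps a1 rho Aeps.
Proof. by move=> a01 H u n au; apply: H; exact: le_trans au. Qed.

Section EquilibriumState.
Context (R : realType) (kappa : nat) (A : aperiodic_matrix kappa) (theta : R).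
Context (theta01 : 0 < theta < 1).
Local Notation S := (shift_space A).
Local Notation d := (@d_theta R kappa A theta).
Context (f : S -> R) (Pf alpha Lf fm fM : R).
Context (f_lip : forall x y, `|f x - f y| <= Lf * d x y).
Context (fm0 : 0 < fm) (f_range : forall x, fm <= f x <= fM).
Context (m0 : probability (borel_shift A theta) R).
Context (PfE : pressure theta (fun xi => - Pf * f xi) = 0%E)
    (m0_eq : equilibrium_state (fun xi => - Pf * f xi) m0)
    (alphaE : (\int[m0]_xi (f xi)%:E = alpha%:E)%E).
Local Notation F := (fun xi => - Pf * f xi).
Let LF := `|Pf| * Lf.
Let BF := `|Pf| * fM.

Let F_lip x y : `|F x - F y| <= LF * d x y.
Proof. by rewrite -mulrBr normrM normrN -mulrA ler_wpM2l. Qed.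

Let F_bound x : `|F x| <= BF.
Proof.
rewrite normrM normrN ler_wpM2l//; have /andP[a b] := f_range x.
by rewrite ger0_norm// (le_trans (ltW fm0)).
Qed.

Let f_bm : bounded_measurable (f : borel_shift A theta -> R).
Proof.
apply: (lipschitz_bounded_measurable theta01 (M := fM) f_lip) => x; have /andP[a b] := f_range x.
by rewrite ger0_norm// (le_trans (ltW fm0)).
Qed.

Let expect_f : expect m0 (f : borel_shift A theta -> R) = alpha.
Proof. by have := expect_EFin m0 f_bm; rewrite alphaE => -[]. Qed.

Lemma mean_gt0 : fm <= alpha.
Proof.
rewrite -expect_f -(expect_cst m0 fm); apply: expect_le => //; first exact: bounded_measurable_cst.
by move=> x; case/andP: (f_range x).
Qed.

(** The equilibrium identity lives in the extended reals, so infinite entropy is excluded before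
    solving for the entropy. *)
Lemma equilibrium_entropy : shift_entropy m0 = (Pf * alpha)%:E.
Proof.
have [inv] := m0_eq; rewrite PfE.
have -> : (\int[m0]_xi (- Pf * f xi)%:E)%E = (- Pf * alpha)%:E.
  have bF : bounded_measurable (F : borel_shift A theta -> R) by exact: bounded_measurableZ.
  by rewrite (expect_EFin m0 bF) expectZ// expect_f.
case: (shift_entropy m0) => [r| |]//=.
by rewrite -EFinD => -[H]; congr _%:E; lra.
Qed.

(** The Gibbs measure gives ln lam <= 0. The entropy bound applied to m0 itself reads Pf alpha <= ln
    lam + Pf alpha, so ln lam >= 0. *)
Lemma eigenfunction_at_pressure_zero : exists (h : S -> R) (D : R), [/\ 1 <= D, forall x, D^-1 <= h x <= D,
  log_lip theta (theta * LF / (1 - theta)) h,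
  forall x, transfer (fun y => expR (F y)) h x = h x &
  exists gamma C, [/\ 0 < gamma, 0 <= C & markov_weight theta gamma C (normalized F h h)]].
Proof.
have [lam [h [D [lam0 D1 hD h_log hE]]]] := eigenfunction theta01 F_lip F_bound.
have [inv _] := m0_eq.
have H1 := ln_le_pressure theta01 F_lip F_bound lam0 D1 hD h_log hE.
have H2 := entropy_le theta01 F_lip F_bound lam0 D1 hD h_log hE inv.
rewrite PfE lee_fin in H1.
have lnE : ln lam = 0.
  apply/eqP; rewrite eq_le H1 /=.
  move: H2; rewrite equilibrium_entropy expectZ// expect_f lee_fin; lra.
have lam1 : lam = 1 by rewrite -(lnK (x := lam)) ?posrE// lnE expR0.
have := gibbs_markov theta01 F_lip F_bound lam0 D1 hD h_log hE.
have -> : (fun x => lam * h x) = h by apply/funext => x; rewrite lam1 mul1r.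
move=> G; exists h, D; split => // x.
by rewrite hE lam1 mul1r.
Qed.

End EquilibriumState.

Section MainConstants.
Context (R : realType) (kappa : nat) (A : aperiodic_matrix kappa) (theta : R).
Context (theta01 : 0 < theta < 1).
Local Notation S := (shift_space A).
Local Notation d := (@d_theta R kappa A theta).

Lemma count_rate_limit (f : S -> R) (Pf alpha Lf fm d1 rho rho1 z p q delta : R)
    (m0 : probability (borel_shift A theta) R) (x : 'I_kappa -> S) :
  (forall x y, `|f x - f y| <= Lf * d x y) -> 0 < fm -> (forall x, fm <= f x <= d1) ->
  pressure theta (fun xi => - Pf * f xi) = 0%E ->
  equilibrium_state (fun xi => - Pf * f xi) m0 ->
  (\int[m0]_xi (f xi)%:E = alpha%:E)%E ->
  ruelle_lemma_constant theta f x rho1 -> 0 < rho1 < rho -> rho < 1 ->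
  weakly_contracting_with theta f Pf rho -> p < q ->
  0 < delta < - (ln rho * alpha) / (3 * d1) ->
  count_rate f alpha z p q delta n @[n --> \oo] --> (Pf * alpha - delta)%:E.
Proof.
move=> f_lip fm0 f_range PfE m0_eq alphaE rho1E rho1_rho rho_lt1 rhoE pq /andP[delta0 deltaM].
have [th0 th1] := andP theta01.
have d10 : 0 < d1 by case/andP: (f_range point) => a b; exact: lt_le_trans (lt_le_trans fm0 a) b.
have al0 : 0 < alpha by exact: (lt_le_trans fm0 (mean_gt0 theta01 f_lip fm0 f_range alphaE)).
have rho0 : 0 < rho by case/andP: rho1_rho; exact: lt_trans.
have rho01 : 0 < rho < 1 by rewrite rho0.
(* The frequencies above a0 contribute rho ^+ s * expR ((3 + eps) * delta * n),
   where s ~ sg * n is the least period used and sg * d1 < alpha; the strict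
   bound on delta leaves room for eps, for the gap alpha - sg * d1 and for the
   smaller scale delta + gam. *)
pose kp := - (ln rho * alpha) / d1.
have kp3 : 3 * delta < kp.
  rewrite /kp ltr_pdivlMr//; move: deltaM; rewrite ltr_pdivlMr ?mulr_gt0//.
  by rewrite mulrA (mulrC delta).
have kp0 : 0 < kp by apply: (lt_trans _ kp3); rewrite mulr_gt0.
pose De := kp - 3 * delta; have De0 : 0 < De by rewrite subr_gt0.
(* The slack De is spent in quarters: 3 gmax, eps (delta + gmax) and the loss g1 kp in the least
   period each take at most De / 4. *)
pose gmax := De / 12; have gmax0 : 0 < gmax by rewrite divr_gt0.
have dg0 : 0 < delta + gmax by exact: addr_gt0.
pose eps := Num.min 1 (De / (4 * (delta + gmax))).
have eps01 : 0 < eps <= 1.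
  by rewrite lt_min ltr01 divr_gt0 ?mulr_gt0//= ge_min lexx.
have [eps0 eps1] := andP eps01.
have epsM : eps * (delta + gmax) <= De / 4.
  apply: (@le_trans _ _ (De / (4 * (delta + gmax)) * (delta + gmax))).
    by rewrite ler_wpM2r ?(ltW dg0)// ge_min lexx orbT.
  by rewrite le_eqVlt; apply/orP; left; apply/eqP; field; rewrite gt_eqF.
pose g1 := De / (4 * kp); have g10 : 0 < g1 by rewrite divr_gt0// mulr_gt0.
have g1kp : g1 * kp = De / 4 by rewrite /g1; field; rewrite gt_eqF.
have g11 : g1 < 1.
  have De4 : De < 4 * kp by rewrite /De; move: kp0 delta0; move: (kp) => K; lra.
  by rewrite /g1 ltr_pdivrMr ?mul1r// mulr_gt0.
pose sg := (1 - g1) * alpha / d1.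
have sg0 : 0 < sg by rewrite divr_gt0// mulr_gt0// subr_gt0.
have sgE : - (ln rho * sg) = kp - De / 4.
  rewrite -g1kp /sg /kp; field; exact: lt0r_neq0.
have [Q HQ] : exists Q, kappa%:R / theta <= theta ^- Q.
  have th : 0 <= theta < 1 by rewrite (ltW th0).
  have kp' : 0 < kappa%:R :> R by rewrite ltr0n (leq_trans _ (tmx_ge2 A)).
  have [Q /ltW HQ] := exprn_lt_eps th (divr_gt0 th0 kp'); exists Q.
  by rewrite -[leLHS]invf_div lef_pV2 ?posrE ?exprn_gt0 ?divr_gt0.
pose k := (4 * Q + 4)%N.
have k0 : 0 < k%:R :> R by rewrite ltr0n /k addnS.
(* The plateau starts at s + k r. Here k g2 d1 = g1 alpha / 2 is half of the gap alpha - sg d1, so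
   the plateau begins before the periods to be counted. *)
pose g2 := g1 * alpha / (2 * k%:R * d1).
have g20 : 0 < g2.
  by apply: divr_gt0; [exact: mulr_gt0|apply: mulr_gt0 => //; exact: mulr_gt0].
(* The plateau must reach beyond n alpha / fm, the order of the longest period with Birkhoff sum
   near n alpha. *)
pose Cl := 2 * alpha / fm; have Cl0 : 0 < Cl by rewrite divr_gt0// mulr_gt0.
have al1 : (sg + k%:R * g2) * d1 < alpha.
  have -> : (sg + k%:R * g2) * d1 = alpha - g1 * alpha / 2.
    rewrite /sg /g2; move: k0; set kk := k%:R => k0; field; rewrite !lt0r_neq0//.
  by rewrite ltrBlDr ltrDl divr_gt0// mulr_gt0.
have al2 : alpha < Cl * fm.
  by rewrite /Cl divfK ?gt_eqF//; lra.
have [a0' [Aeps [a0'0 Aeps0 est']]] := rhoE eps eps0.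
pose a0 := Num.max 1 a0'.
have a01 : 1 <= a0 by rewrite le_max lexx.
have est : contraction_estimate theta f Pf eps a0 rho Aeps.
  by apply: contraction_estimateW est'; rewrite le_max lexx orbT.
have [h [D [D1 hD h_log hE [gamma [C [gamma0 C0 mg]]]]]] :=
  eigenfunction_at_pressure_zero theta01 f_lip fm0 f_range PfE m0_eq alphaE.
have Lf0 : 0 <= Lf.
  apply: (@lip_by_ge0 _ _ A _ theta01 (fun x => (f x)%:C)) => y y'.
  by rewrite -raddfB normc_real.
have Bh0 : 0 <= theta * (`|Pf| * Lf) / (1 - theta).
  by rewrite divr_ge0 ?mulr_ge0 ?subr_ge0 ?(ltW th0) ?(ltW th1).
have [Cm Cm0 mid] := mid_frequency theta01 f_lip fm0 f_range D1 hD Bh0 h_log hE gamma0 C0 mg Aeps0 rho01 eps0 est a01.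
have [Ch Ch0 high] := high_frequency theta01 est Aeps0 a01 eps0 rho1E rho1_rho rho_lt1 PfE.
have [c0 [CC0 [M [c00 renew]]]] := renewal_lower theta01 f_lip fm0 f_range D1 hD hE.
have triv := periodic_sum_le theta01 f_lip D1 hD hE.
pose Zb := Zbound kappa theta Pf Lf D.
have Zb0 : 0 <= Zb by apply: le_trans (triv 0 1%N isT); exact: normc_ge0.
have rate gam : 0 <= gam <= gmax -> (3 + eps) * (delta + gam) < - (ln rho * sg).
  move=> /andP[ga gb]; rewrite sgE.
  apply: (@le_lt_trans _ _ ((3 + eps) * (delta + gmax))).
    by rewrite ler_wpM2l ?addr_ge0 ?(ltW eps0)// lerD2l.
  rewrite mulrDl; move: epsM; rewrite /gmax /De; move: De0; rewrite /De; move: (kp) => K; lra.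
have rate0 : (3 + eps) * delta < - (ln rho * sg).
  by have := rate 0; rewrite addr0 lexx (ltW gmax0); exact.
have [C2 C20 upp] := kernel_upper eps01 rho01 a01 Zb0 Ch0 triv high sg0 g20 Cl0 Q rate0.
apply: (count_rate_cvg z fm0 f_range sg0 g20 Cl0 al1 al2 pq delta0 C20 upp gmax0).
move=> gam B0 /andP[ga gb].
have dg : 0 < delta + gam by exact: addr_gt0.
have rg : (3 + eps) * (delta + gam) < - (ln rho * sg) by apply: rate; rewrite (ltW ga).
exact: (kernel_lower theta01 fm0 f_range c00 renew eps01 rho01 a01 Zb0 Cm0 Ch0 triv mid high sg0 g20 Cl0 HQ B0 dg rg al0 al1 al2).
Qed.

End MainConstants.

Theorem corollary1 (R : realType) (kappa0 : nat) (A : aperiodic_matrix kappa0)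
    (theta : R) (f : shift_space A -> R) (Pf alpha d1 rho rho1 : R)
    (m0 : probability (borel_shift A theta) R)
    (x : 'I_kappa0 -> shift_space A)
    (theta01 : 0 < theta < 1)
    (f_lip : F_theta theta (fun xi => (f xi)%:C))
    (f_gt0 : forall xi, 0 < f xi)
    (PfE : pressure theta (fun xi => - Pf * f xi) = 0%E)
    (m0_eq : equilibrium_state (fun xi => - Pf * f xi) m0)
    (alphaE : (\int[m0]_xi (f xi)%:E = alpha%:E)%E)
    (d1_max : (exists xi, f xi = d1) /\ (forall xi, f xi <= d1))
    (f_nonlattice : non_lattice f)
    (f_contracting : weakly_contracting theta f Pf)
    (x_cyl : forall i, sval (x i) 0%N = i)
    (rho1E : ruelle_lemma_constant theta f x rho1)
    (rho1_rho : 0 < rho1 < rho) (rho_lt1 : rho < 1)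
    (rhoE : weakly_contracting_with theta f Pf rho)
    (z p q : R) (z_alpha : 0 <= z <= alpha) (pq : p < q) :
  (forall delta : R, 0 < delta < - (ln rho * alpha) / (3 * d1) ->
     count_rate f alpha z p q delta n @[n --> \oo]
       --> (shift_entropy m0 - delta%:E)%E)
  /\
  limn (count_rate f alpha z p q delta) @[delta --> 0^'+]
    --> shift_entropy m0.
Proof.
have [Lf {}f_lip] : exists L, forall y y', `|f y - f y'| <= L * d_theta theta y y'.
  have [L HL] := f_lip; exists L => y y'.
  by have := HL y y'; rewrite -raddfB normc_real.
have [fm fm0 f_ge] := positive_lower_bound theta01 f_lip f_gt0.
have f_range y : fm <= f y <= d1 by rewrite f_ge d1_max.2.
rewrite (equilibrium_entropy theta01 f_lip fm0 f_range PfE m0_eq alphaE).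
have main delta : 0 < delta < - (ln rho * alpha) / (3 * d1) ->
    count_rate f alpha z p q delta n @[n --> \oo] --> (Pf * alpha - delta)%:E.
  exact: (count_rate_limit theta01 z f_lip fm0 f_range PfE m0_eq alphaE rho1E rho1_rho rho_lt1 rhoE pq).
split=> [delta dd|]; first by rewrite -EFinB; exact: main.
have rho0 : 0 < rho by case/andP: rho1_rho; exact: lt_trans.
have d10 : 0 < d1 by rewrite (lt_le_trans (f_gt0 point))// d1_max.2.
have al0 : 0 < alpha by exact: (lt_le_trans fm0 (mean_gt0 theta01 f_lip fm0 f_range alphaE)).
have K0 : 0 < - (ln rho * alpha) / (3 * d1).
  by rewrite divr_gt0 ?mulr_gt0// oppr_gt0 nmulr_rlt0// ln_lt0// rho0.
(* For small delta > 0 the inner limit is known, so the outer limit is that of an affine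
   function. *)
apply: (@cvg_trans _ ((Pf * alpha - delta)%:E @[delta --> 0^'+])).
  apply: near_eq_cvg; near=> delta; apply/esym; apply: cvg_lim => //; apply: main.
  by apply/andP; split; near: delta; [exact: nbhs_right_gt|exact: nbhs_right_lt].
apply: cvg_EFin; first exact: nearW.
rewrite -[X in _ --> X]subr0; apply: cvgB; first exact: cvg_cst.
exact: cvg_at_right_filter cvg_id.
Unshelve. all: by end_near. Qed.
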